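(* Define $\widehat\mu_{2,2}(u,v,\tau)=\mu_{2,2}(u,v,\tau)-\frac14R_{2,2}(u,v,\tau)$ for $\tau$ in the upper half-plane, $u\in\mathbb{C}\setminus(\tau\mathbb{Z}+\mathbb{Z})$ and $v\in\mathbb{C}$ not a zero of $\Theta(\cdot,\tau)$. Then $\widehat\mu_{2,2}$ transforms as a two-variable Jacobi form of weight $1$ under $\Gamma_0(3)$ with multiplier $\left(\frac d3\right)$ and matrix-valued index $m=\begin{pmatrix}-1&1\\1&-1\end{pmatrix}$; that is, for every $\begin{pmatrix}a&b\\c&d\end{pmatrix}\in\Gamma_0(3)$, $\widehat\mu_{2,2}\!\left(\frac{u}{c\tau+d},\frac{v}{c\tau+d},\frac{a\tau+b}{c\tau+d}\right)=\left(\frac d3\right)(c\tau+d)\,e^{-\frac{2\pi\mathrm{i}c(u-v)^2}{c\tau+d}}\,\widehat\mu_{2,2}(u,v,\tau)$.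
   Context: $q=e^{2\pi\mathrm{i}\tau}$, $\tau_2=\operatorname{Im}\tau$, $\left(\frac d3\right)$ the Legendre symbol mod 3, $\operatorname{sign}(0)=0$. $\Theta(v,\tau)=\sum_{k_1,k_2\in\mathbb{Z}}e^{2\pi\mathrm{i}v(k_1+2k_2)}q^{k_1^2+k_2^2+k_1k_2}$. $\mu_{2,1}(u,v,\tau)=\frac12+\frac{e^{\pi\mathrm{i}u}}{\Theta(v)}\sum_{k_1,k_2\in\mathbb{Z}}\frac{e^{2\pi\mathrm{i}v(k_1+2k_2)}q^{k_1^2+k_2^2+k_1k_2+2k_1+k_2}}{1-e^{2\pi\mathrm{i}u}q^{2k_1+k_2}}$, $\mu_{2,2}(u,v,\tau)=\frac14+\frac{e^{2\pi\mathrm{i}u}}{\Theta(v)}\sum_{k_1,k_2\in\mathbb{Z}}\frac{e^{2\pi\mathrm{i}v(k_1+2k_2)}q^{k_1^2+k_2^2+k_1k_2+2k_1+k_2}}{(1-e^{2\pi\mathrm{i}u}q^{2k_1+k_2})(1-e^{2\pi\mathrm{i}u}q^{k_2-k_1})}$. $E_1(u)=\operatorname{Erf}(u\sqrt\pi)$, $M_1(u)=-\operatorname{sign}(u)\operatorname{Erfc}(|u|\sqrt\pi)$. For $\alpha\in\mathbb{R}$, $u_1\neq0$, $u_2\neq\alpha u_1$: $M_2(\alpha;u_1,u_2)=-\frac{1}{\pi^2}\int_{\mathbb{R}-\mathrm{i}u_1}dz_1\int_{\mathbb{R}-\mathrm{i}u_2}dz_2\frac{e^{-\pi z_1^2-\pi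 z_2^2-2\pi\mathrm{i}(u_1z_1+u_2z_2)}}{z_1(z_2-\alpha z_1)}$ and $E_2(\alpha;u_1,u_2)=M_2(\alpha;u_1,u_2)+\operatorname{sign}(u_1)M_1(u_2)+\operatorname{sign}(u_2-\alpha u_1)M_1\!\left(\frac{u_1+\alpha u_2}{\sqrt{1+\alpha^2}}\right)+\operatorname{sign}(u_2)\operatorname{sign}(u_1+\alpha u_2)$, extended to a $C^\infty$ function on $\mathbb{R}^2$. For $w\in\mathbb{C}$ put $a=\operatorname{Im}(w)/\tau_2$ and define, for $j\in\{0,1\}$, $R_{1,j}(w,\tau)=\sum_{\ell\in\mathbb{Z}+\frac j2}\left[\operatorname{sign}(\ell)-E_1(\sqrt{\tau_2}(2\ell-a))\right]e^{3\pi\mathrm{i}\ell w}q^{-3\ell^2}$ and $R_2(w,\tau)=\sum_{k_3,k_4\in\mathbb{Z}}\Big\{\operatorname{sign}(k_3)\operatorname{sign}(k_4)-2\left[\operatorname{sign}(k_4)-E_1(\sqrt{3\tau_2}(k_4-a))\right]\operatorname{sign}(2k_3-k_4)-E_2\!\left(\tfrac{1}{\sqrt3};\sqrt{\tau_2}(2k_3-k_4-a),\sqrt{3\tau_2}(k_4-a)\right)\Big\}e^{2\pi\mathrm{i}(k_3+k_4)w}q^{-k_3^2-k_4^2+k_3k_4}$. Finally $R_{2,2}(u,v,\tau)=R_2(u-v)+4e^{\pi\mathrm{i}u}\mu_{2,1}(u,v)R_{1,0}(u-v)+4e^{\pi\mathrm{i}v}q^{-1/4}\left(\mu_{2,1}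(u,v-\tau)-\frac12\right)R_{1,1}(u-v)$.
   Formalization: The printed R_{1,j} diverges; proved with E_1(√(3τ_2)(2ℓ−a)) and e^{6πiℓw} in R_{1,j}, with 4(1/2+e^{πiu}(μ_{2,1}−1/2))R_{1,0} replacing 4e^{πiu}μ_{2,1}R_{1,0} in R_{2,2}, and with the sum in R_2 taken over squares |k_3|,|k_4|≤N. *)

(* Defs.v *)
From HB Require Import structures.
From mathcomp Require Import all_boot all_order all_algebra.
From mathcomp Require Import complex.
From mathcomp Require Import all_classical all_reals all_analysis.
Set Implicit Arguments.
Unset Strict Implicit.
Unset Printing Implicit Defensive.
Import Order.TTheory GRing.Theory Num.Theory.
Import numFieldNormedType.Exports.
Local Open Scope classical_set_scope.
Local Open Scope ring_scope.
Local Open Scope complex_scope.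

Definition Gamma0 (N a b c d : int) : bool :=
  (a * d - b * c == 1) && (N %| c)%Z.

Definition legendre (p : nat) (d : int) : int :=
  if (p%:Z %| d)%Z then 0
  else if [exists x : 'I_p, (x%:Z ^+ 2 == d %[mod p%:Z])%Z] then 1 else - 1.

Section Defs.
Variable R : realType.
Local Notation C := R[i].
Local Notation Re := (@complex.Re R).
Local Notation Im := (@complex.Im R).
Implicit Types (tau u v w z : C).

Definition cexp z : C := (expR (Re z))%:C * (cos (Im z) +i* sin (Im z)).

Definition e2pi z : C := cexp (2 * (pi : R)%:C * 'i * z).

(* [qpow tau x] is q^x = e^{2 pi i tau x}, for fractional x as well. *)
Definition qpow tau (x : C) : C := e2pi (x * tau).

(** Limits, series and integrals of complex-valued functions are taken
    on the real and imaginary parts. *)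

Definition clim {T : Type} (F : set_system T) (f : T -> C) : C :=
  lim (Re (f x) @[x --> F]) +i* lim (Im (f x) @[x --> F]).

Definition sumZ (f : int -> C) : C :=
  clim \oo (fun N : nat => \sum_(i < N.*2.+1) f (i%:Z - N%:Z)).

(* Series over Z^2 are limits of the partial sums over the squares
   |k1|, |k2| <= N.  For absolutely convergent series the choice of the
   squares is immaterial; it matters for [R2] below. *)
Definition sumZ2 (f : int -> int -> C) : C :=
  clim \oo (fun N : nat =>
    \sum_(i < N.*2.+1) \sum_(j < N.*2.+1) f (i%:Z - N%:Z) (j%:Z - N%:Z)).

(* The integral of f over the horizontal line R - i y. *)
Definition line_integral (y : R) (f : C -> C) : C :=
  (\int[lebesgue_measure]_(x in setT) Re (f (x +i* (- y))))
  +i* (\int[lebesgue_measure]_(x in setT) Im (f (x +i* (- y)))).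

Definition Theta v tau : C :=
  sumZ2 (fun k1 k2 => e2pi (v * (k1 + 2 * k2)%:~R)
    * qpow tau (k1 ^+ 2 + k2 ^+ 2 + k1 * k2)%:~R).

Definition mu21 u v tau : C :=
  2^-1 + e2pi (u / 2) / Theta v tau *
  sumZ2 (fun k1 k2 =>
    e2pi (v * (k1 + 2 * k2)%:~R)
    * qpow tau (k1 ^+ 2 + k2 ^+ 2 + k1 * k2 + 2 * k1 + k2)%:~R
    / (1 - e2pi u * qpow tau (2 * k1 + k2)%:~R)).

Definition mu22 u v tau : C :=
  4^-1 + e2pi u / Theta v tau *
  sumZ2 (fun k1 k2 =>
    e2pi (v * (k1 + 2 * k2)%:~R)
    * qpow tau (k1 ^+ 2 + k2 ^+ 2 + k1 * k2 + 2 * k1 + k2)%:~R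
    / ((1 - e2pi u * qpow tau (2 * k1 + k2)%:~R)
       * (1 - e2pi u * qpow tau (k2 - k1)%:~R))).

Definition Erf (x : R) : R :=
  Num.sg x * (2 / Num.sqrt pi)
  * \int[lebesgue_measure]_(t in `[0, `|x|]) expR (- t ^+ 2).

Definition Erfc (x : R) : R := 1 - Erf x.

Definition E1 (x : R) : R := Erf (x * Num.sqrt pi).

Definition M1 (x : R) : R := - Num.sg x * Erfc (`|x| * Num.sqrt pi).

Definition M2 (alpha u1 u2 : R) : C :=
  - ((pi : R) ^- 2)%:C *
  line_integral u1 (fun z1 => line_integral u2 (fun z2 =>
    cexp (- (pi : R)%:C * z1 ^+ 2 - (pi : R)%:C * z2 ^+ 2
          - 2 * (pi : R)%:C * 'i * (u1%:C * z1 + u2%:C * z2))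
    / (z1 * (z2 - alpha%:C * z1)))).

Definition E2_generic (alpha u1 u2 : R) : C :=
  M2 alpha u1 u2
  + (Num.sg u1 * M1 u2
     + Num.sg (u2 - alpha * u1)
       * M1 ((u1 + alpha * u2) / Num.sqrt (1 + alpha ^+ 2))
     + Num.sg u2 * Num.sg (u1 + alpha * u2))%:C.

(* [E2_generic alpha] makes sense off the two lines u1 = 0 and
   u2 = alpha u1, whose complement is dense, so that its smooth extension to
   the plane is its extension by continuity. *)
Definition E2 (alpha u1 u2 : R) : C :=
  clim (within [set p : R * R | p.1 != 0 /\ p.2 != alpha * p.1]
          (nbhs ((u1, u2) : R * R)))
    (fun p => E2_generic alpha p.1 p.2).

(* The shadow of the completion of the sum over a rank one sublattice of A_2
   spanned by a vector of norm 6: q^{-3 l^2} = q^{-(3/4) k^2} with k = 2 l in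
   2 Z + j.  The error function sqrt(3 tau_2) and the elliptic factor
   e^{6 pi i l w} = e^{2 pi i (3/2) k w} are those attached to this form; with
   sqrt(tau_2) in place of sqrt(3 tau_2) the terms would grow
   like e^{2 pi tau_2 l^2}. *)
Definition R1 (j : nat) w tau : C :=
  let t2 := Im tau in let a := Im w / t2 in
  sumZ (fun n => let l : R := n%:~R + j%:R / 2 in
    (Num.sg l - E1 (Num.sqrt (3 * t2) * (2 * l - a)))%:C
    * e2pi (3 * l%:C * w) * qpow tau (- 3 * l ^+ 2)%:C).

(* The terms are unbounded: for fixed k4 and k3 -> oo the braces tend to a
   nonzero limit.  The average of the terms at (k3, k4) and (k4, k3) is
   absolutely summable, and since the squares of [sumZ2] are stable under this
   exchange, the partial sums converge to the sum of these averages. *)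
Definition R2 w tau : C :=
  let t2 := Im tau in let a := Im w / t2 in
  sumZ2 (fun n3 n4 => let k3 : R := n3%:~R in let k4 : R := n4%:~R in
    ((Num.sg k3 * Num.sg k4
      - 2 * (Num.sg k4 - E1 (Num.sqrt (3 * t2) * (k4 - a)))
        * Num.sg (2 * k3 - k4))%:C
     - E2 (Num.sqrt 3)^-1 (Num.sqrt t2 * (2 * k3 - k4 - a))
         (Num.sqrt (3 * t2) * (k4 - a)))
    * e2pi ((n3 + n4)%:~R * w)
    * qpow tau (- n3 ^+ 2 - n4 ^+ 2 + n3 * n4)%:~R).

(* 1/2 + e^{pi i u} (mu21 - 1/2) is 1/2 plus e^{2 pi i u} / Theta(v) times the
   Appell sum: the average over the lattice, against Theta(v), of
   (1/2) (1 + x) / (1 - x) at x = e^{2 pi i u} q^{2 k1 + k2}.  It is this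
   function, and not e^{pi i u} mu21, which comes out of the even k4. *)
Definition R22 u v tau : C :=
  R2 (u - v) tau
  + 4 * (2^-1 + e2pi (u / 2) * (mu21 u v tau - 2^-1)) * R1 0 (u - v) tau
  + 4 * e2pi (v / 2) * qpow tau (- 4^-1)
    * (mu21 u (v - tau) tau - 2^-1) * R1 1 (u - v) tau.

Definition muhat22 u v tau : C := mu22 u v tau - 4^-1 * R22 u v tau.

End Defs.

(* Main.v *)
From HB Require Import structures.
Require Import Defs.
From mathcomp Require Import all_boot all_order all_algebra.
From mathcomp Require Import complex.
From mathcomp Require Import all_classical all_reals all_analysis.
From mathcomp Require Import measurable_realfun gauss_integral exponential_distribution.
From mathcomp Require Import ring lra zify.
Set Implicit Arguments.
Unset Strict Implicit.
Unset Printing Implicit Defensive.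
Import Order.TTheory GRing.Theory Num.Theory.
Import numFieldNormedType.Exports.
Local Open Scope ring_scope.
Local Open Scope complex_scope.

(** Write [e(z) = exp(2 pi i z)], [C(z) = (1 + e(z)) / (1 - e(z))], [w = u - v],
    [a = Im w / Im tau], and, for [x = (k1, k2)], [z1 = u + (2 k1 + k2) tau] and
    [z2 = u + (k2 - k1) tau].  The involution [(k1, k2) |-> (- k1, k1 + k2)]
    preserves the summand of [Theta] and exchanges [z1] and [z2]; hence
    [4 Theta mu22] is the sum over [x] of the theta summand times [C(z1) C(z2)].

    For fixed [z1], [z2] the product [C(z1) C(z2)], corrected by series in
    [e(k z1)], [e(l z2)] with coefficients made of [E1], [E2] and signs, equals
    [- pi^-2] times a Gaussian sum over [(m, n)] with denominators
    [(z1 + m) (z2 + n)].  Indeed both sides have the same derivative in the shift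
    [s] of the error functions, by the one-dimensional identity and Poisson
    summation, and both are multiplied by [e(z1) != 1] under [s |-> s + 1].

    Summed over [x] with [s = a], the corrections can be moved across the lattice:
    [theta_term x * e(k z1 + l z2)] is a translate of [theta_term].  Even and odd
    [l] give the products of [mu21] with [R1], and the remainder is [R2] up to a
    part antisymmetric in [(k, l)], which cancels on squares.  Thus
    [4 Theta muhat22 = - pi^-2 Fsum], where [Fsum] is an absolutely convergent
    sum over [Z^4] whose terms are permuted by [Gamma0(3)] up to the automorphy
    factor.  The statement follows by dividing by the transformation law of
    [Theta]. *)

(** Derivatives are taken only in real parameters (a shift of the error functions, a path of
    Gaussian exponents), so no holomorphy is used: each identity is proved up to a constant, and a
    constant multiplied by [e(z1) != 1] under a unit shift is zero. The obstacle is growth. After a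
    lattice translation the term [(k, l)] carries [q^(-k^2 - l^2 + k l)], of size
    [exp(2 pi T (k^2 + l^2 - k l))] with [T = Im tau], and every rearrangement needs coefficients
    that decay faster. The definition of [E2], a limit of double contour integrals, shows no such
    decay; it is rewritten as a one-variable convolution [N2], for which Chernoff bounds with free
    parameters give Gaussian decay. Level 3 enters twice: [(2 k1 + k2, k2 - k1)] runs over a
    sublattice of index 3 in [Z^2], stable because 3 divides [c]; and the form of [Theta] has a dual
    with denominator 3, so the inverted theta series is unchanged by [1/tau -> 1/tau + 3 k]. For
    complex arguments Gaussian constants occur only squared, so no branch of a square root is
    chosen. *)

Notation cn := (@complex.ComplexField.Normc.normc _).
Notation cRe := (@complex.Re _).
Notation cIm := (@complex.Im _).

(** * Complex exponentials *)
Section ComplexBasics.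
Variable R : realType.
Local Notation C := R[i].
Implicit Types (x y : R) (z w : C).

Lemma ReM z w : cRe (z * w) = cRe z * cRe w - cIm z * cIm w.
Proof. by case: z => a b; case: w. Qed.

Lemma ImM z w : cIm (z * w) = cRe z * cIm w + cIm z * cRe w.
Proof. by case: z => a b; case: w. Qed.

Lemma ReD z w : cRe (z + w) = cRe z + cRe w.
Proof. by case: z => a b; case: w. Qed.

Lemma ImD z w : cIm (z + w) = cIm z + cIm w.
Proof. by case: z => a b; case: w. Qed.

Lemma ReN z : cRe (- z) = - cRe z. Proof. by case: z. Qed.

Lemma ImN z : cIm (- z) = - cIm z. Proof. by case: z. Qed.

Definition ReImE := (ReM, ImM, ReD, ImD, ReN, ImN).

Lemma ceqP z w : cRe z = cRe w -> cIm z = cIm w -> z = w.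
Proof. by case: z => a b; case: w => c d /= -> ->. Qed.

Lemma Re_int (n : int) : cRe (n%:~R : C) = n%:~R.
Proof. by rewrite -[n%:~R : C](rmorph_int (real_complex R)). Qed.

Lemma Im_int (n : int) : cIm (n%:~R : C) = 0.
Proof. by rewrite -[n%:~R : C](rmorph_int (real_complex R)). Qed.

Lemma cnM z w : cn (z * w) = cn z * cn w.
Proof. exact: Normc.normcM. Qed.

Lemma cnV z : cn z^-1 = (cn z)^-1.
Proof. exact: Normc.normcV. Qed.

Lemma cn0 : cn (0 : C) = 0. Proof. exact: Normc.normc0. Qed.

Lemma cn1 : cn (1 : C) = 1. Proof. exact: Normc.normc1. Qed.

Lemma cn_ge0 z : 0 <= cn z.
Proof. by case: z => a b; exact: sqrtr_ge0. Qed.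

Lemma cn_eq0 z : (cn z == 0) = (z == 0).
Proof.
apply/eqP/eqP => [|->]; [exact: Normc.eq0_normc | exact: cn0].
Qed.

Lemma cn_gt0 z : (0 < cn z) = (z != 0).
Proof. by rewrite lt_neqAle cn_ge0 andbT eq_sym cn_eq0. Qed.

Lemma cnD z w : cn (z + w) <= cn z + cn w.
Proof. exact: (@le_normcD R). Qed.

Lemma cnN z : cn (- z) = cn z.
Proof. exact: (@normcN R). Qed.

Lemma cnB z w : cn (z - w) <= cn z + cn w.
Proof. by rewrite -(cnN w); exact: cnD. Qed.

Lemma cn_real x : cn x%:C = `|x|.
Proof. by rewrite /= expr0n /= addr0 sqrtr_sqr. Qed.

Lemma cn_i : cn ('i : C) = 1.
Proof. by rewrite /= expr0n /= add0r expr1n sqrtr1. Qed.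

Lemma Re_le_cn z : `|cRe z| <= cn z.
Proof.
by case: z => a b /=; rewrite -sqrtr_sqr ler_sqrt ?addr_ge0 ?sqr_ge0// lerDl sqr_ge0.
Qed.

Lemma Im_le_cn z : `|cIm z| <= cn z.
Proof.
by case: z => a b /=; rewrite -sqrtr_sqr ler_sqrt ?addr_ge0 ?sqr_ge0// lerDr sqr_ge0.
Qed.

Lemma complexRI z : z = (cRe z)%:C + 'i * (cIm z)%:C.
Proof. exact: complexE. Qed.

Lemma cn_le_ReIm z : cn z <= `|cRe z| + `|cIm z|.
Proof.
rewrite {1}[z]complexRI (le_trans (cnD _ _))// cnM cn_i mul1r.
by rewrite !cn_real.
Qed.

Lemma cn_int (n : int) : cn (n%:~R : C) = `|n%:~R|.
Proof. by rewrite -[n%:~R : C](rmorph_int (real_complex R)) cn_real. Qed.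

Lemma cexpD z w : cexp (z + w) = cexp z * cexp w.
Proof.
apply: ceqP; rewrite /cexp !ReImE /= expRD ?cosD ?sinD; ring.
Qed.

Lemma cexp0 : cexp (0 : C) = 1.
Proof. by apply: ceqP; rewrite /cexp !ReImE /= expR0 cos0 sin0; ring. Qed.

Lemma cn_cexp z : cn (cexp z) = expR (cRe z).
Proof.
rewrite /cexp cnM cn_real ger0_norm ?expR_ge0//= cos2Dsin2 sqrtr1 mulr1//.
Qed.

Lemma cexp_neq0 z : cexp z != 0.
Proof. by rewrite -cn_gt0 cn_cexp expR_gt0. Qed.

Lemma cexpN z : cexp (- z) = (cexp z)^-1.
Proof.
apply: (mulfI (cexp_neq0 z)); rewrite -cexpD subrr cexp0 divff//.
exact: cexp_neq0.
Qed.

Lemma cexpR x : cexp x%:C = (expR x)%:C.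
Proof. by apply: ceqP; rewrite /cexp !ReImE /= cos0 sin0; ring. Qed.

Lemma e2piD z w : e2pi (z + w) = e2pi z * e2pi w.
Proof. by rewrite /e2pi mulrDr cexpD. Qed.

Lemma e2pi0 : e2pi (0 : C) = 1. Proof. by rewrite /e2pi mulr0 cexp0. Qed.

Lemma e2pi_neq0 z : e2pi z != 0. Proof. exact: cexp_neq0. Qed.

Lemma e2piN z : e2pi (- z) = (e2pi z)^-1.
Proof. by rewrite /e2pi mulrN cexpN. Qed.

Lemma e2piB z w : e2pi (z - w) = e2pi z / e2pi w.
Proof. by rewrite e2piD e2piN. Qed.

Lemma Re_2pii z : cRe (2 * (pi : R)%:C * 'i * z) = - (2 * pi * cIm z).
Proof. by rewrite !ReImE /=; ring. Qed.

Lemma Im_2pii z : cIm (2 * (pi : R)%:C * 'i * z) = 2 * pi * cRe z.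
Proof. by rewrite !ReImE /=; ring. Qed.

Lemma e2piE z : e2pi z = (expR (- (2 * pi * cIm z)))%:C
  * (cos (2 * pi * cRe z) +i* sin (2 * pi * cRe z)).
Proof. by rewrite /e2pi /cexp Re_2pii Im_2pii. Qed.

Lemma cn_e2pi z : cn (e2pi z) = expR (- (2 * pi * cIm z)).
Proof. by rewrite /e2pi cn_cexp Re_2pii. Qed.

Lemma e2pi_nat (n : nat) : e2pi (n%:R : C) = 1.
Proof.
elim: n => [|n IH]; first exact: e2pi0.
rewrite -addn1 natrD e2piD IH mul1r.
rewrite e2piE /= mulr0 oppr0 mulr1 mulr_natl cos2pi sin2pi expR0.
by apply: ceqP; rewrite !ReImE /=; ring.
Qed.

Lemma e2pi_int (n : int) : e2pi (n%:~R : C) = 1.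
Proof.
case: n => n; first exact: e2pi_nat.
by rewrite NegzE mulrNz e2piN e2pi_nat invr1.
Qed.

Lemma e2piDint z (n : int) : e2pi (z + n%:~R) = e2pi z.
Proof. by rewrite e2piD e2pi_int mulr1. Qed.

(** The modulus forces [z] to be real; its fractional part [x] then has [cos (2 pi x) = 1], hence
    [sin (pi x) = 0], while the sine is positive on []0, pi[]. *)
Lemma e2pi_eq1 z : e2pi z = 1 -> exists n : int, z = n%:~R.
Proof.
move=> e1.
have y0 : cIm z = 0.
  have := cn_e2pi z; rewrite e1 cn1 -[X in X = _ -> _]expR0 => /(@expR_inj R)/eqP.
  rewrite eq_sym oppr_eq0 !mulf_eq0 pnatr_eq0 /=.
  by rewrite (gt_eqF (pi_gt0 R)) /= => /eqP.
pose x := cRe z - (Num.floor (cRe z))%:~R.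
have zE : z = x%:C + (Num.floor (cRe z))%:~R.
  apply: ceqP; rewrite !ReImE ?Re_int ?Im_int /= /x; first by ring.
  by rewrite y0 addr0.
have /andP[x0 x1] : (0 <= x < 1).
  rewrite /x subr_ge0 floor_le_tmp ltrBlDl.
  by have := floorD1_gt (cRe z); rewrite intrD addrC.
have cx : cos (2 * pi * x) = 1.
  move: e1; rewrite zE e2piDint => /(congr1 cRe).
  by rewrite e2piE ReM /= mulr0 oppr0 expR0; lra.
have [/eqP x00|xn0] := boolP (x == 0).
  by exists (Num.floor (cRe z)); rewrite {1}zE x00 add0r.
have : sin (pi * x) ^+ 2 = 0.
  have : cos (2 * pi * x) = cos (pi * x) ^+ 2 - sin (pi * x) ^+ 2.
    by rewrite (_ : 2 * pi * x = pi * x + pi * x) ?cosD -?expr2//; ring.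
  by have := cos2Dsin2 (pi * x); rewrite cx; lra.
move=> /eqP; rewrite sqrf_eq0 => /eqP s0.
have : 0 < sin (pi * x).
  apply: sin_gt0_pi; rewrite mulr_gt0 ?pi_gt0 ?gtr_pMr ?pi_gt0//=.
  by rewrite lt_neqAle eq_sym xn0.
by rewrite s0 ltxx.
Qed.

Lemma qpowE tau z : qpow tau z = e2pi (z * tau). Proof. by []. Qed.

End ComplexBasics.

(** * Derivatives of complex-valued functions of a real variable *)

Section ComplexDerivative.
Variable R : realType.
Local Notation C := R[i].

(** Componentwise, so that real differential calculus applies; complex parameters are always reached
    along a real path. *)
Definition is_cd (f : R -> C) (x : R) (d : C) :=
  is_derive x 1 (fun s => cRe (f s)) (cRe d) /\
  is_derive x 1 (fun s => cIm (f s)) (cIm d).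

Lemma is_cd_eq f x d d' : is_cd f x d -> d = d' -> is_cd f x d'.
Proof. by move=> ? <-. Qed.

Lemma is_cd_ext f g x d : (forall s, f s = g s) -> is_cd f x d -> is_cd g x d.
Proof. by move=> /funext ->. Qed.

Lemma is_cd_cst (c : C) x : is_cd (fun=> c) x 0.
Proof. by split; exact: is_derive_cst. Qed.

Lemma is_cdD f g x d e : is_cd f x d -> is_cd g x e ->
  is_cd (fun s => f s + g s) x (d + e).
Proof.
move=> [f1 f2] [g1 g2]; split.
- rewrite ReD (_ : (fun s => _) = (fun s => cRe (f s)) + (fun s => cRe (g s))).
    exact: is_deriveD.
  by apply/funext => s; rewrite ReD.
- rewrite ImD (_ : (fun s => _) = (fun s => cIm (f s)) + (fun s => cIm (g s))).
    exact: is_deriveD.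
  by apply/funext => s; rewrite ImD.
Qed.

Lemma is_cdM f g x d e : is_cd f x d -> is_cd g x e ->
  is_cd (fun s => f s * g s) x (d * g x + f x * e).
Proof.
move=> [f1 f2] [g1 g2]; split.
- rewrite (_ : (fun s => _) = ((fun s => cRe (f s)) * (fun s => cRe (g s))
     - (fun s => cIm (f s)) * (fun s => cIm (g s)))).
    apply: (is_derive_eq (is_deriveB (is_deriveM f1 g1) (is_deriveM f2 g2))).
    by rewrite /GRing.scale /= !ReImE; move: (cRe _) (cIm _) => *; ring.
  by apply/funext => s; rewrite ReM.
- rewrite (_ : (fun s => _) = ((fun s => cRe (f s)) * (fun s => cIm (g s))
     + (fun s => cIm (f s)) * (fun s => cRe (g s)))).
    apply: (is_derive_eq (is_deriveD (is_deriveM f1 g2) (is_deriveM f2 g1))).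
    by rewrite /GRing.scale /= !ReImE; move: (cRe _) (cIm _) => *; ring.
  by apply/funext => s; rewrite ImM.
Qed.

Lemma is_cdZ (c : C) f x d : is_cd f x d -> is_cd (fun s => c * f s) x (c * d).
Proof.
move=> fd; apply: is_cd_eq (is_cdM (is_cd_cst c x) fd) _.
by rewrite mul0r add0r.
Qed.

Lemma is_cdN f x d : is_cd f x d -> is_cd (fun s => - f s) x (- d).
Proof.
move=> fd; rewrite -mulN1r; apply: is_cd_ext (is_cdZ (-1) fd) => s.
by rewrite mulN1r.
Qed.

Lemma is_cd_real (g : R -> R) (x d : R) : is_derive x 1 g d ->
  is_cd (fun s => (g s)%:C) x d%:C.
Proof. by move=> gd; split => //=; exact: is_derive_cst. Qed.

Lemma is_cd_id x : is_cd (fun s => s%:C) x 1.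
Proof. exact: (is_cd_real (is_derive_id x 1)). Qed.

Lemma is_cd_cexp f x d : is_cd f x d ->
  is_cd (fun s => cexp (f s)) x (d * cexp (f x)).
Proof.
move=> [f1 f2].
have E : is_derive x 1 (fun s => expR (cRe (f s))) (expR (cRe (f x)) * cRe d).
  apply: (@is_derive1_comp R expR (fun s => cRe (f s))).
have Co : is_derive x 1 (fun s => cos (cIm (f s))) (- sin (cIm (f x)) * cIm d).
  apply: (@is_derive1_comp R cos (fun s => cIm (f s))).
have S : is_derive x 1 (fun s => sin (cIm (f s))) (cos (cIm (f x)) * cIm d).
  apply: (@is_derive1_comp R sin (fun s => cIm (f s))).
rewrite /cexp; split.
- rewrite (_ : (fun s => _) = (fun s => expR (cRe (f s))) * (fun s => cos (cIm (f s)))).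
    by apply: is_derive_eq; rewrite /GRing.scale /= !ReImE /=; ring.
  by apply/funext => s; rewrite ReM /=; rewrite mul0r subr0.
- rewrite (_ : (fun s => _) = (fun s => expR (cRe (f s))) * (fun s => sin (cIm (f s)))).
    by apply: is_derive_eq; rewrite /GRing.scale /= !ReImE /=; ring.
  by apply/funext => s; rewrite ImM /=; rewrite mul0r addr0.
Qed.

Lemma is_cd0_cst f (x y : R) : (forall s, is_cd f s 0) -> f x = f y.
Proof.
by move=> f0; apply: ceqP;
  [apply: (@is_derive_0_is_cst _ (fun s => cRe (f s))) => s; case: (f0 s)
  |apply: (@is_derive_0_is_cst _ (fun s => cIm (f s))) => s; case: (f0 s)].
Qed.

End ComplexDerivative.

(** * Absolutely convergent sums *)
Section NonnegativeSums.
Local Open Scope classical_set_scope.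
Variable R : realType.

Definition esE (I : choiceType) (g : I -> R) : \bar R := \esum_(i in [set: I]) (g i)%:E.
(** [fine] sends an infinite sum to 0, so statements about [es] go together with [nns]. *)
Definition es (I : choiceType) (g : I -> R) : R := fine (esE g).
Definition nns (I : choiceType) (g : I -> R) : Prop :=
  (forall i, 0 <= g i) /\ (esE g < +oo)%E.

Section OneIndex.
Variable I : choiceType.
Implicit Types g h : I -> R.

Lemma nns_ge0 g i : nns g -> 0 <= g i. Proof. by case. Qed.

Lemma esE_ge0 g : (forall i, 0 <= g i) -> (0 <= esE g)%E.
Proof. by move=> g0; apply: esum_ge0 => i _; rewrite lee_fin. Qed.

Lemma es_fin g : nns g -> (es g)%:E = esE g.
Proof.
by case=> g0 gf; rewrite fineK// ge0_fin_numE//; exact: esE_ge0.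
Qed.

Lemma es_ge0 g : nns g -> 0 <= es g.
Proof. by move=> [g0 gf]; apply: fine_ge0; exact: esE_ge0. Qed.

Lemma nns_le g h : (forall i, 0 <= g i <= h i) -> nns h -> nns g.
Proof.
move=> gh [h0 hf]; split=> [i|]; first by case/andP: (gh i).
by apply: le_lt_trans hf; apply: le_esum => i _; rewrite lee_fin; case/andP: (gh i).
Qed.

Lemma es_le g h : (forall i, 0 <= g i <= h i) -> nns h -> es g <= es h.
Proof.
move=> gh nh; rewrite -lee_fin (es_fin nh) es_fin; last exact: nns_le nh.
by apply: le_esum => i _; rewrite lee_fin; case/andP: (gh i).
Qed.

Lemma nnsD g h : nns g -> nns h -> nns (fun i => g i + h i).
Proof.
move=> ng nh; split=> [i|]; first by rewrite addr_ge0 ?nns_ge0.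
rewrite /esE; under eq_esum do rewrite EFinD.
rewrite esumD ?lte_add_pinfty//; [by case: ng|by case: nh| |] => i _;
  by rewrite lee_fin nns_ge0.
Qed.

Lemma esD g h : nns g -> nns h -> es (fun i => g i + h i) = es g + es h.
Proof.
move=> ng nh; apply: EFin_inj; rewrite (es_fin (nnsD ng nh)) EFinD !es_fin//.
rewrite /esE; under eq_esum do rewrite EFinD.
by rewrite esumD// => i _; rewrite lee_fin nns_ge0.
Qed.

Lemma esE_scale_le g (c : R) : 0 <= c -> (forall i, 0 <= g i) ->
  (esE (fun i => (c * g i)%R) <= c%:E * esE g)%E.
Proof.
move=> c0 g0; apply: ge_ereal_sup => _ [A [fA _] <-].
rewrite (eq_fsbigr (fun i => c%:E * (g i)%:E)%E); last by move=> i _; rewrite EFinM.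
rewrite -ge0_mule_fsumr; last by move=> i; rewrite lee_fin.
apply: lee_wpmul2l; first by rewrite lee_fin.
by apply: esum_ge; exists A.
Qed.

Lemma nnsZ g (c : R) : 0 <= c -> nns g -> nns (fun i => c * g i).
Proof.
move=> c0 ng; split=> [i|]; first by rewrite mulr_ge0//; exact: nns_ge0 ng.
apply: le_lt_trans (esE_scale_le c0 ng.1) _.
by rewrite -(es_fin ng) -EFinM ltry.
Qed.

(** Finite sums give one inequality; the other one is the same inequality for [c^-1] and the
    function [c g]. *)
Lemma esZ g (c : R) : 0 <= c -> nns g -> es (fun i => c * g i) = c * es g.
Proof.
move=> c0 ng.
have H (d : R) (f : I -> R) : 0 <= d -> nns f -> es (fun i => d * f i) <= d * es f.
  move=> d0 nf; rewrite -lee_fin EFinM !es_fin//; last exact: nnsZ.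
  by apply: esE_scale_le => //; case: nf.
have [->|cn0] := eqVneq c 0.
  apply/eqP; rewrite eq_le H//= mul0r; apply: es_ge0.
  by apply: nnsZ.
apply/eqP; rewrite eq_le H//=.
have := H c^-1 (fun i => c * g i); rewrite invr_ge0 => /(_ c0 (nnsZ c0 ng)).
rewrite (_ : (fun i => _) = g); last by apply/funext => i; rewrite mulKf.
by rewrite ler_pdivlMl// lt_neqAle eq_sym cn0.
Qed.

Lemma es_bounded g (M : R) : (forall i, 0 <= g i) ->
  (forall s : seq I, uniq s -> \sum_(i <- s) g i <= M) -> nns g.
Proof.
move=> g0 gM; split=> //; apply: (@le_lt_trans _ _ M%:E); last exact: ltry.
apply: ge_ereal_sup => _ [A [fA _] <-].
have /finite_fsetP[B ->] := fA.
rewrite fsbig_finite//= set_fsetK sumEFin lee_fin; apply: gM.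
exact: finmap.fset_uniq.
Qed.

Lemma es_seq_le g (s : seq I) : nns g -> uniq s -> \sum_(i <- s) g i <= es g.
Proof.
move=> ng us; rewrite -lee_fin es_fin// -sumEFin.
apply: esum_ge; exists [set` s].
  by split=> //; exact: finite_seq.
by rewrite -fsbig_seq.
Qed.

Lemma es_approx g (e : R) : nns g -> 0 < e ->
  exists2 s : seq I, uniq s & es g - e < \sum_(i <- s) g i.
Proof.
move=> ng e0.
have : esE g \is a fin_num by rewrite -(es_fin ng).
move=> /(@ub_ereal_sup_adherent _ _ e e0) [_ [A [fA _] <-]].
have /finite_fsetP[B ->] := fA.
rewrite fsbig_finite//= set_fsetK sumEFin => H.
exists (finmap.enum_fset B); first exact: finmap.fset_uniq.
by rewrite -lte_fin EFinB es_fin.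
Qed.

Lemma big_subseq_le g (s t : seq I) : (forall i, 0 <= g i) -> uniq s -> uniq t ->
  {subset s <= t} -> \sum_(i <- s) g i <= \sum_(i <- t) g i.
Proof.
move=> g0 us ut st.
rewrite [leRHS](bigID (mem s))/= -[X in _ <= X + _]big_filter.
rewrite (perm_big [seq i <- t | i \in s]); last first.
  apply: uniq_perm => //; first exact: filter_uniq.
  by move=> i; rewrite mem_filter; case: (boolP (i \in s)) => //= /st ->.
by rewrite lerDl sumr_ge0.
Qed.

End OneIndex.

Lemma es_reindex (I J : choiceType) (e : I -> J) (g : J -> R) :
  bijective e -> es (fun i => g (e i)) = es g.
Proof.
move=> be; congr fine; symmetry; apply: reindex_esum.
by rewrite setTT_bijective.
Qed.

Lemma nns_reindex (I J : choiceType) (e : I -> J) (g : J -> R) :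
  bijective e -> nns g -> nns (fun i => g (e i)).
Proof.
move=> be [g0 gf]; split=> //; rewrite /esE -(@reindex_esum _ _ _ setT setT e (fun j => (g j)%:E))//.
by rewrite setTT_bijective.
Qed.

Lemma esE_pair (I J : choiceType) (g : I * J -> R) : (forall p, 0 <= g p) ->
  esE g = \esum_(i in [set: I]) \esum_(j in [set: J]) (g (i, j))%:E.
Proof.
move=> g0; rewrite (esum_esum (a := fun i j => (g (i, j))%:E)); last first.
  by move=> i j _ _; rewrite lee_fin.
rewrite /esE (_ : [set: I] `*`` _ = setT).
  by apply: eq_esum => -[i j] _.
by apply/seteqP; split.
Qed.

Lemma nns_slice (I J : choiceType) (g : I * J -> R) : nns g ->
  forall i, nns (fun j => g (i, j)).
Proof.
move=> ng i; split=> [j|]; first by case: ng.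
apply: le_lt_trans ng.2; rewrite esE_pair; last by case: ng.
apply: esum_ge; exists [set i]; first by split => //; exact: finite_set1.
by rewrite fsbig_set1.
Qed.

Lemma nns_es (I J : choiceType) (g : I * J -> R) : nns g ->
  nns (fun i => es (fun j => g (i, j))).
Proof.
move=> ng; split=> [i|]; first by apply: es_ge0; exact: nns_slice.
rewrite (_ : esE _ = esE g); first by case: ng.
rewrite esE_pair; last by case: ng.
by apply: eq_esum => i _; rewrite es_fin//; exact: nns_slice.
Qed.

Lemma es_pair (I J : choiceType) (g : I * J -> R) : nns g ->
  es g = es (fun i => es (fun j => g (i, j))).
Proof.
move=> ng; congr fine; rewrite esE_pair; last by case: ng.
by apply: eq_esum => i _; rewrite es_fin//; exact: nns_slice.
Qed.

Lemma nns_prod (I J : choiceType) (g : I -> R) (h : J -> R) : nns g -> nns h ->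
  nns (fun p => g p.1 * h p.2).
Proof.
move=> ng nh; split=> [p|]; first by rewrite mulr_ge0 ?nns_ge0.
rewrite esE_pair; last by move=> p; rewrite mulr_ge0 ?nns_ge0.
rewrite (_ : (\esum_(i in _) _) = esE (fun i => es h * g i)); last first.
  apply: eq_esum => i _; rewrite mulrC -esZ ?nns_ge0// es_fin//.
  exact: nnsZ (nns_ge0 _ _) nh.
exact: (nnsZ (es_ge0 nh) ng).2.
Qed.

End NonnegativeSums.

Section ComplexSums.
Local Open Scope classical_set_scope.
Variable R : realType.
Local Notation C := R[i].

(** No enumeration of [I] enters, so reindexing along a bijection is free. Absolute convergence is
    asked for by linearity, by bounds and by iterated sums. *)
Definition rsum (I : choiceType) (f : I -> R) : R :=
  es (fun i => Num.max (f i) 0) - es (fun i => Num.max (- f i) 0).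

Definition csum (I : choiceType) (f : I -> C) : C :=
  rsum (fun i => cRe (f i)) +i* rsum (fun i => cIm (f i)).

Definition absum (I : choiceType) (f : I -> C) : Prop := nns (fun i => cn (f i)).

Section OneIndex.
Variable I : choiceType.
Implicit Types (f : I -> C) (g h : I -> R).

Let rs g := nns (fun i => `|g i|).

Lemma rs_pos g : rs g -> nns (fun i => Num.max (g i) 0).
Proof.
apply: nns_le => i; rewrite le_max lexx orbT ge_max normr_ge0 andbT.
exact: ler_norm.
Qed.

Lemma rs_neg g : rs g -> nns (fun i => Num.max (- g i) 0).
Proof.
apply: nns_le => i; rewrite le_max lexx orbT ge_max normr_ge0 andbT.
by rewrite -normrN ler_norm.
Qed.

Lemma maxB (x : R) : Num.max x 0 - Num.max (- x) 0 = x.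
Proof. by rewrite /Num.max; do !case: ifPn; lra. Qed.

(** Any splitting into summable nonnegative functions may replace the positive and negative parts,
    because [k^+ + h = k^- + g] termwise. Linearity and the iterated sum both reduce to this. *)
Lemma rsumE g h k : nns g -> nns h -> (forall i, k i = g i - h i) ->
  rsum k = es g - es h.
Proof.
move=> ng nh kE.
have rk : rs k.
  apply: nns_le (nnsD ng nh) => i; rewrite normr_ge0/= kE.
  rewrite (le_trans (ler_normB _ _))// !ger0_norm ?nns_ge0//.
apply/eqP; rewrite subr_eq addrAC eq_sym subr_eq eq_sym.
rewrite -!esD//; [|exact: rs_neg|exact: rs_pos].
apply/eqP; congr es; apply/funext => i.
by have := maxB (k i); rewrite {3}kE; lra.
Qed.

Lemma absum_Re f : absum f -> rs (fun i => cRe (f i)).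
Proof. by apply: nns_le => i; rewrite normr_ge0 Re_le_cn. Qed.

Lemma absum_Im f : absum f -> rs (fun i => cIm (f i)).
Proof. by apply: nns_le => i; rewrite normr_ge0 Im_le_cn. Qed.

Lemma rsumD g h : rs g -> rs h -> rsum (fun i => g i + h i) = rsum g + rsum h.
Proof.
move=> rg rh; rewrite (rsumE (nnsD (rs_pos rg) (rs_pos rh)) (nnsD (rs_neg rg) (rs_neg rh))).
  by rewrite !esD ?rs_pos ?rs_neg// /rsum; [ring|..]; do ?[exact: rs_pos|exact: rs_neg].
by move=> i; have := maxB (g i); have := maxB (h i); lra.
Qed.

Lemma rsumN g : rs g -> rsum (fun i => - g i) = - rsum g.
Proof.
move=> rg; rewrite (rsumE (rs_neg rg) (rs_pos rg)) /rsum ?opprB//.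
by move=> i; have := maxB (g i); lra.
Qed.

Lemma rsumZ (c : R) g : rs g -> rsum (fun i => c * g i) = c * rsum g.
Proof.
move=> rg.
have H (d : R) : 0 <= d -> rsum (fun i => d * g i) = d * rsum g.
  move=> d0; rewrite (rsumE (nnsZ d0 (rs_pos rg)) (nnsZ d0 (rs_neg rg))).
    by rewrite !esZ// /rsum; [ring|exact: rs_neg|exact: rs_pos].
  by move=> i; rewrite -mulrBr maxB.
have [c0|c0] := leP 0 c; first exact: H.
rewrite (_ : (fun i => _) = (fun i => - ((- c) * g i))); last first.
  by apply/funext => i; rewrite mulNr opprK.
rewrite rsumN ?H ?mulNr ?opprK// ?oppr_ge0 ?ltW//.
rewrite /rs; under eq_fun do rewrite normrM.
by apply: nnsZ.
Qed.

Lemma absum_ext f f' : (forall i, f i = f' i) -> absum f -> absum f'.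
Proof. by move=> /funext ->. Qed.

Lemma absum_le f g : (forall i, cn (f i) <= g i) -> nns g -> absum f.
Proof. by move=> fg; apply: nns_le => i; rewrite cn_ge0 fg. Qed.

Lemma absumD f f' : absum f -> absum f' -> absum (fun i => f i + f' i).
Proof. by move=> sf sf'; apply: absum_le (nnsD sf sf') => i; exact: cnD. Qed.

Lemma absumZ (c : C) f : absum f -> absum (fun i => c * f i).
Proof.
by move=> sf; apply: absum_le (nnsZ (cn_ge0 c) sf) => i; rewrite cnM.
Qed.

Lemma absumN f : absum f -> absum (fun i => - f i).
Proof. by move=> sf; apply: absum_le sf => i; rewrite cnN. Qed.

Lemma absumB f f' : absum f -> absum f' -> absum (fun i => f i - f' i).
Proof. by move=> sf sf'; apply: absumD => //; exact: absumN. Qed.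

Lemma eq_csum f f' : (forall i, f i = f' i) -> csum f = csum f'.
Proof. by move=> /funext ->. Qed.

Lemma csumD f f' : absum f -> absum f' ->
  csum (fun i => f i + f' i) = csum f + csum f'.
Proof.
move=> sf sf'; rewrite /csum; apply: ceqP => /=.
- rewrite -rsumD; [|exact: absum_Re|exact: absum_Re].
  by congr rsum; apply/funext => i; rewrite ReD.
- rewrite -rsumD; [|exact: absum_Im|exact: absum_Im].
  by congr rsum; apply/funext => i; rewrite ImD.
Qed.

Lemma csumZ (c : C) f : absum f -> csum (fun i => c * f i) = c * csum f.
Proof.
move=> sf; have rR := absum_Re sf; have rI := absum_Im sf.
have rZ (d : R) g : rs g -> rs (fun i => d * g i).
  by move=> rg; rewrite /rs; under eq_fun do rewrite normrM; exact: nnsZ.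
rewrite /csum (_ : (fun i => cRe (c * f i)) =
    fun i => cRe c * cRe (f i) + (- cIm c) * cIm (f i)); last first.
  by apply/funext => i; rewrite ReM mulNr.
rewrite (_ : (fun i => cIm (c * f i)) =
    fun i => cRe c * cIm (f i) + cIm c * cRe (f i)); last first.
  by apply/funext => i; rewrite ImM.
rewrite !rsumD; [|exact: rZ..].
rewrite !rsumZ//.
by apply: ceqP; rewrite !ReImE /= ?mulNr.
Qed.

Lemma csumZr (c : C) f : absum f -> csum (fun i => f i * c) = csum f * c.
Proof. by move=> sf; rewrite mulrC -csumZ//; apply: eq_csum => i; rewrite mulrC. Qed.

Lemma csumN f : absum f -> csum (fun i => - f i) = - csum f.
Proof. by move=> sf; rewrite -mulN1r -csumZ//; apply: eq_csum => i; rewrite mulN1r. Qed.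

Lemma csumB f f' : absum f -> absum f' ->
  csum (fun i => f i - f' i) = csum f - csum f'.
Proof. by move=> sf sf'; rewrite csumD ?csumN//; exact: absumN. Qed.

Lemma rsum_le g h : (forall i, `|g i| <= h i) -> nns h -> `|rsum g| <= es h.
Proof.
move=> gh nh.
have rg : rs g by apply: nns_le nh => i; rewrite normr_ge0 gh.
rewrite ler_norml /rsum.
have p0 := es_ge0 (rs_pos rg); have n0 := es_ge0 (rs_neg rg).
have h0 i : 0 <= h i := le_trans (normr_ge0 _) (gh i).
have gl i : g i <= h i := le_trans (ler_norm _) (gh i).
have ngl i : - g i <= h i by apply: le_trans (gh i); rewrite -normrN ler_norm.
have pl : es (fun i => Num.max (g i) 0) <= es h.
  by apply: (es_le _ nh) => i; rewrite le_max lexx orbT ge_max gl h0.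
have nl : es (fun i => Num.max (- g i) 0) <= es h.
  by apply: (es_le _ nh) => i; rewrite le_max lexx orbT ge_max ngl h0.
by apply/andP; split; lra.
Qed.

(** The factor 2 comes from bounding real and imaginary parts separately; the size of such constants
    is immaterial below. *)
Lemma cn_csum f g : (forall i, cn (f i) <= g i) -> nns g -> cn (csum f) <= 2 * es g.
Proof.
move=> fg ng; rewrite (le_trans (cn_le_ReIm _))//= mulr_natl mulr2n lerD//.
  by apply: rsum_le => // i; exact: le_trans (Re_le_cn _) (fg i).
by apply: rsum_le => // i; exact: le_trans (Im_le_cn _) (fg i).
Qed.

Lemma es_delta (j : I) (c : R) : 0 <= c ->
  nns (fun i => if i == j then c else 0) /\ es (fun i => if i == j then c else 0) = c.
Proof.
move=> c0.
have E : esE (fun i => if i == j then c else 0) = c%:E.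
  rewrite -(@esum_set1 R I j (fun=> c%:E)) ?lee_fin// /esE [RHS]esum_mkcond.
  apply: eq_esum => i _; rewrite (_ : (i \in [set j]) = (i == j)); first by case: ifP.
  by apply/idP/eqP => [/set_mem|->]//; exact/mem_set.
split; last by rewrite /es E.
by split; [move=> i; case: ifP | rewrite E ltry].
Qed.

Lemma csum_delta (j : I) (c : C) :
  absum (fun i => if i == j then c else 0) /\ csum (fun i => if i == j then c else 0) = c.
Proof.
split.
  rewrite /absum (_ : (fun i => _) = (fun i => if i == j then cn c else 0)).
    by case: (es_delta j (cn_ge0 c)).
  by apply/funext => i; case: ifP; rewrite ?cn0.
have H (x : R) : rsum (fun i => if i == j then x else 0) = x.
  have p0 : 0 <= Num.max x 0 by rewrite le_max lexx orbT.
  have n0 : 0 <= Num.max (- x) 0 by rewrite le_max lexx orbT.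
  have [np ep] := es_delta j p0; have [nn en] := es_delta j n0.
  rewrite (rsumE np nn) ?ep ?en ?maxB// => i.
  by case: ifP; rewrite ?maxB ?subrr.
rewrite /csum; apply: ceqP => /=.
- by rewrite -[RHS]H; congr rsum; apply/funext => i; case: ifP.
- by rewrite -[RHS]H; congr rsum; apply/funext => i; case: ifP.
Qed.

Lemma absum0 : absum (fun _ : I => 0 : C).
Proof.
split=> [i|]; first exact: cn_ge0.
by rewrite /esE esum1 ?ltry// => i _; rewrite cn0.
Qed.

Lemma csum0 : csum (fun _ : I => 0 : C) = 0.
Proof.
rewrite -[RHS](mul0r (csum (fun _ : I => 0 : C))) -csumZ; last exact: absum0.
by apply: eq_csum => i; rewrite mul0r.
Qed.

Lemma csum_seq f (s : seq I) : uniq s -> (forall i, i \notin s -> f i = 0) ->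
  absum f /\ csum f = \sum_(i <- s) f i.
Proof.
elim: s f => [|j s IH] f /=.
  move=> _ f0; rewrite big_nil.
  have -> : f = (fun=> 0) by apply/funext => i; rewrite f0.
  by split; [exact: absum0 | exact: csum0].
move=> /andP[js us] f0.
pose f' i := if i == j then 0 else f i.
have [sf' Ef'] : absum f' /\ csum f' = \sum_(i <- s) f' i.
  apply: IH => // i is_; rewrite /f'; case: eqP => // ij.
  by apply: f0; rewrite in_cons negb_or is_ andbT; apply/eqP.
have [sd Ed] := csum_delta j (f j).
have fE i : (if i == j then f j else 0) + f' i = f i.
  by rewrite /f'; case: eqP => [->|_]; rewrite ?addr0 ?add0r.
split; first by apply: absum_ext fE _; exact: absumD.
rewrite -(eq_csum fE) csumD// Ed Ef' big_cons; congr (_ + _).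
rewrite [LHS]big_seq [RHS]big_seq; apply: eq_bigr => i is_; rewrite /f'.
by case: eqP => // ij; move: js; rewrite -ij is_.
Qed.

(** The finite set depends on the majorant alone and serves every [f] below it. Dominated
    convergence and the comparison with partial sums both rest on this uniformity. *)
Lemma csum_tail g (e : R) : nns g -> 0 < e -> exists s : seq I,
  forall t, uniq t -> {subset s <= t} -> forall f, (forall i, cn (f i) <= g i) ->
  cn (csum f - \sum_(i <- t) f i) <= e.
Proof.
move=> ng e0; have e20 : 0 < e / 2 by rewrite divr_gt0.
have [s us ss] := es_approx ng e20; exists s => t ut st f fg.
pose ft i := if i \in t then f i else 0; pose fr i := if i \in t then 0 else f i.
have [sft Eft] : absum ft /\ csum ft = \sum_(i <- t) ft i.
  by apply: csum_seq => // i it; rewrite /ft (negbTE it).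
have sfr : absum fr.
  by apply: (absum_le _ ng) => i; rewrite /fr; case: ifP => _ //; rewrite cn0; exact: nns_ge0 ng.
have fE i : ft i + fr i = f i by rewrite /ft /fr; case: ifP; rewrite ?addr0 ?add0r.
have -> : \sum_(i <- t) f i = csum ft.
  rewrite Eft big_seq [RHS]big_seq; apply: eq_bigr => i it.
  by rewrite /ft it.
rewrite -(eq_csum fE) csumD// addrC addKr.
pose gt i := if i \in t then g i else 0; pose gr i := if i \in t then 0 else g i.
have g0 i : 0 <= g i by exact: nns_ge0 ng.
have ngt : nns gt by apply: nns_le ng => i; rewrite /gt; case: ifP; rewrite ?lexx ?g0.
have ngr : nns gr by apply: nns_le ng => i; rewrite /gr; case: ifP; rewrite ?lexx ?g0.
have gE : (fun i => gt i + gr i) = g.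
  by apply/funext => i; rewrite /gt /gr; case: ifP; rewrite ?addr0 ?add0r.
have frgr i : cn (fr i) <= gr i by rewrite /fr /gr; case: ifP; rewrite ?cn0.
apply: (le_trans (cn_csum frgr ngr)).
have := esD ngt ngr; rewrite gE => esgE.
have : \sum_(i <- t) g i <= es gt.
  apply: le_trans (es_seq_le ngt ut); rewrite big_seq [leRHS]big_seq.
  by apply: ler_sum => i it; rewrite /gt it.
have := big_subseq_le ng.1 us ut st.
by move: ss; rewrite esgE; lra.
Qed.

(** Tannery's theorem: outside a finite set chosen from [g] both sums are small, and on that set the
    terms converge. The filter is arbitrary because both sequences and punctured neighbourhoods
    occur. *)
Lemma csum_tannery (T : Type) (F : set_system T) {FF : Filter F}
    (q : T -> I -> C) (l : I -> C) g :
  nns g -> (\forall t \near F, forall i, cn (q t i) <= g i) ->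
  (forall i, cn (l i) <= g i) ->
  (forall i e, 0 < e -> \forall t \near F, cn (q t i - l i) <= e) ->
  forall e, 0 < e -> \forall t \near F, cn (csum (q t) - csum l) <= e.
Proof.
move=> ng qg lg ql e e0; have e30 : 0 < e / 3 by rewrite divr_gt0.
have [s hs] := csum_tail ng e30.
pose t0 := undup s.
have h0 := hs t0 (undup_uniq _) (fun i => etrans (mem_undup s i) \o idfun).
have [N hN] : exists N : R, 0 < N /\ (size t0)%:R <= N.
  by exists ((size t0)%:R + 1); split; [rewrite ltr_wpDl|rewrite lerDl].
have small : \forall t \near F, cn (\sum_(i <- t0) q t i - \sum_(i <- t0) l i) <= e / 3.
  have : forall r : seq I, \forall t \near F, cn (\sum_(i <- r) q t i - \sum_(i <- r) l i) <= (size r)%:R * (e / 3 / N).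
    elim=> [|i r IH].
      by apply: nearW => t; rewrite !big_nil subrr cn0 mul0r.
    have d0 : 0 < e / 3 / N by rewrite divr_gt0 //; case: hN.
    near=> t.
    rewrite !big_cons opprD addrACA (le_trans (cnD _ _))//= -add1n natrD mulrDl mul1r lerD//.
      by near: t; exact: ql.
    by near: t.
  move=> /(_ t0); apply: filterS => t /le_trans; apply.
  by case: hN => N0 hN; rewrite mulrCA ger_pMr// ler_pdivrMr// mul1r.
near=> t.
have qt : forall i, cn (q t i) <= g i by near: t.
have -> : csum (q t) - csum l = (csum (q t) - \sum_(i <- t0) q t i)
   + (\sum_(i <- t0) q t i - \sum_(i <- t0) l i) - (csum l - \sum_(i <- t0) l i) by ring.
apply: le_trans (cnB _ _) _.
have -> : e = e / 3 + e / 3 + e / 3 by field.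
rewrite lerD//; last exact: h0.
apply: le_trans (cnD _ _) _; rewrite lerD//; first exact: h0.
by near: t.
Unshelve. all: by end_near. Qed.

End OneIndex.

Lemma csum_reindex (I J : choiceType) (e : I -> J) (f : J -> C) :
  bijective e -> csum (fun i => f (e i)) = csum f.
Proof.
move=> be; rewrite /csum /rsum.
rewrite -!(es_reindex (fun j => Num.max (cRe (f j)) 0) be, es_reindex (fun j => Num.max (- cRe (f j)) 0) be).
by rewrite -!(es_reindex (fun j => Num.max (cIm (f j)) 0) be, es_reindex (fun j => Num.max (- cIm (f j)) 0) be).
Qed.

Lemma absum_reindex (I J : choiceType) (e : I -> J) (f : J -> C) :
  bijective e -> absum f -> absum (fun i => f (e i)).
Proof. by move=> be sf; exact: (nns_reindex be sf). Qed.

Lemma absum_slice (I J : choiceType) (f : I * J -> C) i :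
  absum f -> absum (fun j => f (i, j)).
Proof. by move=> sf; exact: (nns_slice sf). Qed.

Lemma rsum_pair (I J : choiceType) (f : I * J -> R) : nns (fun p => `|f p|) ->
  rsum f = rsum (fun i => rsum (fun j => f (i, j))).
Proof.
move=> rf; have np := rs_pos rf; have nn := rs_neg rf.
rewrite (rsumE (nns_es np) (nns_es nn)) => [|i].
  by rewrite /rsum (es_pair np) (es_pair nn).
by rewrite /rsum.
Qed.

Lemma csum_pair (I J : choiceType) (f : I * J -> C) : absum f ->
  csum f = csum (fun i => csum (fun j => f (i, j))).
Proof.
move=> sf; rewrite {1}/csum /=.
by rewrite (rsum_pair (absum_Re sf)) (rsum_pair (absum_Im sf)).
Qed.

Lemma absum_csum (I J : choiceType) (f : I * J -> C) : absum f ->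
  absum (fun i => csum (fun j => f (i, j))).
Proof.
move=> sf; have n2 : (0 : R) <= 2 by [].
apply: (absum_le _ (nnsZ n2 (nns_es sf))) => i.
by apply: cn_csum => //; exact: nns_slice sf i.
Qed.

Lemma absum_prod (I J : choiceType) (f : I -> C) (h : J -> C) :
  absum f -> absum h -> absum (fun p => f p.1 * h p.2).
Proof.
move=> sf sh; apply: (absum_le _ (nns_prod sf sh)) => p.
by rewrite cnM.
Qed.

Lemma csum_swap (I J : choiceType) (f : I * J -> C) : absum f ->
  csum (fun i => csum (fun j => f (i, j))) = csum (fun j => csum (fun i => f (i, j))).
Proof.
move=> sf; rewrite -csum_pair//.
pose sw (p : J * I) := (p.2, p.1).
have bs : bijective sw by exists (fun p => (p.2, p.1)) => -[].
rewrite -(csum_reindex f bs) csum_pair//.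
exact: absum_reindex.
Qed.

End ComplexSums.

(** * Limits in epsilon form and termwise differentiation *)

Section Limits.
Local Open Scope classical_set_scope.
Variable R : realType.
Local Notation C := R[i].

Lemma clim_eq (T : Type) (F : set_system T) {FF : ProperFilter F} (f : T -> C) (l : C) :
  (forall e, 0 < e -> \forall t \near F, cn (f t - l) <= e) -> clim F f = l.
Proof.
move=> H; rewrite /clim; apply: ceqP => /=.
- apply: cvg_lim => //; apply/cvgrPdist_le => e e0.
  apply: filterS (H e e0) => t; apply: le_trans.
  by rewrite -normrN opprB (le_trans _ (Re_le_cn _))// !ReImE.
- apply: cvg_lim => //; apply/cvgrPdist_le => e e0.
  apply: filterS (H e e0) => t; apply: le_trans.
  by rewrite -normrN opprB (le_trans _ (Im_le_cn _))// !ReImE.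
Qed.

Lemma is_deriveP (F : R -> R) (x d : R) :
  is_derive x 1 F d <->
  (forall e, 0 < e -> \forall h \near 0^', `|h^-1 * (F (h + x) - F x) - d| <= e).
Proof.
split=> [[dF <-] e e0|H].
- move: dF => /cvgrPdist_le /(_ e e0); apply: filterS => h.
  by rewrite /= distrC scaler1 /GRing.scale/=.
- have cv : (fun h => h^-1 *: ((F \o shift x) (h *: 1) - F x)) @ 0^' --> d.
    apply/cvgrPdist_le => e e0; apply: filterS (H e e0) => h.
    by rewrite /= distrC scaler1 /GRing.scale/=.
  apply: DeriveDef; first by apply/cvg_ex; exists d.
  by apply: cvg_lim.
Qed.

Lemma Re_realM (x : R) (z : C) : cRe (x%:C * z) = x * cRe z.
Proof. by rewrite ReM /= mul0r subr0. Qed.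

Lemma Im_realM (x : R) (z : C) : cIm (x%:C * z) = x * cIm z.
Proof. by rewrite ImM /= mul0r addr0. Qed.

Lemma is_cdP (F : R -> C) (x : R) (d : C) :
  is_cd F x d <->
  (forall e, 0 < e -> \forall h \near 0^', cn ((h^-1)%:C * (F (h + x) - F x) - d) <= e).
Proof.
split=> [[/is_deriveP dR /is_deriveP dI] e e0|H].
- have e20 : 0 < e / 2 by rewrite divr_gt0.
  near=> h.
  rewrite (le_trans (cn_le_ReIm _))// (splitr e) lerD//.
    rewrite ReD ReN Re_realM ReD ReN; near: h; exact: dR.
  rewrite ImD ImN Im_realM ImD ImN; near: h; exact: dI.
- split; apply/is_deriveP => e e0; apply: filterS (H e e0) => h; apply: le_trans.
    by apply: le_trans (Re_le_cn _); rewrite ReD ReN Re_realM ReD ReN.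
  by apply: le_trans (Im_le_cn _); rewrite ImD ImN Im_realM ImD ImN.
Unshelve. all: by end_near. Qed.

Lemma is_derive_lip (f df : R -> R) (a b M : R) : a <= b ->
  (forall s, a <= s <= b -> is_derive s 1 f (df s)) ->
  (forall s, a <= s <= b -> `|df s| <= M) -> `|f b - f a| <= M * (b - a).
Proof.
move=> ab fd dM.
have [] := @MVT_segment _ f df a b ab.
- by move=> s; rewrite in_itv/= => /andP[/ltW ? /ltW ?]; apply: fd; apply/andP.
- apply: derivable_within_continuous => s; rewrite in_itv/= => sab.
  by have [] := fd s sab.
move=> c; rewrite in_itv/= => cab ->.
by rewrite normrM [X in _ * X]ger0_norm ?subr_ge0// ler_wpM2r ?subr_ge0// dM.
Qed.

(** The mean value theorem fails for complex values; applying it to each component costs the factor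
    2. *)
Lemma is_cd_lip (f df : R -> C) (a b M : R) : a <= b ->
  (forall s, a <= s <= b -> is_cd f s (df s)) ->
  (forall s, a <= s <= b -> cn (df s) <= M) -> cn (f b - f a) <= 2 * M * (b - a).
Proof.
move=> ab fd dM; rewrite (le_trans (cn_le_ReIm _))//.
rewrite -mulrA mulr_natl mulr2n lerD// !ReImE.
  apply: (@is_derive_lip (fun s => cRe (f s)) (fun s => cRe (df s))) => // s sab.
    by case: (fd s sab).
  exact: le_trans (Re_le_cn _) (dM s sab).
apply: (@is_derive_lip (fun s => cIm (f s)) (fun s => cIm (df s))) => // s sab.
  by case: (fd s sab).
exact: le_trans (Im_le_cn _) (dM s sab).
Qed.

(** The mean value inequality bounds all difference quotients near [x] by [2 g i], and they converge
    termwise, so [csum_tannery] applies. *)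
Lemma csum_derive (I : choiceType) (f d : I -> R -> C) (g : I -> R) (x r : R) :
  0 < r -> nns g ->
  (forall i s, `|s - x| < r -> is_cd (f i) s (d i s)) ->
  (forall i s, `|s - x| < r -> cn (d i s) <= g i) ->
  (forall s, `|s - x| < r -> absum (fun i => f i s)) ->
  is_cd (fun s => csum (fun i => f i s)) x (csum (fun i => d i x)).
Proof.
move=> r0 ng fd dg sf; apply/is_cdP => e e0.
have xx : `|x - x| < r by rewrite subrr normr0.
have n2 : nns (fun i => 2 * g i) by apply: nnsZ.
pose q (h : R) i := (h^-1)%:C * (f i (h + x) - f i x).
have near_r : \forall h \near (0 : R)^', h != 0 /\ `|h| < r.
  near=> h; split; first by near: h; exact: nbhs_dnbhs_neq.
  near: h; apply: dnbhs0_lt => //.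
have qg : \forall h \near (0:R)^', forall i, cn (q h i) <= 2 * g i.
  apply: filterS near_r => h [h0 hr] i; rewrite /q cnM cn_real normfV.
  rewrite ler_pdivrMl ?normr_gt0//.
  have [hp|hn] := leP 0 h.
    have -> : `|h| * (2 * g i) = 2 * g i * (h + x - x) by rewrite addrK mulrC ger0_norm.
    apply: (@is_cd_lip (f i) (d i)) => [|s sab|s sab]; rewrite ?lerDr//.
      apply: fd; rewrite ger0_norm ?subr_ge0; last by case/andP: sab.
      by move: hr; rewrite ger0_norm// => hr; case/andP: sab => ? ?; lra.
    apply: dg; rewrite ger0_norm ?subr_ge0; last by case/andP: sab.
    by move: hr; rewrite ger0_norm// => hr; case/andP: sab => ? ?; lra.
  have -> : `|h| * (2 * g i) = 2 * g i * (x - (h + x)).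
    by rewrite ltr0_norm//; ring.
  rewrite -cnN opprB; move: hr; rewrite ltr0_norm// => hr.
  apply: (@is_cd_lip (f i) (d i)) => [|s sab|s sab]; first by lra.
    by apply: fd; rewrite ler0_norm; case/andP: sab => ? ?; lra.
  by apply: dg; rewrite ler0_norm; case/andP: sab => ? ?; lra.
have dg2 i : cn (d i x) <= 2 * g i.
  by rewrite (le_trans (dg i x xx))// ler_peMl ?nns_ge0 ?ler1n//; exact: nns_ge0 ng.
have qd i e' : 0 < e' -> \forall h \near (0:R)^', cn (q h i - d i x) <= e'.
  move=> e'0; have /is_cdP := fd i x xx; exact.
have := csum_tannery n2 qg dg2 qd e0.
move=> /(_ (dnbhs_filter _)) H; near=> h.
have [h0 hr] : h != 0 /\ `|h| < r by near: h.
have -> : (h^-1)%:C * (csum (fun i => f i (h + x)) - csum (fun i => f i x)) = csum (q h).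
  rewrite -csumB ?csumZ//; [apply: absumB|..]; apply: sf => //; by rewrite addrK.
by near: h.
Unshelve. all: by end_near. Qed.

End Limits.

(** * Sums over the integers and their Gaussian majorants *)

Section IntegerSums.
Local Open Scope classical_set_scope.
Variable R : realType.
Local Notation C := R[i].

Definition symseq (N : nat) : seq int := [seq i%:Z - N%:Z | i <- iota 0 N.*2.+1].

Lemma symseq_uniq N : uniq (symseq N).
Proof. by rewrite map_inj_uniq ?iota_uniq// => i j /addIr []. Qed.

Lemma mem_symseq N (n : int) : (n \in symseq N) = (`|n|%N <= N)%N.
Proof.
apply/mapP/idP => [ [j]|nN].
  by rewrite mem_iota => /andP[_ ?] ->; lia.
by exists (absz (n + N%:Z)); [rewrite mem_iota|]; lia.
Qed.

Lemma sum_symseq (V : nmodType) (f : int -> V) N :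
  \sum_(i < N.*2.+1) f (i%:Z - N%:Z) = \sum_(n <- symseq N) f n.
Proof. by rewrite big_map -(big_mkord xpredT (fun i => f (i%:Z - N%:Z))) /index_iota subn0. Qed.

Lemma sumZ_csum (f : int -> C) : absum f -> sumZ f = csum f.
Proof.
move=> sf; apply: clim_eq => e e0.
have [s hs] := csum_tail sf e0.
exists (\max_(n <- s) `|n|%N) => //= N /= sN.
rewrite sum_symseq -cnN opprB; apply: hs => //; first exact: symseq_uniq.
move=> n ns; rewrite mem_symseq (leq_trans _ sN)//.
exact: (@leq_bigmax_seq _ s xpredT (fun n : int => `|n|%N) n).
Qed.

Definition sqseq N : seq (int * int) := [seq (x, y) | x <- symseq N, y <- symseq N].

Lemma sqseq_uniq N : uniq (sqseq N).
Proof. by apply: allpairs_uniq; rewrite ?symseq_uniq// => -[? ?] [? ?]. Qed.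

Lemma mem_sqseq N (p : int * int) :
  (p \in sqseq N) = (`|p.1|%N <= N)%N && (`|p.2|%N <= N)%N.
Proof.
apply/allpairsP/idP => [[[x y] /= []]|].
  by rewrite !mem_symseq => ? ? -> /=; apply/andP.
by case: p => x y /= /andP[? ?]; exists (x, y); rewrite /= !mem_symseq.
Qed.

Lemma sum_sqseq (f : int -> int -> C) N :
  \sum_(i < N.*2.+1) \sum_(j < N.*2.+1) f (i%:Z - N%:Z) (j%:Z - N%:Z)
  = \sum_(p <- sqseq N) f p.1 p.2.
Proof.
rewrite big_allpairs /= -sum_symseq; apply: eq_bigr => i _.
by rewrite (sum_symseq (f _)).
Qed.

(** For series that need not converge absolutely: only the partial sums over squares have to agree
    with those of a summable [h]. For [R2], [h] differs from the term by an antisymmetric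
    function. *)
Lemma sumZ2_approx (f h : int -> int -> C) : absum (fun p => h p.1 p.2) ->
  (forall N, \sum_(p <- sqseq N) f p.1 p.2 = \sum_(p <- sqseq N) h p.1 p.2) ->
  sumZ2 f = csum (fun p : int * int => h p.1 p.2).
Proof.
move=> sh fh; apply: clim_eq => e e0.
have [s hs] := csum_tail sh e0.
exists (\max_(p <- s) maxn `|p.1|%N `|p.2|%N) => //= N /= sN.
rewrite sum_sqseq fh -cnN opprB; apply: (hs _ (sqseq_uniq N)) => // p ps.
rewrite mem_sqseq -geq_max (leq_trans _ sN)//.
exact: (@leq_bigmax_seq _ s xpredT (fun p : int * int => maxn `|p.1|%N `|p.2|%N) p).
Qed.

Lemma sumZ2_csum (f : int -> int -> C) : absum (fun p => f p.1 p.2) ->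
  sumZ2 f = csum (fun p : int * int => f p.1 p.2).
Proof. by move=> sf; apply: sumZ2_approx. Qed.

Lemma symsumS (V : nmodType) (f : int -> V) N : \sum_(n <- symseq N.+1) f n =
  f (- N.+1%:Z) + \sum_(n <- symseq N) f n + f N.+1%:Z.
Proof.
rewrite -!sum_symseq doubleS big_ord_recl big_ord_recr /= addrA.
congr (_ + _ + _); first by congr f; lia.
  by apply: eq_bigr => i _; congr f; rewrite /bump /=; lia.
by congr f; rewrite /bump /=; lia.
Qed.

Lemma nns_geom : nns (fun n : int => (2^-1 : R) ^+ `|n|%N).
Proof.
apply: (@es_bounded _ _ _ 3) => [i|s us]; first by rewrite exprn_ge0// invr_ge0.
pose N := \max_(n <- s) `|n|%N.
apply: (@le_trans _ _ (\sum_(n <- symseq N) (2^-1 : R) ^+ `|n|%N)).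
  have uN := symseq_uniq N.
  apply: big_subseq_le => //.
  by move=> n ns; rewrite mem_symseq; exact: (@leq_bigmax_seq _ s xpredT (fun n : int => `|n|%N) n).
(* Partial sums of [1 + 2 (1/2 + 1/4 + ...)], whence the bound 3. *)
have -> : \sum_(n <- symseq N) (2^-1 : R) ^+ `|n|%N = 3 - 2 * (2^-1) ^+ N.
  elim: N => [|N IH]; first by rewrite /symseq /= big_seq1 /= expr0; lra.
  by rewrite symsumS IH abszN /= exprS; lra.
by rewrite lerBlDr lerDl mulr_ge0// exprn_ge0// invr_ge0.
Qed.

(** Comparison with [2^-|n|]: completing the square in [- A m^2 + (B + ln 2) m] gives the constant
    [exp (l^2 / (4 A))]. *)
Lemma nns_gauss (A B : R) : 0 < A ->
  nns (fun n : int => expR (- A * n%:~R ^+ 2 + B * `|n%:~R|)).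
Proof.
move=> A0; pose l := B + ln 2.
apply: (nns_le _ (nnsZ (expR_ge0 (l ^+ 2 / (4 * A))) nns_geom)) => n.
rewrite expR_ge0/=.
have -> : (2^-1 : R) ^+ `|n|%N = expR (- ln 2 * `|n%:~R|).
  rewrite mulNr expRN exprVn; congr (_^-1).
  rewrite -[in RHS](intr_norm R) -abszE mulrC -pmulrn expRM_natl.
  by rewrite lnK// posrE.
rewrite -expRD ler_expR -subr_ge0.
set m := `|n%:~R|.
have -> : (n%:~R : R) ^+ 2 = m ^+ 2 by rewrite /m real_normK ?num_real.
have -> : l ^+ 2 / (4 * A) + - ln 2 * m - (- A * m ^+ 2 + B * m)
  = (l - 2 * A * m) ^+ 2 / (4 * A).
  by rewrite /l; field; rewrite gt_eqF.
by rewrite divr_ge0 ?sqr_ge0// mulr_ge0// ltW.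
Qed.

Lemma nns_gauss2 (A B K : R) : 0 < A -> nns (fun p : int * int =>
  expR (- A * (p.1%:~R ^+ 2 + p.2%:~R ^+ 2) + B * (`|p.1%:~R| + `|p.2%:~R|) + K)).
Proof.
move=> A0; apply: (nns_le _ (nnsZ (expR_ge0 K) (nns_prod (nns_gauss B A0) (nns_gauss B A0)))).
by move=> p; rewrite expR_ge0/= -!expRD ler_expR; lra.
Qed.

End IntegerSums.

(** * Complex integrals *)
Section ComplexMeasurable.
Local Open Scope classical_set_scope.
Context d (T : measurableType d) (R : realType).
Local Notation C := R[i].
Implicit Types f g : T -> C.

Definition cmeas f := measurable_fun [set: T] (fun x => cRe (f x)) /\
  measurable_fun [set: T] (fun x => cIm (f x)).

Lemma cmeas_ext f g : (forall x, f x = g x) -> cmeas f -> cmeas g.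
Proof. by move=> /funext ->. Qed.

Lemma cmeas_cst (c : C) : cmeas (fun=> c).
Proof. by split; exact: measurable_cst. Qed.

Lemma cmeas_real (g : T -> R) : measurable_fun [set: T] g -> cmeas (fun x => (g x)%:C).
Proof. by move=> mg; split => //=; exact: measurable_cst. Qed.

Lemma cmeasD f g : cmeas f -> cmeas g -> cmeas (fun x => f x + g x).
Proof.
move=> [f1 f2] [g1 g2]; split.
  by under eq_fun do rewrite ReD; exact: measurable_funD.
by under eq_fun do rewrite ImD; exact: measurable_funD.
Qed.

Lemma cmeasN f : cmeas f -> cmeas (fun x => - f x).
Proof.
move=> [f1 f2]; split.
  by under eq_fun do rewrite ReN; exact: measurableT_comp.
by under eq_fun do rewrite ImN; exact: measurableT_comp.
Qed.

Lemma cmeasM f g : cmeas f -> cmeas g -> cmeas (fun x => f x * g x).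
Proof.
move=> [f1 f2] [g1 g2]; split.
  by under eq_fun do rewrite ReM; apply: measurable_funB; exact: measurable_funM.
by under eq_fun do rewrite ImM; apply: measurable_funD; exact: measurable_funM.
Qed.

Lemma cmeas_cexp f : cmeas f -> cmeas (fun x => cexp (f x)).
Proof.
move=> [f1 f2]; apply: cmeasM.
  by apply: cmeas_real; apply: measurableT_comp => //; exact: measurable_expR.
split => /=.
  by apply: measurableT_comp => //; apply: continuous_measurable_fun; exact: continuous_cos.
by apply: measurableT_comp => //; apply: continuous_measurable_fun; exact: continuous_sin.
Qed.

End ComplexMeasurable.

Section ComplexIntegral.
Local Open Scope classical_set_scope.
Context d (T : measurableType d) (R : realType) (m : {measure set T -> \bar R}).
Local Notation C := R[i].
Implicit Types f g : T -> C.

Definition cint f : C :=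
  (\int[m]_(x in setT) cRe (f x)) +i* (\int[m]_(x in setT) cIm (f x)).

Definition cinteg f := m.-integrable setT (EFin \o (fun x => cRe (f x))) /\
  m.-integrable setT (EFin \o (fun x => cIm (f x))).

Lemma eq_cint f g : (forall x, f x = g x) -> cint f = cint g.
Proof. by move=> /funext ->. Qed.

Lemma cinteg_ext f g : (forall x, f x = g x) -> cinteg f -> cinteg g.
Proof. by move=> /funext ->. Qed.

Lemma cinteg_le f (g : T -> R) : cmeas f -> (forall x, cn (f x) <= g x) ->
  m.-integrable setT (EFin \o g) -> cinteg f.
Proof.
move=> [f1 f2] fg ig.
have g0 x : 0 <= g x := le_trans (cn_ge0 _) (fg x).
split; (apply: le_integrable ig => //; first exact/measurable_EFinP).
  move=> x _ /=; rewrite lee_fin (ger0_norm (g0 x)).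
  exact: le_trans (Re_le_cn _) (fg x).
move=> x _ /=; rewrite lee_fin (ger0_norm (g0 x)).
exact: le_trans (Im_le_cn _) (fg x).
Qed.

Lemma cintegD f g : cinteg f -> cinteg g -> cinteg (fun x => f x + g x).
Proof.
move=> [f1 f2] [g1 g2]; split.
  apply: eq_integrable (integrableD _ f1 g1) => // x _ /=.
  by rewrite ReD EFinD.
apply: eq_integrable (integrableD _ f2 g2) => // x _ /=.
by rewrite ImD EFinD.
Qed.

Lemma cintegZ (c : C) f : cinteg f -> cinteg (fun x => c * f x).
Proof.
move=> [f1 f2]; split.
  apply: eq_integrable (integrableB _ (integrableZl _ (cRe c) f1) (integrableZl _ (cIm c) f2)) => // x _ /=.
  by rewrite ReM EFinB !EFinM.
apply: eq_integrable (integrableD _ (integrableZl _ (cRe c) f2) (integrableZl _ (cIm c) f1)) => // x _ /=.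
by rewrite ImM EFinD !EFinM.
Qed.

Lemma cintD f g : cinteg f -> cinteg g ->
  cint (fun x => f x + g x) = cint f + cint g.
Proof.
move=> [f1 f2] [g1 g2]; apply: ceqP; rewrite !ReImE /=.
  by rewrite -RintegralD//; apply: eq_Rintegral => x _; rewrite ReD.
by rewrite -RintegralD//; apply: eq_Rintegral => x _; rewrite ImD.
Qed.

Lemma cintZ (c : C) f : cinteg f -> cint (fun x => c * f x) = c * cint f.
Proof.
move=> [f1 f2].
have RZ (r : R) (h : T -> R) : m.-integrable setT (EFin \o h) ->
    m.-integrable setT (EFin \o (fun x => r * h x)).
  by move=> ih; apply: eq_integrable (integrableZl _ r ih) => // x _ /=; rewrite EFinM.
apply: ceqP; rewrite !ReImE /=.
  rewrite -!RintegralZl// -RintegralB//; [|exact: RZ|exact: RZ].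
  by apply: eq_Rintegral => x _; rewrite ReM.
rewrite -!RintegralZl// -RintegralD//; [|exact: RZ|exact: RZ].
by apply: eq_Rintegral => x _; rewrite ImM.
Qed.

Lemma cintegN f : cinteg f -> cinteg (fun x => - f x).
Proof. by move=> fi; apply: cinteg_ext (cintegZ (-1) fi) => x; rewrite mulN1r. Qed.

Lemma cintN f : cinteg f -> cint (fun x => - f x) = - cint f.
Proof. by move=> fi; rewrite -mulN1r -cintZ//; apply: eq_cint => x; rewrite mulN1r. Qed.

Lemma cintB f g : cinteg f -> cinteg g ->
  cint (fun x => f x - g x) = cint f - cint g.
Proof. by move=> fi gi; rewrite cintD ?cintN//; exact: cintegN. Qed.

Lemma cint_real (g : T -> R) : cint (fun x => (g x)%:C) = (\int[m]_(x in setT) g x)%:C.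
Proof. by rewrite /cint /= Rintegral_cst// mul0r. Qed.

Lemma cinteg_real (g : T -> R) : m.-integrable setT (EFin \o g) ->
  cinteg (fun x => (g x)%:C).
Proof.
move=> ig; split => //=.
by apply: eq_integrable (integrable0 _ _).
Qed.

Lemma cn_cint f (g : T -> R) : cmeas f -> (forall x, cn (f x) <= g x) ->
  m.-integrable setT (EFin \o g) -> cn (cint f) <= 2 * \int[m]_(x in setT) g x.
Proof.
move=> mf fg ig; have [f1 f2] := cinteg_le mf fg ig.
rewrite (le_trans (cn_le_ReIm _))//= mulr_natl mulr2n.
rewrite lerD// (le_trans (le_normr_Rintegral _ _))// le_Rintegral//.
- exact: integrable_norm.
- by move=> x _; exact: le_trans (Re_le_cn _) (fg x).
- exact: integrable_norm.
- by move=> x _; exact: le_trans (Im_le_cn _) (fg x).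
Qed.

Lemma cint_dct (f_ : nat -> T -> C) f (g : T -> R) :
  (forall n, cmeas (f_ n)) -> cmeas f ->
  (forall x e, 0 < e -> \forall n \near \oo, cn (f_ n x - f x) <= e) ->
  m.-integrable setT (EFin \o g) -> (forall n x, cn (f_ n x) <= g x) ->
  forall e, 0 < e -> \forall n \near \oo, cn (cint (f_ n) - cint f) <= e.
Proof.
move=> mf_ mf ff ig fg e e0.
have H (P : C -> R) : (forall z w, P (z - w) = P z - P w) -> (forall z, `|P z| <= cn z) ->
    (forall n, measurable_fun setT (fun x => P (f_ n x))) ->
    measurable_fun setT (fun x => P (f x)) ->
    \forall n \near \oo, `|\int[m]_(x in setT) P (f_ n x) - \int[m]_(x in setT) P (f x)| <= e / 2.
  move=> PB Pn mP_ mP.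
  have g0 x : 0 <= g x := le_trans (cn_ge0 _) (fg 0%N x).
  have hcv x : setT x -> (fun n => (P (f_ n x))%:E) @ \oo --> (P (f x))%:E.
    move=> _; apply/fine_cvgP; split; first by apply: nearW.
    apply/cvgrPdist_le => e1 e10; apply: filterS (ff x e1 e10) => n /=.
    by apply: le_trans; rewrite distrC -PB.
  have hb x n : setT x -> (`|(P (f_ n x))%:E| <= (EFin \o g) x)%E.
    by move=> _; rewrite /= lee_fin (le_trans (Pn _)).
  have [iP _ cvP] := @dominated_convergence _ T R m setT measurableT
    (fun n x => (P (f_ n x))%:E) (fun x => (P (f x))%:E) (EFin \o g)
    (fun n => (measurable_EFinP _ _).2 (mP_ n)) ((measurable_EFinP _ _).2 mP)
    (aeW _ hcv) ig (aeW _ hb).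
  have iPn n : m.-integrable setT (EFin \o (fun x => P (f_ n x))).
    apply: le_integrable ig => //; first exact/measurable_EFinP.
    by move=> x _ /=; rewrite lee_fin (ger0_norm (g0 x)) (le_trans (Pn _)).
  have e20 : 0 < e / 2 by rewrite divr_gt0.
  have fE : (\int[m]_x (P (f x))%:E)%E = (\int[m]_x P (f x))%:E.
    by rewrite fineK//; exact: integrable_fin_num.
  move: cvP; rewrite fE => /fine_cvg /cvgrPdist_le /(_ _ e20); apply: filterS => n.
  by rewrite distrC.
have HR : \forall n \near \oo, `|\int[m]_x cRe (f_ n x) - \int[m]_x cRe (f x)| <= e / 2.
  apply: (H cRe) => [z w|z|n|]; [by rewrite ReD ReN|exact: Re_le_cn|by case: (mf_ n)|by case: mf].
have HI : \forall n \near \oo, `|\int[m]_x cIm (f_ n x) - \int[m]_x cIm (f x)| <= e / 2.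
  apply: (H cIm) => [z w|z|n|]; [by rewrite ImD ImN|exact: Im_le_cn|by case: (mf_ n)|by case: mf].
near=> n.
rewrite (le_trans (cn_le_ReIm _))// !ReImE /= (splitr e) lerD//; by near: n.
Unshelve. all: by end_near. Qed.

Lemma cint_derive (f df : R -> T -> C) (g : T -> R) (x r : R) : 0 < r ->
  (forall s, `|s - x| < r -> cinteg (f s)) ->
  (forall s y, `|s - x| < r -> is_cd (fun t => f t y) s (df s y)) ->
  (forall s y, `|s - x| < r -> cn (df s y) <= g y) ->
  m.-integrable setT (EFin \o g) ->
  is_cd (fun s => cint (f s)) x (cint (df x)).
Proof.
move=> r0 fi fd dg ig.
have xx : `|x - x| < r by rewrite subrr normr0.
have g0 y : 0 <= g y := le_trans (cn_ge0 _) (dg x y xx).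
have inI s : `](x - r), (x + r)[ s -> `|s - x| < r.
  by rewrite /= in_itv/= ltr_distl.
have Ix : `](x - r), (x + r)[ x by rewrite /= in_itv/=; apply/andP; split; lra.
have H (P : C -> R) : (forall s, `|s - x| < r -> m.-integrable setT (EFin \o (fun y => P (f s y)))) ->
    (forall s y, `|s - x| < r -> is_derive s 1 (fun t => P (f t y)) (P (df s y))) ->
    (forall z, `|P z| <= cn z) ->
    is_derive x 1 (fun s => \int[m]_(y in setT) P (f s y)) (\int[m]_(y in setT) P (df x y)).
  move=> iP dP Pn.
  have E s y : `|s - x| < r -> partial1of2 (fun s y => P (f s y)) s y = P (df s y).
    by move=> sx; rewrite partial1of2E; have [] := dP s y sx.
  have iP' s : `](x - r), (x + r)[ s -> m.-integrable setT (EFin \o (fun y => P (f s y))).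
    by move=> /inI; exact: iP.
  have dP' s y : `](x - r), (x + r)[ s -> setT y -> derivable (fun t => P (f t y)) s 1.
    by move=> /inI sx _; have [] := dP s y sx.
  have bP' s y : `](x - r), (x + r)[ s -> setT y -> `|partial1of2 (fun s y => P (f s y)) s y| <= g y.
    by move=> /inI sx _; rewrite E// (le_trans (Pn _))// dg.
  apply: DeriveDef.
    exact: (@derivable_under_integral R _ T m (fun s y => P (f s y)) setT measurableT x _ _ Ix iP' dP' g g0 ig bP').
  rewrite -derive1E (@differentiation_under_integral R _ T m (fun s y => P (f s y)) setT measurableT x _ _ Ix iP' dP' g g0 ig bP').
  by apply: eq_Rintegral => y _; rewrite E.
split.
  apply: (H cRe) => [s /fi[]//|s y /fd -/(_ y) []//|]; exact: Re_le_cn.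
apply: (H cIm) => [s /fi[]//|s y /fd -/(_ y) []//|]; exact: Im_le_cn.
Qed.

End ComplexIntegral.

Section ComplexFubini.
Local Open Scope classical_set_scope.
Variable R : realType.
Local Notation C := R[i].
Local Notation mu := (@lebesgue_measure R).
Local Notation RM := (measurableTypeR R).

(** A majorant of product form makes integrability on the plane immediate by Tonelli. The double
    integrals below have one: a Gaussian in one variable times an exponentially decaying function of
    the other. *)
Lemma cint_fubini (f : RM -> RM -> C) (g h : RM -> R) :
  cmeas (fun p : RM * RM => f p.1 p.2) ->
  mu.-integrable setT (EFin \o g) -> mu.-integrable setT (EFin \o h) ->
  (forall x y, cn (f x y) <= g x * h y) ->
  cint mu (fun x => cint mu (fun y => f x y)) =
  cint mu (fun y => cint mu (fun x => f x y)).
Proof.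
move=> mf ig ih fgh.
have H (P : C -> R) : (forall z, `|P z| <= cn z) ->
    measurable_fun setT (fun p : RM * RM => P (f p.1 p.2)) ->
    \int[mu]_(x in setT) (\int[mu]_(y in setT) P (f x y)) =
    \int[mu]_(y in setT) (\int[mu]_(x in setT) P (f x y)).
  move=> Pn mP.
  have Pgh x y : `|P (f x y)| <= `|g x| * `|h y|.
    rewrite -normrM (le_trans (Pn _))// (le_trans (fgh x y))//; exact: ler_norm.
  have ig' := integrable_norm ig; have ih' := integrable_norm ih.
  have m1 x : measurable_fun setT (fun y => P (f x y)).
    exact: (measurableT_comp mP (pair1_measurable x)).
  have m2 y : measurable_fun setT (fun x => P (f x y)).
    exact: (measurableT_comp mP (pair2_measurable y)).
  have i1 x : mu.-integrable setT (EFin \o (fun y => P (f x y))).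
    apply: (le_integrable _ _ _ (integrableZl measurableT `|g x| ih')) => //.
      exact/measurable_EFinP.
    by move=> y _ /=; rewrite lee_fin normrM !normr_id.
  have i2 y : mu.-integrable setT (EFin \o (fun x => P (f x y))).
    apply: (le_integrable _ _ _ (integrableZl measurableT `|h y| ig')) => //.
      exact/measurable_EFinP.
    by move=> x _ /=; rewrite lee_fin normrM !normr_id mulrC.
  rewrite /Rintegral.
  have E1 x : (fine (\int[mu]_y (P (f x y))%:E))%:E = (\int[mu]_y (P (f x y))%:E)%E.
    by rewrite fineK//; exact: (integrable_fin_num measurableT (i1 x)).
  have E2 y : (fine (\int[mu]_x (P (f x y))%:E))%:E = (\int[mu]_x (P (f x y))%:E)%E.
    by rewrite fineK//; exact: (integrable_fin_num measurableT (i2 y)).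
  under eq_integral do rewrite E1.
  under [in RHS]eq_integral do rewrite E2.
  congr fine; apply: (@Fubini _ _ _ _ _ mu mu (fun p => (P (f p.1 p.2))%:E)).
  apply/integrable12ltyP; first exact/measurable_EFinP.
  apply: (@le_lt_trans _ _ (\int[mu]_x (`|g x| * \int[mu]_y `|h y|)%:E)%E).
    apply: ge0_le_integral => //.
    - by move=> x _; apply: integral_ge0.
    - apply: (@measurable_fun_fubini_tonelli_F _ _ _ _ _ mu (fun p => `|(P (f p.1 p.2))%:E|)%E) => //.
      by apply: measurableT_comp => //; exact/measurable_EFinP.
    - apply/measurable_EFinP; apply: measurable_funM => //.
      by apply: measurableT_comp => //; apply/measurable_EFinP; case/integrableP: ig.
    - move=> x _; rewrite EFinM /Rintegral fineK; last exact: integrable_fin_num.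
      rewrite -ge0_integralZl//; last by case/integrableP: ih'.
      apply: ge0_le_integral => //.
      * by apply: measurableT_comp => //; apply/measurable_EFinP; exact: m1.
      * by apply: measurable_funeM; case/integrableP: ih'.
      * by move=> y _; rewrite /= -EFinM lee_fin.
  have iK : mu.-integrable setT (fun x => (`|g x| * \int[mu]_y `|h y|)%:E).
    apply: eq_integrable (integrableZl measurableT (\int[mu]_y `|h y|) ig') => // x _ /=.
    by rewrite -EFinM mulrC.
  exact: integrable_lty iK.
rewrite /cint; apply: ceqP => /=.
  by apply: (H cRe) => //; [exact: Re_le_cn|case: mf].
by apply: (H cIm) => //; [exact: Im_le_cn|case: mf].
Qed.

End ComplexFubini.

(** * Affine change of variables for Lebesgue integrals *)

Section Affine.
Local Open Scope classical_set_scope.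
Variable R : realType.
Local Notation C := R[i].
Local Notation mu := (@lebesgue_measure R).
Local Notation RM := (measurableTypeR R).
Lemma measurable_affine (c d : R) : measurable_fun [set: RM] (fun x : RM => c * x + d : RM).
Proof. by apply: measurable_funD => //; apply: measurable_funM. Qed.

(** Lebesgue measure is [|c|] times its image under [x -> c x + d], by uniqueness on half-open
    intervals. For [c < 0] the preimage of []a, b]] is closed on the left and open on the right,
    hence the two cases. *)
Lemma ge0_integral_affine (c d : R) (f : RM -> \bar R) : c != 0 ->
  measurable_fun setT f -> (forall x, 0 <= f x)%E ->
  (\int[mu]_x f (c * x + d)%R = (`|c|^-1)%:E * \int[mu]_x f x)%E.
Proof.
move=> c0 mf f0.
pose phi (x : RM) : RM := c * x + d.
have mphi : measurable_fun setT phi by exact: measurable_affine.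
have cp : 0 < `|c| by rewrite normr_gt0.
have k0 : 0 <= `|c|^-1 by rewrite invr_ge0.
pose k : {nonneg R} := NngNum k0.
have kp : 0 <= `|c| by [].
pose k' : {nonneg R} := NngNum kp.
have E A : measurable A -> pushforward mu phi A = mscale k mu A.
  move=> mA.
  have : mu A = mscale k' (pushforward mu phi) A.
    move=> m; apply: lebesgue_measure_unique => // X [[a b] _ <-] /=.
    rewrite /mscale /= /pushforward lebesgue_measure_itv/= lte_fin.
    have [cpos|cneg] := ltP 0 c.
      have -> : phi @^-1` `]a, b] = `](a - d) / c, (b - d) / c].
        apply/seteqP; split => x /=; rewrite !in_itv/= ltr_pdivrMr// ler_pdivlMr//;
          rewrite ltrBlDr lerBrDr mulrC; by [].
      rewrite lebesgue_measure_itv/= lte_fin ltr_pM2r ?invr_gt0// ltrD2r.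
      case: ifP => _; last by rewrite mule0.
      rewrite -!EFinB -EFinM; congr EFin.
      by rewrite gtr0_norm//; field; rewrite gt_eqF.
    have {}cneg : c < 0 by rewrite lt_neqAle c0 cneg.
    have -> : phi @^-1` `]a, b] = `[(b - d) / c, (a - d) / c[.
      apply/seteqP; split => x /=; rewrite !in_itv/= ltr_ndivlMr// ler_ndivrMr//;
        rewrite ltrBlDr lerBrDr mulrC andbC; by [].
    rewrite lebesgue_measure_itv/= lte_fin ltr_nM2r ?invr_lt0// ltrD2r.
    case: ifP => _; last by rewrite mule0.
    rewrite -!EFinB -EFinM; congr EFin.
    by rewrite ltr0_norm//; field.
  move=> /(_ mphi); rewrite /mscale /= => ->; rewrite muleA -EFinM mulVf ?mul1e//.
  by rewrite gt_eqF.
have := @ge0_integral_pushforward _ _ RM RM R phi mphi mu setT f measurableT.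
move=> /(_ mf (fun x _ => f0 x)); rewrite preimage_setT => <-.
rewrite (eq_measure_integral (mscale k mu)); last by move=> A mA _; exact: E.
by rewrite ge0_integral_mscale.
Qed.

Lemma integrable_affine (c d : R) (f : RM -> R) : c != 0 ->
  mu.-integrable setT (EFin \o f) -> mu.-integrable setT (EFin \o (fun x => f (c * x + d))).
Proof.
move=> c0 /integrableP[mf ff]; apply/integrableP; split.
  exact: (measurableT_comp mf (measurable_affine c d)).
rewrite (@ge0_integral_affine c d (fun x => `|(f x)%:E|)%E)//; last exact: measurableT_comp.
apply: lte_mul_pinfty => //; by rewrite lee_fin invr_ge0.
Qed.

Lemma Rintegral_affine (c d : R) (f : RM -> R) : c != 0 ->
  mu.-integrable setT (EFin \o f) ->
  \int[mu]_x f (c * x + d) = `|c|^-1 * \int[mu]_x f x.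
Proof.
move=> c0 fi; have /integrableP[mf _] := fi.
rewrite /Rintegral integralE [in RHS]integralE.
have P : (\int[mu]_x (fun x => (f (c * x + d))%:E)^\+ x)%E =
    ((`|c|^-1)%:E * \int[mu]_x (EFin \o f)^\+ x)%E.
  rewrite -(ge0_integral_affine d c0)//; last exact: measurable_funepos.
  by apply: eq_integral => x _; rewrite ?[funepos]unlock ?[funeneg]unlock.
have N : (\int[mu]_x (fun x => (f (c * x + d))%:E)^\- x)%E =
    ((`|c|^-1)%:E * \int[mu]_x (EFin \o f)^\- x)%E.
  rewrite -(ge0_integral_affine d c0)//; last exact: measurable_funeneg.
  by apply: eq_integral => x _; rewrite ?[funepos]unlock ?[funeneg]unlock.
rewrite P N -muleBr//; last first.
  by apply: fin_num_adde_defl; rewrite fin_numN; exact: integrable_neg_fin_num.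
have /= := integrable_fin_num measurableT fi; rewrite integralE => finf.
by rewrite fineM.
Qed.

Lemma cinteg_affine (c d : R) (f : RM -> C) : c != 0 -> cinteg mu f ->
  cinteg mu (fun x => f (c * x + d)).
Proof.
by move=> c0 [f1 f2]; split;
  [exact: (@integrable_affine c d (fun x => cRe (f x)))|exact: (@integrable_affine c d (fun x => cIm (f x)))].
Qed.

Lemma cint_affine (c d : R) (f : RM -> C) : c != 0 -> cinteg mu f ->
  cint mu (fun x => f (c * x + d)) = (`|c|^-1)%:C * cint mu f.
Proof.
move=> c0 [f1 f2]; rewrite /cint.
rewrite (@Rintegral_affine c d (fun x => cRe (f x)))// (@Rintegral_affine c d (fun x => cIm (f x)))//.
by apply: ceqP; rewrite !ReImE /=; ring.
Qed.

End Affine.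

(** * Gaussian integrals and Poisson summation *)
Section Gaussian.
Local Open Scope classical_set_scope.
Variable R : realType.
Local Notation C := R[i].
Local Notation mu := (@lebesgue_measure R).
Local Notation RM := (measurableTypeR R).

(** Normalized to have integral 1 and to be its own Fourier transform; [E1] has derivative
    [2 gam]. *)
Definition gam (x : R) : R := expR (- pi * x ^+ 2).

Lemma gam_gt0 x : 0 < gam x. Proof. exact: expR_gt0. Qed.

Lemma sqrt_pi_gt0 : 0 < Num.sqrt pi :> R. Proof. by rewrite sqrtr_gt0 pi_gt0. Qed.

Lemma gam_gauss x : gam x = gauss_fun (Num.sqrt pi * x + 0).
Proof. by rewrite /gam addr0 /gauss_fun exprMn sqr_sqrtr ?pi_ge0// mulNr. Qed.

Lemma integrable_gauss_scale (a : R) : 0 < a ->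
  mu.-integrable setT (EFin \o (fun x : RM => expR (- a * x ^+ 2))).
Proof.
move=> a0; have sa : Num.sqrt a != 0 by rewrite gt_eqF ?sqrtr_gt0.
apply: eq_integrable (integrable_affine 0 sa (@integrableT_gauss R)) => // x _ /=.
by rewrite addr0 /gauss_fun exprMn sqr_sqrtr ?ltW// mulNr.
Qed.

Lemma Rintegral_gauss_scale (a : R) : 0 < a ->
  \int[mu]_(x in setT) expR (- pi * a * x ^+ 2) = (Num.sqrt a)^-1.
Proof.
move=> a0; have sa0 : 0 < Num.sqrt (pi * a) by rewrite sqrtr_gt0 mulr_gt0 ?pi_gt0.
have := @Rintegral_affine R (Num.sqrt (pi * a)) 0 (@gauss_fun R) (lt0r_neq0 sa0) (@integrableT_gauss R).
rewrite [X in _ = _ * X -> _]/Rintegral integralT_gauss /= gtr0_norm//.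
rewrite sqrtrM ?pi_ge0// invfM mulrAC mulVf ?mul1r ?gt_eqF ?sqrt_pi_gt0// => <-.
apply: eq_Rintegral => x _.
by rewrite /gauss_fun addr0 exprMn -sqrtrM ?pi_ge0// sqr_sqrtr ?mulr_ge0 ?pi_ge0 ?ltW// !mulNr.
Qed.

Lemma integrable_gam : mu.-integrable setT (EFin \o gam).
Proof. exact: (integrable_gauss_scale (pi_gt0 R)). Qed.

Lemma Rintegral_gam : \int[mu]_(x in setT) gam x = 1.
Proof.
have := Rintegral_gauss_scale ltr01; rewrite sqrtr1 invr1 => <-.
by apply: eq_Rintegral => x _; rewrite /gam mulr1.
Qed.

(** Common shape of the majorants of integrands: polynomial factors and bounded shifts are absorbed
    by enlarging [B] and [K]. *)
Definition egauss (A B K : R) (x : R) : R := expR (- A * x ^+ 2 + B * `|x| + K).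

Lemma measurable_egauss (A B K : R) : measurable_fun [set: RM] (egauss A B K : RM -> R).
Proof.
apply: measurableT_comp => //; apply: measurable_funD => //.
by apply: measurable_funD; apply: measurable_funM.
Qed.

Lemma integrable_egauss (A B K : R) : 0 < A ->
  mu.-integrable setT (EFin \o (egauss A B K : RM -> R)).
Proof.
move=> A0; have A20 : 0 < A / 2 by rewrite divr_gt0.
have := integrableZl measurableT (expR (B ^+ 2 / (2 * A) + K)) (integrable_gauss_scale A20).
apply: le_integrable => //; first by apply/measurable_EFinP; exact: measurable_egauss.
move=> x _ /=; rewrite lee_fin -expRD !ger0_norm ?expR_ge0// ler_expR -subr_ge0.
have -> : B ^+ 2 / (2 * A) + K + - (A / 2) * x ^+ 2 - (- A * x ^+ 2 + B * `|x| + K)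
   = (A * `|x| - B) ^+ 2 / (2 * A).
  have -> : x ^+ 2 = `|x| ^+ 2 by rewrite real_normK ?num_real.
  by field; rewrite gt_eqF.
by rewrite divr_ge0 ?sqr_ge0// mulr_ge0// ltW.
Qed.

Lemma egauss_scale (A B K x : R) : egauss A B K x = expR K * egauss A B 0 x.
Proof. by rewrite /egauss -expRD; congr expR; ring. Qed.

Lemma egauss_shift (A B K : R) (x s : R) : 0 < A -> 0 <= B -> `|s| < 1 ->
  egauss A B K (x + s) <= egauss A (2 * A + B) (B + K) x.
Proof.
move=> A0 B0 s1; rewrite ler_expR.
have xs : `|x + s| <= `|x| + 1 by rewrite (le_trans (ler_normD _ _))// lerD2l ltW.
have h1 : B * `|x + s| <= B * (`|x| + 1) by rewrite ler_wpM2l.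
have h2 : - (x * s) <= `|x|.
  by rewrite (le_trans (ler_norm _))// normrN normrM ler_piMr// ltW.
have h3 : 0 <= A * s ^+ 2 by rewrite mulr_ge0 ?sqr_ge0// ltW.
have h4 : A * (- (x * s)) <= A * `|x| by rewrite ler_wpM2l// ltW.
nra.
Qed.

Lemma is_cd_shift (F : R -> C) (y s : R) (d : C) :
  is_cd F (y + s) d -> is_cd (fun t => F (y + t)) s d.
Proof.
move=> /is_cdP H; apply/is_cdP => e e0; apply: filterS (H e e0) => h.
by rewrite addrCA.
Qed.

(** The integral of [F (x + s)] is constant in [s] by translation invariance, and its derivative at
    0 is the integral of [dF]. This gives integration by parts without limits at infinity. *)
Lemma cint_derive0 (F dF : RM -> C) (A B K : R) : 0 < A -> 0 <= B ->
  cinteg mu F -> (forall x, is_cd F x (dF x)) ->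
  (forall x, cn (dF x) <= egauss A B K x) -> cint mu dF = 0.
Proof.
move=> A0 B0 Fi Fd dg.
have n1 : (1 : R) != 0 by exact: oner_neq0.
have E s : cint mu (fun x => F (1 * x + s)) = cint mu F.
  by rewrite cint_affine// normr1 invr1 mul1r.
have D : is_cd (fun s => cint mu (fun x => F (1 * x + s))) 0 (cint mu (fun x => dF (1 * x + 0))).
  apply: (@cint_derive _ _ _ mu (fun s x => F (1 * x + s)) (fun s x => dF (1 * x + s))
    (egauss A (2 * A + B) (B + K)) 0 1).
  - exact: ltr01.
  - by move=> s _; exact: cinteg_affine.
  - move=> s y _; rewrite mul1r.
    exact: is_cd_shift (Fd (y + s)).
  - move=> s y; rewrite subr0 mul1r => s1.
    exact: le_trans (dg _) (egauss_shift _ _ A0 B0 s1).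
  - exact: integrable_egauss.
have D0 : is_cd (fun s => cint mu (fun x => F (1 * x + s))) 0 0.
  by apply: is_cd_ext (is_cd_cst (cint mu F) 0) => s; rewrite E.
have -> : cint mu dF = cint mu (fun x => dF (1 * x + 0)).
  by apply: eq_cint => x; rewrite mul1r addr0.
by case: D D0 => [[_ d1] [_ d2]] [[_ e1] [_ e2]]; apply: ceqP;
  [rewrite -d1 e1|rewrite -d2 e2].
Qed.

Definition cgauss (p z : C) (x : R) : C :=
  cexp (- (pi : R)%:C * p * x%:C ^+ 2 + 2 * (pi : R)%:C * 'i * z * x%:C).

Lemma Re_cgauss_arg (p z : C) (x : R) :
  cRe (- (pi : R)%:C * p * x%:C ^+ 2 + 2 * (pi : R)%:C * 'i * z * x%:C) =
  - (pi * cRe p) * x ^+ 2 - 2 * pi * cIm z * x.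
Proof. by case: p z => [p1 p2] [z1 z2]; rewrite [_%:C ^+ 2]expr2 !ReImE /=; ring. Qed.

Lemma cn_cgauss (p z : C) (x : R) :
  cn (cgauss p z x) <= egauss (pi * cRe p) (2 * pi * `|cIm z|) 0 x.
Proof.
rewrite cn_cexp Re_cgauss_arg ler_expR addr0 lerD2l.
rewrite -!mulrA -mulrN ler_wpM2l// -mulrN ler_wpM2l ?pi_ge0//.
by rewrite (le_trans (ler_norm _))// normrN normrM.
Qed.

Lemma cmeas_x : cmeas (fun x : RM => (x : R)%:C).
Proof. by apply: cmeas_real. Qed.

Lemma cmeas_cgauss (p z : C) : cmeas (cgauss p z : RM -> C).
Proof.
apply: cmeas_cexp; apply: cmeasD.
  apply: cmeasM; first exact: cmeas_cst.
  by apply: cmeas_ext (cmeasM cmeas_x cmeas_x) => x; rewrite expr2.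
by apply: cmeasM; [exact: cmeas_cst | exact: cmeas_x].
Qed.

Lemma norm_le_expR (x : R) : `|x| <= expR `|x|.
Proof. by have := expR_ge1Dx `|x|; lra. Qed.

Lemma sqr_le_expR (x : R) : x ^+ 2 <= expR (2 * `|x|).
Proof.
have -> : x ^+ 2 = `|x| ^+ 2 by rewrite real_normK ?num_real.
by rewrite mulr_natl mulr2n expRD -expr2 ler_sqr ?nnegrE ?expR_ge0// norm_le_expR.
Qed.

Lemma cn_poly_gauss (p z : C) (a b c : C) (x : R) :
  cn ((a + b * x%:C + c * x%:C ^+ 2) * cgauss p z x) <=
  (cn a + cn b + cn c) * egauss (pi * cRe p) (2 + 2 * pi * `|cIm z|) 0 x.
Proof.
rewrite cnM.
have -> : egauss (pi * cRe p) (2 + 2 * pi * `|cIm z|) 0 x =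
   expR (2 * `|x|) * egauss (pi * cRe p) (2 * pi * `|cIm z|) 0 x.
  by rewrite /egauss -expRD; congr expR; ring.
rewrite [leRHS]mulrA ler_pM ?cn_ge0 ?cn_cgauss//.
have e1 : 1 <= expR (2 * `|x|) by rewrite -expR0 ler_expR mulr_ge0.
have e2 : `|x| <= expR (2 * `|x|).
  by rewrite (le_trans (norm_le_expR x))// ler_expR ler_peMl ?ler1n.
have e3 := sqr_le_expR x.
move: (expR _) e1 e2 e3 => E e1 e2 e3.
rewrite (le_trans (cnD _ _))// !mulrDl lerD//; last first.
  by rewrite cnM expr2 cnM cn_real -normrM -expr2 ler_wpM2l ?cn_ge0// normrX real_normK ?num_real.
rewrite (le_trans (cnD _ _))// lerD//; first by rewrite ler_peMr ?cn_ge0.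
by rewrite cnM cn_real ler_wpM2l ?cn_ge0.
Qed.

Lemma cinteg_poly_gauss (p z : C) (a b c : C) : 0 < cRe p ->
  cinteg mu (fun x : RM => (a + b * (x : R)%:C + c * (x : R)%:C ^+ 2) * cgauss p z x).
Proof.
move=> p0; have pp : 0 < pi * cRe p by rewrite mulr_gt0 ?pi_gt0.
have H := integrableZl measurableT (cn a + cn b + cn c) (integrable_egauss (2 + 2 * pi * `|cIm z|) 0 pp).
apply: (@cinteg_le _ RM _ _ _ (fun x : RM => (cn a + cn b + cn c) * egauss (pi * cRe p) (2 + 2 * pi * `|cIm z|) 0 x)).
- apply: cmeasM; last exact: cmeas_cgauss.
  apply: cmeasD; first by apply: cmeasD; [exact: cmeas_cst|apply: cmeasM; [exact: cmeas_cst|exact: cmeas_x]].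
  apply: cmeasM; first exact: cmeas_cst.
  by apply: cmeas_ext (cmeasM cmeas_x cmeas_x) => x; rewrite expr2.
- by move=> x; exact: cn_poly_gauss.
- by apply: eq_integrable H => // x _ /=.
Qed.

Lemma cinteg_cgauss (p z : C) : 0 < cRe p -> cinteg mu (cgauss p z : RM -> C).
Proof.
by move=> p0; apply: cinteg_ext (cinteg_poly_gauss z 1 0 0 p0) => x; ring.
Qed.

Lemma cinteg_x_cgauss (p z : C) : 0 < cRe p ->
  cinteg mu (fun x : RM => (x : R)%:C * cgauss p z x).
Proof.
by move=> p0; apply: cinteg_ext (cinteg_poly_gauss z 0 1 0 p0) => x; ring.
Qed.

Lemma cinteg_x2_cgauss (p z : C) : 0 < cRe p ->
  cinteg mu (fun x : RM => (x : R)%:C ^+ 2 * cgauss p z x).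
Proof.
by move=> p0; apply: cinteg_ext (cinteg_poly_gauss z 0 0 1 p0) => x; ring.
Qed.

Lemma is_cd_cgauss (p z : C) (x : R) :
  is_cd (cgauss p z) x ((2 * (pi : R)%:C * 'i * z - 2 * (pi : R)%:C * p * x%:C) * cgauss p z x).
Proof.
apply: is_cd_cexp.
apply: is_cd_eq (is_cdD (is_cdZ _ (is_cdM (is_cd_id x) (is_cd_id x))) (is_cdZ _ (is_cd_id x))) _.
by ring.
Qed.

Lemma egauss_cst (k A B x : R) : 0 <= k ->
  k * egauss A B 0 x <= egauss A B k x.
Proof.
move=> k0; rewrite (egauss_scale A B k) ler_wpM2r ?expR_ge0//.
by have := expR_ge1Dx k; lra.
Qed.

(** Integration by parts: the derivative of [cgauss p z] is an affine function times [cgauss p z]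
    and has integral 0. *)
Lemma cgauss_moment1 (p z : C) : 0 < cRe p ->
  cint mu (fun x : RM => (x : R)%:C * cgauss p z x) = 'i * z / p * cint mu (cgauss p z).
Proof.
move=> p0; have pn0 : p != 0 by apply/eqP => p1; move: p0; rewrite p1 ltxx.
have pi0 : (pi : R)%:C != 0 :> C by rewrite (inj_eq (@complexI R)) gt_eqF ?pi_gt0.
have pp : 0 < pi * cRe p by rewrite mulr_gt0 ?pi_gt0.
have B0 : 0 <= 2 + 2 * pi * `|cIm z| by rewrite addr_ge0// mulr_ge0// mulr_ge0 ?pi_ge0.
have := cint_derive0 pp B0 (cinteg_cgauss z p0) (is_cd_cgauss p z) (K := _).
set a := 2 * (pi : R)%:C * 'i * z; set b := - (2 * (pi : R)%:C * p).
move=> /(_ (cn a + cn b + cn 0)) H.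
have {}H : cint mu (fun x : RM => a * cgauss p z x + b * ((x : R)%:C * cgauss p z x)) = 0.
  rewrite -H => [|x]; first by apply: eq_cint => x; rewrite /a /b; ring.
  have -> : (a - 2 * pi%:C * p * x%:C) * cgauss p z x = (a + b * x%:C + 0 * x%:C ^+ 2) * cgauss p z x.
    by rewrite /b; ring.
  apply: le_trans (cn_poly_gauss _ _ _ _ _ _) (egauss_cst _ _ _ _).
  by rewrite !addr_ge0 ?cn_ge0.
move: H; rewrite cintD; [|apply: cintegZ; exact: cinteg_cgauss|apply: cintegZ; exact: cinteg_x_cgauss].
rewrite !cintZ; [|exact: cinteg_x_cgauss|exact: cinteg_cgauss].
move=> /eqP; rewrite addrC addr_eq0 => /eqP E.
have b0 : b != 0 by rewrite oppr_eq0 !mulf_neq0// pnatr_eq0.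
apply: (mulfI b0); rewrite E /a /b; move: pi0; move: (pi%:C) => P P0; field.
by rewrite pn0.
Qed.

(** The same argument with the derivative of [x * cgauss p 0 x]. *)
Lemma cgauss_moment2 (p : C) : 0 < cRe p ->
  cint mu (fun x : RM => (x : R)%:C ^+ 2 * cgauss p 0 x) = (2 * (pi : R)%:C * p)^-1 * cint mu (cgauss p 0).
Proof.
move=> p0; have pn0 : p != 0 by apply/eqP => p1; move: p0; rewrite p1 ltxx.
have pi0 : (pi : R)%:C != 0 :> C by rewrite (inj_eq (@complexI R)) gt_eqF ?pi_gt0.
have pp : 0 < pi * cRe p by rewrite mulr_gt0 ?pi_gt0.
have B0 : 0 <= 2 + 2 * pi * `|cIm (0 : C)| by rewrite addr_ge0// mulr_ge0// mulr_ge0 ?pi_ge0.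
set b := - (2 * (pi : R)%:C * p).
have H : cint mu (fun x : RM => 1 * cgauss p 0 x + b * ((x : R)%:C ^+ 2 * cgauss p 0 x)) = 0.
  apply: (cint_derive0 (K := cn 1 + cn 0 + cn b) pp B0 (cinteg_x_cgauss 0 p0)) => x.
    apply: is_cd_eq (is_cdM (is_cd_id x) (is_cd_cgauss p 0 x)) _.
    by rewrite /b; ring.
  have -> : 1 * cgauss p 0 x + b * (x%:C ^+ 2 * cgauss p 0 x) = (1 + 0 * x%:C + b * x%:C ^+ 2) * cgauss p 0 x.
    by ring.
  apply: le_trans (cn_poly_gauss _ _ _ _ _ _) (egauss_cst _ _ _ _).
  by rewrite !addr_ge0 ?cn_ge0.
move: H; rewrite cintD; [|apply: cintegZ; exact: cinteg_cgauss|apply: cintegZ; exact: cinteg_x2_cgauss].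
rewrite !cintZ; [|exact: cinteg_x2_cgauss|exact: cinteg_cgauss].
move=> /eqP; rewrite addrC addr_eq0 => /eqP E.
have b0 : b != 0 by rewrite oppr_eq0 !mulf_neq0// pnatr_eq0.
apply: (mulfI b0); rewrite E /b; move: pi0; move: (pi%:C) => P P0; field.
by rewrite pn0 P0.
Qed.

Section GaussianTransform.
Variable p : C.
Hypothesis p0 : 0 < cRe p.

Let pn0 : p != 0. Proof. by apply/eqP => p1; move: p0; rewrite p1 ltxx. Qed.

(** Along the real path [s z] the first moment gives [I' = - (2 pi s z^2 / p) I], so
    [I s * exp (pi s^2 z^2 / p)] is constant; its values at 1 and 0 are compared. No contour is
    shifted. *)
Lemma cgauss_fourier (z : C) :
  cint mu (cgauss p z) = cint mu (cgauss p 0) * cexp (- ((pi : R)%:C * z ^+ 2 / p)).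
Proof.
have pp : 0 < pi * cRe p by rewrite mulr_gt0 ?pi_gt0.
pose I (s : R) := cint mu (cgauss p (s%:C * z)).
have dI s : is_cd I s (- (2 * (pi : R)%:C * s%:C * z ^+ 2 / p) * I s).
  pose df (t : R) (x : RM) := 2 * (pi : R)%:C * 'i * z * ((x : R)%:C * cgauss p (t%:C * z) x).
  have E : cint mu (df s) = - (2 * (pi : R)%:C * s%:C * z ^+ 2 / p) * I s.
    rewrite /df cintZ; last exact: cinteg_x_cgauss.
    rewrite cgauss_moment1// /I; move: (cint mu _) => J.
    have i2 : 'i * 'i = -1 :> C by rewrite -expr2 sqr_i.
    transitivity (2 * (pi : R)%:C * z * s%:C * z / p * J * ('i * 'i)); first by ring.
    by rewrite i2; ring.
  rewrite -E.
  pose b := 2 * pi * ((`|s| + 1) * cn z).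
  have b0 : 0 <= b by rewrite !mulr_ge0 ?pi_ge0 ?addr_ge0 ?cn_ge0.
  apply: (@cint_derive _ _ _ mu (fun t x => cgauss p (t%:C * z) x) df
    (egauss (pi * cRe p) (2 + b) (cn (2 * (pi : R)%:C * 'i * z))) s 1).
  - exact: ltr01.
  - by move=> t _; exact: cinteg_cgauss.
  - move=> t x _.
    have := is_cdD (is_cd_cst (- (pi : R)%:C * p * (x:R)%:C ^+ 2) t)
       (is_cdM (is_cdZ (2 * (pi : R)%:C * 'i) (is_cdM (is_cd_id t) (is_cd_cst z t))) (is_cd_cst (x : R)%:C t)).
    move=> /is_cd_cexp H; apply: is_cd_eq H _.
    by rewrite /df /cgauss; move: (cexp _) => Q; ring.
  - move=> t x ts; rewrite /df.
    have -> : 2 * (pi : R)%:C * 'i * z * (x%:C * cgauss p (t%:C * z) x) =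
      (0 + 2 * (pi : R)%:C * 'i * z * x%:C + 0 * x%:C ^+ 2) * cgauss p (t%:C * z) x by ring.
    apply: le_trans (cn_poly_gauss _ _ _ _ _ _) _.
    rewrite cn0 add0r addr0.
    apply: le_trans (egauss_cst _ _ _ (cn_ge0 _)).
    rewrite ler_wpM2l ?cn_ge0// ler_expR lerD2r lerD2l ler_wpM2r// lerD2l.
    rewrite ler_wpM2l ?mulr_ge0 ?pi_ge0// (le_trans (Im_le_cn _))// cnM cn_real ler_wpM2r ?cn_ge0//.
    by move: ts; rewrite -[t](subrK s) => /ltW ts; rewrite (le_trans (ler_normD _ _))// addrC lerD2l; move: ts; rewrite subrK.
  - exact: integrable_egauss.
pose f s := I s * cexp ((pi : R)%:C * z ^+ 2 / p * s%:C ^+ 2).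
have f0 s : is_cd f s 0.
  have dq := is_cd_cexp (is_cdZ ((pi : R)%:C * z ^+ 2 / p) (is_cdM (is_cd_id s) (is_cd_id s))).
  have := is_cdM (dI s) dq => H.
  apply: is_cd_eq (is_cd_ext _ H) _ => [t|]; first by rewrite /f expr2.
  by move: (cexp _) (I s) => Q J; ring.
have := is_cd0_cst 1 0 f0; rewrite /f /I !expr2 !mul0r mulr0 cexp0 mulr1 mul1r mulr1 => <-.
rewrite -mulrA -cexpD (_ : _ + _ = 0) ?cexp0 ?mulr1//.
by ring.
Qed.

(** On the segment [P s] from [Re p] to [p] the second moment gives [K' = - P' / (2 P) K], so
    [K^2 P] keeps its value at the real end. The square suffices later and avoids a complex square
    root. *)
Lemma cgauss_sqr : cint mu (cgauss p 0) ^+ 2 * p = 1.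
Proof.
pose P (s : R) : C := (cRe p)%:C + 'i%C * ((s * cIm p)%:C).
have RP s : cRe (P s) = cRe p by rewrite /P !ReImE /=; ring.
pose K s := cint mu (cgauss (P s) 0).
have Pn0 s : P s != 0 by apply/eqP => p1; move: p0; rewrite -(RP s) p1 ltxx.
have pp : 0 < pi * cRe p by rewrite mulr_gt0 ?pi_gt0.
have pi0 : (pi : R)%:C != 0 :> C by rewrite (inj_eq (@complexI R)) gt_eqF ?pi_gt0.
have dP s : is_cd P s ('i%C * (cIm p)%:C).
  have := is_cdD (is_cd_cst (cRe p)%:C s) (is_cdZ 'i%C (is_cdM (is_cd_id s) (is_cd_cst (cIm p)%:C s))).
  move=> H; apply: is_cd_eq (is_cd_ext _ H) _ => [t|]; last by ring.
  by rewrite /P rmorphM.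
have dK s : is_cd K s (- ('i%C * (cIm p)%:C) / (2 * P s) * K s).
  pose df (t : R) (x : RM) := - (pi : R)%:C * ('i%C * (cIm p)%:C) * ((x : R)%:C ^+ 2 * cgauss (P t) 0 x).
  have E : cint mu (df s) = - ('i%C * (cIm p)%:C) / (2 * P s) * K s.
    rewrite /df cintZ; last by apply: cinteg_x2_cgauss; rewrite RP.
    rewrite cgauss_moment2 ?RP// /K; move: (cint mu _) (cIm p)%:C 'i%C => J y i.
    move: pi0 (Pn0 s); move: (pi%:C) (P s) => Pi Q Pi0 Q0; field.
    by rewrite Pi0 Q0.
  rewrite -E.
  apply: (@cint_derive _ _ _ mu (fun t x => cgauss (P t) 0 x) df
    (egauss (pi * cRe p) 2 (cn (- (pi : R)%:C * ('i%C * (cIm p)%:C)))) s 1).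
  - exact: ltr01.
  - by move=> t _; apply: cinteg_cgauss; rewrite RP.
  - move=> t x _.
    have := is_cdM (is_cdZ (- (pi : R)%:C) (dP t)) (is_cd_cst ((x : R)%:C ^+ 2) t).
    move=> /(is_cdD (is_cd_cst (2 * (pi : R)%:C * 'i%C * 0 * (x : R)%:C) t)) /is_cd_cexp H.
    apply: is_cd_eq (is_cd_ext _ H) _ => [t'|]; first by rewrite /cgauss addrC.
    by rewrite /df /cgauss [X in _ = _ * (_ * cexp X)]addrC; move: (cexp _) => Q; ring.
  - move=> t x ts; rewrite /df.
    set c := - (pi : R)%:C * _.
    have -> : c * (x%:C ^+ 2 * cgauss (P t) 0 x) =
      (0 + 0 * x%:C + c * x%:C ^+ 2) * cgauss (P t) 0 x by ring.
    apply: le_trans (cn_poly_gauss _ _ _ _ _ _) _.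
    rewrite cn0 !add0r RP normr0 mulr0 addr0.
    exact: egauss_cst (cn_ge0 _).
  - exact: integrable_egauss.
pose f s := K s * K s * P s.
have f0 s : is_cd f s 0.
  apply: is_cd_eq (is_cdM (is_cdM (dK s) (dK s)) (dP s)) _.
  by move: (Pn0 s); move: (P s) (K s) 'i%C (cIm p)%:C => Q J i y Q0; field.
have P1 : P 1 = p by rewrite /P mul1r -complexRI.
have P0 : P 0 = (cRe p)%:C by rewrite /P mul0r mulr0 addr0.
have := is_cd0_cst 1 0 f0; rewrite /f /K P1 P0 -expr2 => ->.
have -> : cint mu (cgauss (cRe p)%:C 0) = ((Num.sqrt (cRe p))^-1)%:C.
  rewrite -(Rintegral_gauss_scale p0) -cint_real; apply: eq_cint => x.
  rewrite /cgauss mulr0 mul0r addr0 -cexpR; congr cexp.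
  by rewrite !(rmorphM, rmorphN, rmorphXn).
rewrite -!rmorphM /= (_ : _ * _ * _ = 1)//.
rewrite -invfM -expr2 sqr_sqrtr ?ltW// mulVf// gt_eqF//.
Qed.

Lemma cgauss_scale (r : R) : 0 < r ->
  cint mu (cgauss (r%:C * p) 0) = ((Num.sqrt r)^-1)%:C * cint mu (cgauss p 0).
Proof.
move=> r0; have sr : 0 < Num.sqrt r by rewrite sqrtr_gt0.
rewrite -[in RHS](gtr0_norm sr) -(cint_affine 0 (lt0r_neq0 sr) (cinteg_cgauss 0 p0)).
apply: eq_cint => x; rewrite /cgauss !mulr0 !mul0r !addr0; congr cexp.
rewrite rmorphM exprMn -[(Num.sqrt r)%:C ^+ 2]rmorphXn /= sqr_sqrtr ?ltW//.
by ring.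
Qed.

End GaussianTransform.

End Gaussian.

(** * Indicators of intervals and the fundamental theorem of calculus *)

Section Intervals.
Local Open Scope classical_set_scope.
Variable R : realType.
Local Notation C := R[i].
Local Notation mu := (@lebesgue_measure R).
Local Notation RM := (measurableTypeR R).

(** Half-open, so that consecutive pieces tile the line without overlap. *)
Definition ico (a b : R) (t : RM) : R := \1_(`[a, b[ : set R) t.

Lemma icoE a b t : ico a b t = ((a <= t) && (t < b))%:R.
Proof. by rewrite /ico indicE mem_setE in_itv. Qed.

Lemma measurable_ico a b : measurable_fun setT (ico a b).
Proof. by apply: measurable_indic. Qed.

Lemma ico_ge0 a b t : 0 <= ico a b t. Proof. by rewrite icoE. Qed.

Lemma ico_le1 a b t : ico a b t <= 1. Proof. by rewrite icoE; case: (_ && _). Qed.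

Lemma Rintegral_ico (f : RM -> R) a b :
  \int[mu]_(t in setT) (ico a b t * f t) = \int[mu]_(t in `[a, b[) f t.
Proof.
rewrite [RHS]Rintegral_mkcond; apply: eq_Rintegral => t _.
rewrite patchE /ico indicE; case: ifP => _; by rewrite ?mul1r ?mul0r.
Qed.

Lemma ftc_real (f df : R -> R) (a b : R) : a < b ->
  (forall x : R, is_derive x 1 f (df x)) -> continuous df ->
  \int[mu]_(t in setT) (ico a b t * df t) = f b - f a.
Proof.
move=> ab fd cdf; rewrite Rintegral_ico.
have cw : {within `[a, b], continuous df} by apply: continuous_subspaceT.
have ii : mu.-integrable `[a, b] (EFin \o df).
  by apply: continuous_compact_integrable => //; exact: segment_compact.
rewrite Rintegral_itv_bndo_bndc; last first.
  by apply: (integrableS _ _ _ ii) => // x /=; rewrite !in_itv/= => /andP[-> /ltW ->].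
have cf : continuous f.
  move=> x; apply: differentiable_continuous; apply/derivable1_diffP.
  by case: (fd x).
rewrite /Rintegral (@continuous_FTC2 _ df f a b ab cw)//.
- split; first by move=> x _; case: (fd x).
    by apply: cvg_at_right_filter; exact: cf.
  by apply: cvg_at_left_filter; exact: cf.
- by move=> x _; rewrite derive1E; have [_ ->] := fd x.
Qed.

Lemma is_cd_continuous (f df : R -> C) : (forall x, is_cd f x (df x)) ->
  continuous (fun x => cRe (f x)) /\ continuous (fun x => cIm (f x)).
Proof.
move=> fd; split => x; apply: differentiable_continuous; apply/derivable1_diffP;
  by case: (fd x) => [[? _] [? _]].
Qed.

Lemma is_cd_cmeas (f df : R -> C) : (forall x, is_cd f x (df x)) -> cmeas (f : RM -> C).
Proof.
by move=> /is_cd_continuous[c1 c2]; split; exact: continuous_measurable_fun.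
Qed.

(** The derivative [ddf] supplies the continuity of [df] that the fundamental theorem asks for. *)
Lemma cint_ftc (f df ddf : R -> C) a b : a < b ->
  (forall x, is_cd f x (df x)) -> (forall x, is_cd df x (ddf x)) ->
  cint mu (fun t : RM => (ico a b t)%:C * df t) = f b - f a.
Proof.
move=> ab fd /is_cd_continuous[c1 c2]; rewrite /cint; apply: ceqP; rewrite ReImE /=.
- under eq_Rintegral do rewrite Re_realM.
  by rewrite ReN; apply: (@ftc_real (fun x => cRe (f x))) => // x; case: (fd x).
- under eq_Rintegral do rewrite Im_realM.
  by rewrite ImN; apply: (@ftc_real (fun x => cIm (f x))) => // x; case: (fd x).
Qed.

Lemma integrable_ico a b : mu.-integrable setT (EFin \o ico a b).
Proof.
exact: (integrable_indic_itv a b true true).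
Qed.

Lemma cinteg_ico (f : RM -> C) (M a b : R) : cmeas f -> (forall t, a <= t < b -> cn (f t) <= M) ->
  cinteg mu (fun t => (ico a b t)%:C * f t).
Proof.
move=> mf fM.
apply: (@cinteg_le _ RM _ _ _ (fun t => `|M| * ico a b t)).
- by apply: cmeasM => //; apply: cmeas_real; exact: measurable_ico.
- move=> t; rewrite cnM cn_real ger0_norm ?ico_ge0// icoE.
  case: (boolP (_ && _)) => [/fM tM|_]; last by rewrite mul0r mulr0.
  by rewrite mul1r mulr1 (le_trans tM)// ler_norm.
- exact: (integrableZl measurableT `|M| (integrable_ico a b)).
Qed.

Lemma Rintegral_ico1 a b : a <= b -> \int[mu]_(t in setT) ico a b t = b - a.
Proof.
move=> ab; transitivity (\int[mu]_(t in setT) (ico a b t * 1)).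
  by apply: eq_Rintegral => t _; rewrite mulr1.
rewrite Rintegral_ico Rintegral_cst//= lebesgue_measure_itv/= lte_fin.
case: ltP => [_|ba]; first by rewrite mul1r.
by rewrite mulr0; apply/esym/eqP; rewrite subr_eq0 eq_le ba ab.
Qed.

End Intervals.

(** * Fejer kernel, Poisson summation and Jacobi's identity *)

Section Poisson.
Local Open Scope classical_set_scope.
Variable R : realType.
Local Notation C := R[i].
Local Notation mu := (@lebesgue_measure R).
Local Notation RM := (measurableTypeR R).

(** On [[0, 1/4]] the derivative [pi cos (pi s) - 1] is nonnegative, since [pi >= 2] and the cosine
    is at least [1/2] there. On [[1/4, 1/2]] the sine equals the cosine of such an angle and is at
    least [1/2 >= x]. *)
Lemma sin_ge_id (x : R) : 0 <= x <= 2^-1 -> x <= sin (pi * x).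
Proof.
move=> /andP[x0 x2]; have pi2 : 2 <= pi :> R by exact: pi_ge2.
have c4 (y : R) : 0 <= y <= 4^-1 -> 2^-1 <= cos (pi * y).
  move=> /andP[y0 y4].
  have : cos (pi / 4) <= cos (pi * y).
    rewrite leNgt ltr_cos ?in_itv/= -?leNgt ?ler_wpM2l ?pi_ge0//; apply/andP; split; nra.
  have s2 : sin (pi / 4) = cos (pi / 4) :> R.
    have -> : pi / 4 = pi / 2 - pi / 4 :> R by field.
    by rewrite sinB cos_pihalf sin_pihalf mul0r subr0 mul1r; congr cos; field.
  have := cos2Dsin2 (pi / 4 : R); rewrite s2.
  have : 0 <= cos (pi / 4 : R).
    by apply: cos_ge0_pihalf; apply/andP; split; nra.
  move: (cos (pi / 4 : R)) => c; nra.
have [x4|x4] := leP x 4^-1.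
  pose f (t : R) := sin (pi * t) - t.
  have fd (s : R) : is_derive s 1 f (pi * cos (pi * s) - 1).
    by apply: is_derive_eq; rewrite /GRing.scale /=; ring.
  have [] := @MVT_segment _ f (fun s => pi * cos (pi * s) - 1) 0 x x0.
  - by apply: derivable_within_continuous => s _; case: (fd s).
  move=> c; rewrite in_itv/= => /andP[c0 cx].
  rewrite /f mulr0 sin0 !subr0 => E.
  have /c4 h : 0 <= c <= 4^-1 by apply/andP; split; lra.
  have h1 : 0 <= pi * cos (pi * c) - 1 by nra.
  by have := mulr_ge0 h1 x0; lra.
have -> : sin (pi * x) = cos (pi * (2^-1 - x)).
  rewrite (_ : pi * (2^-1 - x) = pi / 2 - pi * x); last by field.
  by rewrite cosB cos_pihalf sin_pihalf mul0r add0r mul1r.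
have /c4 h : 0 <= 2^-1 - x <= 4^-1 by apply/andP; split; lra.
exact: le_trans x2 h.
Qed.

(** Here [|e(x) - 1| = 2 |sin (pi x)|]. The bound turns a Lipschitz estimate near an integer into a
    factor [e(t) - 1], which tames the Fejer kernel. *)
Lemma cn_e2pi_sub1 (x : R) : `|x| <= 2^-1 -> `|x| <= cn (e2pi x%:C - 1).
Proof.
move=> x2.
have H : e2pi x%:C - 1 = (2 * sin (pi * x))%:C * ((- sin (pi * x)) +i* cos (pi * x)).
  rewrite e2piE /= mulr0 oppr0 expR0.
  have -> : 2 * pi * x = pi * x + pi * x by ring.
  have := cos2Dsin2 (pi * x); rewrite cosD sinD -!expr2 => e.
  by apply: ceqP; rewrite !ReImE /=; nra.
rewrite H cnM cn_real.
have -> : cn (- sin (pi * x) +i* cos (pi * x)) = 1.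
  by rewrite /= sqrrN addrC cos2Dsin2 sqrtr1.
rewrite mulr1.
have [x0|x0] := leP 0 x.
  rewrite ger0_norm// in x2 *.
  have : 0 <= x <= 2^-1 by rewrite x0 x2.
  by move=> /sin_ge_id s; rewrite ger0_norm; nra.
rewrite ltr0_norm// in x2 *.
have : 0 <= - x <= 2^-1 by rewrite x2 oppr_ge0 ltW.
move=> /sin_ge_id; rewrite mulrN sinN => s.
by rewrite ler0_norm; nra.
Qed.

Definition dirichlet (N : nat) (t : R) : C := \sum_(n <- symseq N) e2pi (- (n%:~R * t%:C)).

Definition fejer (M : nat) (t : R) : C :=
  M.+1%:R^-1 * \sum_(0 <= N < M.+1) dirichlet N t.

Lemma dirichlet_telescope N t : (e2pi t%:C - 1) * dirichlet N t =
  e2pi (N.+1%:R * t%:C) - e2pi (- (N%:R * t%:C)).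
Proof.
elim: N => [|N IH].
  by rewrite /dirichlet /symseq /= big_seq1 /= !mul0r oppr0 e2pi0 mul1r mulr1.
have E : dirichlet N.+1 t = dirichlet N t + e2pi (N.+1%:R * t%:C) + e2pi (- (N.+1%:R * t%:C)).
  rewrite /dirichlet (symsumS (fun n : int => e2pi (- (n%:~R * t%:C)))).
  by rewrite mulrNz mulNr opprK; ring.
rewrite E !mulrDr IH !mulrBl -!e2piD !mul1r.
have -> : t%:C + N.+1%:R * t%:C = N.+2%:R * t%:C by rewrite -[in RHS]addn1 natrD mulrDl mul1r addrC.
have -> : t%:C - N.+1%:R * t%:C = - (N%:R * t%:C) by rewrite -[in LHS]addn1 natrD mulrDl mul1r; ring.
by ring.
Qed.

Lemma fejer_telescope M t : (e2pi t%:C - 1) * fejer M t = M.+1%:R^-1 *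
  (\sum_(0 <= N < M.+1) e2pi (N.+1%:R * t%:C) - \sum_(0 <= N < M.+1) e2pi (- (N%:R * t%:C))).
Proof.
rewrite /fejer mulrCA; congr (_ * _); rewrite mulr_sumr -sumrB.
by apply: eq_bigr => N _; exact: dirichlet_telescope.
Qed.

Lemma cn_e2pi_real (x : R) : cn (e2pi x%:C) = 1.
Proof. by rewrite cn_e2pi /= mulr0 oppr0 expR0. Qed.

Lemma cn_e2pi_nat (n : nat) (t : R) : cn (e2pi (n%:R * t%:C)) = 1.
Proof. by rewrite -[n%:R : C](rmorph_nat (real_complex R)) -rmorphM cn_e2pi_real. Qed.

Lemma cn_e2pi_natN (n : nat) (t : R) : cn (e2pi (- (n%:R * t%:C))) = 1.
Proof. by rewrite e2piN cnV cn_e2pi_nat invr1. Qed.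

Lemma cn_sum (I : Type) (r : seq I) (F : I -> C) :
  cn (\sum_(i <- r) F i) <= \sum_(i <- r) cn (F i).
Proof.
elim: r => [|i r IH]; first by rewrite !big_nil cn0.
by rewrite !big_cons (le_trans (cnD _ _))// lerD2l.
Qed.

Lemma cn_nat (n : nat) : cn (n%:R : C) = n%:R.
Proof. by rewrite -[n%:R : C](rmorph_nat (real_complex R)) cn_real normr_nat. Qed.

(** After one factor [e(t) - 1] a difference of two means of unit complex numbers is left. This
    bound and [fejer_small] take the place of the positivity of the kernel. *)
Lemma fejer_bound M t : cn ((e2pi t%:C - 1) * fejer M t) <= 2.
Proof.
rewrite fejer_telescope cnM cnV cn_nat ler_pdivrMl ?ltr0n//.
rewrite (le_trans (cnB _ _))// mulr_natr mulr2n lerD// (le_trans (cn_sum _ _))//.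
  under eq_bigr do rewrite cn_e2pi_nat.
  by rewrite sumr_const_nat subn0.
under eq_bigr do rewrite cn_e2pi_natN.
by rewrite sumr_const_nat subn0.
Qed.

Lemma geometric_bound (z : C) M : cn z = 1 -> cn (z - 1) * cn (\sum_(0 <= N < M) z ^+ N) <= 2.
Proof.
move=> z1; rewrite -cnM big_mkord -subrX1.
have cX : cn (z ^+ M) = 1.
  by elim: M => [|M IH]; rewrite ?expr0 ?cn1// exprS cnM z1 IH mulr1.
by rewrite (le_trans (cnB _ _))// cn1 cX.
Qed.

Lemma e2pi_natM (n : nat) (z : C) : e2pi (n%:R * z) = e2pi z ^+ n.
Proof.
elim: n => [|n IH]; first by rewrite mul0r e2pi0.
by rewrite exprSr -[in LHS]addn1 natrD mulrDl mul1r e2piD IH.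
Qed.

(** A second factor [e(t) - 1] telescopes the two geometric sums left by the first one, each to at
    most 2. *)
Lemma fejer_small M t : cn (e2pi t%:C - 1) ^+ 2 * cn (fejer M t) <= 4 / M.+1%:R.
Proof.
set z := e2pi t%:C.
have z1 : cn z = 1 by exact: cn_e2pi_real.
rewrite expr2 -mulrA -cnM fejer_telescope cnM cnV cn_nat mulrCA mulrC.
rewrite ler_wpM2r ?invr_ge0//.
have g1 := geometric_bound M.+1 z1.
have zV1 : cn z^-1 = 1 by rewrite cnV z1 invr1.
have g2 := geometric_bound M.+1 zV1.
have zz : cn (z^-1 - 1) = cn (z - 1).
  rewrite -[LHS]mul1r -z1 -cnM mulrBr mulfV ?e2pi_neq0// mulr1.
  by rewrite -opprB cnN.
rewrite zz in g2.
have -> : \sum_(0 <= N < M.+1) e2pi (N.+1%:R * t%:C) = z * \sum_(0 <= N < M.+1) z ^+ N.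
  by rewrite mulr_sumr; apply: eq_bigr => N _; rewrite e2pi_natM exprS.
have -> : \sum_(0 <= N < M.+1) e2pi (- (N%:R * t%:C)) = \sum_(0 <= N < M.+1) z^-1 ^+ N.
  by apply: eq_bigr => N _; rewrite e2piN e2pi_natM exprVn.
rewrite (le_trans (ler_wpM2l (cn_ge0 _) (cnB _ _)))// mulrDr cnM z1 mul1r.
by move: g1 g2; lra.
Qed.

Lemma is_cd_e2pi (z : C) (x : R) :
  is_cd (fun t => e2pi (z * t%:C)) x (2 * (pi : R)%:C * 'i * z * e2pi (z * x%:C)).
Proof.
have := is_cd_cexp (is_cdZ (2 * (pi : R)%:C * 'i) (is_cdZ z (is_cd_id x))) => H.
by apply: is_cd_eq H _; rewrite mulr1.
Qed.

Lemma e2pi_period_int (n : int) (a : R) : n != 0 ->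
  cint mu (fun t : RM => (ico a (a + 1) t)%:C * e2pi (- (n%:~R * (t : R)%:C))) = 0.
Proof.
move=> n0.
pose c : C := 2 * (pi : R)%:C * 'i * - n%:~R.
have c0 : c != 0.
  rewrite !mulf_neq0//; last by rewrite oppr_eq0 intr_eq0.
    by rewrite (inj_eq (@complexI R)) gt_eqF ?pi_gt0.
  by apply/eqP => /(congr1 cIm) /= /eqP; rewrite oner_eq0.
have fd x : is_cd (fun t => c^-1 * e2pi (- n%:~R * t%:C)) x (e2pi (- n%:~R * x%:C)).
  apply: is_cd_eq (is_cdZ _ (is_cd_e2pi (- n%:~R) x)) _.
  by rewrite -/c mulKf.
under eq_cint do rewrite -mulNr.
rewrite (@cint_ftc R _ _ (fun x => c * e2pi (- n%:~R * x%:C)) _ _ _ fd); last 2 first.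
- by rewrite ltrDl.
- by move=> x; exact: is_cd_e2pi.
rewrite -mulrBr (_ : - n%:~R * (a + 1)%:C = - n%:~R * a%:C + (- n)%:~R) ?e2piDint ?subrr ?mulr0//.
by rewrite rmorphD /= mulrNz mulrDr mulr1.
Qed.

(** Centred at [k], where the periodic kernel concentrates. *)
Definition unit_piece (k : int) : RM -> R := ico (k%:~R - 2^-1) (k%:~R + 2^-1).

Lemma unit_piece_dist (k : int) t : unit_piece k t != 0 -> `|t - k%:~R| <= 2^-1.
Proof.
rewrite /unit_piece icoE; case: (boolP (_ && _)) => [/andP[h1 h2] _|]; last by rewrite eqxx.
by rewrite ler_norml; apply/andP; split; lra.
Qed.

Lemma sum_unit_piece N t :
  \sum_(k <- symseq N) unit_piece k t = ico (- N%:R - 2^-1) (N%:R + 2^-1) t.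
Proof.
elim: N => [|N IH].
  have -> : symseq 0 = [:: 0] by [].
  by rewrite big_seq1 /unit_piece /= oppr0.
rewrite (symsumS (fun k => unit_piece k t)) IH /unit_piece !icoE.
rewrite mulrNz -[(N.+1)%:~R]/(N.+1%:R) -[N.+1]addn1 natrD.
have N0 : 0 <= N%:R :> R by [].
move: (N%:R) N0 => x x0.
have -> : - (x + 1) + 2^-1 = - x - 2^-1 by field.
have -> : x + 1 - 2^-1 = x + 2^-1 by field.
rewrite !ltNge.
case: (leP (- (x + 1) - 2^-1) t) => ?; case: (leP (- x - 2^-1) t) => ?;
  case: (leP (x + 2^-1) t) => ?; case: (leP (x + 1 + 2^-1) t) => ? /=;
  rewrite ?addr0 ?add0r//; lra.
Qed.

Lemma integral_unit_piece k : \int[mu]_(t in setT) unit_piece k t = 1.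
Proof. by rewrite Rintegral_ico1; lra. Qed.

Lemma egauss_piece (A B K : R) (k : int) t : 0 < A -> 0 <= B ->
  `|t - k%:~R| <= 2^-1 -> egauss A B K t <= egauss A (2 * A + B) (B + K) k%:~R.
Proof.
move=> A0 B0 tk; rewrite -[t](subrK k%:~R) addrC.
by apply: egauss_shift => //; lra.
Qed.

Lemma nns_egauss (A B K : R) : 0 < A -> nns (fun k : int => egauss A B K k%:~R).
Proof.
move=> A0; apply: nns_le (nnsZ (expR_ge0 K) (nns_gauss B A0)) => k.
by rewrite expR_ge0 egauss_scale /egauss addr0 lexx.
Qed.

Lemma cn_cint_piece (g : RM -> C) (k : int) (M : R) : cmeas g -> 0 <= M ->
  (forall t, `|t - k%:~R| <= 2^-1 -> cn (g t) <= M) ->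
  cn (cint mu (fun t => (unit_piece k t)%:C * g t)) <= 2 * M.
Proof.
move=> mg M0 gM.
have -> : 2 * M = 2 * \int[mu]_(t in setT) (M * unit_piece k t).
  rewrite RintegralZl//; first by rewrite integral_unit_piece mulr1.
  exact: integrable_ico.
apply: cn_cint.
- by apply: cmeasM => //; apply: cmeas_real; exact: measurable_ico.
- move=> t; rewrite cnM cn_real ger0_norm ?ico_ge0// mulrC.
  have [->|t0] := eqVneq (unit_piece k t) 0; first by rewrite !mulr0.
  by rewrite ler_wpM2r ?ico_ge0// gM// unit_piece_dist.
- exact: (integrableZl measurableT M (integrable_ico _ _)).
Qed.

(** The sum over [|k| <= N] is the integral over one growing interval, so dominated convergence
    gives its limit. *)
Lemma cint_pieces (g : RM -> C) (A B K : R) : 0 < A -> 0 <= B -> cmeas g ->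
  (forall t, cn (g t) <= egauss A B K t) ->
  absum (fun k : int => cint mu (fun t => (unit_piece k t)%:C * g t)) /\
  csum (fun k : int => cint mu (fun t => (unit_piece k t)%:C * g t)) = cint mu g.
Proof.
move=> A0 B0 mg gb; set P := fun k : int => _.
have ig := integrable_egauss B K A0.
have gi : cinteg mu g by exact: cinteg_le ig.
have mup k : measurable_fun setT (unit_piece k) by exact: measurable_ico.
have Pi k : cinteg mu (fun t => (unit_piece k t)%:C * g t).
  apply: cinteg_le ig; first by apply: cmeasM => //; exact: cmeas_real.
  move=> t; rewrite cnM cn_real ger0_norm ?ico_ge0// (le_trans _ (gb t))//.
  by rewrite ler_piMl ?cn_ge0// ico_le1.
have Pb k : cn (P k) <= 2 * egauss A (2 * A + B) (B + K) k%:~R.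
  apply: cn_cint_piece => //; first exact: expR_ge0.
  by move=> t tk; rewrite (le_trans (gb t))// egauss_piece.
have n2 : nns (fun k : int => 2 * egauss A (2 * A + B) (B + K) k%:~R).
  by apply: nnsZ => //; exact: nns_egauss.
have sP : absum P by exact: absum_le n2.
split => //.
have sumE N : \sum_(k <- symseq N) P k =
    cint mu (fun t => (ico (- N%:R - 2^-1) (N%:R + 2^-1) t)%:C * g t).
  have H (s : seq int) : cinteg mu (fun t => (\sum_(k <- s) unit_piece k t)%:C * g t) /\
      \sum_(k <- s) P k = cint mu (fun t => (\sum_(k <- s) unit_piece k t)%:C * g t).
    elim: s => [|k s [IH1 IH2]].
      have E0 t : 0 * g t = (\sum_(k <- [::]) unit_piece k t)%:C * g t by rewrite big_nil.
      split; first by apply: cinteg_ext E0 _; exact: cintegZ.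
      by rewrite big_nil -(eq_cint _ E0) cintZ// mul0r.
    have ES t : (unit_piece k t)%:C * g t + (\sum_(k <- s) unit_piece k t)%:C * g t =
        (\sum_(k <- k :: s) unit_piece k t)%:C * g t.
      by rewrite big_cons rmorphD mulrDl.
    split; first by apply: cinteg_ext ES _; exact: cintegD.
    by rewrite big_cons IH2 -(eq_cint _ ES) cintD.
  by rewrite (H _).2; apply: eq_cint => t; rewrite sum_unit_piece.
have cv' : forall e, 0 < e -> \forall N \near \oo,
    cn (cint mu (fun t => (ico (- N%:R - 2^-1) (N%:R + 2^-1) t)%:C * g t) - cint mu g) <= e.
  apply: (@cint_dct _ RM R mu (fun N t => (ico (- N%:R - 2^-1) (N%:R + 2^-1) t)%:C * g t) g (egauss A B K)) => //.
  - by move=> N; apply: cmeasM => //; apply: cmeas_real; exact: measurable_ico.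
  - move=> t e1 e10; exists (Num.truncn `|t|).+1 => // N /= tN.
    have tN' : `|t| < N%:R.
      by rewrite (lt_le_trans (truncnS_gt _))// ler_nat.
    have i1 : ico (- N%:R - 2^-1) (N%:R + 2^-1) t = 1.
      rewrite icoE (_ : _ && _ = true)//.
      by move: tN'; rewrite ltr_norml => /andP[? ?]; apply/andP; split; lra.
    by rewrite i1 mul1r subrr cn0 ltW.
  - move=> N t; rewrite cnM cn_real ger0_norm ?ico_ge0// (le_trans _ (gb t))//.
    by rewrite ler_piMl ?cn_ge0// ico_le1.
have cv : forall e, 0 < e -> \forall N \near \oo, cn (\sum_(k <- symseq N) P k - cint mu g) <= e.
  by move=> e e0; apply: filterS (cv' e e0) => N; rewrite sumE.
apply/eqP; rewrite -subr_eq0 -cn_eq0; apply/eqP/le_anti; rewrite cn_ge0 andbT.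
apply/ler_addgt0Pr => e e0; rewrite add0r.
have e20 : 0 < e / 2 by rewrite divr_gt0.
have [s hs] := csum_tail sP e20.
have [N0 _ hN] := cv _ e20.
pose N := maxn N0 (\max_(n <- s) `|n|%N).
have -> : csum P - cint mu g = (csum P - \sum_(k <- symseq N) P k) + (\sum_(k <- symseq N) P k - cint mu g) by ring.
rewrite (le_trans (cnD _ _))// (splitr e) lerD//; last by apply: hN; rewrite /= leq_maxl.
apply: hs => //; first exact: symseq_uniq.
move=> n ns; rewrite mem_symseq (leq_trans _ (leq_maxr _ _))//.
exact: (@leq_bigmax_seq _ s xpredT (fun n : int => `|n|%N) n).
Qed.

Lemma cn_dirichlet N t : cn (dirichlet N t) <= N.*2.+1%:R.
Proof.
rewrite (le_trans (cn_sum _ _))//.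
have E (n : int) : cn (e2pi (- (n%:~R * t%:C))) = 1.
  by rewrite -[n%:~R : C](rmorph_int (real_complex R)) -rmorphM -rmorphN cn_e2pi_real.
rewrite (eq_bigr (fun=> 1)) => [|n _]; last exact: E.
by rewrite big_const_seq count_predT iter_addr addr0 size_map size_iota.
Qed.

Lemma cn_fejer M t : cn (fejer M t) <= M.*2.+1%:R.
Proof.
rewrite /fejer cnM cnV cn_nat ler_pdivrMl ?ltr0n// (le_trans (cn_sum _ _))//.
rewrite (@le_trans _ _ (\sum_(0 <= N < M.+1) M.*2.+1%:R))//.
  rewrite big_nat [leRHS]big_nat; apply: ler_sum => N /andP[_ NM].
  by rewrite (le_trans (cn_dirichlet _ _))// ler_nat ltnS leq_double.
by rewrite sumr_const_nat subn0 mulr_natl.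
Qed.

Lemma cmeas_e2pi_real (c : C) : cmeas (fun t : RM => e2pi (c * (t : R)%:C)).
Proof. exact: (is_cd_cmeas (is_cd_e2pi c)). Qed.

Lemma cmeas_sum (I : Type) (r : seq I) (F : I -> RM -> C) :
  (forall i, cmeas (F i)) -> cmeas (fun t => \sum_(i <- r) F i t).
Proof.
move=> mF; elim: r => [|i r IH].
  by apply: cmeas_ext (cmeas_cst _ 0) => t; rewrite big_nil.
by apply: cmeas_ext (cmeasD (mF i) IH) => t; rewrite big_cons.
Qed.

Lemma cmeas_dirichlet N : cmeas (dirichlet N : RM -> C).
Proof.
apply: cmeas_sum => n; apply: cmeas_ext (cmeas_e2pi_real (- n%:~R)) => t.
by rewrite mulNr.
Qed.

Lemma cmeas_fejer M : cmeas (fejer M : RM -> C).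
Proof. by apply: cmeasM; [exact: cmeas_cst|apply: cmeas_sum; exact: cmeas_dirichlet]. Qed.

Lemma cint_sum (I : Type) (r : seq I) (F : I -> RM -> C) :
  (forall i, cinteg mu (F i)) ->
  cinteg mu (fun t => \sum_(i <- r) F i t) /\
  cint mu (fun t => \sum_(i <- r) F i t) = \sum_(i <- r) cint mu (F i).
Proof.
move=> Fi; elim: r => [|i r [IH1 IH2]].
  have E0 t : (fun=> 0) t = \sum_(i <- [::]) F i t by rewrite big_nil.
  split; first by apply: cinteg_ext E0 _; split; apply: integrable0.
  by rewrite -(eq_cint _ E0) /cint /= Rintegral_cst// mul0r big_nil.
have ES t : F i t + \sum_(i <- r) F i t = \sum_(i <- i :: r) F i t by rewrite big_cons.
split; first by apply: cinteg_ext ES _; exact: cintegD.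
by rewrite -(eq_cint _ ES) cintD// IH2 big_cons.
Qed.

Lemma cint_piece_fejer (k : int) M :
  cint mu (fun t => (unit_piece k t)%:C * fejer M t) = 1.
Proof.
have Ei (n : int) : cinteg mu (fun t : RM => (unit_piece k t)%:C * e2pi (- (n%:~R * (t : R)%:C))).
  apply: (cinteg_ico (M := 1)) => [|t _].
    by apply: cmeas_ext (cmeas_e2pi_real (- n%:~R)) => t; rewrite mulNr.
  by rewrite -[n%:~R : C](rmorph_int (real_complex R)) -rmorphM -rmorphN cn_e2pi_real.
have Ev (n : int) : cint mu (fun t : RM => (unit_piece k t)%:C * e2pi (- (n%:~R * (t : R)%:C))) = (n == 0)%:R.
  have [->|n0] := eqVneq n 0.
    transitivity (cint mu (fun t : RM => (unit_piece k t)%:C)).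
      by apply: eq_cint => t; rewrite mul0r oppr0 e2pi0 mulr1.
    by rewrite cint_real integral_unit_piece.
  transitivity (0 : C) => //; rewrite -(@e2pi_period_int n (k%:~R - 2^-1) n0).
  apply: eq_cint => t; rewrite /unit_piece (_ : k%:~R - 2^-1 + 1 = k%:~R + 2^-1)//.
  by lra.
have D N : cinteg mu (fun t => (unit_piece k t)%:C * dirichlet N t) /\
    cint mu (fun t => (unit_piece k t)%:C * dirichlet N t) = 1.
  have [H1 H2] := cint_sum (symseq N) Ei.
  have E t : \sum_(n <- symseq N) (unit_piece k t)%:C * e2pi (- (n%:~R * (t : R)%:C)) =
    (unit_piece k t)%:C * dirichlet N t by rewrite /dirichlet mulr_sumr.
  split; first exact: cinteg_ext E H1.
  rewrite -(eq_cint _ E) H2 (eq_bigr (fun n : int => (n == 0)%:R)) => [|n _]; last exact: Ev.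
  rewrite (bigD1_seq 0) ?symseq_uniq ?mem_symseq//= big1 ?addr0// => n n0.
  by rewrite (negbTE n0).
have [H1 H2] := cint_sum (index_iota 0 M.+1) (fun N => (D N).1).
have E t : M.+1%:R^-1 * (\sum_(0 <= N < M.+1) (unit_piece k t)%:C * dirichlet N t) =
  (unit_piece k t)%:C * fejer M t by rewrite /fejer -mulr_sumr mulrCA.
rewrite -(eq_cint _ E) cintZ// H2 (eq_bigr (fun=> 1)) => [|N _]; last by case: (D N).
by rewrite sumr_const_nat subn0 mulVf// pnatr_eq0.
Qed.

(** The integral of [f] against the Fejer kernel is computed twice. By Fourier coefficients it is a
    Cesaro mean of the partial sums of [c]. Cut into unit intervals around the integers, on each of
    which the kernel has mass 1, it tends to the sum of the [f k]. *)
Lemma poisson (f df : R -> C) (A B K : R) (c := fun n : int =>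
    cint mu (fun t : RM => f t * e2pi (- (n%:~R * (t : R)%:C)))) :
  0 < A -> 0 <= B -> (forall x, is_cd f x (df x)) ->
  (forall t, cn (f t) <= egauss A B K t) ->
  (forall t, cn (df t) <= egauss A B K t) -> absum c ->
  csum (fun k : int => f k%:~R) = csum c.
Proof.
move=> A0 B0 fd fb dfb sc.
have ig := integrable_egauss B K A0.
have mf : cmeas (f : RM -> C) by exact: is_cd_cmeas fd.
pose G (k : int) := egauss A (2 * A + B) (B + K) k%:~R.
have G0 k : 0 <= G k by exact: expR_ge0.
have nG : nns G by exact: nns_egauss.
have sf : absum (fun k : int => f k%:~R).
  by apply: absum_le (nns_egauss B K A0).
have c1 (n : int) (t : R) : cn (e2pi (- (n%:~R * t%:C))) = 1.
  by rewrite -[n%:~R : C](rmorph_int (real_complex R)) -rmorphM -rmorphN cn_e2pi_real.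
have me (n : int) : cmeas (fun t : RM => e2pi (- (n%:~R * (t : R)%:C))).
  by apply: cmeas_ext (cmeas_e2pi_real (- n%:~R)) => t; rewrite mulNr.
have ci (n : int) : cinteg mu (fun t : RM => f t * e2pi (- (n%:~R * (t : R)%:C))).
  apply: cinteg_le ig; first exact: cmeasM.
  by move=> t; rewrite cnM c1 mulr1.
pose SN N := \sum_(n <- symseq N) c n.
have D N : cinteg mu (fun t : RM => f t * dirichlet N t) /\
    cint mu (fun t : RM => f t * dirichlet N t) = SN N.
  have [H1 H2] := cint_sum (symseq N) ci.
  have E (t : RM) : \sum_(n <- symseq N) f t * e2pi (- (n%:~R * (t : R)%:C)) = f t * dirichlet N t.
    by rewrite /dirichlet mulr_sumr.
  by split; [exact: cinteg_ext E H1|rewrite -(eq_cint _ E) H2].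
pose FM M := cint mu (fun t : RM => f t * fejer M t).
have FME M : FM M = M.+1%:R^-1 * \sum_(0 <= N < M.+1) SN N.
  have [H1 H2] := cint_sum (index_iota 0 M.+1) (fun N => (D N).1).
  have E (t : RM) : M.+1%:R^-1 * (\sum_(0 <= N < M.+1) f t * dirichlet N t) = f t * fejer M t.
    by rewrite /fejer -mulr_sumr mulrCA.
  rewrite /FM -(eq_cint _ E) cintZ// H2; congr (_ * _).
  by apply: eq_bigr => N _; case: (D N).
(* Cesaro means of a convergent sequence: the first [N0] terms have a fixed sum [Q], which is
   divided by [M + 1]. *)
have L1 e : 0 < e -> \forall M \near \oo, cn (FM M - csum c) <= e.
  move=> e0; have e20 : 0 < e / 2 by rewrite divr_gt0.
  have SNc e1 : 0 < e1 -> \forall N \near \oo, cn (SN N - csum c) <= e1.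
    move=> e10; have [s hs] := csum_tail sc e10.
    exists (\max_(n <- s) `|n|%N) => //= N /= sN.
    rewrite -cnN opprB; apply: hs => //; first exact: symseq_uniq.
    move=> n ns; rewrite mem_symseq (leq_trans _ sN)//.
    exact: (@leq_bigmax_seq _ s xpredT (fun n : int => `|n|%N) n).
  have [N0 _ hN0] := SNc _ e20.
  pose Q := \sum_(0 <= N < N0) cn (SN N - csum c).
  have Q0 : 0 <= Q by apply: sumr_ge0 => N _; exact: cn_ge0.
  exists (maxn N0 (Num.truncn (Q / (e / 2))).+1) => // M; rewrite [X in X -> _]/= geq_max => /andP[NM QM].
  have -> : FM M - csum c = M.+1%:R^-1 * \sum_(0 <= N < M.+1) (SN N - csum c).
    rewrite FME sumrB sumr_const_nat subn0 mulrBr -[csum c *+ M.+1]mulr_natl mulKf//.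
  rewrite cnM cnV cn_nat ler_pdivrMl ?ltr0n// (le_trans (cn_sum _ _))//.
  rewrite (@big_cat_nat _ _ _ N0)//=; last by rewrite ltnW.
  rewrite -/Q [leRHS](_ : _ = M.+1%:R * (e / 2) + M.+1%:R * (e / 2)); last by field.
  rewrite lerD//.
    rewrite -ler_pdivrMr// (le_trans (ltW (truncnS_gt _)))// ler_nat.
    by rewrite (leq_trans QM).
  rewrite (@le_trans _ _ (\sum_(N0 <= N < M.+1) (e / 2)))//.
    rewrite big_nat [leRHS]big_nat; apply: ler_sum => N /andP[h _]; exact: hN0.
  rewrite sumr_const_nat -[leLHS]mulr_natl; apply: ler_wpM2r; first exact: ltW.
  by rewrite ler_nat leq_subr.
pose q M (k : int) := cint mu (fun t : RM => (unit_piece k t)%:C * ((f t - f k%:~R) * fejer M t)).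
have mg k M : cmeas (fun t : RM => (f t - f k%:~R) * fejer M t).
  apply: cmeasM; last exact: cmeas_fejer.
  by apply: cmeasD => //; exact: cmeas_cst.
(* The Lipschitz bound yields a factor [|t - k|], at most [|e(t) - 1|] on the piece around [k]. *)
have fk k (t : R) : `|t - k%:~R| <= 2^-1 -> cn (f t - f k%:~R) <= 2 * G k * `|t - k%:~R|.
  move=> tk.
  have [kt|tk'] := leP k%:~R t.
    rewrite [X in _ * X]ger0_norm ?subr_ge0//.
    apply: (is_cd_lip (df := df)) => // s /andP[s1 s2]; rewrite (le_trans (dfb _))// egauss_piece//.
    by move: tk; rewrite !ger0_norm ?subr_ge0//; lra.
  rewrite -cnN opprB distrC [X in _ * X]ger0_norm; last by rewrite subr_ge0 ltW.
  apply: (is_cd_lip (df := df)) => // [|s /andP[s1 s2]]; first exact: ltW.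
  rewrite (le_trans (dfb _))// egauss_piece//.
  by move: tk; rewrite !ler_norml => /andP[t1 t2]; apply/andP; split; lra.
have et k (t : R) : `|t - k%:~R| <= 2^-1 -> `|t - k%:~R| <= cn (e2pi t%:C - 1).
  move=> /cn_e2pi_sub1 /le_trans; apply.
  have -> : (t - k%:~R)%:C = t%:C + (- k)%:~R :> C by rewrite mulrNz -(rmorph_int (real_complex R)) -rmorphB.
  by rewrite e2piDint.
have fkF k (t : R) M : `|t - k%:~R| <= 2^-1 ->
    cn ((f t - f k%:~R) * fejer M t) <= 2 * G k * cn ((e2pi t%:C - 1) * fejer M t).
  move=> tk; rewrite (cnM (f t - _)) (cnM (e2pi _ - 1)) mulrA; apply: ler_wpM2r; first exact: cn_ge0.
  rewrite (le_trans (fk k t tk))//.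
  by rewrite ler_wpM2l ?mulr_ge0// et.
have fkb k (t : R) M : `|t - k%:~R| <= 2^-1 -> cn ((f t - f k%:~R) * fejer M t) <= 4 * G k.
  move=> tk; rewrite (le_trans (fkF k t M tk))//.
  rewrite (_ : 4 * G k = 2 * G k * 2); last by ring.
  by rewrite ler_wpM2l ?mulr_ge0// fejer_bound.
have qb M k : cn (q M k) <= 8 * G k.
  rewrite (_ : 8 * G k = 2 * (4 * G k)); last by ring.
  apply: cn_cint_piece => //; first by rewrite mulr_ge0.
  by move=> t tk; exact: fkb.
have q0 k e : 0 < e -> \forall M \near \oo, cn (q M k - 0) <= e.
  move=> e0.
  have <- : cint mu (fun _ : RM => 0 : C) = 0 by rewrite /cint /= Rintegral_cst// mul0r.
  apply: (@cint_dct _ RM R mu _ (fun=> 0) (fun t => 4 * G k * unit_piece k t)) => //.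
  - by move=> M; apply: cmeasM => //; apply: cmeas_real; exact: measurable_ico.
  - move=> t e1 e10.
    have [u0|u0] := eqVneq (unit_piece k t) 0.
      by apply: nearW => M; rewrite u0 mul0r subrr cn0 ltW.
    have tk := unit_piece_dist u0.
    (* Where [e(t) = 1] the kernel is large, but [f t - f k] vanishes; elsewhere on the piece the
       kernel decays like [1 / (M + 1)]. *)
    have [E0|E0] := eqVneq (cn (e2pi t%:C - 1)) 0.
      apply: nearW => M; rewrite subr0 cnM (_ : cn ((f t - f k%:~R) * fejer M t) = 0) ?mulr0 ?ltW//.
      by apply/le_anti; rewrite cn_ge0 andbT (le_trans (fkF k t M tk))// cnM E0 mul0r mulr0.
    have Ep : 0 < cn (e2pi t%:C - 1) by rewrite lt_neqAle eq_sym E0 cn_ge0.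
    pose Q := 2 * G k * (4 / cn (e2pi t%:C - 1)).
    exists (Num.truncn (Q / e1)).+1 => // M /= QM.
    rewrite subr0 cnM cn_real ger0_norm ?ico_ge0//.
    rewrite (@le_trans _ _ (cn ((f t - f k%:~R) * fejer M t)))//.
      by rewrite ler_piMl ?cn_ge0 ?ico_le1.
    rewrite (le_trans (fkF k t M tk))//.
    rewrite (@le_trans _ _ (2 * G k * (4 / M.+1%:R / cn (e2pi t%:C - 1))))//.
      rewrite ler_wpM2l ?mulr_ge0// ler_pdivlMr// cnM mulrC mulrA -expr2.
      exact: fejer_small.
    have -> : 2 * G k * (4 / M.+1%:R / cn (e2pi t%:C - 1)) = Q / M.+1%:R by rewrite /Q; ring.
    rewrite ler_pdivrMr ?ltr0n// mulrC -ler_pdivrMr//.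
    by rewrite (le_trans (ltW (truncnS_gt _)))// ler_nat (leq_trans QM).
  - exact: (integrableZl measurableT (4 * G k) (integrable_ico _ _)).
  - move=> M t; rewrite cnM cn_real ger0_norm ?ico_ge0// mulrC.
    have [->|t0] := eqVneq (unit_piece k t) 0; first by rewrite !mulr0.
    by rewrite ler_wpM2r ?ico_ge0// fkb// unit_piece_dist.
have qE M : csum (q M) = FM M - csum (fun k : int => f k%:~R).
  have [H1 H2] : absum (fun k : int => cint mu (fun t : RM => (unit_piece k t)%:C * (f t * fejer M t))) /\
      csum (fun k : int => cint mu (fun t : RM => (unit_piece k t)%:C * (f t * fejer M t))) = FM M.
    have m0 : 0 < M.*2.+1%:R :> R by rewrite ltr0n.
    apply: (cint_pieces (K := K + ln M.*2.+1%:R) A0 B0).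
      by apply: cmeasM => //; exact: cmeas_fejer.
    move=> t; rewrite cnM /egauss addrA expRD lnK ?posrE//.
    by rewrite ler_pM ?cn_ge0// cn_fejer.
  have fi k : cinteg mu (fun t => (unit_piece k t)%:C * fejer M t).
    apply: (cinteg_ico (M := M.*2.+1%:R)) => [|t _]; first exact: cmeas_fejer.
    exact: cn_fejer.
  have gi k : cinteg mu (fun t : RM => (unit_piece k t)%:C * (f t * fejer M t)).
    apply: (cinteg_ico (M := expR K * 0 + (egauss A (2 * A + B) (B + K) k%:~R) * M.*2.+1%:R)).
      by apply: cmeasM => //; exact: cmeas_fejer.
    move=> t /andP[t1 t2]; rewrite cnM mulr0 add0r ler_pM ?cn_ge0 ?cn_fejer//.
    by rewrite (le_trans (fb t))// egauss_piece// ler_norml; apply/andP; split; lra.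
  rewrite -H2 -csumB//; apply: eq_csum => k.
  rewrite -[f k%:~R in RHS]mulr1 -(cint_piece_fejer k M) -cintZ// -cintB//; last exact: cintegZ.
  by apply: eq_cint => t; ring.
have L2 e : 0 < e -> \forall M \near \oo, cn (FM M - csum (fun k : int => f k%:~R)) <= e.
  move=> e0.
  have n8 : nns (fun k => 8 * G k) by apply: nnsZ.
  have H1 : \forall M \near \oo, forall k, cn (q M k) <= 8 * G k by apply: nearW => M k; exact: qb.
  have H2 (k : int) : cn (0 : C) <= 8 * G k by rewrite cn0 mulr_ge0.
  have := csum_tannery n8 H1 H2 q0 e0.
  by move=> /(_ _)/filterS; rewrite csum0; apply=> M; rewrite subr0 qE.
apply/eqP; rewrite -subr_eq0 -cn_eq0; apply/eqP/le_anti; rewrite cn_ge0 andbT.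
apply/ler_addgt0Pr => e e0; rewrite add0r.
have e20 : 0 < e / 2 by rewrite divr_gt0.
have [M [h1 h2]] : exists M, cn (FM M - csum c) <= e / 2 /\ cn (FM M - csum (fun k : int => f k%:~R)) <= e / 2.
  have [M1 _ H1] := L1 _ e20; have [M2 _ H2] := L2 _ e20.
  by exists (maxn M1 M2); split; [apply: H1|apply: H2]; rewrite /= ?leq_maxl ?leq_maxr.
have -> : csum (fun k : int => f k%:~R) - csum c = (FM M - csum c) - (FM M - csum (fun k : int => f k%:~R)) by ring.
by rewrite (le_trans (cnB _ _))// (splitr e) lerD.
Qed.

Definition gauss_const (p : C) : C := cint mu (cgauss p 0).

Lemma pi_neq0 : (pi : R)%:C != 0 :> C.
Proof. by rewrite (inj_eq (@complexI R)) gt_eqF ?pi_gt0. Qed.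

Lemma absum_gauss (q b c : C) : 0 < cRe q ->
  absum (fun n : int => cexp (- (q * n%:~R ^+ 2) + b * n%:~R + c)).
Proof.
move=> q0; apply: (absum_le _ (nnsZ (expR_ge0 (cRe c)) (nns_gauss `|cRe b| q0))) => n.
rewrite cn_cexp -expRD ler_expR.
have -> : (n%:~R : C) ^+ 2 = (n%:~R ^+ 2 : R)%:C by rewrite rmorphXn /= rmorph_int.
rewrite !ReImE Re_int Im_int /= !mulr0 !subr0 addrC lerD2l mulNr lerD2l.
by rewrite (le_trans (ler_norm _))// normrM.
Qed.

Lemma Re_inv_gt0 (p : C) : 0 < cRe p -> 0 < cRe p^-1.
Proof.
case: p => a b /= a0; rewrite divr_gt0// ltr_wpDr ?sqr_ge0//.
by rewrite exprn_gt0.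
Qed.

(** Poisson summation for [cgauss p z]: the Fourier coefficient at [n] is the Gaussian integral at
    frequency [z - n], and the dual sum is then reversed. *)
Theorem jacobi0 (p z : C) : 0 < cRe p ->
  absum (fun k : int => cexp (- (pi : R)%:C * p * k%:~R ^+ 2) * e2pi (z * k%:~R)) /\
  absum (fun n : int => cexp (- ((pi : R)%:C * (z + n%:~R) ^+ 2 / p))) /\
  csum (fun k : int => cexp (- (pi : R)%:C * p * k%:~R ^+ 2) * e2pi (z * k%:~R)) =
  gauss_const p * csum (fun n : int => cexp (- ((pi : R)%:C * (z + n%:~R) ^+ 2 / p))).
Proof.
move=> p0; have pn0 : p != 0 by apply/eqP => p1; move: p0; rewrite p1 ltxx.
have pp : 0 < pi * cRe p by rewrite mulr_gt0 ?pi_gt0.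
set f := fun k : int => _.
have fE k : cgauss p z k%:~R = f k.
  rewrite /f /cgauss cexpD /e2pi (_ : (k%:~R : R)%:C = k%:~R) ?rmorph_int//.
  by congr (_ * cexp _); ring.
have sf : absum f.
  have q0 : 0 < cRe ((pi : R)%:C * p) by rewrite Re_realM.
  apply: absum_ext (absum_gauss (2 * (pi : R)%:C * 'i * z) 0 q0) => k.
  by rewrite addr0 cexpD /f /e2pi; congr (cexp _ * cexp _); ring.
have sg : absum (fun n : int => cexp (- ((pi : R)%:C * (z + n%:~R) ^+ 2 / p))).
  have q0 : 0 < cRe ((pi : R)%:C / p) by rewrite Re_realM mulr_gt0 ?pi_gt0 ?Re_inv_gt0.
  apply: absum_ext (absum_gauss (- (2 * (pi : R)%:C * z / p)) (- ((pi : R)%:C * z ^+ 2 / p)) q0) => n.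
  by congr cexp; ring.
split=> //; split=> //.
pose g n : C := gauss_const p * cexp (- ((pi : R)%:C * (z + n%:~R) ^+ 2 / p)).
have sgN : absum (fun n : int => g (- n)).
  apply: absum_reindex; last exact: absumZ.
  by exists -%R; exact: opprK.
have cE (n : int) : cint mu (fun t : RM => cgauss p z t * e2pi (- (n%:~R * (t : R)%:C))) = g (- n).
  rewrite /g /gauss_const mulrNz -cgauss_fourier//.
  apply: eq_cint => t; rewrite /cgauss /e2pi -cexpD; congr cexp; ring.
rewrite -(csumZ _ sg).
transitivity (csum (fun n : int => g (- n))); last first.
  by apply: (csum_reindex g); exists -%R; exact: opprK.
rewrite -(eq_csum cE) -(eq_csum fE).
pose a := 2 * (pi : R)%:C * 'i * z; pose b := - (2 * (pi : R)%:C * p).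
have k0 : 0 <= 1 + cn a + cn b by rewrite !addr_ge0 ?cn_ge0.
have e0 (x : R) : 0 <= egauss (pi * cRe p) (2 + 2 * pi * `|cIm z|) 0 x by exact: expR_ge0.
apply: (@poisson _ _ (pi * cRe p) (2 + 2 * pi * `|cIm z|) (1 + cn a + cn b) pp) => [|x|x|x|].
- by rewrite addr_ge0// mulr_ge0// mulr_ge0 ?pi_ge0.
- exact: is_cd_cgauss.
- apply: le_trans (egauss_cst _ _ _ k0).
  have -> : cgauss p z x = (1 + 0 * x%:C + 0 * x%:C ^+ 2) * cgauss p z x by ring.
  apply: (le_trans (cn_poly_gauss _ _ _ _ _ _)).
  by rewrite ler_wpM2r// cn0 cn1 !addr0 -addrA lerDl addr_ge0 ?cn_ge0.
- apply: le_trans (egauss_cst _ _ _ k0).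
  have -> : (2 * (pi : R)%:C * 'i * z - 2 * (pi : R)%:C * p * x%:C) * cgauss p z x =
     (a + b * x%:C + 0 * x%:C ^+ 2) * cgauss p z x by rewrite /a /b; ring.
  apply: (le_trans (cn_poly_gauss _ _ _ _ _ _)).
  by rewrite ler_wpM2r// cn0 addr0 lerD2r lerDr.
- by apply: absum_ext sgN => n; rewrite cE.
Qed.

(** A shift [kap] of the summation variable amounts to a complex change of [z]: replace [z] by
    [z - i p kap] in [jacobi0] and multiply by [exp (- pi p kap^2)]. *)
Theorem jacobi (p z kap : C) : 0 < cRe p ->
  absum (fun k : int => cexp (- (pi : R)%:C * p * (k%:~R - kap) ^+ 2) * e2pi (z * k%:~R)) /\
  absum (fun n : int => cexp (- ((pi : R)%:C * (z + n%:~R) ^+ 2 / p)) * e2pi (kap * (z + n%:~R))) /\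
  csum (fun k : int => cexp (- (pi : R)%:C * p * (k%:~R - kap) ^+ 2) * e2pi (z * k%:~R)) =
  gauss_const p * csum (fun n : int => cexp (- ((pi : R)%:C * (z + n%:~R) ^+ 2 / p)) * e2pi (kap * (z + n%:~R))).
Proof.
move=> p0; have pn0 : p != 0 by apply/eqP => p1; move: p0; rewrite p1 ltxx.
have [s1 [s2 E]] := jacobi0 (z - 'i * p * kap) p0.
pose c := cexp (- (pi : R)%:C * p * kap ^+ 2).
have i2 : 'i * 'i = -1 :> C by rewrite -expr2 sqr_i.
have E1 (k : int) : c * (cexp (- (pi : R)%:C * p * k%:~R ^+ 2) * e2pi ((z - 'i * p * kap) * k%:~R)) =
    cexp (- (pi : R)%:C * p * (k%:~R - kap) ^+ 2) * e2pi (z * k%:~R).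
  rewrite /c /e2pi -!cexpD; congr cexp.
  (* The cross term on the left carries the factor ['i * 'i], which [ring] does not reduce; the
     added zero cancels it and leaves its value. *)
  rewrite -[LHS]addr0 -(subrr ('i * 'i * (2 * (pi : R)%:C * p * kap * k%:~R))) {2}i2.
  ring.
have E2 (n : int) : c * cexp (- ((pi : R)%:C * (z - 'i * p * kap + n%:~R) ^+ 2 / p)) =
    cexp (- ((pi : R)%:C * (z + n%:~R) ^+ 2 / p)) * e2pi (kap * (z + n%:~R)).
  rewrite /c /e2pi -!cexpD; congr cexp.
  have -> : (z - 'i * p * kap + n%:~R) ^+ 2 = (z + n%:~R) ^+ 2 - 2 * 'i * p * kap * (z + n%:~R) + ('i * 'i) * (p * kap) ^+ 2 by ring.
  by rewrite i2; field.
split; first by apply: absum_ext E1 _; exact: absumZ.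
split; first by apply: absum_ext E2 _; exact: absumZ.
rewrite -(eq_csum E1) csumZ// E -(eq_csum E2) csumZ//.
by rewrite mulrCA.
Qed.

End Poisson.

(** * The functions E1 and E2 *)
Section ErrorFunction.
Local Open Scope classical_set_scope.
Variable R : realType.
Local Notation C := R[i].
Local Notation mu := (@lebesgue_measure R).
Local Notation RM := (measurableTypeR R).
Local Notation ri f := (mu.-integrable setT (EFin \o (f : RM -> R))).
Implicit Types x y t : R.

Lemma ri_le (f g : RM -> R) : measurable_fun setT f -> (forall t, `|f t| <= g t) ->
  ri g -> ri f.
Proof.
move=> mf fg ig; apply: le_integrable ig => //; first exact/measurable_EFinP.
by move=> t _ /=; rewrite lee_fin (le_trans (fg t))// ler_norm.
Qed.

Lemma gam_ge0 x : 0 <= gam x. Proof. exact: expR_ge0. Qed.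

Lemma gam_le1 x : gam x <= 1.
Proof. by rewrite /gam -expR0 ler_expR mulNr oppr_le0 mulr_ge0 ?pi_ge0 ?sqr_ge0. Qed.

Lemma measurable_gam : measurable_fun setT (@gam R : RM -> R).
Proof. by have /integrableP[/measurable_EFinP] := @integrable_gam R. Qed.

Lemma continuous_gam : continuous (@gam R).
Proof.
move=> x; apply: differentiable_continuous; apply/derivable1_diffP.
by rewrite /gam; apply: ex_derive.
Qed.

(** A sign without the value 0: its modulus is 1 everywhere, and integrals do not see the point
    0. *)
Definition stp (x : R) : R := (0 < x)%R%:R * 2 - 1.

Lemma stpE x : stp x = if 0 < x then 1 else - 1.
Proof. by rewrite /stp; case: (0 < x); rewrite /=; lra. Qed.

Lemma stp_norm x : `|stp x| = 1.
Proof. by rewrite stpE; case: ifP; rewrite ?normr1// normrN1. Qed.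

Lemma measurable_stp (c : R) : measurable_fun setT (fun t : RM => stp (c - t)).
Proof.
rewrite (_ : (fun t => _) = (fun t : RM => \1_(`]-oo, c[ : set R) t * 2 - 1)).
  by apply: measurable_funB => //; apply: measurable_funM => //; apply: measurable_indic.
by apply/funext => t; rewrite /stp indicE mem_setE in_itv/= subr_gt0.
Qed.

(** [E1] as a primitive of [2 gam], from which the derivative can be read off; in [Erf] the bound of
    integration is [|x|]. *)
Definition Phi x : R := 2 * \int[mu]_(t in `]-oo, x]) gam t - 1.

Lemma Phi_derive x : is_derive x 1 Phi (2 * gam x).
Proof.
have x1 : x < x + 1 by rewrite ltrDl.
have ig : mu.-integrable `]-oo, x + 1] (EFin \o @gam R).
  by apply: (integrableS _ _ _ (@integrable_gam R)).
have [||dF eF] := @continuous_FTC1 R (@gam R) -oo%O x (x + 1) x1 ig.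
- exact: ltNyr.
- exact: continuous_gam.
have D : is_derive x 1 (fun y => \int[mu]_(t in `]-oo, y]) gam t) (gam x).
  by apply: DeriveDef; [exact: dF|rewrite -derive1E; exact: eF].
rewrite /Phi; apply: is_derive_eq.
by rewrite /GRing.scale/=; ring.
Qed.

Lemma Phi0 : Phi 0 = 0.
Proof.
have i0 : \int[mu]_(t in `]-oo, 0]) @gam R t = \int[mu]_(t in setT) gam t - \int[mu]_(t in `]0, +oo[) gam t.
  rewrite -set_itvNyy -(@Rintegral_itvB R (@gam R) -oo%O +oo%O 0)//.
    by rewrite opprB addrC subrK.
  by apply: (integrableS _ _ _ (@integrable_gam R)).
have ih : \int[mu]_(t in `]0, +oo[) @gam R t = 2^-1.
  rewrite Rintegral_itv_obnd_cbnd; last first.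
    by apply: (integrableS _ _ _ (@integrable_gam R)).
  have sp := @sqrt_pi_gt0 R.
  have iG : ri ((@gauss_fun R) \_ `[0, +oo[).
    rewrite -restrict_EFin; apply/integrable_restrict => //=; rewrite setTI.
    by apply: (integrableS _ _ _ (@integrableT_gauss R)).
  have := Rintegral_affine 0 (lt0r_neq0 sp) iG.
  rewrite gtr0_norm// -[X in _ = _ * X]Rintegral_mkcond.
  rewrite [X in _ = _ * X]/Rintegral (@integral0y_gauss R) /= mulrA mulVf ?gt_eqF// mul1r.
  move=> <-; rewrite Rintegral_mkcond; apply: eq_Rintegral => t _.
  rewrite !patchE gam_gauss !mem_setE !in_itv/= !andbT addr0.
  by rewrite pmulr_rge0.
by rewrite /Phi i0 ih Rintegral_gam; lra.
Qed.

Lemma gamN x : gam (- x) = gam x :> R.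
Proof. by rewrite /gam sqrrN. Qed.

Lemma PhiN x : Phi (- x) = - Phi x.
Proof.
have D (s : R) : is_derive s 1 (fun s => Phi s + Phi (- s)) 0.
  have D1 := Phi_derive s; have D2 := Phi_derive (- s).
  have D3 : is_derive s 1 (fun s => Phi (- s)) (- (2 * gam s)).
    rewrite -mulrN1 -gamN; apply: (@is_derive1_comp R Phi -%R s).
  by have := is_deriveD D1 D3; rewrite subrr.
have := @is_derive_0_is_cst R _ x 0 D; rewrite oppr0 Phi0 addr0 => /eqP.
by rewrite addrC addr_eq0 => /eqP.
Qed.

Lemma integral_ico_gam x : 0 <= x -> \int[mu]_(t in setT) (ico 0 x t * gam t) = Phi x / 2.
Proof.
rewrite le_eqVlt => /predU1P[<-|x0].
  rewrite Phi0 mul0r; transitivity (\int[mu]_(t in setT) (0 : R)); last first.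
    by rewrite Rintegral_cst// mul0r.
  apply: eq_Rintegral => t _.
  by rewrite icoE (_ : _ && _ = false) ?mul0r//; apply/negP => /andP[]; lra.
have D (s : R) : is_derive s 1 (fun s => Phi s / 2) (gam s).
  have D1 := Phi_derive s; apply: is_derive_eq.
  by rewrite /GRing.scale/=; field.
by rewrite (@ftc_real R _ _ _ _ x0 D (@continuous_gam)) Phi0 mul0r subr0.
Qed.

Lemma E1_Phi x : E1 x = Phi x.
Proof.
have sp := @sqrt_pi_gt0 R.
have pos y : 0 < y -> E1 y = Phi y.
  move=> y0; rewrite /E1 /Erf gtr0_sg ?mulr_gt0// mul1r gtr0_norm ?mulr_gt0//.
  have E : \int[mu]_(t in `[0, y * Num.sqrt pi]) expR (- t ^+ 2) =
     \int[mu]_(t in setT) (ico 0 (y * Num.sqrt pi) t * gauss_fun t).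
    rewrite Rintegral_ico Rintegral_itv_bndo_bndc//.
    by apply: (integrableS _ _ _ (@integrableT_gauss R)).
  have I : ri (fun t => ico 0 (y * Num.sqrt pi) t * gauss_fun t).
    apply: ri_le (@integrableT_gauss R).
      by apply: measurable_funM; [exact: measurable_ico|exact: measurable_gauss_fun].
    move=> t; rewrite normrM (ger0_norm (gauss_fun_ge0 _)) ger0_norm ?ico_ge0//.
    by rewrite ler_piMl ?gauss_fun_ge0 ?ico_le1.
  have := Rintegral_affine 0 (lt0r_neq0 sp) I.
  rewrite -E gtr0_norm// => H.
  have -> : \int[mu]_(t in `[0, y * Num.sqrt pi]) expR (- t ^+ 2) = Num.sqrt pi * (Phi y / 2).
    rewrite -[LHS](mulVKf (lt0r_neq0 sp)) -H -(integral_ico_gam (ltW y0)); congr (_ * _).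
    apply: eq_Rintegral => t _; rewrite gam_gauss addr0 !icoE; congr (_%:R * _).
    by rewrite pmulr_rge0// mulrC ltr_pM2r.
  by field; rewrite gt_eqF.
have [x0|x0|->] := ltgtP x 0; last 1 first.
- by rewrite /E1 /Erf mul0r sgr0 !mul0r Phi0.
- have N : E1 x = - E1 (- x).
    by rewrite /E1 /Erf mulNr sgrN normrN !mulNr opprK.
  by rewrite N pos ?oppr_gt0// PhiN opprK.
- exact: pos.
Qed.

Lemma E1_derive x : is_derive x 1 (@E1 R) (2 * gam x).
Proof. by rewrite (_ : @E1 R = Phi); [exact: Phi_derive|apply/funext => y; rewrite E1_Phi]. Qed.

Lemma E1N x : E1 (- x) = - E1 x. Proof. by rewrite !E1_Phi PhiN. Qed.

Lemma E10 : E1 (0 : R) = 0. Proof. by rewrite E1_Phi Phi0. Qed.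

Lemma measurable_stp_mul (c : R) (f : RM -> R) : measurable_fun setT f ->
  measurable_fun setT (fun t => stp (c - t) * f t).
Proof. by move=> mf; apply: measurable_funM => //; exact: measurable_stp. Qed.

Lemma ri_stp_gam (c : R) : ri (fun t => stp (c - t) * gam t).
Proof.
apply: ri_le (@integrable_gam R); first exact: measurable_stp_mul measurable_gam.
by move=> t; rewrite normrM stp_norm mul1r ger0_norm// gam_ge0.
Qed.

(** [E1] is the sign smoothed by a Gaussian. This form yields the tail bound and is the model for
    [N2]. *)
Lemma E1_int x : E1 x = \int[mu]_(t in setT) (stp (x - t) * gam t).
Proof.
rewrite E1_Phi /Phi -Rintegral_itv_bndo_bndc; last first.
  by apply: (integrableS _ _ _ (@integrable_gam R)).
rewrite -[X in _ - X]Rintegral_gam [X in 2 * X]Rintegral_mkcond.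
have iN : ri ((@gam R) \_ `]-oo, x[).
  rewrite -restrict_EFin; apply/integrable_restrict => //=; rewrite setTI.
  by apply: (integrableS _ _ _ (@integrable_gam R)).
rewrite -RintegralZl// -RintegralB//; last 2 first.
- by apply: eq_integrable (integrableZl measurableT 2 iN) => // t _.
- exact: integrable_gam.
apply: eq_Rintegral => t _; rewrite patchE mem_setE in_itv/= /stp subr_gt0.
by case: (t < x); rewrite /= -?[point]/(0 : R); ring.
Qed.

Lemma integral_gam_exp (r : R) :
  ri (fun t => expR (2 * pi * r * t) * gam t) /\
  \int[mu]_(t in setT) (expR (2 * pi * r * t) * gam t) = expR (pi * r ^+ 2).
Proof.
have E t : expR (pi * r ^+ 2) * gam (1 * t + (- r)) = expR (2 * pi * r * t) * gam t :> R.
  by rewrite /gam -!expRD; congr expR; ring.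
have n1 : (1 : R) != 0 by exact: oner_neq0.
have i1 := integrable_affine (- r) n1 (@integrable_gam R).
split.
  apply: eq_integrable (integrableZl measurableT (expR (pi * r ^+ 2)) i1) => // t _ /=.
  by rewrite -EFinM E.
under eq_Rintegral do rewrite -E.
by rewrite RintegralZl// Rintegral_affine// ?normr1 ?invr1 ?mul1r ?Rintegral_gam ?mulr1//; exact: integrable_gam.
Qed.

Lemma E1_le1 x : `|E1 x| <= 1.
Proof.
rewrite E1_int (le_trans (le_normr_Rintegral _ (ri_stp_gam x)))//.
rewrite -Rintegral_gam; rewrite le_eqVlt; apply/orP; left; apply/eqP; apply: eq_Rintegral => t _.
by rewrite normrM stp_norm mul1r ger0_norm// gam_ge0.
Qed.

(* Chernoff bound for the Gaussian tail *)
Lemma E1_tail x (r : R) : `|Num.sg r - E1 x| <= 2 * expR (pi * r ^+ 2 - 2 * pi * r * x).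
Proof.
have pos y (s : R) : 0 < s -> `|1 - E1 y| <= 2 * expR (pi * s ^+ 2 - 2 * pi * s * y).
  move=> s0.
  have -> : 1 - E1 y = \int[mu]_(t in setT) (gam t - stp (y - t) * gam t).
    by rewrite RintegralB ?Rintegral_gam -?E1_int//; [exact: integrable_gam|exact: ri_stp_gam].
  have iB : ri (fun t => gam t - stp (y - t) * gam t).
    have := integrableB measurableT (@integrable_gam R) (ri_stp_gam y).
    by apply: eq_integrable => // t _ /=; rewrite EFinB.
  rewrite (le_trans (le_normr_Rintegral _ iB))//.
  have [i2 e2] := integral_gam_exp s.
  have -> : 2 * expR (pi * s ^+ 2 - 2 * pi * s * y) =
     \int[mu]_(t in setT) (2 * expR (- (2 * pi * s * y)) * (expR (2 * pi * s * t) * gam t)).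
    by rewrite RintegralZl// e2 expRD; ring.
  apply: le_Rintegral => //.
  - exact: integrable_norm iB.
  - exact: (integrableZl measurableT _ i2).
  - move=> t _; rewrite -{1}[gam t]mul1r -mulrBl normrM [X in _ * X]ger0_norm ?gam_ge0//.
    rewrite mulrA ler_wpM2r ?gam_ge0// -mulrA -expRD stpE.
    case: ifP => [_|/negbT]; first by rewrite subrr normr0 mulr_ge0// expR_ge0.
    rewrite -leNgt subr_le0 => yt; rewrite opprK ger0_norm//.
    have : 1 <= expR (- (2 * pi * s * y) + 2 * pi * s * t).
      rewrite -expR0 ler_expR addrC -mulrBr mulr_ge0 ?subr_ge0//.
      by rewrite mulr_ge0 ?(ltW s0)// mulr_ge0 ?pi_ge0.
    by lra.
have [r0|r0|->] := ltgtP r 0; last 1 first.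
- rewrite sgr0 sub0r normrN expr0n /= !mulr0 mul0r subrr expR0 mulr1.
  by rewrite (le_trans (E1_le1 x))// ler1n.
- rewrite ltr0_sg// -normrN opprB opprK addrC -[E1 x]opprK -E1N.
  have := pos (- x) (- r); rewrite oppr_gt0 => /(_ r0).
  by rewrite sqrrN !mulrN mulNr opprK.
- by rewrite gtr0_sg//; exact: pos.
Qed.

Lemma E1_lip x y : `|E1 y - E1 x| <= 2 * `|y - x|.
Proof.
have g1 (t : R) : `|2 * gam t| <= 2.
  by rewrite normrM !ger0_norm ?gam_ge0// ler_piMr ?gam_le1.
have [xy|yx] := leP x y.
  rewrite [X in _ * X]ger0_norm ?subr_ge0//.
  by apply: (is_derive_lip (df := fun t => 2 * gam t)) => // s _; exact: E1_derive.
rewrite distrC [in leRHS]distrC [X in _ * X]ger0_norm; last by rewrite subr_ge0 ltW.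
by apply: (is_derive_lip (df := fun t => 2 * gam t)) => [|s _|s _]; [exact: ltW|exact: E1_derive|exact: g1].
Qed.

Lemma continuous_E1 : continuous (@E1 R).
Proof.
by move=> x; apply: differentiable_continuous; apply/derivable1_diffP; case: (E1_derive x).
Qed.

End ErrorFunction.

(** * A closed form of [E2], with its derivative and bounds *)

Section TwoVariableError.
Local Open Scope classical_set_scope.
Variable R : realType.
Local Notation C := R[i].
Local Notation mu := (@lebesgue_measure R).
Local Notation RM := (measurableTypeR R).
Local Notation ri f := (mu.-integrable setT (EFin \o (f : RM -> R))).
Implicit Types x y t c u alpha : R.

Lemma measurable_E1 (c d : R) : measurable_fun setT (fun t : RM => E1 (c - d * t)).
Proof.
have E t : c - d * t = (- d) * t + c by ring.
rewrite (_ : (fun t => _) = (fun t : RM => E1 ((- d) * t + c))); last by apply/funext => t; rewrite E.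
apply: measurableT_comp; last exact: measurable_affine.
by apply: continuous_measurable_fun; exact: continuous_E1.
Qed.

Lemma sigma_gam_integrable (s : RM -> R) : measurable_fun setT s -> (forall t, `|s t| <= 1) ->
  ri (fun t => s t * gam t).
Proof.
move=> ms s1; apply: ri_le (@integrable_gam R).
  by apply: measurable_funM => //; exact: measurable_gam.
by move=> t; rewrite normrM (ger0_norm (gam_ge0 _)) ler_piMl ?gam_ge0.
Qed.

Lemma is_cd_E1_affine (p q b : R) :
  is_cd (fun s => (E1 (p * s + q))%:C) b (p * (2 * gam (p * b + q)))%:C.
Proof.
have D0 : is_derive b 1 (fun s : R => p * s + q) p.
  have := is_deriveD (is_deriveZ p (is_derive_id b 1)) (is_derive_cst q b 1).
  by rewrite addr0 /GRing.scale/= mulr1.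
have D1 := E1_derive (p * b + q).
apply: is_cd_real; rewrite mulrC.
exact: (@is_derive1_comp R (@E1 R) (fun s : R => p * s + q) b).
Qed.

Lemma E1conv_derive (s : RM -> R) alpha c : measurable_fun setT s -> (forall t, `|s t| <= 1) ->
  is_cd (fun b => (\int[mu]_(t in setT) (s t * E1 (b - alpha * t) * gam t))%:C) c
   (\int[mu]_(t in setT) (s t * (2 * gam (c - alpha * t)) * gam t))%:C.
Proof.
move=> ms s1; rewrite -cint_real.
have E b : cint mu (fun t : RM => (s t * E1 (b - alpha * t) * gam t)%:C) =
    (\int[mu]_(t in setT) (s t * E1 (b - alpha * t) * gam t))%:C by rewrite cint_real.
apply: is_cd_ext E _.
apply: (@cint_derive _ RM R mu (fun b t => (s t * E1 (b - alpha * t) * gam t)%:C)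
  (fun b t => (s t * (2 * gam (b - alpha * t)) * gam t)%:C) (fun t => 2 * gam t) c 1).
- exact: ltr01.
- move=> b _; apply: cinteg_real; apply: sigma_gam_integrable.
    by apply: measurable_funM => //; exact: measurable_E1.
  by move=> t; rewrite normrM mulr_ile1 ?normr_ge0 ?E1_le1.
- move=> b t _.
  have D := is_cdZ (s t * gam t)%:C (is_cd_E1_affine 1 (- (alpha * t)) b).
  apply: is_cd_eq (is_cd_ext _ D) _ => [b1|]; rewrite -rmorphM /= !mul1r; congr (_%:C); ring.
- move=> b t _; rewrite cn_real !normrM (ger0_norm (ler0n R 2)) !(ger0_norm (gam_ge0 _)).
  rewrite ler_wpM2r ?gam_ge0//.
  rewrite mulrCA ler_piMr// mulr_ile1 ?normr_ge0 ?gam_ge0 ?gam_le1//.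
- exact: (integrableZl measurableT 2 (@integrable_gam R)).
Qed.

(** Rotation of the plane: [(c - alpha t)^2 + t^2 = (c / a)^2 + (a t - alpha c / a)^2]. *)
Lemma gam_prod alpha a c t : a != 0 -> a ^+ 2 = 1 + alpha ^+ 2 ->
  gam (c - alpha * t) * gam t = gam (c / a) * gam (a * t + - (alpha * c / a)).
Proof.
move=> a0 a2; rewrite /gam -!expRD; congr expR; rewrite -!mulrDr; congr (_ * _).
have -> : (c / a) ^+ 2 + (a * t + - (alpha * c / a)) ^+ 2 =
   c ^+ 2 * ((1 + alpha ^+ 2) / a ^+ 2) + a ^+ 2 * t ^+ 2 - 2 * alpha * c * t by field.
by rewrite -a2 divff ?expf_neq0// a2; ring.
Qed.

Lemma gam_conv (s : RM -> R) alpha a c : 0 < a -> a ^+ 2 = 1 + alpha ^+ 2 ->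
  measurable_fun setT s -> (forall t, `|s t| <= 1) ->
  \int[mu]_(t in setT) (s (a * t + - (alpha * c / a)) * (2 * gam (c - alpha * t)) * gam t) =
  2 * gam (c / a) / a * \int[mu]_(t in setT) (s t * gam t).
Proof.
move=> a0 a2 ms s1; have an : a != 0 by rewrite gt_eqF.
have := Rintegral_affine (- (alpha * c / a)) an (sigma_gam_integrable ms s1).
have := integrable_affine (- (alpha * c / a)) an (sigma_gam_integrable ms s1).
rewrite (gtr0_norm a0) => i1 e1.
transitivity (\int[mu]_(t in setT) (2 * gam (c / a) *
   (s (a * t + - (alpha * c / a)) * gam (a * t + - (alpha * c / a))))).
  apply: eq_Rintegral => t _.
  by rewrite -mulrA -[2 * _ * _]mulrA (gam_prod _ _ an a2); ring.
rewrite RintegralZl; [|by []|exact: i1].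
by rewrite e1 mulrA.
Qed.

Lemma integrable_E1_gam alpha c : ri (fun t => E1 (c - alpha * t) * gam t).
Proof. by apply: sigma_gam_integrable; [exact: measurable_E1|move=> t; exact: E1_le1]. Qed.

(** Both sides have the same derivative in [c], by [gam_conv], and both vanish at [c = 0], where the
    integrand is odd. *)
Lemma E1conv alpha a c : 0 < a -> a ^+ 2 = 1 + alpha ^+ 2 ->
  \int[mu]_(t in setT) (E1 (c - alpha * t) * gam t) = E1 (c / a).
Proof.
move=> a0 a2; pose W b := \int[mu]_(t in setT) (1 * E1 (b - alpha * t) * gam t).
have m1 : measurable_fun setT ((fun=> 1) : RM -> R) by exact: measurable_cst.
have W1 b : W b = \int[mu]_(t in setT) (E1 (b - alpha * t) * gam t).
  by apply: eq_Rintegral => t _; rewrite mul1r.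
have s1 (t : RM) : `|1 : R| <= 1 by rewrite normr1.
have W0 : W 0 = 0.
  rewrite W1; set I := Rintegral _ _ _.
  have n1 : (-1 : R) != 0 by rewrite oppr_eq0 oner_eq0.
  have : - I = I.
    have := Rintegral_affine 0 n1 (integrable_E1_gam alpha 0).
    rewrite normrN1 invr1 mul1r -/I => H.
    rewrite -[RHS]H -[LHS]mulN1r -[LHS]RintegralZl//; last exact: integrable_E1_gam.
    apply: eq_Rintegral => t _; rewrite !mulN1r addr0 gamN !sub0r mulrN opprK.
    by rewrite -mulNr -E1N opprK.
  by move/eqP; rewrite eq_sym -subr_eq0 opprK -mulr2n mulrn_eq0 /= => /eqP.
have D (b : R) : is_cd (fun b => (W b)%:C - (E1 (a^-1 * b + 0))%:C) b 0.
  have D1 := E1conv_derive alpha b m1 s1.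
  rewrite (gam_conv b a0 a2 m1 s1) in D1.
  apply: is_cd_eq (is_cdD D1 (is_cdN (is_cd_E1_affine a^-1 0 b))) _.
  have -> : \int[mu]_(t in setT) (1 * gam t) = 1 :> R.
    by rewrite -[RHS]Rintegral_gam; apply: eq_Rintegral => t _; rewrite mul1r.
  rewrite mulr1 addr0 [a^-1 * b]mulrC.
  by apply/eqP; rewrite subr_eq0; apply/eqP; congr (_%:C); ring.
have /(congr1 cRe)/= := is_cd0_cst c 0 D.
rewrite W0 mulr0 !addr0 E10 subr0 W1 mulrC => /eqP; rewrite subr_eq0 => /eqP ->//.
Qed.

(** With [E1] written as a convolution, this averages [sign (w2) sign (w1 + alpha w2)] over
    [w = u - (s, t)] against [exp (- pi (s^2 + t^2))], with [s] integrated out: the description of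
    [E2] as a smoothed product of signs. *)
Definition N2 alpha u1 u2 : R :=
  \int[mu]_(t in setT) (stp (u2 - t) * E1 (u1 + alpha * u2 - alpha * t) * gam t).

Lemma integrable_N2 alpha c u : ri (fun t => stp (u - t) * E1 (c - alpha * t) * gam t).
Proof.
apply: sigma_gam_integrable.
  by apply: measurable_funM; [exact: measurable_stp|exact: measurable_E1].
by move=> t; rewrite normrM stp_norm mul1r E1_le1.
Qed.

(** In the variable [u1 + alpha u2], with [u2] fixed, only the factor [E1] is differentiated, and
    [gam_conv] merges the two Gaussians. The result is a Gaussian times one [E1], which reduces
    dimension two to dimension one. *)
Lemma N2_derive alpha a u1 u2 : 0 < a -> a ^+ 2 = 1 + alpha ^+ 2 ->
  is_cd (fun s => (N2 alpha (s - alpha * u2) u2)%:C) u1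
   (2 * gam (u1 / a) / a * E1 ((u2 - alpha * (u1 - alpha * u2)) / a))%:C.
Proof.
move=> a0 a2.
have s1 (t : RM) : `|stp (u2 - t)| <= 1 by rewrite stp_norm.
have D := E1conv_derive alpha u1 (measurable_stp u2) s1.
apply: is_cd_eq (is_cd_ext _ D) _ => [b|].
  by rewrite /N2 subrK.
congr (_%:C); pose d := u2 * a - alpha * u1 / a.
have E t : stp (u2 - t) = stp (d - (a * t + - (alpha * u1 / a))).
  rewrite /stp (_ : d - _ = a * (u2 - t)); last by rewrite /d; field; rewrite gt_eqF.
  by rewrite pmulr_rgt0.
transitivity (\int[mu]_(t in setT) (stp (d - (a * t + - (alpha * u1 / a))) *
    (2 * gam (u1 - alpha * t)) * gam t)).
  by apply: eq_Rintegral => t _; rewrite E.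
have sd (t : RM) : `|stp (d - t)| <= 1 by rewrite stp_norm.
rewrite (gam_conv (s := fun t => stp (d - t)) u1 a0 a2 (measurable_stp d) sd) -E1_int.
congr (_ * E1 _); rewrite /d; apply: (mulIf (lt0r_neq0 a0)); rewrite mulfVK ?gt_eqF//.
by rewrite mulrBl (mulfVK (lt0r_neq0 a0)) -[u2 * a * a]mulrA -expr2 a2; ring.
Qed.

(** The combination is the integral of a product of two differences, [stp - sg r'] and [E1 - sg r],
    against [gam]. Each has a Chernoff bound exponential in [t], and the remaining Gaussian integral
    is exact. Only the signs of [r] and [r'] occur on the left, so their sizes can be chosen
    later. *)
Lemma N2_bound alpha a u1 u2 r r' : 0 < a -> a ^+ 2 = 1 + alpha ^+ 2 ->
  `|N2 alpha u1 u2 - Num.sg r' * E1 ((u1 + alpha * u2) / a) - Num.sg r * E1 u2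
    + Num.sg r * Num.sg r'| <=
  4 * expR (pi * r ^+ 2 - 2 * pi * r' * u2 - 2 * pi * r * (u1 + alpha * u2)
            + pi * (r' + alpha * r) ^+ 2).
Proof.
move=> a0 a2; set c := u1 + alpha * u2.
have i1 := integrable_N2 alpha c u2.
have i2 := integrable_E1_gam alpha c.
have i3 := ri_stp_gam u2.
have i4 := @integrable_gam R.
have i2' : ri (fun t => Num.sg r' * (E1 (c - alpha * t) * gam t)).
  exact: (integrableZl measurableT (Num.sg r') i2).
have i3' : ri (fun t => Num.sg r * (stp (u2 - t) * gam t)).
  exact: (integrableZl measurableT (Num.sg r) i3).
have i4' : ri (fun t => Num.sg r * Num.sg r' * gam t).
  exact: (integrableZl measurableT (Num.sg r * Num.sg r') i4).
have i12 : ri (fun t => stp (u2 - t) * E1 (c - alpha * t) * gam t - Num.sg r' * (E1 (c - alpha * t) * gam t)).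
  by have := integrableB measurableT i1 i2'; apply: eq_integrable => // t _ /=; rewrite EFinB.
have i123 : ri (fun t => stp (u2 - t) * E1 (c - alpha * t) * gam t
    - Num.sg r' * (E1 (c - alpha * t) * gam t) - Num.sg r * (stp (u2 - t) * gam t)).
  by have := integrableB measurableT i12 i3'; apply: eq_integrable => // t _ /=; rewrite EFinB.
have iA : ri (fun t => (stp (u2 - t) - Num.sg r') * (E1 (c - alpha * t) - Num.sg r) * gam t).
  have := integrableD measurableT i123 i4'.
  by apply: eq_integrable => // t _ /=; rewrite -EFinD; congr (_%:E); ring.
have -> : N2 alpha u1 u2 - Num.sg r' * E1 (c / a) - Num.sg r * E1 u2 + Num.sg r * Num.sg r' =
   \int[mu]_(t in setT) ((stp (u2 - t) - Num.sg r') * (E1 (c - alpha * t) - Num.sg r) * gam t).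
  rewrite -(E1conv c a0 a2) (E1_int u2) -[X in _ + X]mulr1 -Rintegral_gam /N2 -/c.
  rewrite -!RintegralZl// -!RintegralB// -RintegralD//.
  by apply: eq_Rintegral => t _; ring.
rewrite (le_trans (le_normr_Rintegral _ iA))//.
have [ie ee] := integral_gam_exp (r' + alpha * r).
pose K := 4 * expR (pi * r ^+ 2 - 2 * pi * r' * u2 - 2 * pi * r * c).
have -> : 4 * expR (pi * r ^+ 2 - 2 * pi * r' * u2 - 2 * pi * r * c
            + pi * (r' + alpha * r) ^+ 2) =
   \int[mu]_(t in setT) (K * (expR (2 * pi * (r' + alpha * r) * t) * gam t)).
  by rewrite RintegralZl// ee /K expRD mulrA.
apply: le_Rintegral => //.
- exact: integrable_norm iA.
- exact: (integrableZl measurableT K ie).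
- move=> t _; rewrite normrM (ger0_norm (gam_ge0 _)) mulrA ler_wpM2r ?gam_ge0//.
  have b1 : `|stp (u2 - t) - Num.sg r'| <= 2 * expR (2 * pi * r' * (t - u2)).
    have ex (x : R) : 0 <= x -> 2 <= 2 * expR x.
      by move=> x0; rewrite ler_peMr// -expR0 ler_expR.
    have e0 (x : R) : 0 <= 2 * expR x by rewrite mulr_ge0 ?expR_ge0.
    have p0 := @pi_ge0 R.
    have eq2 : 2 * pi * r' * (t - u2) = 2 * (pi * (r' * (t - u2))) by ring.
    rewrite eq2 stpE; case: ltP => tu; case: (sgrP r') => r0.
    + by rewrite subr0 normr1 r0 mul0r !mulr0 expR0; lra.
    + by rewrite subrr normr0.
    + rewrite opprK (ger0_norm) ?addr_ge0//; apply: ex.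
      by rewrite mulr_ge0// mulr_ge0// nmulr_rge0//; lra.
    + by rewrite subr0 normrN1 r0 mul0r !mulr0 expR0; lra.
    + rewrite (_ : -1 - 1 = - 2) ?normrN ?ger0_norm//; last by ring.
      by apply: ex; rewrite mulr_ge0// mulr_ge0// pmulr_rge0//; lra.
    + by rewrite opprK addNr normr0.
  have b2 : `|E1 (c - alpha * t) - Num.sg r| <= 2 * expR (pi * r ^+ 2 - 2 * pi * r * (c - alpha * t)).
    by rewrite distrC E1_tail.
  rewrite normrM (le_trans (ler_pM (normr_ge0 _) (normr_ge0 _) b1 b2))//.
  rewrite mulrACA -expRD /K -[leRHS]mulrA -expRD.
  rewrite (_ : 2 * 2 = 4 :> R); last by ring.
  by rewrite ler_wpM2l// ler_expR le_eqVlt; apply/orP; left; apply/eqP; ring.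
Qed.

(** Gives the continuity that identifies the limit defining [E2]. *)
Lemma N2_lip alpha u1 u2 v1 v2 :
  `|N2 alpha v1 v2 - N2 alpha u1 u2| <=
  2 * `|v2 - u2| + 2 * `|v1 + alpha * v2 - (u1 + alpha * u2)|.
Proof.
pose J c u := \int[mu]_(t in setT) (stp (u - t) * E1 (c - alpha * t) * gam t).
(* As [|E1| <= 1] and [stp] is nondecreasing, the change is at most [E1 u' - E1 u]. *)
have J1 c u u' : u <= u' -> `|J c u' - J c u| <= 2 * (u' - u).
  move=> uu; rewrite -RintegralB//; [|exact: integrable_N2|exact: integrable_N2].
  have i := integrableB measurableT (integrable_N2 alpha c u') (integrable_N2 alpha c u).
  have i' : ri (fun t => stp (u' - t) * E1 (c - alpha * t) * gam t - stp (u - t) * E1 (c - alpha * t) * gam t).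
    by apply: eq_integrable i => // t _ /=; rewrite EFinB.
  rewrite (le_trans (le_normr_Rintegral _ i'))//.
  have iu := ri_stp_gam u; have iu' := ri_stp_gam u'.
  have j : ri (fun t => stp (u' - t) * gam t - stp (u - t) * gam t).
    by have := integrableB measurableT iu' iu; apply: eq_integrable => // t _ /=; rewrite EFinB.
  rewrite (@le_trans _ _ (E1 u' - E1 u))//; last first.
    by rewrite (le_trans (ler_norm _))// (le_trans (E1_lip u u'))// ger0_norm ?subr_ge0.
  rewrite (E1_int u') (E1_int u) -RintegralB//; apply: le_Rintegral => //.
    exact: integrable_norm i'.
  move=> t _; rewrite -!mulrBl (normrM _ (gam t)) (normrM _ (E1 _)) (ger0_norm (gam_ge0 _)) ler_wpM2r ?gam_ge0//.
  have mo : stp (u - t) <= stp (u' - t).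
    by rewrite !stpE !subr_gt0; case: (ltP t u) => h1; case: (ltP t u') => h2; lra.
  by rewrite ger0_norm ?subr_ge0// ler_piMr ?subr_ge0// E1_le1.
have J2 c c' u : `|J c' u - J c u| <= 2 * `|c' - c|.
  rewrite -RintegralB//; [|exact: integrable_N2|exact: integrable_N2].
  have i := integrableB measurableT (integrable_N2 alpha c' u) (integrable_N2 alpha c u).
  have i' : ri (fun t => stp (u - t) * E1 (c' - alpha * t) * gam t - stp (u - t) * E1 (c - alpha * t) * gam t).
    by apply: eq_integrable i => // t _ /=; rewrite EFinB.
  rewrite (le_trans (le_normr_Rintegral _ i'))//.
  rewrite -[leRHS]mulr1 -[X in _ <= _ * X]Rintegral_gam -RintegralZl//; last exact: integrable_gam.
  apply: le_Rintegral => //.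
  - exact: integrable_norm i'.
  - exact: (integrableZl measurableT (2 * `|c' - c|) (@integrable_gam R)).
  - move=> t _; rewrite -!mulrBl -mulrBr (normrM _ (gam t)) (normrM (stp _)) stp_norm mul1r (ger0_norm (gam_ge0 _)).
    rewrite ler_wpM2r ?gam_ge0// (le_trans (E1_lip _ _))//.
    by rewrite (_ : c' - _ - (c - _) = c' - c)//; ring.
have J1' c u u' : `|J c u' - J c u| <= 2 * `|u' - u|.
  have [h|h] := leP u u'; first by rewrite [X in _ * X]ger0_norm ?subr_ge0 ?J1.
  by rewrite distrC [X in _ * X]distrC [X in _ * X]ger0_norm ?J1 ?subr_ge0 // ltW.
have -> : N2 alpha v1 v2 - N2 alpha u1 u2 = (J (v1 + alpha * v2) v2 - J (v1 + alpha * v2) u2)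
    + (J (v1 + alpha * v2) u2 - J (u1 + alpha * u2) u2) by rewrite addrA subrK.
apply: le_trans (ler_normD _ _) _; apply: lerD; [exact: J1'|exact: J2].
Qed.

Lemma cmeasV d (T : measurableType d) (f : T -> C) : cmeas f -> (forall z, f z != 0) ->
  cmeas (fun z => (f z)^-1).
Proof.
move=> [m1 m2] f0; pose q z := cRe (f z) ^+ 2 + cIm (f z) ^+ 2.
have q0 z : 0 < q z.
  have := f0 z; rewrite /q; case: (f z) => x y /= xy.
  rewrite lt_neqAle addr_ge0 ?sqr_ge0// andbT eq_sym paddr_eq0 ?sqr_ge0// !sqrf_eq0.
  by apply: contra xy => /andP[/eqP -> /eqP ->].
(* The inverse of the squared modulus, written as a composition of measurable functions. *)
have mq : measurable_fun setT (fun z => expR (- ln (q z))).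
  apply: measurableT_comp => //; apply: measurable_funN; apply: measurableT_comp => //.
  by apply: measurable_funD; exact: measurable_funX.
have E z : cRe (f z) * expR (- ln (q z)) = cRe (f z)^-1 /\ - cIm (f z) * expR (- ln (q z)) = cIm (f z)^-1.
  by rewrite expRN lnK ?posrE// /q; case: (f z) => x y /=; rewrite mulNr.
split.
  rewrite (_ : (fun _ => _) = (fun z => cRe (f z) * expR (- ln (q z)))).
    exact: measurable_funM.
  by apply/funext => z; case: (E z).
rewrite (_ : (fun _ => _) = (fun z => - cIm (f z) * expR (- ln (q z)))).
  by apply: measurable_funM => //; exact: measurable_funN.
by apply/funext => z; case: (E z).
Qed.

(** An integrable majorant of [exp (- b |t|)], made of exponential densities on the two half
    lines. *)
Definition lap (b : R) (t : RM) : R :=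
  (exponential_pdf b t + exponential_pdf b (- t)) / b.

Lemma integrable_lap b : 0 < b -> ri (lap b).
Proof.
move=> b0; have i1 := integrable_exponential_pdf b0.
have n1 : (-1 : R) != 0 by rewrite oppr_eq0 oner_eq0.
have i2 := integrable_affine 0 n1 i1.
have := integrableZr measurableT b^-1 (integrableD measurableT i1 i2).
apply: eq_integrable => // t _ /=; rewrite -EFinD -EFinM /lap.
by rewrite mulN1r addr0.
Qed.

Lemma lap_ge b t : 0 < b -> expR (- b * `|t|) <= lap b t.
Proof.
move=> b0.
have P0 x : 0 <= exponential_pdf b x by apply: exponential_pdf_ge0; exact: ltW.
have PE x : 0 <= x -> exponential_pdf b x = b * expR (- b * x).
  by move=> x0; rewrite /exponential_pdf patchE ifT// mem_setE in_itv/= andbT.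
rewrite /lap ler_pdivlMr// mulrC.
have [t0|t0] := leP 0 t.
  by rewrite (ger0_norm t0) -(PE _ t0) lerDl.
have t1 : 0 <= - t by rewrite oppr_ge0 ltW.
by rewrite (ltr0_norm t0) -(PE _ t1) lerDr.
Qed.

(* (1 or -1) on the half line where [0 <= e * t], the representation of
   1 / (x - w) below being over the half line on the side of [Im w] *)
Definition half (e t : R) : R := (e - stp (- t)) / 2.

Lemma measurable_half e : measurable_fun setT (half e : RM -> R).
Proof.
apply: measurable_funM => //; apply: measurable_funB => //.
rewrite (_ : (fun _ => _) = (fun t : RM => stp (0 - t))); first exact: measurable_stp.
by apply/funext => t; rewrite sub0r.
Qed.

Lemma half_bound y (t : R) : y != 0 ->
  `|half (Num.sg y) t| * expR (- (2 * pi * t * y)) <= lap (2 * pi * `|y|) t.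
Proof.
move=> y0; have p0 := @pi_gt0 R.
have b0 : 0 < 2 * pi * `|y| by rewrite !mulr_gt0 ?normr_gt0.
apply: le_trans (lap_ge t b0).
have ex0 x z : `|0 : R| * expR x <= expR z by rewrite normr0 mul0r expR_ge0.
rewrite /half stpE oppr_gt0; case: (sgrP y) => [e|yp|yn]; first by rewrite e eqxx in y0.
- case: (ltP t 0) => t0; first by rewrite subrr mul0r ex0.
  rewrite opprK divff// normr1 mul1r ler_expR (ger0_norm t0).
  by rewrite le_eqVlt; apply/orP; left; apply/eqP; ring.
- case: (ltP t 0) => t0; last by rewrite opprK addNr mul0r ex0.
  rewrite (_ : (-1 - 1) / 2 = -1); last by field.
  rewrite normrN1 mul1r ler_expR (ltr0_norm t0).
  by rewrite le_eqVlt; apply/orP; left; apply/eqP; ring.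
Qed.

Section InverseLinear.
Variables (x p y : R).
Hypothesis y0 : y != 0.
Let w : C := p%:C + 'i * y%:C.
Let eta : C := - (2 * (pi : R)%:C * 'i * (x%:C - w)).

Lemma Re_lin : cRe eta = - (2 * pi * y).
Proof. by rewrite /eta /w !ReImE /=; ring. Qed.

Lemma lin_neq0 : x%:C - w != 0.
Proof.
apply: contra y0 => /eqP/(congr1 cIm); rewrite /w !ReImE /= => H.
by apply/eqP; move: H; lra.
Qed.

Lemma eta_neq0 : eta != 0.
Proof.
apply: contra y0 => /eqP/(congr1 cRe); rewrite Re_lin /= => /eqP.
by rewrite oppr_eq0 !mulf_eq0 pnatr_eq0 /= (gt_eqF (pi_gt0 R)).
Qed.

Lemma cn_lin_exp t : cn (cexp (eta * t%:C)) = expR (- (2 * pi * t * y)).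
Proof. by rewrite cn_cexp ReM Re_lin /= mulr0 subr0; congr expR; ring. Qed.

Lemma cn_half_exp t : cn ((half (Num.sg y) t)%:C * cexp (eta * t%:C)) <= lap (2 * pi * `|y|) t.
Proof. by rewrite cnM cn_real cn_lin_exp half_bound. Qed.

Lemma cmeas_half_exp : cmeas (fun t : RM => (half (Num.sg y) t)%:C * cexp (eta * (t : R)%:C)).
Proof.
apply: cmeasM; first by apply: cmeas_real; exact: measurable_half.
apply: cmeas_cexp; apply: cmeasM; [exact: cmeas_cst|exact: cmeas_x].
Qed.

Lemma lap_rate_gt0 : 0 < 2 * pi * `|y|.
Proof. by rewrite !mulr_gt0 ?normr_gt0// pi_gt0. Qed.

(** Laplace integral over the half line on which [exp (eta t)] decays: the limit of integrals over
    [[0, n + 1]] or [[- n - 1, 0]], computed from the primitive [exp (eta t) / eta], whose value at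
    the far end tends to 0. *)
Lemma inv_lin_laplace :
  (x%:C - w)^-1 = 2 * (pi : R)%:C * 'i *
    cint mu (fun t : RM => (half (Num.sg y) t)%:C * cexp (eta * (t : R)%:C)).
Proof.
suff E : cint mu (fun t : RM => (half (Num.sg y) t)%:C * cexp (eta * (t : R)%:C)) = - eta^-1.
  rewrite E /eta invrN opprK invfM mulrA divff ?mul1r//.
  by have := eta_neq0; rewrite /eta oppr_eq0 mulf_eq0 negb_or => /andP[].
pose a (n : nat) : R := if 0 < y then 0 else - n.+1%:R.
pose b (n : nat) : R := if 0 < y then n.+1%:R else 0.
have ab n : a n < b n by rewrite /a /b; case: ifP => _; rewrite ?ltr0n// oppr_lt0 ltr0n.
pose f (t : R) := cexp (eta * t%:C) / eta.
have df t : is_cd (fun t => cexp (eta * t%:C)) t (eta * cexp (eta * t%:C)).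
  apply: is_cd_eq (is_cd_cexp (is_cdZ eta (is_cd_id t))) _.
  by rewrite mulr1.
have ff t : is_cd f t (cexp (eta * t%:C)).
  apply: is_cd_eq (is_cd_ext _ (is_cdZ eta^-1 (df t))) _ => [s|].
    by rewrite /f mulrC.
  by rewrite mulrA mulVf ?mul1r// eta_neq0.
have I n : cint mu (fun t : RM => (ico (a n) (b n) t)%:C * cexp (eta * (t : R)%:C)) = f (b n) - f (a n).
  exact: cint_ftc (ab n) ff df.
pose s : C := if 0 < y then 1 else -1.
have s1 : cn s = 1 by rewrite /s; case: ifP => _; rewrite ?cnN cn1.
have half_ico n t : cn (s * (ico (a n) (b n) t)%:C) <= `|half (Num.sg y) t|.
  rewrite cnM s1 mul1r cn_real ger0_norm ?ico_ge0// icoE /half stpE oppr_gt0 /a /b.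
  case: ltP => yy.
    rewrite gtr0_sg//; case: (ltP t 0) => t0; first by rewrite /= normr_ge0.
    by rewrite /= opprK divff// normr1; case: (_ < _); rewrite /= ?ler01.
  have yn : y < 0 by rewrite lt_neqAle y0.
  rewrite ltr0_sg//; case: (ltP t 0) => t0; last by rewrite andbF normr_ge0.
  by rewrite (_ : (-1 - 1) / 2 = -1) ?normrN1; [case: (_ && _)|field].
have ico_lim t : \forall n \near \oo, s * (ico (a n) (b n) t)%:C = (half (Num.sg y) t)%:C.
  exists (Num.truncn `|t|).+1 => // n /= tn.
  have tn' : `|t| < n.+1%:R.
    by rewrite (lt_le_trans (truncnS_gt _))// ler_nat (leq_trans tn).
  rewrite icoE /half stpE oppr_gt0 /a /b /s; move: tn'; rewrite ltr_norml => /andP[h1 h2].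
  case: ltP => yy.
    rewrite gtr0_sg// mul1r h2 andbT; congr (_%:C).
    by case: (ltP t 0) => t0; rewrite /=; [rewrite subrr mul0r|rewrite opprK divff].
  have yn : y < 0 by rewrite lt_neqAle y0.
  rewrite ltr0_sg// ltW// mulN1r -rmorphN; congr (_%:C).
  by case: (ltP t 0) => t0; rewrite /=; [field|rewrite opprK addNr mul0r oppr0].
have L e : 0 < e -> \forall n \near \oo,
   cn (cint mu (fun t : RM => s * (ico (a n) (b n) t)%:C * cexp (eta * (t : R)%:C)) -
     cint mu (fun t : RM => (half (Num.sg y) t)%:C * cexp (eta * (t : R)%:C))) <= e.
  apply: (@cint_dct _ RM R mu (fun n (t : RM) => s * (ico (a n) (b n) t)%:C * cexp (eta * (t : R)%:C))
    (fun t : RM => (half (Num.sg y) t)%:C * cexp (eta * (t : R)%:C)) (lap (2 * pi * `|y|))).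
  - move=> n; apply: cmeasM.
      apply: cmeasM; first exact: cmeas_cst.
      by apply: cmeas_real; exact: measurable_ico.
    apply: cmeas_cexp; apply: cmeasM; [exact: cmeas_cst|exact: cmeas_x].
  - exact: cmeas_half_exp.
  - by move=> t e1 e10; apply: filterS (ico_lim t) => n ->; rewrite subrr cn0 ltW.
  - exact: integrable_lap lap_rate_gt0.
  - move=> n t; apply: le_trans (cn_half_exp t).
    by rewrite [leLHS]cnM [leRHS]cnM ler_wpM2r ?cn_ge0// [leRHS]cn_real half_ico.
have fN e : 0 < e -> \forall n \near \oo, cn (s * (f (b n) - f (a n)) - - eta^-1) <= e.
  move=> e0.
  pose Q := (cn eta^-1 / e) / (2 * pi * `|y|).
  exists (Num.truncn Q).+1 => // n /= Qn.
  have Qn' : Q < n.+1%:R by rewrite (lt_le_trans (truncnS_gt _))// ler_nat (leq_trans Qn).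
  have f0 : f 0 = eta^-1 by rewrite /f mulr0 cexp0 mul1r.
  have -> : s * (f (b n) - f (a n)) - - eta^-1 = f (if 0 < y then n.+1%:R else - n.+1%:R).
    rewrite /s /a /b; case: ifP => _; rewrite f0; ring.
  rewrite /f cnM cn_lin_exp.
  have -> : expR (- (2 * pi * (if 0 < y then n.+1%:R else - n.+1%:R) * y)) = expR (- (2 * pi * `|y| * n.+1%:R)).
    congr expR; congr (- _); case: ltP => yy; first by rewrite gtr0_norm//; ring.
    by rewrite ler0_norm//; ring.
  have K0 : 0 < 2 * pi * `|y| * n.+1%:R by rewrite mulr_gt0 ?lap_rate_gt0// ltr0n.
  have K1 : cn eta^-1 / e <= 2 * pi * `|y| * n.+1%:R.
    by move: Qn'; rewrite /Q ltr_pdivrMr ?lap_rate_gt0// [X in _ < X]mulrC => /ltW.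
  rewrite expRN mulrC ler_pdivrMr ?expR_gt0// mulrC -ler_pdivrMr//.
  by rewrite (le_trans K1)// (le_trans _ (expR_ge1Dx _))// lerDr.
apply/eqP; rewrite -subr_eq0 -cn_eq0; apply/eqP/le_anti; rewrite cn_ge0 andbT.
apply/ler_addgt0Pr => e e0; rewrite add0r.
have e20 : 0 < e / 2 by rewrite divr_gt0.
have [n [h1 h2]] : exists n, cn (cint mu (fun t : RM => s * (ico (a n) (b n) t)%:C * cexp (eta * (t : R)%:C)) -
     cint mu (fun t : RM => (half (Num.sg y) t)%:C * cexp (eta * (t : R)%:C))) <= e / 2 /\
     cn (s * (f (b n) - f (a n)) - - eta^-1) <= e / 2.
  have [n1 _ H1] := L _ e20; have [n2 _ H2] := fN _ e20.
  by exists (maxn n1 n2); split; [apply: H1|apply: H2]; rewrite /= ?leq_maxl ?leq_maxr.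
have J : cint mu (fun t : RM => s * (ico (a n) (b n) t)%:C * cexp (eta * (t : R)%:C)) = s * (f (b n) - f (a n)).
  rewrite -I -cintZ.
    by apply: eq_cint => t; rewrite mulrA.
  apply: (cinteg_ico (M := expR (2 * pi * `|y| * n.+1%:R))).
    apply: cmeas_cexp; apply: cmeasM; [exact: cmeas_cst|exact: cmeas_x].
  move=> t tab; rewrite cn_lin_exp ler_expR (le_trans (ler_norm _))// normrN !normrM.
  have tn : `|t| <= n.+1%:R.
    move: tab; rewrite /a /b; case: ifP => _ /andP[h3 h4]; rewrite ler_norml; apply/andP; split; lra.
  rewrite (ger0_norm (ler0n R 2)) (ger0_norm (pi_ge0 R)) -!mulrA ler_wpM2l//.
  by rewrite ler_wpM2l ?pi_ge0// mulrC ler_wpM2l.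
rewrite J in h1.
move: (cint _ _) (s * _) h1 h2 => A B h1 h2.
rewrite (_ : A - - eta^-1 = - (B - A) + (B - - eta^-1)); last by ring.
by rewrite (le_trans (cnD _ _))// cnN (splitr e) lerD.
Qed.
End InverseLinear.

Lemma cgauss_real (x p y : R) : cgauss p%:C y%:C x = (expR (- pi * p * x ^+ 2))%:C * e2pi (y * x)%:C.
Proof.
rewrite /cgauss cexpD; congr (_ * _).
  by rewrite -cexpR; congr cexp; rewrite rmorphM /= rmorphM /= rmorphN rmorphXn.
by rewrite /e2pi; congr cexp; rewrite rmorphM /= !mulrA.
Qed.

Lemma cint_gam_e2pi (x : R) :
  cint mu (fun t : RM => (gam t)%:C * e2pi (x * t)%:C) = (gam x)%:C.
Proof.
have E (z t : R) : cgauss 1 z%:C t = (gam t)%:C * e2pi (z * t)%:C.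
  by rewrite (_ : (1 : C) = 1%:C)// cgauss_real mulr1.
have p1 : 0 < cRe (1 : C) by rewrite /= ltr01.
transitivity (cint mu (cgauss 1 x%:C : RM -> C)); first by apply: eq_cint => t; rewrite E.
rewrite (cgauss_fourier p1 x%:C).
have -> : cint mu (cgauss 1 0 : RM -> C) = 1.
  transitivity (cint mu (fun t : RM => (gam t)%:C)).
    by apply: eq_cint => t; rewrite -[0 : C]/(0%:C) E mul0r e2pi0 mulr1.
  by rewrite cint_real Rintegral_gam.
by rewrite mul1r divr1 -rmorphXn -rmorphM -rmorphN /= cexpR /gam mulNr.
Qed.

Lemma lin_exp (x p y t : R) :
  cexp (- (2 * (pi : R)%:C * 'i * (x%:C - (p%:C + 'i * y%:C))) * t%:C) =
  e2pi (- (t * x))%:C * e2pi (t * p)%:C * (expR (- (2 * pi * t * y)))%:C.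
Proof.
rewrite /e2pi -cexpR -!cexpD; congr cexp.
rewrite !rmorphN /= !rmorphM /= (_ : 2%:C = 2 :> C); last exact: rmorph_nat.
have i2 : 'i * 'i = -1 :> C by rewrite -expr2 sqr_i.
by move: (pi%:C) (x%:C) (p%:C) (y%:C) (t%:C) => P X P' Y T; ring: i2.
Qed.

Lemma cmeas_inv_lin (p y : R) : y != 0 ->
  cmeas (fun x : RM => (x%:C - (p%:C + 'i * y%:C))^-1).
Proof.
move=> y0; apply: cmeasV => [|x]; last exact: lin_neq0.
by apply: cmeasD; [exact: cmeas_x|exact: cmeas_cst].
Qed.

Lemma cn_inv_lin (x p y : R) : y != 0 -> cn ((x%:C - (p%:C + 'i * y%:C))^-1) <= `|y|^-1.
Proof.
move=> y0; rewrite cnV lef_pV2 ?posrE ?normr_gt0//; last first.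
  by rewrite cn_gt0 lin_neq0.
apply: le_trans (Im_le_cn _); rewrite !ReImE /=.
by rewrite (_ : 0 - (0 + (0 * 0 + 1 * y)) = - y) ?normrN//; ring.
Qed.

(** The pole becomes a Laplace integral in [t]; after Fubini the integral over [x] is the Fourier
    transform of [gam] at [xi - t]. *)
Lemma gauss_inv_lin (xi p y : R) : y != 0 ->
  cint mu (fun x : RM => (gam x)%:C * e2pi (xi * x)%:C / (x%:C - (p%:C + 'i * y%:C))) =
  2 * (pi : R)%:C * 'i * cint mu (fun t : RM => (half (Num.sg y) t * expR (- (2 * pi * t * y)) * gam (xi - t))%:C
     * e2pi (t * p)%:C).
Proof.
move=> y0.
pose F (x t : RM) : C := (gam x)%:C * e2pi (xi * x)%:C *
   ((half (Num.sg y) t)%:C * cexp (- (2 * (pi : R)%:C * 'i * ((x:R)%:C - (p%:C + 'i * y%:C))) * (t : R)%:C)).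
have lg0 : 0 < 2 * pi * `|y| by exact: lap_rate_gt0.
have ie (z : R) : cn (e2pi z%:C) = 1 by exact: cn_e2pi_real.
have GE x : (gam x)%:C * e2pi (xi * x)%:C / (x%:C - (p%:C + 'i * y%:C)) =
    2 * (pi : R)%:C * 'i * cint mu (fun t : RM => F x t).
  rewrite (inv_lin_laplace x p y0) /F cintZ.
    by rewrite mulrCA.
  apply: cinteg_le (cmeas_half_exp x p y) (cn_half_exp x p y0) (integrable_lap lg0).
transitivity (cint mu (fun x : RM => 2 * (pi : R)%:C * 'i * cint mu (fun t : RM => F x t))).
  by apply: eq_cint => x; exact: GE.
have FE x t : F x t = ((half (Num.sg y) t * expR (- (2 * pi * t * y)))%:C * e2pi (t * p)%:C) *
    ((gam x)%:C * e2pi ((xi - t) * x)%:C).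
  rewrite /F lin_exp mulrBl rmorphB /= e2piB rmorphN /= e2piN.
  rewrite (_ : (half (Num.sg y) t * expR (- (2 * pi * t * y)))%:C =
     (half (Num.sg y) t)%:C * (expR (- (2 * pi * t * y)))%:C); last exact: rmorphM.
  by move: (e2pi (xi * x)%:C) (e2pi _)^-1 (e2pi _) (gam x)%:C => a b c g; ring.
have mg : cmeas (fun x : RM => (gam x)%:C).
  by apply: cmeas_real; exact: measurable_gam.
have sg : cmeas (fun p : RM * RM => F p.1 p.2).
  apply: cmeasM; first apply: cmeasM.
  - apply: cmeas_real; apply: measurableT_comp; [exact: measurable_gam|exact: measurable_fst].
  - apply: cmeas_cexp; apply: cmeasM; first exact: cmeas_cst.
    apply: cmeas_real; apply: measurable_funM => //; exact: measurable_fst.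
  - apply: cmeasM.
      apply: cmeas_real; apply: measurableT_comp; [exact: measurable_half|exact: measurable_snd].
    apply: cmeas_cexp; apply: cmeasM; last by apply: cmeas_real; exact: measurable_snd.
    apply: cmeasN; apply: cmeasM; first exact: cmeas_cst.
    apply: cmeasD; last exact: cmeas_cst.
    by apply: cmeas_real; exact: measurable_fst.
have me2 (m n : R) : cmeas (fun x : RM => e2pi (m * x + n)%:C).
  apply: cmeas_cexp; apply: cmeasM; first exact: cmeas_cst.
  by apply: cmeas_real; exact: measurable_affine.
have Fb x t : cn (F x t) <= gam x * lap (2 * pi * `|y|) t.
  rewrite /F cnM ler_pM ?cn_ge0 ?cn_half_exp//.
  by rewrite cnM ie mulr1 cn_real ger0_norm ?gam_ge0.
have pi0 : 2 * (pi : R)%:C * 'i != 0 :> C.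
  rewrite -cn_eq0 !cnM cn_i cn_real mulr1 mulf_neq0 ?normr_eq0 ?gt_eqF ?pi_gt0//.
  by rewrite cn_gt0 pnatr_eq0.
rewrite cintZ; last first.
  pose G (x : RM) := (gam x)%:C * e2pi (xi * x)%:C / (x%:C - (p%:C + 'i * y%:C)).
  have iG : cinteg mu G.
    apply: (@cinteg_le _ RM _ _ _ (fun x => `|y|^-1 * gam x)) => [|x|].
    - apply: cmeasM; last exact: cmeas_inv_lin.
      by apply: cmeasM => //; apply: cmeas_ext (me2 xi 0) => x; rewrite addr0.
    - rewrite /G cnM [leRHS]mulrC ler_pM ?cn_ge0 ?cn_inv_lin//.
      by rewrite cnM ie mulr1 cn_real ger0_norm ?gam_ge0.
    - exact: (integrableZl measurableT _ (@integrable_gam R)).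
  apply: cinteg_ext (cintegZ (2 * (pi : R)%:C * 'i)^-1 iG) => x.
  by apply: (mulfI pi0); rewrite mulVKf//; exact: GE.
congr (_ * _); rewrite (cint_fubini (g := @gam R) (h := lap (2 * pi * `|y|)))//.
- apply: eq_cint => t.
  transitivity (cint mu (fun x : RM => ((half (Num.sg y) t * expR (- (2 * pi * t * y)))%:C * e2pi (t * p)%:C) *
    ((gam x)%:C * e2pi ((xi - t) * x)%:C))); first by apply: eq_cint => x; rewrite FE.
  rewrite cintZ ?cint_gam_e2pi; first by rewrite rmorphM /=; ring.
  apply: (@cinteg_le _ RM _ _ _ (@gam R)) => [|x|]; last exact: integrable_gam.
    apply: cmeasM => //; apply: cmeas_ext (me2 (xi - t) 0) => x; by rewrite addr0.
  by rewrite cnM ie mulr1 cn_real ger0_norm ?gam_ge0.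
- exact: integrable_gam.
- exact: integrable_lap.
Qed.

Lemma half_int e (c : R) : \int[mu]_(t in setT) (half e t * gam (t + c)) = (e - E1 c) / 2.
Proof.
have n1 : (1 : R) != 0 by exact: oner_neq0.
have j1 := ri_stp_gam c; have j2 := @integrable_gam R.
have j2' : ri (fun t => e * gam t) by exact: (integrableZl measurableT e j2).
have j3 : ri (fun t => e * gam t - stp (c - t) * gam t).
  by have := integrableB measurableT j2' j1; apply: eq_integrable => // t _ /=; rewrite EFinB.
have j4 : ri (fun t => (e * gam t - stp (c - t) * gam t) / 2).
  by have := integrableZr measurableT 2^-1 j3; apply: eq_integrable => // t _ /=; rewrite EFinM.
have <- : \int[mu]_(t in setT) ((e * gam t - stp (c - t) * gam t) / 2) = (e - E1 c) / 2.
  by rewrite RintegralZr// RintegralB// RintegralZl// Rintegral_gam mulr1 -E1_int.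
have := Rintegral_affine c n1 j4; rewrite normr1 invr1 mul1r => <-.
apply: eq_Rintegral => t _; rewrite mul1r /half.
by rewrite (_ : c - (t + c) = - t); ring.
Qed.

Lemma integrable_half_gam e (c : R) : `|e| <= 1 -> ri (fun t => half e t * gam (t + c)).
Proof.
move=> e1; have n1 : (1 : R) != 0 by exact: oner_neq0.
have ig := integrable_affine c n1 (@integrable_gam R).
have mg : measurable_fun setT (fun t : RM => gam (1 * t + c)).
  by have /integrableP[/measurable_EFinP] := ig.
apply: ri_le ig.
  apply: measurable_funM; first exact: measurable_half.
  rewrite (_ : (fun t => _) = (fun t : RM => gam (1 * t + c)))//.
  by apply/funext => t; rewrite mul1r.
move=> t; rewrite mul1r normrM (ger0_norm (gam_ge0 _)) ler_piMl ?gam_ge0//.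
rewrite /half normrM normfV (ger0_norm (ler0n R 2)) ler_pdivrMr// mul1r.
by rewrite (le_trans (ler_normB _ _))// stp_norm; lra.
Qed.

(** The prefactor completes the square: [gam v * exp (- 2 pi t v) * gam (x - t)] is a multiple of
    [gam (t + v - x)]. *)
Lemma half_gauss e (v x : R) : `|e| <= 1 ->
  gam v * \int[mu]_(t in setT) (half e t * expR (- (2 * pi * t * v)) * gam (x - t)) =
  expR (- (2 * pi * v * x)) * ((e - E1 (v - x)) / 2).
Proof.
move=> e1; rewrite -half_int.
have g0 : gam v != 0 :> R by rewrite gt_eqF ?gam_gt0.
have E t : gam v * (half e t * expR (- (2 * pi * t * v)) * gam (x - t)) =
    expR (- (2 * pi * v * x)) * (half e t * gam (t + (v - x))).
  transitivity (half e t * (gam v * expR (- (2 * pi * t * v)) * gam (x - t))); first by ring.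
  rewrite [RHS]mulrCA; congr (_ * _); rewrite /gam -!expRD; congr expR; ring.
transitivity (gam v * \int[mu]_(t in setT) ((gam v)^-1 * expR (- (2 * pi * v * x)) * (half e t * gam (t + (v - x))))).
  congr (_ * _); apply: eq_Rintegral => t _.
  by apply: (mulfI g0); rewrite E -[in RHS]mulrA mulVKf.
rewrite RintegralZl; [|by []|exact: integrable_half_gam].
by rewrite !mulrA mulfV// mul1r.
Qed.

Lemma neg_pi2_2pii_sqr :
  - ((pi : R) ^- 2)%:C * (2 * (pi : R)%:C * 'i * (2 * (pi : R)%:C * 'i)) = 4 :> C.
Proof.
have PV : ((pi : R) ^- 2)%:C = ((pi : R)%:C ^+ 2)^-1 :> C by rewrite fmorphV rmorphXn.
have P0 : (pi : R)%:C != 0 :> C by rewrite -cn_eq0 cn_real normr_eq0 gt_eqF ?pi_gt0.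
rewrite PV; move: ((pi : R)%:C) P0 => P P0.
have i2 : 'i * 'i = -1 :> C by rewrite -expr2 sqr_i.
transitivity (- (4 * ('i * 'i)) : C); last by rewrite i2; ring.
by field.
Qed.

Lemma line_integralE y (f : C -> C) : line_integral y f = cint mu (fun x : RM => f ((x : R) +i* (- y))).
Proof. by []. Qed.

(** On the line [R - i u] the exponent [- pi z^2 - 2 pi i u z] is real, equal to
    [- pi x^2 - pi u^2]: the contours of [M2] pass through the saddle points. *)
Lemma M2_exponent (x1 x2 u1 u2 : R) (z1 := x1 +i* (- u1)) (z2 := x2 +i* (- u2)) :
  cexp (- (pi : R)%:C * z1 ^+ 2 - (pi : R)%:C * z2 ^+ 2
          - 2 * (pi : R)%:C * 'i * (u1%:C * z1 + u2%:C * z2)) =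
  (gam u1 * gam u2)%:C * ((gam x1)%:C * (gam x2)%:C).
Proof.
rewrite !rmorphM /= -!cexpR -!cexpD; congr cexp.
have H (x y : R) (z := x +i* (- y)) :
    - (pi : R)%:C * z ^+ 2 - 2 * (pi : R)%:C * 'i * (y%:C * z) = (- pi * y ^+ 2)%:C + (- pi * x ^+ 2)%:C.
  by apply: ceqP; rewrite /z !expr2 !ReImE /=; ring.
have H1 := H x1 u1; have H2 := H x2 u2; rewrite -/z1 -/z2 in H1 H2.
transitivity ((- (pi : R)%:C * z1 ^+ 2 - 2 * (pi : R)%:C * 'i * (u1%:C * z1))
  + (- (pi : R)%:C * z2 ^+ 2 - 2 * (pi : R)%:C * 'i * (u2%:C * z2))); first by ring.
by rewrite H1 H2 addrACA.
Qed.

(** The pole in [z2] is turned into a Laplace integral by [gauss_inv_lin], then, after exchanging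
    the integrals, the pole in [z1]. The constant [- pi^-2 (2 pi i)^2 = 4] clears two factors [1/2],
    and [t] is finally shifted by [u2]. *)
Lemma M2E alpha u1 u2 : u1 != 0 -> u2 - alpha * u1 != 0 ->
  M2 alpha u1 u2 = (\int[mu]_(t in setT) ((Num.sg (u2 - alpha * u1) - stp (u2 - t)) *
     (Num.sg u1 - E1 (u1 + alpha * u2 - alpha * t)) * gam t))%:C.
Proof.
move=> u10 y0; set y := u2 - alpha * u1 in y0 *.
pose K : C := 2 * (pi : R)%:C * 'i.
have ie (z : R) : cn (e2pi z%:C) = 1 by exact: cn_e2pi_real.
have zlin (x v : R) : x +i* (- v) = x%:C - (0%:C + 'i * v%:C).
  by apply: ceqP; rewrite !ReImE /=; ring.
have inner (x1 : R) : line_integral u2 (fun z2 =>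
    cexp (- (pi : R)%:C * (x1 +i* (- u1)) ^+ 2 - (pi : R)%:C * z2 ^+ 2
          - 2 * (pi : R)%:C * 'i * (u1%:C * (x1 +i* (- u1)) + u2%:C * z2))
    / ((x1 +i* (- u1)) * (z2 - alpha%:C * (x1 +i* (- u1))))) =
   (gam u1 * gam u2)%:C * ((gam x1)%:C / (x1%:C - (0%:C + 'i * u1%:C)) * (K *
     cint mu (fun t : RM => (half (Num.sg y) t * expR (- (2 * pi * t * y)) * gam (0 - t))%:C
     * e2pi (t * (alpha * x1))%:C))).
  rewrite -(gauss_inv_lin 0 (alpha * x1) y0).
  pose Q := (gam u1 * gam u2)%:C * ((gam x1)%:C / (x1%:C - (0%:C + 'i * u1%:C))).
  pose G (x2 : RM) := (gam x2)%:C * e2pi (0 * x2)%:C / (x2%:C - ((alpha * x1)%:C + 'i * y%:C)).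
  have iG : cinteg mu G.
    apply: (@cinteg_le _ RM _ _ _ (fun x => `|y|^-1 * gam x)) => [|x|].
    - apply: cmeasM; last exact: cmeas_inv_lin.
      apply: cmeasM; first by apply: cmeas_real; exact: measurable_gam.
      rewrite (_ : (fun x => _) = (fun=> 1 : C)); first exact: cmeas_cst.
      by apply/funext => x; rewrite mul0r e2pi0.
    - rewrite /G cnM [leRHS]mulrC ler_pM ?cn_ge0 ?cn_inv_lin//.
      by rewrite cnM ie mulr1 cn_real ger0_norm ?gam_ge0.
    - exact: (integrableZl measurableT _ (@integrable_gam R)).
  transitivity (Q * cint mu G); last by rewrite /Q !mulrA.
  rewrite -cintZ//; rewrite line_integralE; apply: eq_cint => x2.
  rewrite M2_exponent /Q /G mul0r e2pi0 mulr1.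
  rewrite (_ : x2 +i* - u2 - alpha%:C * (x1 +i* - u1) = x2%:C - ((alpha * x1)%:C + 'i * y%:C)); last first.
    by rewrite /y; apply: ceqP; rewrite !ReImE /=; ring.
  rewrite zlin invfM; ring.
pose H (t : R) := half (Num.sg y) t * expR (- (2 * pi * t * y)) * gam t.
pose c0 : C := (gam u1 * gam u2)%:C * K.
pose F (x t : RM) : C := c0 * ((gam x)%:C / (x%:C - (0%:C + 'i * u1%:C)) * ((H t)%:C * e2pi (t * (alpha * x))%:C)).
have lg0 : 0 < 2 * pi * `|y| by exact: lap_rate_gt0.
have Hb t : `|H t| <= lap (2 * pi * `|y|) t.
  apply: le_trans (half_bound t y0).
  rewrite /H (normrM _ (gam t)) (normrM (half _ _)) (ger0_norm (gam_ge0 _)) [X in _ * X * _]ger0_norm ?expR_ge0//.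
  by rewrite ler_piMr ?gam_le1// mulr_ge0 ?expR_ge0.
have mH : measurable_fun setT (H : RM -> R).
  apply: measurable_funM; last exact: measurable_gam.
  apply: measurable_funM; first exact: measurable_half.
  apply: measurableT_comp => //.
  rewrite (_ : (fun t => _) = (fun t : RM => - (2 * pi * y) * t + 0)); first exact: measurable_affine.
  by apply/funext => t; ring.
have mHx (x : R) : cmeas (fun t : RM => (H t)%:C * e2pi (t * (alpha * x))%:C).
  apply: cmeasM; first exact: cmeas_real.
  apply: cmeas_cexp; apply: cmeasM; first exact: cmeas_cst.
  apply: cmeas_real; exact: measurable_funM.
have iHx (x : R) : cinteg mu (fun t : RM => (H t)%:C * e2pi (t * (alpha * x))%:C).
  apply: (@cinteg_le _ RM _ _ _ (lap (2 * pi * `|y|))) => //; last exact: integrable_lap.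
  by move=> t; rewrite cnM ie mulr1 cn_real.
have Fb x t : cn (F x t) <= cn c0 * (`|u1|^-1 * gam x) * lap (2 * pi * `|y|) t.
  rewrite /F (cnM c0) -[leRHS]mulrA; apply: ler_wpM2l; first exact: cn_ge0.
  rewrite (cnM (_ / _)); apply: ler_pM; rewrite ?cn_ge0//.
    by rewrite (cnM (gam x)%:C) cn_real ger0_norm ?gam_ge0// mulrC ler_wpM2r ?gam_ge0// cn_inv_lin.
  by rewrite cnM ie mulr1 cn_real.
have sF : cmeas (fun p : RM * RM => F p.1 p.2).
  apply: cmeasM; first exact: cmeas_cst.
  apply: cmeasM; first apply: cmeasM.
  - apply: cmeas_real; apply: measurableT_comp; [exact: measurable_gam|exact: measurable_fst].
  - apply: cmeasV => [|q]; last exact: lin_neq0.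
    by apply: cmeasD; [apply: cmeas_real; exact: measurable_fst|exact: cmeas_cst].
  - apply: cmeasM.
      by apply: cmeas_real; apply: measurableT_comp; [exact: mH|exact: measurable_snd].
    apply: cmeas_cexp; apply: cmeasM; first exact: cmeas_cst.
    apply: cmeas_real; apply: measurable_funM; first exact: measurable_snd.
    by apply: measurable_funM => //; exact: measurable_fst.
have e1 (z : R) : `|Num.sg z| <= 1 by rewrite normr_sg; case: (_ == _).
pose B t := 2 * half (Num.sg y) t * gam (t + u2) * (Num.sg u1 - E1 (u1 - alpha * t)).
have FtE t : cint mu (fun x : RM => F x t) = (gam u2 * H t)%:C * K * K *
    (expR (- (2 * pi * u1 * (alpha * t))) * ((Num.sg u1 - E1 (u1 - alpha * t)) / 2))%:C.
  pose G (x : RM) := (gam x)%:C * e2pi (alpha * t * x)%:C / (x%:C - (0%:C + 'i * u1%:C)).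
  have iG : cinteg mu G.
    apply: (@cinteg_le _ RM _ _ _ (fun x => `|u1|^-1 * gam x)) => [|x|].
    - apply: cmeasM; last exact: cmeas_inv_lin.
      apply: cmeasM; first by apply: cmeas_real; exact: measurable_gam.
      apply: cmeas_cexp; apply: cmeasM; first exact: cmeas_cst.
      by apply: cmeas_real; exact: measurable_funM.
    - rewrite /G cnM [leRHS]mulrC ler_pM ?cn_ge0 ?cn_inv_lin//.
      by rewrite cnM ie mulr1 cn_real ger0_norm ?gam_ge0.
    - exact: (integrableZl measurableT _ (@integrable_gam R)).
  transitivity (cint mu (fun x : RM => c0 * (H t)%:C * G x)).
    apply: eq_cint => x; rewrite /F /G (_ : t * (alpha * x) = alpha * t * x); last by ring.
    by move: (e2pi _) (_^-1) => a b; ring.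
  rewrite cintZ// /G (gauss_inv_lin (alpha * t) 0 u10) -(half_gauss u1 (alpha * t) (e1 u1)).
  have -> : cint mu (fun r : RM => (half (Num.sg u1) r * expR (- (2 * pi * r * u1)) * gam (alpha * t - r))%:C * e2pi (r * 0)%:C)
    = (\int[mu]_(r in setT) (half (Num.sg u1) r * expR (- (2 * pi * r * u1)) * gam (alpha * t - r)))%:C.
    by rewrite -cint_real; apply: eq_cint => r; rewrite mulr0 e2pi0 mulr1.
  rewrite /c0 -/K; move: (Rintegral _ _ _) => I.
  by rewrite !rmorphM /=; move: (K) => k; ring.
have p2 : - ((pi : R) ^- 2)%:C * (K * K) = 4 by exact: neg_pi2_2pii_sqr.
have BE t : - ((pi : R) ^- 2)%:C * cint mu (fun x : RM => F x t) = (B t)%:C.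
  rewrite FtE (_ : - (pi ^- 2)%:C * _ = - (pi ^- 2)%:C * (K * K) * (gam u2 * H t *
    (expR (- (2 * pi * u1 * (alpha * t))) * ((Num.sg u1 - E1 (u1 - alpha * t)) / 2)))%:C); last first.
    by rewrite !rmorphM /=; move: (K) => k; ring.
  rewrite p2 -[4 : C](rmorph_nat (real_complex R)) /= -rmorphM /=; congr (_%:C).
  have EX : gam (t + u2) = gam u2 * gam t * expR (- (2 * pi * t * y)) * expR (- (2 * pi * u1 * (alpha * t))).
    by rewrite /gam -!expRD; congr expR; rewrite /y; ring.
  by rewrite /B EX /H; field.
have inner2 (x : RM) : line_integral u2 (fun z2 =>
    cexp (- (pi : R)%:C * ((x : R) +i* (- u1)) ^+ 2 - (pi : R)%:C * z2 ^+ 2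
          - 2 * (pi : R)%:C * 'i * (u1%:C * ((x : R) +i* (- u1)) + u2%:C * z2))
    / (((x : R) +i* (- u1)) * (z2 - alpha%:C * ((x : R) +i* (- u1))))) = cint mu (fun t : RM => F x t).
  transitivity (c0 * ((gam x)%:C / (x%:C - (0%:C + 'i * u1%:C))) *
      cint mu (fun t : RM => (H t)%:C * e2pi (t * (alpha * x))%:C)).
    rewrite inner /c0.
    have -> : cint mu (fun t : RM => (half (Num.sg y) t * expR (- (2 * pi * t * y)) * gam (0 - t))%:C
       * e2pi (t * (alpha * x))%:C) = cint mu (fun t : RM => (H t)%:C * e2pi (t * (alpha * x))%:C).
      by apply: eq_cint => t; rewrite /H sub0r gamN.
    by move: (cint _ _) (_^-1) => I w; ring.
  by rewrite -cintZ//; apply: eq_cint => t; rewrite -[LHS]mulrA.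
rewrite /M2.
transitivity (- ((pi : R) ^- 2)%:C * cint mu (fun x : RM => cint mu (fun t : RM => F x t))).
  have inner3 := eq_cint mu inner2.
  rewrite -inner3.
  rewrite -(line_integralE u1 (fun z1 => line_integral u2 (fun z2 =>
    cexp (- (pi : R)%:C * z1 ^+ 2 - (pi : R)%:C * z2 ^+ 2
          - 2 * (pi : R)%:C * 'i * (u1%:C * z1 + u2%:C * z2))
    / (z1 * (z2 - alpha%:C * z1))))).
  by [].
rewrite (cint_fubini (g := fun x => cn c0 * (`|u1|^-1 * gam x)) (h := lap (2 * pi * `|y|)))//; last 2 first.
- have := integrableZl measurableT (cn c0 * `|u1|^-1) (@integrable_gam R).
  by apply: eq_integrable => // x _ /=; rewrite -EFinM mulrA.
- exact: integrable_lap.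
pose T t := (Num.sg y - stp (u2 - t)) * (Num.sg u1 - E1 (u1 + alpha * u2 - alpha * t)) * gam t.
have iT : ri T.
  have i1 := integrable_N2 alpha (u1 + alpha * u2) u2.
  have i2 := integrable_E1_gam alpha (u1 + alpha * u2).
  have i3 := ri_stp_gam u2.
  have i4 := @integrable_gam R.
  have := integrableD measurableT (integrableB measurableT (integrableB measurableT i1
    (integrableZl measurableT (Num.sg y) i2)) (integrableZl measurableT (Num.sg u1) i3))
    (integrableZl measurableT (Num.sg u1 * Num.sg y) i4).
  apply: eq_integrable => // t _ /=; rewrite /T -!EFinM -!EFinB -EFinD.
  by congr (_%:E); ring.
have n1 : (1 : R) != 0 by exact: oner_neq0.
have TB t : T (1 * t + u2) = B t.
  rewrite /T /B /half mul1r.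
  rewrite (_ : u2 - (t + u2) = - t); last by ring.
  rewrite (_ : u1 + alpha * u2 - alpha * (t + u2) = u1 - alpha * t); last by ring.
  by field.
have kn0 : - ((pi : R) ^- 2)%:C != 0.
  by rewrite oppr_eq0 -cn_eq0 cn_real normr_eq0 invr_eq0 expf_neq0// gt_eqF ?pi_gt0.
transitivity (cint mu (fun t : RM => (B t)%:C)).
  rewrite -cintZ; first by apply: eq_cint => t; exact: BE.
  have iB : cinteg mu (fun t : RM => (B t)%:C).
    apply: cinteg_real; have := integrable_affine u2 n1 iT.
    by apply: eq_integrable => // t _ /=; rewrite TB.
  apply: cinteg_ext (cintegZ (- ((pi : R) ^- 2)%:C)^-1 iB) => t.
  by rewrite -BE mulKf.
rewrite cint_real; congr (_%:C).
have := Rintegral_affine u2 n1 iT; rewrite normr1 invr1 mul1r => <-.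
by apply: eq_Rintegral => t _; rewrite TB.
Qed.

Lemma sqrt1D alpha : 0 < Num.sqrt (1 + alpha ^+ 2) /\ Num.sqrt (1 + alpha ^+ 2) ^+ 2 = 1 + alpha ^+ 2 :> R.
Proof.
have p : 0 < 1 + alpha ^+ 2 by rewrite ltr_pwDl// sqr_ge0.
by rewrite sqrtr_gt0 p sqr_sqrtr// ltW.
Qed.

Lemma M1E x : M1 x = E1 x - Num.sg x.
Proof.
rewrite /M1 /Erfc -/(E1 `|x|); case: (sgrP x) => [->|x0|x0].
- by rewrite E10; ring.
- by ring.
- by rewrite E1N; ring.
Qed.

(** Once [M1 = E1 - sign] is inserted, the two sides differ by a product of two differences of
    signs, one of which vanishes. *)
Lemma E2_genericE alpha u1 u2 : 0 < alpha -> u1 != 0 -> u2 != alpha * u1 ->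
  E2_generic alpha u1 u2 = (N2 alpha u1 u2)%:C.
Proof.
move=> al0 u10; rewrite -subr_eq0 => y0.
have [a0 a2] := sqrt1D alpha; set a := Num.sqrt _ in a0 a2 *.
rewrite /E2_generic -/a M2E// -rmorphD /=; congr (_%:C).
set c := u1 + alpha * u2.
have i1 := integrable_N2 alpha c u2.
have i2 := integrable_E1_gam alpha c.
have i3 := ri_stp_gam u2.
have i4 := @integrable_gam R.
set e1 := Num.sg u1; set e2 := Num.sg (u2 - alpha * u1).
have j2 : ri (fun t => e2 * (E1 (c - alpha * t) * gam t)) by exact: (integrableZl measurableT e2 i2).
have j3 : ri (fun t => e1 * (stp (u2 - t) * gam t)) by exact: (integrableZl measurableT e1 i3).
have j4 : ri (fun t => e1 * e2 * gam t) by exact: (integrableZl measurableT (e1 * e2) i4).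
have k1 : ri (fun t => stp (u2 - t) * E1 (c - alpha * t) * gam t - e2 * (E1 (c - alpha * t) * gam t)).
  by have := integrableB measurableT i1 j2; apply: eq_integrable => // t _ /=; rewrite EFinB.
have k2 : ri (fun t => stp (u2 - t) * E1 (c - alpha * t) * gam t - e2 * (E1 (c - alpha * t) * gam t)
     - e1 * (stp (u2 - t) * gam t)).
  by have := integrableB measurableT k1 j3; apply: eq_integrable => // t _ /=; rewrite EFinB.
have -> : \int[mu]_(t in setT) ((e2 - stp (u2 - t)) * (e1 - E1 (c - alpha * t)) * gam t) =
    N2 alpha u1 u2 - e2 * E1 (c / a) - e1 * E1 u2 + e1 * e2.
  rewrite -(E1conv c a0 a2) (E1_int u2) -[X in _ + X]mulr1 -[X in _ + _ * X]Rintegral_gam /N2 -/c.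
  rewrite -!RintegralZl// -!RintegralB// -RintegralD//.
  by apply: eq_Rintegral => t _; ring.
rewrite !M1E (sgrM c) (@gtr0_sg _ a^-1) ?invr_gt0// mulr1.
(* If [c = u1 + alpha u2] does not have the sign of [u1], then [u2] has the opposite strict sign,
   and so has [u2 - alpha u1]; this uses [alpha > 0]. *)
have Z : (e1 - Num.sg c) * (e2 - Num.sg u2) = 0.
  apply/eqP; rewrite mulf_eq0 !subr_eq0 /e1 /e2 /c.
  case: (ltgtP u1 0) u10 => // u1s _.
  - rewrite (ltr0_sg u1s); case: (ltP c 0) => cs; first by rewrite ltr0_sg// eqxx.
    have u2p : 0 < u2 by move: cs; rewrite /c => cs; rewrite -(pmulr_rgt0 _ al0); lra.
    have y0' : 0 < u2 - alpha * u1 by rewrite subr_gt0 (le_lt_trans _ u2p)// pmulr_rle0// ltW.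
    by rewrite (gtr0_sg u2p) (gtr0_sg y0') eqxx orbT.
  - rewrite (gtr0_sg u1s); case: (ltP 0 c) => cs; first by rewrite gtr0_sg// eqxx.
    have u2n : u2 < 0 by move: cs; rewrite /c => cs; rewrite -(pmulr_rlt0 _ al0); lra.
    have y0' : u2 - alpha * u1 < 0 by rewrite subr_lt0 (lt_le_trans u2n)// pmulr_rge0// ltW.
    by rewrite (ltr0_sg u2n) (ltr0_sg y0') eqxx orbT.
move: Z; move: (N2 _ _ _) (E1 (c / a)) (E1 u2) (Num.sg u2) (Num.sg c) => n p q s1 s2 Z.
by apply/eqP; rewrite -subr_eq0 -Z; apply/eqP; ring.
Qed.

Lemma E2E alpha u1 u2 : 0 < alpha -> E2 alpha u1 u2 = (N2 alpha u1 u2)%:C.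
Proof.
move=> al0; rewrite /E2.
set A := [set p : R * R | _]; set F := within A _.
have PF : ProperFilter F.
  apply: within_nbhs_proper => B /nbhs_ballP[e /= e0 eB].
  suff [t [t0 te t1 t2]] : exists t, [/\ 0 < t, t < e, u1 + t != 0 & u1 + t != u2 / alpha].
    exists (u1 + t, u2); split.
      split => //=; apply: contra t2 => /eqP ->; apply/eqP; field; exact: lt0r_neq0.
    by apply: eB; split => /=; [rewrite /ball /= opprD addNKr normrN gtr0_norm|exact: ballxx].
  pose ok t := (u1 + t != 0) && (u1 + t != u2 / alpha).
  (* Two values of [t] are excluded, so one of three candidates is admissible. *)
  have [h|] := boolP (ok (e / 2)); first by case/andP: h => h1 h2; exists (e / 2); split => //; lra.
  have [h|] := boolP (ok (e / 3)); first by case/andP: h => h1 h2; exists (e / 3); split => //; lra.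
  have [h|] := boolP (ok (e / 4)); first by case/andP: h => h1 h2; exists (e / 4); split => //; lra.
  rewrite /ok !negb_and !negbK => /orP[/eqP a4|/eqP a4] /orP[/eqP a3|/eqP a3] /orP[/eqP a2|/eqP a2]; exfalso; lra.
apply: clim_eq => e e0.
(* Sum of the Lipschitz constants [2] and [2 + 2 alpha] of [N2] in its two arguments. *)
pose M := 4 + 2 * alpha.
have M0 : 0 < M by rewrite /M; lra.
have near_p : \forall p \near ((u1, u2) : R * R), `|p.1 - u1| < e / M /\ `|p.2 - u2| < e / M.
  apply/nbhs_ballP; exists (e / M) => /=; first by rewrite divr_gt0.
  by move=> p [h1 h2]; split; rewrite distrC.
apply: filterS near_p => p [h1 h2] [v10 v2n].
rewrite E2_genericE// -rmorphB cn_real (le_trans (N2_lip _ _ _ _ _))//.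
have h : `|p.1 + alpha * p.2 - (u1 + alpha * u2)| <= e / M + alpha * (e / M).
  rewrite (_ : _ - _ = (p.1 - u1) + alpha * (p.2 - u2)); last by ring.
  rewrite (le_trans (ler_normD _ _))// lerD ?(ltW h1)// normrM (gtr0_norm al0).
  by rewrite ler_wpM2l ?ltW.
have -> : e = 2 * (e / M) + 2 * (e / M + alpha * (e / M)).
  by rewrite /M; field; rewrite -/M gt_eqF.
by rewrite lerD// ler_wpM2l// ltW.
Qed.
End TwoVariableError.

(** * Completed cotangent series *)
Section Cotangent.
Variable R : realType.
Local Notation C := R[i].
Local Notation mu := (@lebesgue_measure R).
Local Notation RM := (measurableTypeR R).
Implicit Types (z w : C) (k l m n : int).

(** This is [i cot (pi z)]. *)
Definition cotz z : C := (1 + e2pi z) / (1 - e2pi z).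

Definition sgk k : R := Num.sg (k%:~R : R).

Lemma e2pi_neq1 z : (forall n, z + n%:~R != 0) -> e2pi z != 1.
Proof.
move=> zn; apply/negP => /eqP /e2pi_eq1[n zE].
by have := zn (- n); rewrite zE mulrNz subrr eqxx.
Qed.

(** Shifting [X] by one multiplies the series by [e(z)] except at the jumps of [sgk], which the
    cotangent term makes up for. The constant [A] is 1 in one variable; in two variables it is a
    one-variable expression in [z2]. *)
Lemma quasi_shift z (A : C) (X : int -> C) : e2pi z != 1 ->
  absum (fun k => (X k - (sgk k)%:C * A) * e2pi (k%:~R * z)) ->
  absum (fun k => (X (k - 1) - (sgk k)%:C * A) * e2pi (k%:~R * z)) /\
  cotz z * A + csum (fun k => (X (k - 1) - (sgk k)%:C * A) * e2pi (k%:~R * z)) =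
  e2pi z * (cotz z * A + csum (fun k => (X k - (sgk k)%:C * A) * e2pi (k%:~R * z))).
Proof.
move=> z1; set f := fun k => _; set g := fun k => _ => sf.
pose de k := ((sgk k)%:C - (sgk (k + 1))%:C) * A * e2pi ((k + 1)%:~R * z).
have bij : bijective (fun k : int => k + 1).
  by exists (fun k => k - 1) => k; [exact: addrK|exact: subrK].
have gE k : g (k + 1) = e2pi z * f k + de k.
  have H : e2pi ((k + 1)%:~R * z) = e2pi (k%:~R * z) * e2pi z.
    by rewrite intrD mulrDl mul1r e2piD.
  rewrite /g /f /de addrK H.
  by move: (e2pi z) (e2pi _) (X k) => a b c; ring.
(* [sgk k] and [sgk (k + 1)] differ only at [k = -1] and [k = 0]. *)
have [sd dE] : absum de /\ csum de = \sum_(k <- [:: -1; 0]) de k.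
  apply: csum_seq => // k; rewrite !inE negb_or => /andP[k1 k0].
  have H : sgk k = sgk (k + 1).
    rewrite /sgk; have [h|h] := leP 0 k.
      have h1 : 0 < k by rewrite lt_neqAle eq_sym k0.
      by rewrite !gtr0_sg// ltr0z// addr_gt0.
    have h1 : k + 1 < 0 by move: k1; lia.
    by rewrite !ltr0_sg// ltrz0.
  by rewrite /de H subrr !mul0r.
have sg1 : absum (fun k => g (k + 1)).
  by apply: absum_ext (absumD (absumZ (e2pi z) sf) sd) => k; rewrite gE.
have sg : absum g.
  have bij' : bijective (fun k : int => k - 1).
    by exists (fun k => k + 1) => k; [exact: subrK|exact: addrK].
  by apply: absum_ext (absum_reindex bij' sg1) => k; rewrite subrK.
split=> //.
rewrite -(csum_reindex g bij) (eq_csum gE) csumD//; last exact: absumZ.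
rewrite csumZ// dE !big_cons big_nil addr0 /de.
have -> : sgk (-1) = -1 by rewrite /sgk ltr0_sg// ltrz0.
have -> : sgk 0 = 0 by rewrite /sgk sgr0.
rewrite (_ : (-1 : int) + 1 = 0)// (_ : (0 : int) + 1 = 1)//.
have -> : sgk 1 = 1 by rewrite /sgk sgr1.
rewrite mul0r e2pi0 mul1r /cotz.
have z1' : 1 - e2pi z != 0 by rewrite subr_eq0 eq_sym.
rewrite rmorphN /=; move: (e2pi z) z1' (csum f) => E E1 S.
by field.
Qed.

Lemma exists_lower_bound z : (forall n, z + n%:~R != 0) ->
  exists2 d : R, 0 < d & forall n, d <= cn (z + n%:~R).
Proof.
move=> zn.
have [y0|y0] := eqVneq (cIm z) 0; last first.
  exists `|cIm z|; first by rewrite normr_gt0.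
  by move=> n; apply: le_trans (Im_le_cn _); rewrite ImD Im_int addr0.
pose x := cRe z; pose n0 := Num.floor (- x).
have xn n : x + n%:~R != 0.
  apply: contra (zn n) => /eqP h; apply/eqP; apply: ceqP; rewrite ?ReD ?ImD ?Re_int ?Im_int//=.
  by rewrite y0 addr0.
have h1 : n0%:~R <= - x by exact: floor_le.
have h2 : - x < n0%:~R + 1 by have := lt_succ_floor (- x); rewrite intrD.
have d1 : 0 < - x - n0%:~R.
  rewrite subr_gt0 lt_neqAle h1 andbT; apply: contra (xn n0) => /eqP ->.
  by rewrite subrr.
have d2 : 0 < n0%:~R + 1 + x by lra.
exists (Num.min (- x - n0%:~R) (n0%:~R + 1 + x)); first by rewrite lt_min d1.
move=> n; apply: le_trans (Re_le_cn _); rewrite ReD Re_int -/x ge_min.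
have [nn|nn] := leP n n0.
  have : (n%:~R : R) <= n0%:~R by rewrite ler_int.
  move=> h; apply/orP; left; rewrite ler0_norm; lra.
have h : (n0%:~R + 1 : R) <= n%:~R.
  have : n0 + 1 <= n by lia.
  by rewrite -(ler_int R) intrD.
 apply/orP; right; rewrite ger0_norm; lra.
Qed.

Lemma cn_e2pi_mul (s : R) z : cn (e2pi (s%:C * z)) = expR (- (2 * pi * s * cIm z)).
Proof. by rewrite cn_e2pi Im_realM; congr expR; ring. Qed.

Lemma int_real n : (n%:~R : C) = (n%:~R : R)%:C.
Proof. by rewrite (rmorph_int (real_complex R)). Qed.

Lemma gauss_const_real (p : R) : 0 < p -> gauss_const p%:C = ((Num.sqrt p)^-1)%:C.
Proof.
move=> p0; rewrite /gauss_const -[p%:C]mulr1.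
have p1 : 0 < cRe (1 : C) by rewrite /= ltr01.
rewrite (cgauss_scale p1 p0).
have := @cint_gam_e2pi R 0; rewrite [gam 0]/gam expr0n mulr0 expR0 => H.
rewrite (_ : cint mu (cgauss 1 0 : RM -> C) = 1) ?mulr1// -[RHS]H.
apply: eq_cint => t; rewrite mul0r e2pi0 mulr1 (_ : (1 : C) = 1%:C)// (_ : (0 : C) = 0%:C)//.
by rewrite cgauss_real mul0r e2pi0 !mulr1.
Qed.

Lemma linear_bound (p s M x y : R) : 0 < p -> `|s| <= M ->
  2 * pi * p * (x * s) - 2 * pi * x * y <= (2 * pi * p * M + 2 * pi * `|y|) * `|x|.
Proof.
move=> p0 sM; have p2 : 0 <= 2 * pi :> R by rewrite mulr_ge0 ?pi_ge0.
rewrite (mulrDl (2 * pi * p * M)); apply: lerD.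
  rewrite -!(mulrA (2 * pi)) -(mulrA p M) ler_wpM2l// ler_wpM2l ?(ltW p0)// (le_trans (ler_norm _))// normrM mulrC.
  by rewrite ler_wpM2r.
rewrite (le_trans (ler_norm _))// normrN !normrM (ger0_norm (ler0n R 2)) (ger0_norm (pi_ge0 R)).
by rewrite -!(mulrA (2 * pi)) ler_wpM2l// mulrC.
Qed.

(** The Chernoff parameter is [sqrt p * k] and not the argument of [E1]: its sign is that of [k]
    whatever the shift, and the bound is uniform for [|s| <= M]. *)
Lemma E1_term_bound (p s M : R) z k : 0 < p -> `|s| <= M ->
  cn ((E1 (Num.sqrt p * (k%:~R - s)) - sgk k)%:C * e2pi (k%:~R * z)) <=
  2 * expR (- (pi * p) * k%:~R ^+ 2 + (2 * pi * p * M + 2 * pi * `|cIm z|) * `|k%:~R|).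
Proof.
move=> p0 sM; have sp : 0 < Num.sqrt p by rewrite sqrtr_gt0.
rewrite cnM cn_real int_real cn_e2pi_mul distrC.
have -> : sgk k = Num.sg (Num.sqrt p * k%:~R) by rewrite sgrM gtr0_sg// mul1r.
apply: le_trans (ler_wpM2r (expR_ge0 _) (E1_tail _ _)) _.
rewrite -[leLHS]mulrA -expRD ler_wpM2l// ler_expR.
have -> : pi * (Num.sqrt p * k%:~R) ^+ 2 - 2 * pi * (Num.sqrt p * k%:~R) * (Num.sqrt p * (k%:~R - s)) =
  - (pi * p) * k%:~R ^+ 2 + 2 * pi * p * (k%:~R * s).
  by rewrite -[in RHS](sqr_sqrtr (ltW p0)); ring.
by rewrite -addrA lerD2l linear_bound.
Qed.

Lemma absum_E1_term (p s : R) z : 0 < p ->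
  absum (fun k => (E1 (Num.sqrt p * (k%:~R - s)) - sgk k)%:C * e2pi (k%:~R * z)).
Proof.
move=> p0; have pp : 0 < pi * p by rewrite mulr_gt0 ?pi_gt0.
apply: absum_le (nnsZ (ler0n R 2) (nns_gauss (2 * pi * p * `|s| + 2 * pi * `|cIm z|) pp)) => k.
exact: E1_term_bound.
Qed.

Lemma gam_term_bound (p s M : R) z k : 0 < p -> `|s| <= M ->
  cn ((gam (Num.sqrt p * (k%:~R - s)))%:C * e2pi (k%:~R * z)) <=
  expR (- (pi * p) * k%:~R ^+ 2 + (2 * pi * p * M + 2 * pi * `|cIm z|) * `|k%:~R|).
Proof.
move=> p0 sM.
rewrite cnM cn_real int_real cn_e2pi_mul ger0_norm ?gam_ge0// /gam -expRD ler_expR.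
rewrite exprMn (sqr_sqrtr (ltW p0)).
have -> : - pi * (p * (k%:~R - s) ^+ 2) = - (pi * p) * k%:~R ^+ 2 + 2 * pi * p * (k%:~R * s) - pi * p * s ^+ 2 by ring.
have := linear_bound k%:~R (cIm z) p0 sM.
have : 0 <= pi * p * s ^+ 2 by rewrite mulr_ge0 ?sqr_ge0// mulr_ge0 ?pi_ge0// ltW.
lra.
Qed.

Lemma dist_lt1 (s x : R) : `|s - x| < 1 -> `|s| <= `|x| + 1.
Proof. by move=> /ltW h; rewrite -[s](subrK x) (le_trans (ler_normD _ _))// addrC lerD2l. Qed.

Lemma is_cd_E1_term (p s : R) z k :
  is_cd (fun s => (E1 (Num.sqrt p * (k%:~R - s)) - sgk k)%:C * e2pi (k%:~R * z)) s
   ((- (2 * Num.sqrt p))%:C * ((gam (Num.sqrt p * (k%:~R - s)))%:C * e2pi (k%:~R * z))).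
Proof.
have H := is_cdM (is_cdD (is_cd_E1_affine (- Num.sqrt p) (Num.sqrt p * k%:~R) s)
  (is_cd_cst (- (sgk k)%:C) s)) (is_cd_cst (e2pi (k%:~R * z)) s).
have E (t : R) : - Num.sqrt p * t + Num.sqrt p * k%:~R = Num.sqrt p * (k%:~R - t) by ring.
apply: is_cd_eq (is_cd_ext _ H) _ => [t|]; first by rewrite E -rmorphB.
rewrite addr0 mulr0 addr0 E [RHS]mulrA; congr (_ * _).
rewrite -[RHS](rmorphM (real_complex R)); congr (_%:C); ring.
Qed.

Lemma is_cd_e2piM z (s : R) : is_cd (fun s => e2pi (s%:C * z)) s (2 * (pi : R)%:C * 'i * z * e2pi (s%:C * z)).
Proof.
rewrite [s%:C * z]mulrC; apply: is_cd_ext (is_cd_e2pi z s) => t.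
by rewrite mulrC.
Qed.

Lemma e2pi_shift1 (s : R) z n : e2pi ((s + 1)%:C * (z + n%:~R)) = e2pi z * e2pi (s%:C * (z + n%:~R)).
Proof.
rewrite (_ : (s + 1)%:C = s%:C + 1); last by rewrite rmorphD.
by rewrite mulrDl mul1r e2piD e2piDint mulrC.
Qed.

Lemma absum_gauss_shift (p : R) z : 0 < p ->
  absum (fun n => cexp (- ((pi : R)%:C * (z + n%:~R) ^+ 2 / p%:C))).
Proof. by move=> p0; have [_ [h _]] := @jacobi0 R p%:C z p0. Qed.

Lemma cot_rhs_bound (p s M d : R) z n : 0 < d -> (forall n, d <= cn (z + n%:~R)) -> `|s| <= M ->
  cn (cexp (- ((pi : R)%:C * (z + n%:~R) ^+ 2 / p%:C)) * e2pi (s%:C * (z + n%:~R)) / (z + n%:~R)) <=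
  expR (2 * pi * M * `|cIm z|) / d * cn (cexp (- ((pi : R)%:C * (z + n%:~R) ^+ 2 / p%:C))).
Proof.
move=> d0 dn sM; rewrite cnM cnV cnM -mulrA mulrC ler_wpM2r ?cn_ge0//.
apply: ler_pM; rewrite ?cn_ge0 ?invr_ge0 ?cn_ge0//.
  rewrite cn_e2pi_mul ler_expR ImD Im_int addr0 (le_trans (ler_norm _))// normrN !normrM.
  rewrite (ger0_norm (ler0n R 2)) (ger0_norm (pi_ge0 R)) ler_wpM2r// ler_wpM2l// mulr_ge0 ?pi_ge0//.
by rewrite lef_pV2 ?posrE// (lt_le_trans d0).
Qed.

Lemma mul_factorB (a b c E : C) : E * a - c * (E * b) = E * (a - c * b).
Proof. by ring. Qed.

(** Differentiating in the shift turns [E1] into a Gaussian on the left and removes the denominator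
    on the right; [jacobi] matches the two theta series. The leftover constant is killed by
    [quasi_shift]. *)
Theorem cot_E1 (p kap : R) z : 0 < p -> (forall n, z + n%:~R != 0) ->
  cotz z + csum (fun k => (E1 (Num.sqrt p * (k%:~R - kap)) - sgk k)%:C * e2pi (k%:~R * z)) =
  'i / (pi : R)%:C * csum (fun n => cexp (- ((pi : R)%:C * (z + n%:~R) ^+ 2 / p%:C))
     * e2pi (kap%:C * (z + n%:~R)) / (z + n%:~R)).
Proof.
move=> p0 zn; have z1 := e2pi_neq1 zn; have [d d0 dn] := exists_lower_bound zn.
have pp : 0 < pi * p by rewrite mulr_gt0 ?pi_gt0.
have sp : 0 < Num.sqrt p by rewrite sqrtr_gt0.
pose L s := csum (fun k => (E1 (Num.sqrt p * (k%:~R - s)) - sgk k)%:C * e2pi (k%:~R * z)).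
pose Rt (s : R) n := cexp (- ((pi : R)%:C * (z + n%:~R) ^+ 2 / p%:C))
     * e2pi (s%:C * (z + n%:~R)) / (z + n%:~R).
have sG := absum_gauss_shift z p0.
have sR s : absum (Rt s).
  have c0 : 0 <= expR (2 * pi * `|s| * `|cIm z|) / d by rewrite divr_ge0 ?expR_ge0 ?ltW.
  apply: absum_le (nnsZ c0 sG) => n; exact: cot_rhs_bound.
have dL s : is_cd L s ((- (2 * Num.sqrt p))%:C * csum (fun k => (gam (Num.sqrt p * (k%:~R - s)))%:C * e2pi (k%:~R * z))).
  have sg : absum (fun k => (gam (Num.sqrt p * (k%:~R - s)))%:C * e2pi (k%:~R * z)).
    apply: absum_le (nns_gauss (2 * pi * p * `|s| + 2 * pi * `|cIm z|) pp) => k.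
    exact: gam_term_bound.
  rewrite -csumZ//.
  have c0 : 0 <= 2 * Num.sqrt p by rewrite mulr_ge0// ltW.
  apply: (@csum_derive R int (fun k s => (E1 (Num.sqrt p * (k%:~R - s)) - sgk k)%:C * e2pi (k%:~R * z))
    (fun k s => (- (2 * Num.sqrt p))%:C * ((gam (Num.sqrt p * (k%:~R - s)))%:C * e2pi (k%:~R * z)))
    (fun k => 2 * Num.sqrt p * expR (- (pi * p) * k%:~R ^+ 2 + (2 * pi * p * (`|s| + 1) + 2 * pi * `|cIm z|) * `|k%:~R|))
    s 1) => [||k t _|k t ts|t _].
  - exact: ltr01.
  - by apply: nnsZ => //; exact: nns_gauss.
  - exact: is_cd_E1_term.
  - rewrite cnM cn_real normrN ger0_norm// ler_wpM2l//; apply: gam_term_bound => //; exact: dist_lt1.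
  - exact: absum_E1_term.
have nz n : z + n%:~R != 0 := zn n.
have perm (a b c w : C) : a * (b * c) / w = b * (a * c / w) by rewrite -!mulrA mulrCA.
have canc (a b Z P : C) : Z != 0 -> a / Z * (P * Z * b) = P * (a * b) by move=> Z0; field.
have dR s : is_cd (fun s => csum (Rt s)) s (2 * (pi : R)%:C * 'i *
    csum (fun n => cexp (- ((pi : R)%:C * (z + n%:~R) ^+ 2 / p%:C)) * e2pi (s%:C * (z + n%:~R)))).
  have [_ [sJ _]] := @jacobi R p%:C z s%:C p0.
  rewrite -csumZ//.
  have c0 : 0 <= cn (2 * (pi : R)%:C * 'i) * expR (2 * pi * (`|s| + 1) * `|cIm z|).
    by rewrite mulr_ge0 ?cn_ge0 ?expR_ge0.
  apply: (@csum_derive R int (fun n s => Rt s n)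
    (fun n s => 2 * (pi : R)%:C * 'i * (cexp (- ((pi : R)%:C * (z + n%:~R) ^+ 2 / p%:C)) * e2pi (s%:C * (z + n%:~R))))
    (fun n => cn (2 * (pi : R)%:C * 'i) * expR (2 * pi * (`|s| + 1) * `|cIm z|) * cn (cexp (- ((pi : R)%:C * (z + n%:~R) ^+ 2 / p%:C))))
    s 1) => // [|n t _|n t ts].
  - exact: (nnsZ c0 sG).
  - have H := is_cdZ (cexp (- ((pi : R)%:C * (z + n%:~R) ^+ 2 / p%:C)) / (z + n%:~R)) (is_cd_e2piM (z + n%:~R) t).
    apply: is_cd_eq (is_cd_ext _ H) _ => [x|]; first by rewrite /Rt mulrAC.
    exact: canc.
  - rewrite (cnM (2 * _ * _)) -[leRHS]mulrA; apply: ler_wpM2l; first exact: cn_ge0.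
    rewrite (cnM (cexp _)) mulrC; apply: ler_wpM2r; first exact: cn_ge0.
    rewrite cn_e2pi_mul ler_expR ImD Im_int addr0 (le_trans (ler_norm _))// normrN !normrM.
    rewrite (ger0_norm (ler0n R 2)) (ger0_norm (pi_ge0 R)) ler_wpM2r// ler_wpM2l ?dist_lt1// mulr_ge0 ?pi_ge0//.
pose D s := cotz z + L s - 'i / (pi : R)%:C * csum (Rt s).
have D0 s : is_cd D s 0.
  apply: is_cd_eq (is_cdD (is_cdD (is_cd_cst (cotz z) s) (dL s)) (is_cdN (is_cdZ ('i / (pi : R)%:C) (dR s)))) _.
  have [_ [_ J]] := @jacobi R p%:C z s%:C p0.
  have -> : csum (fun k => (gam (Num.sqrt p * (k%:~R - s)))%:C * e2pi (k%:~R * z)) =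
     ((Num.sqrt p)^-1)%:C * csum (fun n => cexp (- ((pi : R)%:C * (z + n%:~R) ^+ 2 / p%:C)) * e2pi (s%:C * (z + n%:~R))).
    rewrite -gauss_const_real// -J; apply: eq_csum => k.
    rewrite [z * _]mulrC /gam -cexpR; congr (cexp _ * _).
    rewrite exprMn sqr_sqrtr ?ltW// int_real -rmorphB -rmorphXn -rmorphN -!rmorphM /=; congr (_%:C); ring.
  move: (csum _) => S.
  have S2 : (- (2 * Num.sqrt p))%:C * (((Num.sqrt p)^-1)%:C * S) = - (2 * S).
    rewrite mulrA -(rmorphM (real_complex R)) (_ : - (2 * _) / _ = - 2); last by field; rewrite gt_eqF.
    by rewrite rmorphN (rmorph_nat (real_complex R)) mulNr.
  rewrite add0r S2.
  have i2 : 'i * 'i = -1 :> C by rewrite -expr2 sqr_i.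
  have -> : 'i / (pi : R)%:C * (2 * (pi : R)%:C * 'i * S) = 2 * S * ('i * 'i).
    by have := @pi_neq0 R; move: (pi%:C) => P P0; field.
  by rewrite i2; ring.
have Dq : D (kap + 1) = e2pi z * D kap.
  have TE (X : R) k : (X%:C - (sgk k)%:C * 1) * e2pi (k%:~R * z) = (X - sgk k)%:C * e2pi (k%:~R * z).
    by rewrite mulr1 rmorphB.
  have [|_] := @quasi_shift z 1 (fun k => (E1 (Num.sqrt p * (k%:~R - kap)))%:C) z1.
    by apply: absum_ext (absum_E1_term kap z p0) => k; rewrite TE.
  rewrite (eq_csum (fun k => TE _ k)) (eq_csum (fun k => TE _ k)) mulr1 => Q.
  have R1 : csum (Rt (kap + 1)) = e2pi z * csum (Rt kap).
    rewrite -csumZ//; apply: eq_csum => n.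
    rewrite /Rt e2pi_shift1.
    exact: perm.
  have L1 : L (kap + 1) = csum (fun k => (E1 (Num.sqrt p * ((k - 1)%:~R - kap)) - sgk k)%:C * e2pi (k%:~R * z)).
    apply: eq_csum => k; rewrite (_ : k%:~R - (kap + 1) = (k - 1)%:~R - kap)//.
    by rewrite intrD mulrNz; ring.
  rewrite -L1 -/(L kap) in Q.
  rewrite /D R1; transitivity (e2pi z * (cotz z + L kap) - 'i / (pi : R)%:C * (e2pi z * csum (Rt kap))).
    exact: (congr1 (fun y : C => y - 'i / (pi : R)%:C * (e2pi z * csum (Rt kap))) Q).
  exact: mul_factorB.
have /eqP := is_cd0_cst (kap + 1) kap D0.
rewrite Dq -subr_eq0 -[X in _ - X]mul1r -mulrBl mulf_eq0 subr_eq0 (negbTE z1) /= => /eqP DE.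
by apply/eqP; rewrite -subr_eq0; apply/eqP.
Qed.

Lemma is_cd_affine (F : R -> C) (p q s : R) (d : C) : is_cd F (p * s + q) d ->
  is_cd (fun t => F (p * t + q)) s (p%:C * d).
Proof.
have D0 : is_derive s 1 (fun t : R => p * t + q) p.
  have := is_deriveD (is_deriveZ p (is_derive_id s 1)) (is_derive_cst q s 1).
  by rewrite addr0 /GRing.scale/= mulr1.
move=> [D1 D2]; split.
  rewrite Re_realM mulrC.
  exact: (@is_derive1_comp R (fun x => cRe (F x)) (fun t : R => p * t + q) s).
rewrite Im_realM mulrC.
exact: (@is_derive1_comp R (fun x => cIm (F x)) (fun t : R => p * t + q) s).
Qed.

Lemma mul_perm5 (g a c b d w : C) : g * a * (c * (b * d) * w) = g * (a * b) * (c * d * w).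
Proof. by ring. Qed.

Lemma mul_perm4 (x y p r w : C) : x * p * (y * r * w) = x * y * (p * r) * w.
Proof. by ring. Qed.

Lemma mul_perm3 (g E a b w : C) : g * (E * a * b) * w = E * (g * (a * b) * w).
Proof. by ring. Qed.

Lemma exponent_square (P z m Y t : C) : t != 0 ->
  - (P * (z + Y / 2 + m) ^+ 2 / (3 * t)) - P * Y ^+ 2 / (4 * t) =
  - (P * ((z + m) ^+ 2 + (z + m) * Y + Y ^+ 2) / (3 * t)).
Proof. by move=> t0; field. Qed.

Lemma bb_split (N E F sk sl : R) (e1 e2 : C) :
  (N - sl * E - sk * F + sk * sl)%:C * (e1 * e2) =
  ((N - sl * E)%:C * e2 - sk%:C * ((F - sl)%:C * e2)) * e1.
Proof.
rewrite !(rmorphD (real_complex R)) !(rmorphN (real_complex R)) !(rmorphM (real_complex R)) /=.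
by ring.
Qed.

Lemma X_split (d s : R) (x a b c : C) :
  (x * d%:C + a - s%:C * (x + b)) * c = x * ((d - s)%:C * c) + (a - s%:C * b) * c.
Proof. by rewrite (rmorphB (real_complex R)) /=; ring. Qed.

(** * The two-variable cotangent identity for fixed [z1] and [z2] *)

Section TwoDim.
Variables (T : R) (z1 z2 : C).
Hypothesis T0 : 0 < T.
Hypothesis z1n : forall n, z1 + n%:~R != 0.
Hypothesis z2n : forall n, z2 + n%:~R != 0.

Definition alpha3 : R := (Num.sqrt 3)^-1.

Lemma s3_gt0 : 0 < Num.sqrt 3 :> R. Proof. by rewrite sqrtr_gt0. Qed.

Lemma s3_sqr : Num.sqrt 3 ^+ 2 = 3 :> R. Proof. by rewrite sqr_sqrtr. Qed.

Lemma alpha3_gt0 : 0 < alpha3. Proof. by rewrite invr_gt0 s3_gt0. Qed.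

(** At this slope the normalization [a] of [N2_derive] and [N2_bound] is [2 alpha]. *)
Lemma alpha3_sqr : (2 * alpha3) ^+ 2 = 1 + alpha3 ^+ 2.
Proof. by rewrite exprMn /alpha3 exprVn s3_sqr; field. Qed.

(* [R2] uses this value of [E2] at [x = k3 - a], [y = k4 - a]. *)
Definition NN (x y : R) : R := N2 alpha3 (Num.sqrt T * (2 * x - y)) (Num.sqrt (3 * T) * y).

Definition EE (x : R) : R := E1 (Num.sqrt (3 * T) * x).

Lemma sqrt3T : Num.sqrt (3 * T) = Num.sqrt 3 * Num.sqrt T.
Proof. by rewrite sqrtrM. Qed.

Lemma sT_gt0 : 0 < Num.sqrt T. Proof. by rewrite sqrtr_gt0. Qed.

Lemma sT_sqr : Num.sqrt T ^+ 2 = T. Proof. by rewrite sqr_sqrtr// ltW. Qed.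

Lemma NN_arg (x y : R) :
  Num.sqrt T * (2 * x - y) + alpha3 * (Num.sqrt (3 * T) * y) = 2 * Num.sqrt T * x.
Proof.
rewrite sqrt3T /alpha3; have := s3_gt0; move: (Num.sqrt 3) (Num.sqrt T) => s t s0.
by field; rewrite gt_eqF.
Qed.

(* The polarization of [(EE x - sgk k) * (EE y - sgk l)], with [NN x y] in
   place of the product [EE x * EE y]; it decays like a Gaussian. *)
Definition bb (x y : R) k l : R :=
  NN x y - sgk l * EE x - sgk k * EE y + sgk k * sgk l.

Lemma bb_bound (s t : R) k l :
  `|bb (k%:~R - s) (l%:~R - t) k l| <=
  4 * expR (pi * T * (- (8 / 3) * (k%:~R ^+ 2 + l%:~R ^+ 2) + 4 / 3 * (k%:~R * l%:~R)
     + 4 * (k%:~R * s + l%:~R * t))).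
Proof.
have a0 : 0 < 2 * alpha3 by rewrite mulr_gt0// alpha3_gt0.
(* Only the signs are prescribed; these multiples of [k] and [l] make the exponent symmetric in the
   two, with a negative definite form. *)
pose r := Num.sqrt T * k%:~R; pose r' := 2 * alpha3 * Num.sqrt T * l%:~R.
have := N2_bound (Num.sqrt T * (2 * (k%:~R - s) - (l%:~R - t))) (Num.sqrt (3 * T) * (l%:~R - t)) r r' a0 alpha3_sqr.
have -> : Num.sg r = sgk k by rewrite sgrM gtr0_sg ?sT_gt0// mul1r.
have -> : Num.sg r' = sgk l.
  by rewrite sgrM gtr0_sg ?mul1r// mulr_gt0 ?sT_gt0.
rewrite NN_arg.
have -> : 2 * Num.sqrt T * (k%:~R - s) / (2 * alpha3) = Num.sqrt (3 * T) * (k%:~R - s).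
  rewrite sqrt3T /alpha3; have := s3_gt0; move: (Num.sqrt 3) (Num.sqrt T) => p q p0.
  by field; rewrite gt_eqF.
rewrite -/(EE _) -/(EE _) -/(NN _ _) -/(bb _ _ _ _).
move=> /le_trans; apply; rewrite ler_wpM2l// ler_expR le_eqVlt; apply/orP; left; apply/eqP.
rewrite /r /r' sqrt3T.
have aE : alpha3 = Num.sqrt 3 / 3.
  by rewrite /alpha3 -[X in _ / X]s3_sqr; field; rewrite gt_eqF ?s3_gt0.
rewrite aE; have := s3_sqr; have := sT_sqr; move: (Num.sqrt 3) (Num.sqrt T) => p q qT p3.
rewrite -[in RHS]qT.
move: (k%:~R : R) (l%:~R : R) => K L.
transitivity (pi * (q ^+ 2 * K ^+ 2 - 4 * (p ^+ 2 / 3) * q ^+ 2 * L * (L - t) - 4 * q ^+ 2 * K * (K - s)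
   + (p ^+ 2 / 9) * q ^+ 2 * (2 * L + K) ^+ 2)); first by field.
by rewrite p3; field.
Qed.

Lemma is_cd_NN (s y : R) k :
  is_cd (fun s => (NN (k%:~R - s) y)%:C) s
   (- (2 * Num.sqrt (3 * T)) * gam (Num.sqrt (3 * T) * (k%:~R - s)) * E1 (Num.sqrt T * (2 * y - (k%:~R - s))))%:C.
Proof.
have a0 : 0 < 2 * alpha3 by rewrite mulr_gt0// alpha3_gt0.
have E (t : R) : - (2 * Num.sqrt T) * t + 2 * Num.sqrt T * k%:~R = 2 * Num.sqrt T * (k%:~R - t) by ring.
have D := N2_derive (- (2 * Num.sqrt T) * s + 2 * Num.sqrt T * k%:~R) (Num.sqrt (3 * T) * y) a0 alpha3_sqr.
apply: is_cd_eq (is_cd_ext _ (is_cd_affine D)) _ => [t|].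
  by rewrite E -(NN_arg (k%:~R - t) y) addrK.
rewrite E -(rmorphM (real_complex R)); congr (_%:C).
have -> : 2 * Num.sqrt T * (k%:~R - s) / (2 * alpha3) = Num.sqrt (3 * T) * (k%:~R - s).
  rewrite sqrt3T /alpha3; have := s3_gt0; move: (Num.sqrt 3) (Num.sqrt T) => p q p0.
  by field; rewrite gt_eqF.
have aE : alpha3 = Num.sqrt 3 / 3.
  by rewrite /alpha3 -[X in _ / X]s3_sqr; field; rewrite gt_eqF ?s3_gt0.
have -> : (Num.sqrt (3 * T) * y - alpha3 * (2 * Num.sqrt T * (k%:~R - s) - alpha3 * (Num.sqrt (3 * T) * y))) / (2 * alpha3)
   = Num.sqrt T * (2 * y - (k%:~R - s)).
  rewrite aE sqrt3T; have := s3_gt0; have := s3_sqr; move: (Num.sqrt 3) (Num.sqrt T) => p q p3 p0.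
  have -> : (p * q * y - p / 3 * (2 * q * (k%:~R - s) - p / 3 * (p * q * y))) / (2 * (p / 3)) =
    3 / 2 * q * y - q * (k%:~R - s) + p ^+ 2 / 6 * q * y by field; rewrite gt_eqF.
  by rewrite p3; field.
move: (gam _) (E1 _) => g e; rewrite aE sqrt3T; have := s3_gt0; have := s3_sqr; move: (Num.sqrt 3) (Num.sqrt T) => p q p3 p0.
have -> : - (2 * q) * (2 * g / (2 * (p / 3)) * e) = - (2 * (3 / p * q)) * g * e by field; rewrite gt_eqF.
by rewrite -p3 expr2 mulfK ?gt_eqF.
Qed.

(** The derivative of [bb] in [s] up to a constant: a Gaussian in [k] times a one-variable
    coefficient in [l], of the kind that [cot_E1] sums. *)
Definition dd (s t : R) k l : R :=
  gam (Num.sqrt (3 * T) * (k%:~R - s)) *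
  (E1 (Num.sqrt T * (2 * (l%:~R - t) - (k%:~R - s))) - sgk l).

Lemma is_cd_bb (s t : R) k l :
  is_cd (fun s => (bb (k%:~R - s) (l%:~R - t) k l)%:C) s ((- (2 * Num.sqrt (3 * T)))%:C * (dd s t k l)%:C).
Proof.
have D1 := is_cd_NN s (l%:~R - t) k.
have D2 := is_cd_E1_affine (- Num.sqrt (3 * T)) (Num.sqrt (3 * T) * k%:~R) s.
have H := is_cdD (is_cdD (is_cdD D1 (is_cdZ (- (sgk l)%:C) D2))
   (is_cd_cst (- (sgk k * EE (l%:~R - t))%:C) s)) (is_cd_cst (sgk k * sgk l)%:C s).
have E (u : R) : - Num.sqrt (3 * T) * u + Num.sqrt (3 * T) * k%:~R = Num.sqrt (3 * T) * (k%:~R - u) by ring.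
apply: is_cd_eq (is_cd_ext _ H) _ => [u|].
  rewrite E -!rmorphN -!(rmorphM (real_complex R)) -!rmorphD /=; congr (_%:C).
  by rewrite /bb /EE; ring.
rewrite !addr0 E -!rmorphN -!(rmorphM (real_complex R)) -!rmorphD /=; congr (_%:C).
by rewrite /dd; ring.
Qed.

Lemma dd_bound (s t : R) k l :
  `|dd s t k l| <= 2 * expR (pi * T * (- 2 * (k%:~R ^+ 2 + l%:~R ^+ 2) + 4 * (k%:~R * s + l%:~R * t))).
Proof.
rewrite normrM (ger0_norm (gam_ge0 _)) distrC.
have -> : sgk l = Num.sg (Num.sqrt T * l%:~R) by rewrite sgrM gtr0_sg ?sT_gt0// mul1r.
apply: le_trans (ler_wpM2l (gam_ge0 _) (E1_tail _ _)) _.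
rewrite mulrCA /gam -expRD ler_wpM2l// ler_expR -subr_ge0 sqrt3T.
have := s3_sqr; have := sT_sqr; move: (Num.sqrt 3) (Num.sqrt T) => p q qT p3.
move: (k%:~R : R) (l%:~R : R) => K L; rewrite -qT.
have -> : pi * q ^+ 2 * (- 2 * (K ^+ 2 + L ^+ 2) + 4 * (K * s + L * t)) -
  (- pi * (p * q * (K - s)) ^+ 2 + (pi * (q * L) ^+ 2 - 2 * pi * (q * L) * (q * (2 * (L - t) - (K - s))))) =
  pi * (q ^+ 2 * ((p ^+ 2 - 3) * (K - s) ^+ 2 + ((K - s) - L) ^+ 2 + 2 * s ^+ 2)) by ring.
rewrite p3 subrr mul0r add0r mulr_ge0 ?pi_ge0// mulr_ge0 ?sqr_ge0// addr_ge0 ?sqr_ge0//.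
by rewrite mulr_ge0 ?sqr_ge0.
Qed.

Lemma linear_bound2 (s t M K L y y' : R) : `|s| <= M ->
  pi * T * (4 * (K * s + L * t)) - 2 * pi * K * y - 2 * pi * L * y' <=
  (4 * pi * T * (M + `|t|) + 2 * pi * (`|y| + `|y'|)) * (`|K| + `|L|).
Proof.
move=> sM; have p0 := @pi_gt0 R.
have H (a b : R) : a * b <= `|a| * `|b| by rewrite -normrM ler_norm.
have Ks : K * s <= `|K| * M by apply: le_trans (H _ _) _; rewrite ler_wpM2l.
have Lt := H L t.
have Ky : - (K * y) <= `|K| * `|y| by rewrite -mulrN -(normrN y).
have Ly : - (L * y') <= `|L| * `|y'| by rewrite -mulrN -(normrN y').
have M0 : 0 <= M by apply: le_trans sM.
have pT : 0 < pi * T by rewrite mulr_gt0.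
have nn := (normr_ge0 K, normr_ge0 L, normr_ge0 t, normr_ge0 y, normr_ge0 y').
case: nn => -[[[nK nL] nt] ny] ny'.
have a1 : pi * T * (K * s + L * t) <= pi * T * ((`|K| + `|L|) * (M + `|t|)).
  rewrite ler_wpM2l ?(ltW pT)//.
  have := mulr_ge0 nK nt; have := mulr_ge0 nL M0; lra.
have a2 : pi * (- (K * y) - L * y') <= pi * ((`|K| + `|L|) * (`|y| + `|y'|)).
  rewrite ler_wpM2l ?(ltW p0)//.
  have := mulr_ge0 nK ny'; have := mulr_ge0 nL ny; lra.
lra.
Qed.

Lemma cn_e2pi_pair k l : cn (e2pi (k%:~R * z1) * e2pi (l%:~R * z2)) =
  expR (- (2 * pi * k%:~R * cIm z1) - 2 * pi * l%:~R * cIm z2).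
Proof. by rewrite cnM !int_real !cn_e2pi_mul -expRD. Qed.

Definition Blin (M t : R) : R := 4 * pi * T * (M + `|t|) + 2 * pi * (`|cIm z1| + `|cIm z2|).

Definition maj2 (c M t : R) (p : int * int) : R :=
  c * expR (- (2 * pi * T) * (p.1%:~R ^+ 2 + p.2%:~R ^+ 2) + Blin M t * (`|p.1%:~R| + `|p.2%:~R|) + 0).

Lemma nns_maj2 c M t : 0 <= c -> nns (maj2 c M t).
Proof. by move=> c0; apply: nnsZ => //; apply: nns_gauss2; rewrite mulr_gt0// mulr_gt0// pi_gt0. Qed.

Definition Bt (s t : R) (p : int * int) : C :=
  (bb (p.1%:~R - s) (p.2%:~R - t) p.1 p.2)%:C * (e2pi (p.1%:~R * z1) * e2pi (p.2%:~R * z2)).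

Lemma Bt_bound (s t M : R) p : `|s| <= M -> cn (Bt s t p) <= maj2 4 M t p.
Proof.
move=> sM; case: p => k l; rewrite /Bt /fst /snd cnM cn_real cn_e2pi_pair.
apply: le_trans (ler_wpM2r (expR_ge0 _) (bb_bound s t k l)) _.
rewrite -[leLHS]mulrA -expRD ler_wpM2l// ler_expR /= addr0 -/(Blin M t).
have := linear_bound2 t k%:~R l%:~R (cIm z1) (cIm z2) sM; rewrite -/(Blin M t).
have pT : 0 <= pi * T by rewrite mulr_ge0 ?pi_ge0// ltW.
(* The amount by which the form of [bb_bound] lies below [- 2 (k^2 + l^2)]. *)
have : 0 <= pi * T * (2 / 3 * (k%:~R - l%:~R) ^+ 2) by rewrite mulr_ge0// mulr_ge0// sqr_ge0.
lra.
Qed.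

Lemma absum_Bt (s t : R) : absum (Bt s t).
Proof. by apply: absum_le (nns_maj2 `|s| t (ler0n R 4)) => p; exact: Bt_bound. Qed.

Definition Dt (s t : R) (p : int * int) : C :=
  (dd s t p.1 p.2)%:C * (e2pi (p.1%:~R * z1) * e2pi (p.2%:~R * z2)).

Lemma Dt_bound (s t M : R) p : `|s| <= M -> cn (Dt s t p) <= maj2 2 M t p.
Proof.
move=> sM; case: p => k l; rewrite /Dt /fst /snd cnM cn_real cn_e2pi_pair.
apply: le_trans (ler_wpM2r (expR_ge0 _) (dd_bound s t k l)) _.
rewrite -[leLHS]mulrA -expRD ler_wpM2l// ler_expR /= addr0 -/(Blin M t).
have := linear_bound2 t k%:~R l%:~R (cIm z1) (cIm z2) sM; rewrite -/(Blin M t).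
lra.
Qed.

Lemma absum_Dt (s t : R) : absum (Dt s t).
Proof. by apply: absum_le (nns_maj2 `|s| t (ler0n R 2)) => p; exact: Dt_bound. Qed.

Definition GG (p : int * int) : C := cexp (- ((pi : R)%:C * ((z1 + p.1%:~R) ^+ 2 +
  (z1 + p.1%:~R) * (z2 + p.2%:~R) + (z2 + p.2%:~R) ^+ 2) / (3 * T)%:C)).

Lemma absum_GG : absum GG.
Proof.
have T3 : 0 < 3 * T by rewrite mulr_gt0.
pose x1 := cRe z1; pose x2 := cRe z2; pose y1 := cIm z1; pose y2 := cIm z2.
pose q := pi / (3 * T).
have q0 : 0 < q by rewrite divr_gt0 ?pi_gt0.
pose K := q * (y1 ^+ 2 + y1 * y2 + y2 ^+ 2).
have A0 : 0 < q / 2 by rewrite divr_gt0.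
apply: absum_le (nns_gauss2 (q * (`|x1| + `|x2|)) K A0) => -[m n].
rewrite /GG /fst /snd cn_cexp ler_expR.
have -> : cRe (- ((pi : R)%:C * ((z1 + m%:~R) ^+ 2 + (z1 + m%:~R) * (z2 + n%:~R) + (z2 + n%:~R) ^+ 2) / (3 * T)%:C)) =
   - q * ((x1 + m%:~R) ^+ 2 + (x1 + m%:~R) * (x2 + n%:~R) + (x2 + n%:~R) ^+ 2) + K.
  rewrite mulrAC -fmorphV -(rmorphM (real_complex R)) -/q ReN Re_realM !expr2 !ReImE !Re_int !Im_int /K /x1 /x2 /y1 /y2.
  by ring.
rewrite lerD2r.
move: (m%:~R : R) (n%:~R : R) => M N.
have H (a b : R) : - (a * b) <= `|a| * `|b| by rewrite -mulrN -(normrN b) -normrM ler_norm.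
have h1 := H x1 M; have h2 := H x2 N.
have c1 : 0 <= `|x1| * `|N| by rewrite mulr_ge0.
have c2 : 0 <= `|x2| * `|M| by rewrite mulr_ge0.
(* [X^2 + X Y + Y^2] is half of [X^2 + Y^2 + (X + Y)^2]. *)
have s1 := sqr_ge0 (x1 + M + (x2 + N)).
have s2 := sqr_ge0 x1; have s3 := sqr_ge0 x2.
rewrite (_ : - (q / 2) * (M ^+ 2 + N ^+ 2) + q * (`|x1| + `|x2|) * (`|M| + `|N|) =
  q * (- 2^-1 * (M ^+ 2 + N ^+ 2) + (`|x1| + `|x2|) * (`|M| + `|N|))); last by ring.
rewrite mulNr -mulrN ler_wpM2l ?(ltW q0)//.
lra.
Qed.

Definition Rt (s t : R) (p : int * int) : C :=
  GG p * (e2pi (s%:C * (z1 + p.1%:~R)) * e2pi (t%:C * (z2 + p.2%:~R))) / ((z1 + p.1%:~R) * (z2 + p.2%:~R)).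

(** The derivative of [Rt] in [s] up to [2 pi i], the factor [z1 + m] having cancelled. *)
Definition St (s t : R) (p : int * int) : C :=
  GG p * (e2pi (s%:C * (z1 + p.1%:~R)) * e2pi (t%:C * (z2 + p.2%:~R))) / (z2 + p.2%:~R).

Lemma cn_e2pi_le (s M : R) z n : `|s| <= M ->
  cn (e2pi (s%:C * (z + n%:~R))) <= expR (2 * pi * M * `|cIm z|).
Proof.
move=> sM; rewrite cn_e2pi_mul ler_expR ImD Im_int addr0 (le_trans (ler_norm _))// normrN !normrM.
by rewrite (ger0_norm (ler0n R 2)) (ger0_norm (pi_ge0 R)) ler_wpM2r// ler_wpM2l// mulr_ge0 ?pi_ge0.
Qed.

Lemma St_bound (s t M d : R) p : 0 < d -> (forall n, d <= cn (z2 + n%:~R)) -> `|s| <= M ->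
  cn (St s t p) <= expR (2 * pi * M * `|cIm z1|) * expR (2 * pi * `|t| * `|cIm z2|) / d * cn (GG p).
Proof.
move=> d0 dn sM; rewrite /St cnM (cnM (GG p)) (cnM (e2pi _)) -mulrA mulrC; apply: ler_wpM2r; first exact: cn_ge0.
apply: ler_pM; rewrite ?mulr_ge0 ?cn_ge0//.
  by apply: ler_pM; rewrite ?cn_ge0 ?cn_e2pi_le.
by rewrite cnV lef_pV2 ?posrE// (lt_le_trans d0).
Qed.

Lemma St_const_ge0 (t M d : R) : 0 < d ->
  0 <= expR (2 * pi * M * `|cIm z1|) * expR (2 * pi * `|t| * `|cIm z2|) / d.
Proof. by move=> d0; rewrite divr_ge0 ?mulr_ge0 ?expR_ge0// ltW. Qed.

Lemma absum_St (s t : R) : absum (St s t).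
Proof.
have [d d0 dn] := exists_lower_bound z2n.
apply: absum_le (nnsZ (St_const_ge0 t `|s| d0) absum_GG) => p; exact: St_bound.
Qed.

Lemma RtE (s t : R) p : Rt s t p = St s t p / (z1 + p.1%:~R).
Proof. by rewrite /Rt /St invfM mulrCA mulrC. Qed.

Lemma absum_Rt (s t : R) : absum (Rt s t).
Proof.
have [d d0 dn] := exists_lower_bound z1n.
have d1 : 0 <= d^-1 by rewrite invr_ge0 ltW.
apply: absum_le (nnsZ d1 (absum_St s t)) => p.
rewrite RtE cnM mulrC; apply: ler_wpM2r; first exact: cn_ge0.
by rewrite cnV lef_pV2 ?posrE// (lt_le_trans d0).
Qed.

Lemma is_cd_Rt (s t : R) p : is_cd (fun s => Rt s t p) s (2 * (pi : R)%:C * 'i * St s t p).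
Proof.
have H := is_cdZ (GG p * e2pi (t%:C * (z2 + p.2%:~R)) / ((z1 + p.1%:~R) * (z2 + p.2%:~R))) (is_cd_e2piM (z1 + p.1%:~R) s).
apply: is_cd_eq (is_cd_ext _ H) _ => [u|].
  by rewrite /Rt; move: (_^-1) (GG p) (e2pi _) (e2pi _) => a b c d; ring.
rewrite /St; have := z1n p.1; have := z2n p.2.
move: (GG p) => g; move: (e2pi _) (e2pi _) => b c; move: (z1 + _) (z2 + _) => Z1 Z2 h2 h1.
by field; rewrite h1 h2.
Qed.

Lemma is_cd_sum_Rt (s t : R) :
  is_cd (fun s => csum (Rt s t)) s (2 * (pi : R)%:C * 'i * csum (St s t)).
Proof.
have [d d0 dn] := exists_lower_bound z2n.
rewrite -csumZ; last exact: absum_St.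
have c0 := St_const_ge0 t (`|s| + 1) d0.
have c1 := mulr_ge0 (cn_ge0 (2 * (pi : R)%:C * 'i)) c0.
apply: (@csum_derive R (int * int)%type (fun p s => Rt s t p) (fun p s => 2 * (pi : R)%:C * 'i * St s t p)
  (fun p => cn (2 * (pi : R)%:C * 'i) * (expR (2 * pi * (`|s| + 1) * `|cIm z1|) * expR (2 * pi * `|t| * `|cIm z2|) / d) * cn (GG p)) s 1)
  => // [|p u _|p u us|u _].
- exact: (nnsZ c1 absum_GG).
- exact: is_cd_Rt.
- rewrite (cnM (2 * _ * _)) -[leRHS]mulrA; apply: ler_wpM2l; first exact: cn_ge0.
  by apply: St_bound => //; exact: dist_lt1.
- exact: absum_Rt.
Qed.

Lemma is_cd_sum_Bt (s t : R) :
  is_cd (fun s => csum (Bt s t)) s ((- (2 * Num.sqrt (3 * T)))%:C * csum (Dt s t)).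
Proof.
rewrite -csumZ; last exact: absum_Dt.
have c0 : 0 <= 2 * Num.sqrt (3 * T) by rewrite mulr_ge0 ?sqrtr_ge0.
apply: (@csum_derive R (int * int)%type (fun p s => Bt s t p) (fun p s => (- (2 * Num.sqrt (3 * T)))%:C * Dt s t p)
  (fun p => 2 * Num.sqrt (3 * T) * maj2 2 (`|s| + 1) t p) s 1) => // [|p u _|p u us|u _].
- by apply: nnsZ => //; exact: nns_maj2.
- have H := is_cdM (is_cd_bb u t p.1 p.2) (is_cd_cst (e2pi (p.1%:~R * z1) * e2pi (p.2%:~R * z2)) u).
  by apply: is_cd_eq H _; rewrite mulr0 addr0 /Dt [RHS]mulrA.
- rewrite cnM cn_real normrN ger0_norm//; apply: ler_wpM2l => //.
  by apply: Dt_bound; exact: dist_lt1.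
- exact: absum_Bt.
Qed.

Let E2sum t := csum (fun l => (EE (l%:~R - t) - sgk l)%:C * e2pi (l%:~R * z2)).
Let E1sum s := csum (fun k => (EE (k%:~R - s) - sgk k)%:C * e2pi (k%:~R * z1)).

Let T3 : 0 < 3 * T. Proof. by rewrite mulr_gt0. Qed.
Let T4 : 0 < 4 * T. Proof. by rewrite mulr_gt0. Qed.

Lemma sqrt4T : Num.sqrt (4 * T) = 2 * Num.sqrt T.
Proof. by rewrite sqrtrM// (_ : (4 : R) = 2 ^+ 2) ?sqrtr_sqr ?ger0_norm//; ring. Qed.

Let gk s k : R := gam (Num.sqrt (3 * T) * (k%:~R - s)).

Lemma is_cd_E1sum (s : R) : is_cd E1sum s
  ((- (2 * Num.sqrt (3 * T)))%:C * csum (fun k => (gk s k)%:C * e2pi (k%:~R * z1))).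
Proof.
have pp : 0 < pi * (3 * T) by rewrite mulr_gt0 ?pi_gt0.
have sg : absum (fun k => (gk s k)%:C * e2pi (k%:~R * z1)).
  apply: absum_le (nns_gauss (2 * pi * (3 * T) * `|s| + 2 * pi * `|cIm z1|) pp) => k.
  exact: gam_term_bound.
rewrite -csumZ//.
have c0 : 0 <= 2 * Num.sqrt (3 * T) by rewrite mulr_ge0 ?sqrtr_ge0.
apply: (@csum_derive R int (fun k s => (EE (k%:~R - s) - sgk k)%:C * e2pi (k%:~R * z1))
  (fun k s => (- (2 * Num.sqrt (3 * T)))%:C * ((gk s k)%:C * e2pi (k%:~R * z1)))
  (fun k => 2 * Num.sqrt (3 * T) * expR (- (pi * (3 * T)) * k%:~R ^+ 2 + (2 * pi * (3 * T) * (`|s| + 1) + 2 * pi * `|cIm z1|) * `|k%:~R|))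
  s 1) => [||k t _|k t ts|t _].
- exact: ltr01.
- by apply: nnsZ => //; exact: nns_gauss.
- exact: is_cd_E1_term.
- rewrite cnM cn_real normrN ger0_norm// ler_wpM2l//; apply: gam_term_bound => //; exact: dist_lt1.
- exact: absum_E1_term.
Qed.

Let Wn s t n : C := cexp (- ((pi : R)%:C * (z2 + n%:~R) ^+ 2 / (4 * T)%:C)) *
  e2pi ((t - s / 2)%:C * (z2 + n%:~R)) / (z2 + n%:~R).
Let Pt s t (p : int * int) : C := (gk s p.1)%:C * e2pi (p.1%:~R * (z1 + (z2 + p.2%:~R) / 2)) * Wn s t p.2.

Lemma absum_Pt (s t : R) : absum (Pt s t).
Proof.
have [d d0 dn] := exists_lower_bound z2n.
have pp : 0 < pi * (3 * T) by rewrite mulr_gt0 ?pi_gt0.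
have c0 : 0 <= expR (2 * pi * `|t - s / 2| * `|cIm z2|) / d by rewrite divr_ge0 ?expR_ge0 ?ltW.
have n2 := nnsZ c0 (absum_gauss_shift z2 T4).
have n1 := nns_gauss (2 * pi * (3 * T) * `|s| + 2 * pi * `|cIm (z1 + z2 / 2)|) pp.
apply: absum_le (nns_prod n1 n2) => p.
rewrite /Pt cnM; apply: ler_pM; rewrite ?cn_ge0//; last exact: cot_rhs_bound.
have -> : cIm (z1 + z2 / 2) = cIm (z1 + (z2 + p.2%:~R) / 2).
  rewrite mulrDl !ImD -[2 : C](rmorph_nat (real_complex R)) -fmorphV !ImM !Re_int !Im_int /=; ring.
exact: gam_term_bound.
Qed.

(** For fixed [k] the sum over [l] is that of [cot_E1] with [p = 4 T] and a shift depending on [k];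
    the term in [cotz z2] supplies the cotangent of that identity. *)
Lemma sum_Dt (s t : R) :
  cotz z2 * csum (fun k => (gk s k)%:C * e2pi (k%:~R * z1)) + csum (Dt s t) =
  'i / (pi : R)%:C * csum (fun k => csum (fun n => Pt s t (k, n))).
Proof.
have pp : 0 < pi * (3 * T) by rewrite mulr_gt0 ?pi_gt0.
have sg : absum (fun k => (gk s k)%:C * e2pi (k%:~R * z1)).
  apply: absum_le (nns_gauss (2 * pi * (3 * T) * `|s| + 2 * pi * `|cIm z1|) pp) => k.
  exact: gam_term_bound.
rewrite csum_pair; last exact: absum_Dt.
rewrite -csumZ// -csumD; last 2 first.
- exact: absumZ.
- exact: (absum_csum (absum_Dt s t)).
rewrite -csumZ; last exact: (absum_csum (absum_Pt s t)).
apply: eq_csum => k.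
(* From [2 (l - t) - (k - s) = 2 (l - kap)]. *)
pose kap := t + (k%:~R - s) / 2.
have := cot_E1 kap T4 z2n.
set L := csum _; set Q := csum _ => EQ.
have LE : (gk s k)%:C * e2pi (k%:~R * z1) * L = csum (fun l => Dt s t (k, l)).
  rewrite -csumZ; last exact: absum_E1_term.
  apply: eq_csum => l; rewrite /Dt /fst /snd /dd -/(gk s k) rmorphM /= sqrt4T.
  rewrite (_ : 2 * Num.sqrt T * (l%:~R - kap) = Num.sqrt T * (2 * (l%:~R - t) - (k%:~R - s))); last first.
    by rewrite /kap; field.
  by move: (e2pi _) (e2pi _) (gk s k)%:C (_%:C) => a b c x; ring.
rewrite -LE.
have QE : (gk s k)%:C * e2pi (k%:~R * z1) * Q = csum (fun n => Pt s t (k, n)).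
  rewrite -csumZ.
    apply: eq_csum => n; rewrite /Pt /Wn /fst /snd.
    have -> : e2pi (kap%:C * (z2 + n%:~R)) = e2pi (k%:~R * ((z2 + n%:~R) / 2)) * e2pi ((t - s / 2)%:C * (z2 + n%:~R)).
      rewrite -e2piD; congr e2pi; rewrite /kap !rmorphD !rmorphN !rmorphM /= !rmorphB /= -int_real.
      rewrite !fmorphV (rmorph_nat (real_complex R)); by field.
    rewrite [k%:~R * (z1 + _)]mulrDr e2piD.
    exact: mul_perm5.
  have [d d0 dn] := exists_lower_bound z2n.
  have c0 : 0 <= expR (2 * pi * `|kap| * `|cIm z2|) / d by rewrite divr_ge0 ?expR_ge0 ?ltW.
  by apply: absum_le (nnsZ c0 (absum_gauss_shift z2 T4)) => n; exact: cot_rhs_bound.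
have fac (a b c : C) : a * b + b * c = b * (a + c) by ring.
by rewrite fac EQ -QE; exact: mulrCA.
Qed.

(** Poisson summation in [k] with [p = 3 T] at [z1 + (z2 + n) / 2]; the Gaussians with denominators
    [3 T] and [4 T] then combine into [GG] by completing the square. *)
Lemma sum_Pt (s t : R) :
  csum (fun k => csum (fun n => Pt s t (k, n))) = ((Num.sqrt (3 * T))^-1)%:C * csum (St s t).
Proof.
rewrite (csum_swap (absum_Pt s t)).
rewrite [csum (St s t)]csum_pair; last exact: absum_St.
rewrite (csum_swap (absum_St s t)) -csumZ; last first.
  have bs : bijective (fun q : int * int => (q.2, q.1)) by exists (fun q => (q.2, q.1)) => -[].
  exact: (absum_csum (absum_reindex bs (absum_St s t))).
apply: eq_csum => n.
have pp : 0 < pi * (3 * T) by rewrite mulr_gt0 ?pi_gt0.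
have [s1 [s2 J]] := @jacobi R (3 * T)%:C (z1 + (z2 + n%:~R) / 2) s%:C T3.
have J1 : csum (fun k => (gk s k)%:C * e2pi (k%:~R * (z1 + (z2 + n%:~R) / 2))) =
  ((Num.sqrt (3 * T))^-1)%:C * csum (fun m => cexp (- ((pi : R)%:C * (z1 + (z2 + n%:~R) / 2 + m%:~R) ^+ 2 / (3 * T)%:C))
     * e2pi (s%:C * (z1 + (z2 + n%:~R) / 2 + m%:~R))).
  rewrite -gauss_const_real// -J; apply: eq_csum => k.
  rewrite [k%:~R * _]mulrC /gk /gam -cexpR; congr (cexp _ * _).
  rewrite exprMn sqr_sqrtr ?(ltW T3)// int_real -rmorphB -rmorphXn -rmorphN -!rmorphM /=; congr (_%:C); ring.
rewrite /Pt /fst /snd csumZr ?J1; last first.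
  apply: absum_le (nns_gauss (2 * pi * (3 * T) * `|s| + 2 * pi * `|cIm (z1 + (z2 + n%:~R) / 2)|) pp) => k.
  exact: gam_term_bound.
rewrite -mulrA; congr (_ * _); rewrite -csumZr//; apply: eq_csum => m.
rewrite /Wn /St /GG /fst /snd.
have h1 : cexp (- ((pi : R)%:C * (z1 + (z2 + n%:~R) / 2 + m%:~R) ^+ 2 / (3 * T)%:C)) *
   cexp (- ((pi : R)%:C * (z2 + n%:~R) ^+ 2 / (4 * T)%:C)) =
   cexp (- ((pi : R)%:C * ((z1 + m%:~R) ^+ 2 + (z1 + m%:~R) * (z2 + n%:~R) + (z2 + n%:~R) ^+ 2) / (3 * T)%:C)).
  rewrite -cexpD; congr cexp; rewrite !(rmorphM (real_complex R)) !(rmorph_nat (real_complex R)).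
  have Tn : T%:C != 0 :> C by rewrite -cn_eq0 cn_real normr_eq0 gt_eqF.
  exact: exponent_square.
have h2 : e2pi (s%:C * (z1 + (z2 + n%:~R) / 2 + m%:~R)) * e2pi ((t - s / 2)%:C * (z2 + n%:~R)) =
   e2pi (s%:C * (z1 + m%:~R)) * e2pi (t%:C * (z2 + n%:~R)).
  rewrite -!e2piD; congr e2pi; rewrite !rmorphB !rmorphM /= fmorphV (rmorph_nat (real_complex R)).
  by field.
by rewrite -h1 -h2; exact: mul_perm4.
Qed.

Definition lhs2 (s t : R) : C := cotz z1 * cotz z2 + cotz z1 * E2sum t + cotz z2 * E1sum s + csum (Bt s t).

Lemma is_cd_lhs2 (s t : R) :
  is_cd (fun s => lhs2 s t) s (- (((pi : R) ^- 2)%:C) * (2 * (pi : R)%:C * 'i * csum (St s t))).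
Proof.
have H := is_cdD (is_cdD (is_cd_cst (cotz z1 * cotz z2 + cotz z1 * E2sum t) s)
  (is_cdZ (cotz z2) (is_cd_E1sum s))) (is_cd_sum_Bt s t).
apply: is_cd_eq H _.
have sD := sum_Dt s t; rewrite sum_Pt in sD.
have c3 : Num.sqrt (3 * T) != 0 by rewrite gt_eqF// sqrtr_gt0.
rewrite add0r mulrCA -mulrDr sD; move: (csum _) => S.
have -> : (- (2 * Num.sqrt (3 * T)))%:C * ('i / (pi : R)%:C * (((Num.sqrt (3 * T))^-1)%:C * S)) =
   (- (2 * Num.sqrt (3 * T)) * (Num.sqrt (3 * T))^-1)%:C * ('i / (pi : R)%:C * S).
  by rewrite [in RHS]rmorphM /=; ring.
rewrite (_ : - (2 * _) / _ = - 2); last by field.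
rewrite rmorphN (rmorph_nat (real_complex R)) fmorphV rmorphXn /=.
by have := @pi_neq0 R; move: (pi%:C) => P P0; field.
Qed.

(** Summed over [l] first, [lhs2] has the shape of [quasi_shift]: the coefficient of [e(k z1)] is
    [X k - sgk k * A], where [A] collects everything that multiplies [cotz z1]. The shift of [s] is
    the shift of [k] in [X]. *)
Lemma lhs2_quasi (s t : R) : lhs2 (s + 1) t = e2pi z1 * lhs2 s t.
Proof.
pose A := cotz z2 + E2sum t.
pose I (u : R) k l : C := (NN (k%:~R - u) (l%:~R - t) - sgk l * EE (k%:~R - u))%:C * e2pi (l%:~R * z2).
pose X u k : C := cotz z2 * (EE (k%:~R - u))%:C + csum (I u k).
have sE : absum (fun l => (EE (l%:~R - t) - sgk l)%:C * e2pi (l%:~R * z2)) by exact: absum_E1_term.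
have BI u k l : Bt u t (k, l) = (I u k l - (sgk k)%:C * ((EE (l%:~R - t) - sgk l)%:C * e2pi (l%:~R * z2))) * e2pi (k%:~R * z1).
  exact: bb_split.
have sI u k : absum (I u k).
  have h := absumZ (e2pi (k%:~R * z1))^-1 (absum_slice k (absum_Bt u t)).
  apply: absum_ext (absumD h (absumZ (sgk k)%:C sE)) => l.
  by rewrite BI [_ * e2pi (k%:~R * z1)]mulrC mulKf ?e2pi_neq0// subrK.
have FE u k : (X u k - (sgk k)%:C * A) * e2pi (k%:~R * z1) =
    cotz z2 * ((EE (k%:~R - u) - sgk k)%:C * e2pi (k%:~R * z1)) + csum (fun l => Bt u t (k, l)).
  have -> : csum (fun l => Bt u t (k, l)) = (csum (I u k) - (sgk k)%:C * E2sum t) * e2pi (k%:~R * z1).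
    rewrite /E2sum -csumZ// -csumB//; last exact: absumZ.
    rewrite -csumZr; first by apply: eq_csum => l; rewrite BI.
    by apply: absumB => //; exact: absumZ.
  exact: X_split.
have s1 u : absum (fun k => (EE (k%:~R - u) - sgk k)%:C * e2pi (k%:~R * z1)) by exact: absum_E1_term.
have sF u : absum (fun k => (X u k - (sgk k)%:C * A) * e2pi (k%:~R * z1)).
  apply: absum_ext (absumD (absumZ (cotz z2) (s1 u)) (absum_csum (absum_Bt u t))) => k.
  by rewrite FE.
have LE u : lhs2 u t = cotz z1 * A + csum (fun k => (X u k - (sgk k)%:C * A) * e2pi (k%:~R * z1)).
  rewrite (eq_csum (FE u)) csumD; [|exact: absumZ|exact: (absum_csum (absum_Bt u t))].
  rewrite csumZ// -csum_pair; last exact: absum_Bt.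
  by rewrite /lhs2 /A mulrDr !addrA.
have [_ Q] := quasi_shift (e2pi_neq1 z1n) (sF s).
have kE k : k%:~R - (s + 1) = (k - 1)%:~R - s :> R by rewrite intrD mulrNz; ring.
have XE k : X (s + 1) k = X s (k - 1).
  have IE : csum (I (s + 1) k) = csum (I s (k - 1)) by apply: eq_csum => l; rewrite /I kE.
  by rewrite /X kE IE.
have SE : csum (fun k => (X (s + 1) k - (sgk k)%:C * A) * e2pi (k%:~R * z1)) =
   csum (fun k => (X s (k - 1) - (sgk k)%:C * A) * e2pi (k%:~R * z1)).
  by apply: eq_csum => k; rewrite XE.
rewrite (LE (s + 1)).
rewrite SE.
rewrite Q.
rewrite (LE s).
reflexivity.
Qed.

Theorem cot_E2 (s t : R) : lhs2 s t = - (((pi : R) ^- 2)%:C) * csum (Rt s t).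
Proof.
pose D u := lhs2 u t - - (((pi : R) ^- 2)%:C) * csum (Rt u t).
have D0 u : is_cd D u 0.
  by apply: is_cd_eq (is_cdD (is_cd_lhs2 u t) (is_cdN (is_cdZ _ (is_cd_sum_Rt u t)))) _; rewrite subrr.
have R1 : csum (Rt (s + 1) t) = e2pi z1 * csum (Rt s t).
  rewrite -csumZ; last exact: absum_Rt.
  apply: eq_csum => p; rewrite /Rt e2pi_shift1.
  exact: mul_perm3.
have Dq : D (s + 1) = e2pi z1 * D s by rewrite /D lhs2_quasi R1; exact: mul_factorB.
have /eqP := is_cd0_cst (s + 1) s D0.
rewrite Dq -subr_eq0 -[X in _ - X]mul1r -mulrBl mulf_eq0 subr_eq0 (negbTE (e2pi_neq1 z1n)) /= => /eqP DE.
by apply/eqP; rewrite -subr_eq0; apply/eqP.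
Qed.
End TwoDim.
End Cotangent.

(** * The theta function *)
Section Modular.
Variable R : realType.
Local Notation C := R[i].
Implicit Types (z w v tau : C) (a b c d k l m n : int).

Lemma Im_div z w : cIm (z / w) = (cIm z * cRe w - cRe z * cIm w) / (cRe w ^+ 2 + cIm w ^+ 2).
Proof. by case: z => x y; case: w => p q /=; rewrite mulrN !mulrA; ring. Qed.

Lemma cocycle_neq0 a b c d tau : a * d - b * c = 1 -> 0 < cIm tau ->
  c%:~R * tau + d%:~R != 0.
Proof.
move=> det t0; apply/eqP => j0.
have := congr1 cIm j0; rewrite !ReImE !Re_int !Im_int /= mul0r !addr0 => /eqP.
rewrite mulf_eq0 (gt_eqF t0) orbF intr_eq0 => /eqP c0.
move: j0; rewrite c0 mul0r add0r => /(congr1 cRe); rewrite Re_int /= => /eqP.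
rewrite intr_eq0 => /eqP d0.
by move: det; rewrite c0 d0 !mulr0 subr0 => /eqP; rewrite eq_sym oner_eq0.
Qed.

Lemma Im_mobius a b c d tau : a * d - b * c = 1 -> 0 < cIm tau ->
  cIm ((a%:~R * tau + b%:~R) / (c%:~R * tau + d%:~R)) =
  cIm tau / (cRe (c%:~R * tau + d%:~R) ^+ 2 + cIm (c%:~R * tau + d%:~R) ^+ 2).
Proof.
move=> det t0; rewrite Im_div; congr (_ / _).
have detR : a%:~R * d%:~R - b%:~R * c%:~R = 1 :> R by rewrite -!intrM -intrB det.
rewrite !ReImE !Re_int !Im_int /= -[RHS]mul1r -[X in _ = X * _]detR.
by move: (a%:~R : R) (b%:~R : R) (c%:~R : R) (d%:~R : R) => A B K D; ring.
Qed.

Lemma sqr_norm_gt0 z : z != 0 -> 0 < cRe z ^+ 2 + cIm z ^+ 2.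
Proof.
case: z => x y /= xy.
rewrite lt_neqAle addr_ge0 ?sqr_ge0// andbT eq_sym paddr_eq0 ?sqr_ge0// !sqrf_eq0.
by apply: contra xy => /andP[/eqP -> /eqP ->].
Qed.

Lemma Im_mobius_gt0 a b c d tau : a * d - b * c = 1 -> 0 < cIm tau ->
  0 < cIm ((a%:~R * tau + b%:~R) / (c%:~R * tau + d%:~R)).
Proof.
move=> det t0; rewrite (Im_mobius det t0) divr_gt0//.
by apply: sqr_norm_gt0; exact: cocycle_neq0 det t0.
Qed.

Definition theta_term v tau (k : int * int) : C :=
  e2pi (v * (k.1 + 2 * k.2)%:~R + (k.1 ^+ 2 + k.2 ^+ 2 + k.1 * k.2)%:~R * tau).

Definition quad_term (x y : C) tau (k : int * int) : C :=
  e2pi (x * k.1%:~R + y * k.2%:~R + (k.1 ^+ 2 + k.2 ^+ 2 + k.1 * k.2)%:~R * tau).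

Lemma theta_quad v tau (k : int * int) : theta_term v tau k = quad_term v (2 * v) tau k.
Proof.
rewrite /theta_term /quad_term; congr e2pi; rewrite (intrD _ k.1) intrM.
by move: ((_ + _ + _)%:~R) => q; ring.
Qed.

Lemma absum_quad (x y : C) tau : 0 < cIm tau -> absum (quad_term x y tau).
Proof.
move=> t0; have A0 : 0 < pi * cIm tau by rewrite mulr_gt0 ?pi_gt0.
apply: absum_le (nns_gauss2 (2 * pi * (`|cIm x| + `|cIm y|)) 0 A0) => -[k l].
rewrite /quad_term cn_e2pi !ReImE !Re_int !Im_int ler_expR /fst /snd addr0 !intrD intrM !rmorphXn /=.
move: (k%:~R : R) (l%:~R : R) => K L.
have p0 := @pi_gt0 R.
have H (a b : R) : - (a * b) <= `|a| * `|b| by rewrite -mulrN -(normrN b) -normrM ler_norm.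
have h1 := H K (cIm x); have h2 := H L (cIm y).
have nK := mulr_ge0 (normr_ge0 K) (normr_ge0 (cIm y)).
have nL := mulr_ge0 (normr_ge0 L) (normr_ge0 (cIm x)).
have s := mulr_ge0 (sqr_ge0 (K + L)) (ltW t0).
rewrite -subr_ge0.
set E := (X in 0 <= X).
have -> : E =
  pi * ((K + L) ^+ 2 * cIm tau + 2 * ((`|cIm x| + `|cIm y|) * (`|K| + `|L|)) + 2 * (K * cIm x) + 2 * (L * cIm y)).
  by rewrite /E; ring.
rewrite mulr_ge0 ?(ltW p0)//; lra.
Qed.

Lemma absum_theta v tau : 0 < cIm tau -> absum (theta_term v tau).
Proof. by move=> t0; apply: absum_ext (absum_quad v (2 * v) t0) => k; rewrite theta_quad. Qed.

Lemma ThetaE v tau : 0 < cIm tau -> Theta v tau = csum (theta_term v tau).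
Proof.
move=> t0; have sT := absum_theta v t0; rewrite /Theta sumZ2_csum.
  by apply: eq_csum => k; rewrite /theta_term e2piD.
by apply: absum_ext sT => k; rewrite /theta_term e2piD.
Qed.

Definition theta_dual_term v tau (k : int * int) : C :=
  e2pi (- (v / tau * k.2%:~R) - (k.1 ^+ 2 - k.1 * k.2 + k.2 ^+ 2)%:~R / (3 * tau)).

Definition theta_const tau : C :=
  gauss_const (- (2 * 'i * tau)) * gauss_const ((3 / 4)%:C * (- (2 * 'i * tau))).

(** Two Poisson summations, following [k^2 + k l + l^2 = (k + l/2)^2 + (3/4) l^2]: in [k] with
    [p = - 2 i tau], then in [l] with [3 p / 4]. *)
Lemma theta_inv v tau : 0 < cIm tau ->
  Theta v tau = theta_const tau * e2pi (- (v ^+ 2 / tau)) * csum (theta_dual_term v tau).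
Proof.
move=> t0; rewrite ThetaE//; set p := - (2 * 'i * tau).
have p0 : 0 < cRe p.
  by rewrite /p !ReImE /=; move: t0; case: (tau) => x y /=; lra.
have q0 : 0 < cRe ((3 / 4)%:C * p) by rewrite Re_realM mulr_gt0// divr_gt0.
have tn0 : tau != 0 by apply/eqP => h; move: t0; rewrite h ltxx.
have pn0 : p != 0 by apply/eqP => h; move: p0; rewrite h ltxx.
have bs : bijective (fun q : int * int => (q.2, q.1)) by exists (fun q => (q.2, q.1)) => -[].
rewrite -(csum_reindex _ bs) csum_pair; last exact: (absum_reindex bs (absum_theta v t0)).
rewrite /fst /snd.
pose A m := cexp (- ((pi : R)%:C * (v + m%:~R) ^+ 2 / p)).
pose B (z : C) l := cexp (- (pi : R)%:C * ((3 / 4)%:C * p) * l%:~R ^+ 2) * e2pi (z * l%:~R).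
(* After the first summation the coefficient of [l] is [2 v - (v + m) / 2]. *)
pose P (x : int * int) : C := A x.2 * B (2 * v - (v + x.2%:~R) / 2) x.1.
have sA : absum A by have [_ [h _]] := jacobi0 v p0.
have sB z : absum (B z) by have [h _] := jacobi0 z q0.
have sP : absum P.
  have h := absum_prod (sB (2 * v - v / 2)) sA.
  apply: absum_le h => x; rewrite cnM le_eqVlt; apply/orP; left; apply/eqP.
  rewrite mulrC /P (cnM (A _)); congr (_ * _); rewrite /B (cnM (cexp _)) [RHS](cnM (cexp _)); congr (_ * _).
  rewrite !cn_e2pi; congr (expR (- (_ * _))).
  rewrite !ReImE !Re_int !Im_int /=; ring.
have i2 : 'i * 'i = -1 :> C by rewrite -expr2 sqr_i.
have pV : p^-1 = 'i / (2 * tau).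
  apply: (mulfI pn0); rewrite mulfV// /p.
  transitivity (- ('i * 'i) * (2 * tau / (2 * tau)) : C); last by ring.
  by rewrite i2 opprK mul1r divff// mulf_neq0// pnatr_eq0.
have qE : (3 / 4)%:C = 3 / 4 :> C by rewrite rmorphM fmorphV !(rmorph_nat (real_complex R)).
have E1 l : csum (fun k => theta_term v tau (k, l)) = gauss_const p * csum (fun m => P (l, m)).
  have [_ [s2 J]] := jacobi v (- (l%:~R / 2)) p0.
  pose F := cexp (- (pi : R)%:C * ((3 / 4)%:C * p) * l%:~R ^+ 2) * e2pi (2 * v * l%:~R).
  have e1 k : theta_term v tau (k, l) = cexp (- (pi : R)%:C * p * (k%:~R - - (l%:~R / 2)) ^+ 2) * e2pi (v * k%:~R) * F.
    rewrite /F /theta_term /e2pi -!cexpD; congr cexp; rewrite /fst /snd qE /p !intrD !intrM ?rmorphXn /=.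
    rewrite (_ : 2%:~R = 2 :> C)//.
    by move: (pi%:C) (k%:~R : C) (l%:~R : C) => Pi K L; field.
  have e2 m : P (l, m) = cexp (- ((pi : R)%:C * (v + m%:~R) ^+ 2 / p)) * e2pi (- (l%:~R / 2) * (v + m%:~R)) * F.
    rewrite /P /F /A /B /e2pi -!cexpD; congr cexp; rewrite /fst /snd.
    by move: (pi%:C) (m%:~R : C) (l%:~R : C) (p^-1) => Pi M L w; field.
  rewrite (eq_csum e1) (eq_csum e2) csumZr ?csumZr ?J ?mulrA//.
  have FN : F != 0 by rewrite mulf_neq0 ?cexp_neq0 ?e2pi_neq0.
  have h := absum_reindex bs (absum_theta v t0).
  have h2 := absumZ F^-1 (absum_slice l h).
  by apply: absum_ext h2 => k; rewrite /fst /snd e1 mulrC mulfK.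
rewrite (eq_csum E1) csumZ; last exact: (absum_csum sP).
rewrite (csum_swap sP).
pose tau' := - (3 * tau)^-1.
have t0' : 0 < cIm tau'.
  have n0 : 0 < cRe (3 * tau) ^+ 2 + cIm (3 * tau) ^+ 2.
    by apply: sqr_norm_gt0; rewrite mulf_neq0 ?pnatr_eq0.
  rewrite /tau' -[(3 * tau)^-1]mul1r ImN Im_div -mulNr divr_gt0//.
  by rewrite !ReImE /=; move: t0; lra.
have sD : absum (theta_dual_term v tau).
  have bn : bijective (fun q : int * int => (- q.1, q.2)).
    by exists (fun q => (- q.1, q.2)) => -[a b] /=; rewrite opprK.
  apply: absum_ext (absum_reindex bn (absum_quad 0 (- (v / tau)) t0')) => -[m n].
  rewrite /quad_term /theta_dual_term /tau' /fst /snd mul0r add0r mulNr mulrN sqrrN mulNr.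
  by rewrite (addrAC (m ^+ 2)).
have E2 m : csum (fun l => P (l, m)) = gauss_const ((3 / 4)%:C * p) * (e2pi (- (v ^+ 2 / tau)) *
    csum (fun n => theta_dual_term v tau (m, n))).
  have [_ [s2 J]] := jacobi0 (2 * v - (v + m%:~R) / 2) q0.
  rewrite /P /fst /snd csumZ// J mulrCA; congr (_ * _).
  rewrite -(csumZ (A m) s2) -(csumZ _ (absum_slice m sD)).
  apply: eq_csum => n; rewrite /A /theta_dual_term /e2pi -!cexpD; congr cexp.
  rewrite /fst /snd invfM pV qE !intrD !intrN !intrM ?rmorphXn /=.
  by move: (pi%:C) (m%:~R : C) (n%:~R : C) => Pi M N; field.
rewrite (eq_csum E2) csumZ; last by apply: absumZ; exact: (absum_csum sD).
rewrite csumZ; last exact: (absum_csum sD).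
by rewrite -csum_pair// /theta_const -/p !mulrA.
Qed.


Lemma Theta_T v tau k : 0 < cIm tau -> Theta v (tau + k%:~R) = Theta v tau.
Proof.
move=> t0; rewrite !ThetaE//; last by rewrite ImD Im_int addr0.
apply: eq_csum => x; rewrite /theta_term mulrDr addrA -intrM; exact: e2piDint.
Qed.

Lemma Theta_N v tau : 0 < cIm tau -> Theta (- v) tau = Theta v tau.
Proof.
move=> t0; rewrite !ThetaE//.
have bn : bijective (fun q : int * int => (- q.1, - q.2)).
  by exists (fun q => (- q.1, - q.2)) => -[a b] /=; rewrite !opprK.
rewrite -(csum_reindex _ bn); apply: eq_csum => x.
rewrite /theta_term /fst /snd; congr e2pi; case: x => k l.
rewrite (_ : - k + 2 * - l = - (k + 2 * l)); last by ring.
rewrite (_ : (- k) ^+ 2 + (- l) ^+ 2 + - k * - l = k ^+ 2 + l ^+ 2 + k * l); last by ring.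
by rewrite intrN mulrNN.
Qed.

(** [gauss_const (3 p / 4)] is a real multiple of [gauss_const p], so the product is a multiple of a
    square, which [cgauss_sqr] gives without ambiguity of sign. *)
Lemma theta_constE tau : 0 < cIm tau -> theta_const tau = 2 * ((Num.sqrt 3)^-1)%:C * ('i / (2 * tau)).
Proof.
move=> t0; set p := - (2 * 'i * tau).
have p0 : 0 < cRe p.
  by rewrite /p !ReImE /=; move: t0; case: (tau) => x y /=; lra.
have tn0 : tau != 0 by apply/eqP => h; move: t0; rewrite h ltxx.
have pn0 : p != 0 by apply/eqP => h; move: p0; rewrite h ltxx.
have i2 : 'i * 'i = -1 :> C by rewrite -expr2 sqr_i.
have q0 : 0 < 3 / 4 :> R by rewrite divr_gt0.
have sc : gauss_const ((3 / 4)%:C * p) = ((Num.sqrt (3 / 4))^-1)%:C * gauss_const p := cgauss_scale p0 q0.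
have G2 : gauss_const p ^+ 2 * p = 1 := cgauss_sqr p0.
rewrite /theta_const -/p sc; move: (gauss_const p) G2 => G G2.
have -> : 'i / (2 * tau) = G ^+ 2.
  apply: (mulIf pn0); rewrite G2 /p.
  transitivity (- ('i * 'i) * (2 * tau / (2 * tau)) : C); first by ring.
  by rewrite i2 opprK mul1r divff// mulf_neq0// pnatr_eq0.
have -> : (Num.sqrt (3 / 4))^-1 = 2 * (Num.sqrt 3)^-1 :> R.
  rewrite sqrtrM// sqrtrV// (_ : (4 : R) = 2 ^+ 2) ?sqrtr_sqr ?ger0_norm//; last by ring.
  by rewrite invfM invrK mulrC.
rewrite (rmorphM (real_complex R)) (rmorph_nat (real_complex R)).
by ring.
Qed.

(** The dual form is an integral form divided by 3, so adding [3 k] to [1 / tau] multiplies each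
    term by [e] of an integer. *)
Lemma theta_dual_shift v tau v' tau' k : v' / tau' = v / tau -> (tau' )^-1 = tau^-1 + 3 * k%:~R ->
  csum (theta_dual_term v' tau') = csum (theta_dual_term v tau).
Proof.
move=> e1 e2; apply: eq_csum => x; rewrite /theta_dual_term e1 !invfM e2.
set N := (_ + _)%:~R.
have -> : - (v / tau * x.2%:~R) - N * (3^-1 * (tau^-1 + 3 * k%:~R)) =
   - (v / tau * x.2%:~R) - N * (3^-1 * tau^-1) - N * k%:~R.
  by move: (tau^-1) => w; field.
by rewrite /N -intrM -mulrNz; exact: e2piDint.
Qed.

(** The inversion is applied on both sides: [tau / (3 k tau + 1)] has inverse [1 / tau + 3 k], and
    [v / tau] does not change. *)
Lemma Theta_L v tau k : 0 < cIm tau ->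
  Theta (v / ((3 * k)%:~R * tau + 1)) (tau / ((3 * k)%:~R * tau + 1)) =
  ((3 * k)%:~R * tau + 1) * e2pi ((3 * k)%:~R * v ^+ 2 / ((3 * k)%:~R * tau + 1)) * Theta v tau.
Proof.
move=> t0; set j := (3 * k)%:~R * tau + 1.
have det : 1 * 1 - 0 * (3 * k) = 1 :> int by rewrite mul0r subr0 mulr1.
have j0 : j != 0 by have := cocycle_neq0 det t0; rewrite -/j.
have t0' : 0 < cIm (tau / j).
  by have := Im_mobius_gt0 det t0; rewrite mul1r addr0 -/j.
have tn0 : tau != 0 by apply/eqP => h; move: t0; rewrite h ltxx.
have jE : j = 3 * k%:~R * tau + 1 by rewrite /j intrM.
rewrite (theta_inv _ t0') (theta_inv v t0) (theta_constE t0') (theta_constE t0).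
rewrite (@theta_dual_shift v tau (v / j) (tau / j) k); last 2 first.
- by field; rewrite tn0 j0.
- by rewrite invf_div jE; field.
have eE : e2pi (- ((v / j) ^+ 2 / (tau / j))) = e2pi ((3 * k)%:~R * v ^+ 2 / j) * e2pi (- (v ^+ 2 / tau)).
  rewrite -e2piD; congr e2pi; rewrite intrM.
  have -> : v ^+ 2 / tau = v ^+ 2 / (tau * j) * j by field; rewrite tn0 j0.
  have -> : (v / j) ^+ 2 / (tau / j) = v ^+ 2 / (tau * j) by field; rewrite tn0 j0.
  have -> : 3%:~R * k%:~R * v ^+ 2 / j = v ^+ 2 / (tau * j) * (3 * k%:~R * tau) by field; rewrite tn0 j0.
  by rewrite jE; ring.
rewrite eE; move: (e2pi _) (e2pi _) (csum _) (_%:C) => a b S s.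
by field; rewrite tn0 j0.
Qed.

Lemma legendre3_mod d d' : (d %% 3)%Z = (d' %% 3)%Z -> legendre 3 d = legendre 3 d'.
Proof.
move=> h; have E1 : (3%:Z %| d)%Z = (3%:Z %| d')%Z by apply/dvdz_mod0P/dvdz_mod0P; rewrite h.
have E2 : [exists x : 'I_3, (x%:Z ^+ 2 == d %[mod 3%:Z])%Z] =
    [exists x : 'I_3, (x%:Z ^+ 2 == d' %[mod 3%:Z])%Z] by apply: eq_existsb => x; rewrite h.
by rewrite /legendre E1 E2.
Qed.

Lemma legendre3_1 : legendre 3 1 = 1.
Proof. by rewrite /legendre /= ifT//; apply/existsP; exists (inord 1); rewrite inordK. Qed.

Lemma legendre3_N1 : legendre 3 (-1) = -1.
Proof.
rewrite /legendre /= ifF//; apply/negbTE; rewrite negb_exists; apply/forallP.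
by case; case=> [|[|[|]]].
Qed.

Definition theta_modular a b c d := forall v tau, 0 < cIm tau ->
  Theta (v / (c%:~R * tau + d%:~R)) ((a%:~R * tau + b%:~R) / (c%:~R * tau + d%:~R)) =
  (legendre 3 d)%:~R * (c%:~R * tau + d%:~R) * e2pi (c%:~R * v ^+ 2 / (c%:~R * tau + d%:~R)) * Theta v tau.

(** Right multiplication by a translation; [d] changes by a multiple of 3, so its Legendre symbol
    stays. *)
Lemma theta_modular_T a b c d k : (3 %| c)%Z -> theta_modular a b c d ->
  theta_modular a (a * k + b) c (c * k + d).
Proof.
move=> c3 P v tau t0.
have t0' : 0 < cIm (tau + k%:~R) by rewrite ImD Im_int addr0.
have := P v (tau + k%:~R) t0'; rewrite Theta_T//.
have -> : c%:~R * (tau + k%:~R) + d%:~R = c%:~R * tau + (c * k + d)%:~R by rewrite intrD intrM; ring.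
have -> : a%:~R * (tau + k%:~R) + b%:~R = a%:~R * tau + (a * k + b)%:~R by rewrite intrD intrM; ring.
rewrite (@legendre3_mod (c * k + d) d)//.
by case/dvdzP: c3 => q ->; rewrite mulrAC modzMDl.
Qed.

(** Right multiplication by the lower triangular matrix of [Theta_L]; the cocycles multiply. *)
Lemma theta_modular_L a b c d k : a * d - b * c = 1 -> theta_modular a b c d ->
  theta_modular (a + 3 * k * b) b (c + 3 * k * d) d.
Proof.
move=> det P v tau t0; set g := (3 * k)%:~R * tau + 1.
have det1 : 1 * 1 - 0 * (3 * k) = 1 :> int by rewrite mul0r subr0 mulr1.
have g0 : g != 0 by have := cocycle_neq0 det1 t0; rewrite -/g.
have t1 : 0 < cIm (tau / g) by have := Im_mobius_gt0 det1 t0; rewrite mul1r addr0 -/g.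
have := P (v / g) (tau / g) t1; rewrite (Theta_L v k t0) -/g.
have det2 : (a + 3 * k * b) * d - b * (c + 3 * k * d) = 1 by rewrite -det; ring.
have J0 := cocycle_neq0 det2 t0.
set J := _ + _ in J0 *.
have gE : g = 3 * k%:~R * tau + 1 by rewrite /g intrM.
have e3 : 3%:~R = 3 :> C by [].
have jE : c%:~R * (tau / g) + d%:~R = J / g.
  transitivity ((c%:~R * tau + d%:~R * g) / g); first by field.
  by congr (_ / _); rewrite gE /J intrD !intrM e3; ring.
have nE : a%:~R * (tau / g) + b%:~R = ((a + 3 * k * b)%:~R * tau + b%:~R) / g.
  transitivity ((a%:~R * tau + b%:~R * g) / g); first by field.
  by congr (_ / _); rewrite gE intrD !intrM e3; ring.
have eE : e2pi ((c + 3 * k * d)%:~R * v ^+ 2 / J) =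
    e2pi (c%:~R * (v / g) ^+ 2 / (J / g)) * e2pi ((3 * k)%:~R * v ^+ 2 / g).
  rewrite -e2piD; congr e2pi.
  transitivity ((c%:~R + (3 * k)%:~R * J) * v ^+ 2 / (J * g)); last by field; rewrite J0 g0.
  transitivity ((c + 3 * k * d)%:~R * g * v ^+ 2 / (J * g)); first by field; rewrite J0 g0.
  congr (_ * _ / _); rewrite gE /J !intrD !intrM e3; ring.
rewrite jE nE eE.
have -> : v / g / (J / g) = v / J by field; rewrite J0 g0.
have -> : ((a + 3 * k * b)%:~R * tau + b%:~R) / g / (J / g) = ((a + 3 * k * b)%:~R * tau + b%:~R) / J.
  by field; rewrite J0 g0.
move=> ->; move: (e2pi _) (e2pi _) (Theta _ _) => x y S; field; exact: g0.
Qed.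

Lemma theta_modular_c0 a b d : a * d = 1 -> theta_modular a b 0 d.
Proof.
move=> ad v tau t0; rewrite mul0r add0r mul0r mul0r e2pi0 mulr1.
have : (d == 1) || (d == -1).
  have : (`|d| %| 1)%N by apply/dvdnP; exists `|a|%N; rewrite -abszM ad.
  rewrite dvdn1; lia.
move=> /orP[/eqP d1|/eqP d1].
  have a1 : a = 1 by move: ad; rewrite d1; lia.
  by rewrite d1 a1 legendre3_1 !divr1 !mul1r Theta_T.
have a1 : a = -1 by move: ad; rewrite d1; lia.
rewrite d1 a1 legendre3_N1 (_ : (-1)%:~R = -1 :> C)// invrN1 !mulrN1 mulN1r opprK mul1r.
by rewrite opprD opprK -mulrNz Theta_T// Theta_N.
Qed.

(** The remainder of least absolute value; the gain of a factor 2 makes the descent in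
    [theta_Gamma0] strict. *)
Lemma reduce_mod d c : c != 0 -> exists k, (2 * absz (d + c * k)%R <= absz c)%N.
Proof.
move=> c0; have h1 := divz_eq d c; have h2 := modz_ge0 d c0; have h3 := ltz_mod d c0.
set q := (d %/ c)%Z in h1; set r := (d %% c)%Z in h1 h2 h3.
have [h|h] := leP (2 * r) `|c|.
  exists (- q); rewrite {1}h1 (_ : q * c + r + c * - q = r); last by ring.
  lia.
have [cp|cn] := ltP 0 c.
  exists (- q - 1); rewrite {1}h1 (_ : q * c + r + c * (- q - 1) = r - c); last by ring.
  lia.
exists (- q + 1); rewrite {1}h1 (_ : q * c + r + c * (- q + 1) = r + c); last by ring.
lia.
Qed.

(** Euclid's algorithm on the bottom row: reduce [d] modulo [c], then [c] modulo [3 d]. With centred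
    remainders [|d1| <= |c| / 2] and [|c1| <= 3 |d1| / 2 <= 3 |c| / 4], so [|c|] decreases and stays
    divisible by 3 until it is 0. *)
Theorem theta_Gamma0 a b c d : Gamma0 3 a b c d -> theta_modular a b c d.
Proof.
move=> /andP[/eqP det c3].
have [N] := ubnP `|c|%N; elim: N a b c d det c3 => // N IH a b c d det c3 cN.
have [c0|c0] := eqVneq c 0.
  by rewrite c0; apply: theta_modular_c0; rewrite -det c0 mulr0 subr0.
have [k kd] := reduce_mod d c0.
set d1 := d + c * k in kd; pose b1 := a * k + b.
(* [d1 = 0] would make 3 divide the determinant. *)
have d1n : 3 * d1 != 0.
  apply/eqP => d10.
  have d10' : d1 = 0 by lia.
  have : a * d1 - b1 * c = 1 by rewrite -det /d1 /b1; ring.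
  rewrite d10' mulr0 sub0r; case/dvdzP: c3 => q ->; lia.
have [k' kc] := reduce_mod c d1n.
have c1E : c + 3 * d1 * k' = c + 3 * k' * d1 by ring.
rewrite c1E in kc; set c1 := c + 3 * k' * d1 in kc.
have det1 : a * d1 - b1 * c = 1 by rewrite -det /d1 /b1; ring.
have det2 : (a + 3 * k' * b1) * d1 - b1 * c1 = 1 by rewrite -[RHS]det1 /c1; ring.
have c13 : (3 %| c1)%Z by case/dvdzP: c3 => q cq; apply/dvdzP; exists (q + k' * d1); rewrite /c1 cq; ring.
have P2 : theta_modular (a + 3 * k' * b1) b1 c1 d1 by apply: IH => //; lia.
have P1 := @theta_modular_L _ _ _ _ (- k') det2 P2.
have e1 : a + 3 * k' * b1 + 3 * - k' * b1 = a by ring.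
have e2 : c1 + 3 * - k' * d1 = c by rewrite /c1; ring.
rewrite e1 e2 in P1.
have := @theta_modular_T _ _ _ _ (- k) c3 P1.
have -> : a * - k + b1 = b by rewrite /b1; ring.
by have -> : c * - k + d1 = d by rewrite /d1; ring.
Qed.

End Modular.

(** * The modular sum over Z^4 *)
Section Lattice.
Variable R : realType.
Local Notation C := R[i].
Implicit Types (z w u v tau : C).

Definition cbar z : C := (cRe z)%:C - 'i * (cIm z)%:C.

Lemma Re_cbar z : cRe (cbar z) = cRe z. Proof. by rewrite !ReImE /=; ring. Qed.
Lemma Im_cbar z : cIm (cbar z) = - cIm z. Proof. by rewrite !ReImE /=; ring. Qed.

Lemma cbarD z w : cbar (z + w) = cbar z + cbar w.
Proof. by apply: ceqP; rewrite !(Re_cbar, Im_cbar, ReD, ImD)//; ring. Qed.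

Lemma cbarM z w : cbar (z * w) = cbar z * cbar w.
Proof. by apply: ceqP; rewrite !(Re_cbar, Im_cbar, ReM, ImM)//; ring. Qed.

Lemma cbar_int (n : int) : cbar n%:~R = n%:~R.
Proof. by apply: ceqP; rewrite !(Re_cbar, Im_cbar) ?Re_int ?Im_int ?oppr0. Qed.

Lemma cbar_sub z : z - cbar z = 2 * 'i * (cIm z)%:C.
Proof. by apply: ceqP; rewrite !ReImE /=; ring. Qed.

Lemma cbar_neq0 z : z != 0 -> cbar z != 0.
Proof.
apply: contra => /eqP h; apply/eqP; apply: ceqP.
  by have := congr1 cRe h; rewrite Re_cbar.
by have := congr1 cIm h; rewrite Im_cbar => /eqP; rewrite oppr_eq0 => /eqP.
Qed.

Lemma cbarV z : cbar z^-1 = (cbar z)^-1.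
Proof.
have [->|z0] := eqVneq z 0; first by rewrite invr0 (cbar_int 0) invr0.
have zb := cbar_neq0 z0.
apply: (mulIf zb); rewrite mulVf// -cbarM mulVf//.
exact: (cbar_int 1).
Qed.

Lemma cn_cbar z : cn (cbar z) = cn z.
Proof.
case: z => x y; rewrite /cbar /=; congr (Num.sqrt _); ring.
Qed.

(* The exponent of the summand of [Fsum] in terms of the lattice vectors
   [w1 = r1 tau + m], [w2 = r2 tau + n], their conjugates [w1b], [w2b] and the
   pairing [L]: in this form the action of [Gamma0(3)] only rescales. *)
Definition expo (Q tau tb u v wb w1 w1b w2 w2b L : C) : C :=
  - (2 * Q / (3 * (tau - tb))) * (w1 * w1b + (w1 * w2b + w1b * w2) / 2 + w2 * w2b) - Q * L
  + 2 * Q / (tau - tb) * (u ^+ 2 - 2 * u * v - 2 * u * wb - v * (w1b + w2b) - wb * (w1 + w2)).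

(** Conjugates are treated as independent variables, which makes this an identity of rational
    functions. *)
Lemma expo_expand (Q tau tb u v wb K1 K2 M N : C) : tau - tb != 0 ->
  let w1 := (2 * K1 + K2) * tau + M in let w2 := (K2 - K1) * tau + N in
  let w1b := (2 * K1 + K2) * tb + M in let w2b := (K2 - K1) * tb + N in
  let a := (u - v - wb) / (tau - tb) in
  2 * Q * (v * (K1 + 2 * K2) + (K1 ^+ 2 + K2 ^+ 2 + K1 * K2) * tau)
  - 2 * Q * ((u + w1) ^+ 2 + (u + w1) * (u + w2) + (u + w2) ^+ 2) / (3 * (tau - tb))
  + (2 * Q * (a * (u + w1)) + 2 * Q * (a * (u + w2))) =
  expo Q tau tb u v wb w1 w1b w2 w2b (K1 * M + K2 * (M + N)).
Proof. by move=> D0 /=; rewrite /expo; field. Qed.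

(** [tau - tb] scales by [1 / (j jb)], so every product of a plain and a barred variable is
    invariant. Only [u^2 - 2 u v] has no bar; its factor [jb / j = 1 - c (tau - tb) / j] produces
    the automorphy exponent. *)
Lemma expo_transform (Q tau tb u v wb w1 w1b w2 w2b L L' c j jb t t' : C) :
  tau - tb != 0 -> j != 0 -> jb != 0 -> jb = j - c * (tau - tb) ->
  t - t' = (tau - tb) / (j * jb) ->
  expo Q t t' (u / j) (v / j) (wb / jb) (w1 / j) (w1b / jb) (w2 / j) (w2b / jb) L' =
  expo Q tau tb u v wb w1 w1b w2 w2b L + 2 * Q * (- (c * (u - v) ^+ 2 / j) + c * v ^+ 2 / j) + Q * (L - L').
Proof.
move=> D0 j0 jb0 jE tE; rewrite /expo tE.
move: (tau - tb) D0 jE tE => D D0 jE _.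
rewrite jE in jb0 *.
by field; rewrite jb0 j0 D0.
Qed.

Definition lam1 tau (k : int * int) : C := (2 * k.1 + k.2)%:~R * tau.
Definition lam2 tau (k : int * int) : C := (k.2 - k.1)%:~R * tau.

Definition idx := ((int * int) * (int * int))%type.

Definition om1 tau (x : idx) : C := lam1 tau x.1 + x.2.1%:~R.
Definition om2 tau (x : idx) : C := lam2 tau x.1 + x.2.2%:~R.
Definition pairing (x : idx) : int := x.1.1 * x.2.1 + x.1.2 * (x.2.1 + x.2.2).

Definition Fterm u v tau (x : idx) : C :=
  theta_term v tau x.1 * Rt (cIm tau) (u + lam1 tau x.1) (u + lam2 tau x.1)
    (cIm (u - v) / cIm tau) (cIm (u - v) / cIm tau) x.2.

Definition Qpi : C := (pi : R)%:C * 'i.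

(** Conjugates enter through [a = Im (u - v) / Im tau] and through [Im tau] in the denominator of
    the Gaussian. *)
Lemma FtermE u v tau x : 0 < cIm tau -> Fterm u v tau x =
  cexp (expo Qpi tau (cbar tau) u v (cbar (u - v)) (om1 tau x) (cbar (om1 tau x))
   (om2 tau x) (cbar (om2 tau x)) (pairing x)%:~R) / ((u + om1 tau x) * (u + om2 tau x)).
Proof.
move=> t0; have Dn0 : tau - cbar tau != 0.
  rewrite cbar_sub -cn_eq0 !cnM cn_i cn_real mulr1 mulf_neq0 ?normr_eq0 ?gt_eqF//.
  by rewrite cn_gt0 pnatr_eq0.
have Tn0 : (cIm tau)%:C != 0 :> C by rewrite -cn_eq0 cn_real normr_eq0 gt_eqF.
have i0 : 'i != 0 :> C by rewrite -cn_eq0 cn_i oner_eq0.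
case: x => -[k1 k2] [m n].
have := @expo_expand Qpi tau (cbar tau) u v (cbar (u - v)) k1%:~R k2%:~R m%:~R n%:~R Dn0.
move=> /=; set a := (u - v - cbar (u - v)) / _ => EX.
have aE : (cIm (u - v) / cIm tau)%:C = a.
  rewrite /a !cbar_sub rmorphM fmorphV /=.
  move: (cIm (u - v))%:C (cIm tau)%:C Tn0 => x y y0.
  by field; rewrite y0 i0.
have o1 : om1 tau ((k1, k2), (m, n)) = (2 * k1%:~R + k2%:~R) * tau + m%:~R.
  by rewrite /om1 /lam1 /= intrD intrM.
have o2 : om2 tau ((k1, k2), (m, n)) = (k2%:~R - k1%:~R) * tau + n%:~R.
  by rewrite /om2 /lam2 /= intrD mulrNz.
have o1b : cbar (om1 tau ((k1, k2), (m, n))) = (2 * k1%:~R + k2%:~R) * cbar tau + m%:~R.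
  by rewrite /om1 /lam1 /= cbarD cbarM !cbar_int intrD intrM.
have o2b : cbar (om2 tau ((k1, k2), (m, n))) = (k2%:~R - k1%:~R) * cbar tau + n%:~R.
  by rewrite /om2 /lam2 /= cbarD cbarM !cbar_int intrD mulrNz.
have pE : (pairing ((k1, k2), (m, n)))%:~R = k1%:~R * m%:~R + k2%:~R * (m%:~R + n%:~R) :> C.
  by rewrite /pairing /= intrD !intrM intrD.
rewrite o1b o2b o1 o2 pE -EX /Fterm /Rt.
rewrite [theta_term _ _ _ * _]mulrA; congr (_ / _); last first.
  by rewrite /lam1 /lam2 /= !intrD mulrNz intrM -!addrA.
rewrite /theta_term /GG /e2pi -!cexpD; congr cexp; rewrite aE /fst /snd /lam1 /lam2.
rewrite (intrD _ k1) !intrM !intrD ?intrM !mulrNz (_ : 2%:~R = 2 :> C)//.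
have T3 : (3 * cIm tau)%:C = 3 * (tau - cbar tau) / (2 * 'i).
  rewrite cbar_sub rmorphM (rmorph_nat (real_complex R)); by field.
rewrite T3 /Qpi; move: (tau - cbar tau) Dn0 {EX aE T3} => D D0.
move: (a) (pi%:C) (k1%:~R : C) (k2%:~R : C) (m%:~R : C) (n%:~R : C) => A P K1 K2 M N.
by field; rewrite D0 i0.
Qed.

(** On the row vectors [(2 k1 + k2, m)] and [(k2 - k1, n)] this is right multiplication by the
    matrix with [c = 3 c3]. The two first entries are congruent modulo 3 and must remain so, which
    is where the level comes from. *)
Definition moebius_idx (a b c3 d : int) (x : idx) : idx :=
  ((a * x.1.1 + c3 * (x.2.1 - x.2.2), a * x.1.2 + c3 * (x.2.1 + 2 * x.2.2)),
   (b * (2 * x.1.1 + x.1.2) + d * x.2.1, b * (x.1.2 - x.1.1) + d * x.2.2)).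

Lemma moebius_idxK (a b c3 d : int) : a * d - b * (3 * c3) = 1 ->
  cancel (moebius_idx a b c3 d) (moebius_idx d (- b) (- c3) a).
Proof.
move=> det [[k1 k2] [m n]]; rewrite /moebius_idx /=.
have E (k l : int) : l = (a * d - b * (3 * c3)) * k -> l = k by rewrite det mul1r.
congr (_, _, (_, _)); apply: E; ring.
Qed.

Lemma moebius_idx_bij (a b c3 d : int) : a * d - b * (3 * c3) = 1 ->
  bijective (moebius_idx a b c3 d).
Proof.
move=> det; exists (moebius_idx d (- b) (- c3) a); first exact: moebius_idxK.
have det' : d * a - (- b) * (3 * - c3) = 1 by rewrite -[RHS]det; ring.
by have := moebius_idxK det'; rewrite !opprK.
Qed.

(** The exponent contains [- pi i] times the pairing, so only its parity matters. *)
Lemma pairing_moebius (a b c3 d : int) x : a * d - b * (3 * c3) = 1 ->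
  exists q : int, pairing (moebius_idx a b c3 d x) = pairing x + 2 * q.
Proof.
case: x => -[k1 k2] [m n] det.
exists (a * b * (k1 ^+ 2 + k1 * k2 + k2 ^+ 2) + c3 * d * (m ^+ 2 + m * n + n ^+ 2)
  + b * (3 * c3) * (k1 * m + k2 * (m + n))).
(* The determinant relation is used once, on the pairing; what remains is a polynomial identity. *)
have E (k l : int) : l = (a * d - b * (3 * c3)) * k + (l - (a * d - b * (3 * c3)) * k) by ring.
rewrite /pairing /moebius_idx /=.
rewrite [LHS](E (k1 * m + k2 * (m + n))) {1}det mul1r; congr (_ + _).
ring.
Qed.

Lemma cexp_2Q z : cexp (2 * Qpi * z) = e2pi z.
Proof. by rewrite /e2pi /Qpi !mulrA. Qed.

Lemma mul_swap (e f J Z : C) : e * f * (J / Z) = J * f * (e / Z).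
Proof. by ring. Qed.

(** The factor [j ^ 2] comes from the two denominators, the exponential from [expo_transform]. *)
Lemma Fterm_moebius u v tau (a b c3 d : int) x (j := (3 * c3)%:~R * tau + d%:~R) :
  0 < cIm tau -> a * d - b * (3 * c3) = 1 ->
  Fterm (u / j) (v / j) ((a%:~R * tau + b%:~R) / j) x =
  j ^+ 2 * e2pi (- ((3 * c3)%:~R * (u - v) ^+ 2 / j) + (3 * c3)%:~R * v ^+ 2 / j)
  * Fterm u v tau (moebius_idx a b c3 d x).
Proof.
move=> t0 det; set tau' := (a%:~R * tau + b%:~R) / j; set y := moebius_idx a b c3 d x.
have t0' : 0 < cIm tau' by exact: Im_mobius_gt0 det t0.
have j0 : j != 0 by exact: cocycle_neq0 det t0.
have jb0 := cbar_neq0 j0.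
have Dn0 : tau - cbar tau != 0.
  rewrite cbar_sub -cn_eq0 !cnM cn_i cn_real mulr1 mulf_neq0 ?normr_eq0 ?gt_eqF//.
  by rewrite cn_gt0 pnatr_eq0.
have jbE : cbar j = j - (3 * c3)%:~R * (tau - cbar tau).
  by rewrite /j cbarD cbarM !cbar_int; ring.
have tE : tau' - cbar tau' = (tau - cbar tau) / (j * cbar j).
  rewrite /tau' (cbarM _ j^-1) cbarV (cbarD (a%:~R * tau)) (cbarM a%:~R) !cbar_int.
  transitivity (((a%:~R * tau + b%:~R) * cbar j - (a%:~R * cbar tau + b%:~R) * j) / (j * cbar j)).
    by field; rewrite j0 jb0.
  congr (_ / _).
  have detC : a%:~R * d%:~R - b%:~R * (3 * c3)%:~R = 1 :> C by rewrite -!intrM -intrB det.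
  rewrite -[RHS]mul1r -[X in _ = X * _]detC /j cbarD cbarM !cbar_int.
  by move: ((3 * c3)%:~R : C) => K; ring.
have o1 : om1 tau' x = om1 tau y / j.
  transitivity (((2 * x.1.1 + x.1.2)%:~R * (a%:~R * tau + b%:~R) + x.2.1%:~R * j) / j).
    by rewrite /om1 /lam1 /tau'; field.
  congr (_ / _); rewrite /om1 /lam1 /y /moebius_idx /j /=; case: (x) => -[k1 k2] [m n] /=.
  by rewrite !(intrD, intrM, mulrNz); ring.
have o2 : om2 tau' x = om2 tau y / j.
  transitivity (((x.1.2 - x.1.1)%:~R * (a%:~R * tau + b%:~R) + x.2.2%:~R * j) / j).
    by rewrite /om2 /lam2 /tau'; field.
  congr (_ / _); rewrite /om2 /lam2 /y /moebius_idx /j /=; case: (x) => -[k1 k2] [m n] /=.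
  by rewrite !(intrD, intrM, mulrNz); ring.
have wE : cbar (u / j - v / j) = cbar (u - v) / cbar j by rewrite -mulrBl cbarM cbarV.
rewrite (FtermE _ _ _ t0') (FtermE _ _ _ t0) wE o1 o2 !(cbarM _ j^-1) !cbarV.
rewrite (@expo_transform Qpi tau (cbar tau) u v (cbar (u - v)) _ _ _ _ (pairing y)%:~R _ (3 * c3)%:~R)//; last first.
  by rewrite -tE /tau' (cbarM _ j^-1) cbarV.
have [q qE] := pairing_moebius x det.
have LE : Qpi * ((pairing y)%:~R - (pairing x)%:~R) = 2 * Qpi * q%:~R.
  by rewrite /y qE intrD intrM (_ : 2%:~R = 2 :> C)//; move: Qpi => Q; ring.
rewrite LE (cexpD _ (2 * Qpi * q%:~R)) cexp_2Q e2pi_int mulr1 cexpD cexp_2Q.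
have -> : (u / j + om1 tau y / j) * (u / j + om2 tau y / j) = ((u + om1 tau y) * (u + om2 tau y)) / j ^+ 2.
  by field.
rewrite invf_div; move: (cexp _) (e2pi _) (_ * (u + _)) => e f Z.
exact: mul_swap.
Qed.

(** Except in the two rows [r] that enclose [- Im u / Im tau], the imaginary part alone is at least
    [Im tau]; these two rows are translates of the integers. *)
Lemma lattice_lower_bound u tau : 0 < cIm tau ->
  (forall r m : int, u + r%:~R * tau + m%:~R != 0) ->
  exists2 d : R, 0 < d & forall r m : int, d <= cn (u + r%:~R * tau + m%:~R).
Proof.
move=> t0 hu; pose T := cIm tau; pose y := cIm u; pose r0 := Num.floor (- y / T).
have [d1 d10 h1] := exists_lower_bound (hu r0).
have [d2 d20 h2] := exists_lower_bound (hu (r0 + 1)).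
exists (Num.min T (Num.min d1 d2)); first by rewrite !lt_min t0 d10 d20.
move=> r m; rewrite !ge_min.
have f1 : r0%:~R <= - y / T by exact: floor_le.
have f2 : - y / T < r0%:~R + 1 by have := lt_succ_floor (- y / T); rewrite intrD.
rewrite ler_pdivlMr// in f1; rewrite ltr_pdivrMr// in f2.
have [rr|rn] := eqVneq r r0; first by rewrite rr h1 orbT.
have [rr|rn'] := eqVneq r (r0 + 1); first by rewrite rr h2 !orbT.
apply/orP; left; apply: le_trans (Im_le_cn _).
rewrite !ReImE !Re_int !Im_int mul0r !addr0 -/y -/T.
have T0 : 0 < T := t0.
have [lt|gt] := ltP r r0.
  have : (r%:~R : R) + 1 <= r0%:~R by rewrite -[1]/(1%:~R) -intrD ler_int; lia.
  rewrite -(ler_pM2r T0) => h.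
  by rewrite ler0_norm; lra.
have : (r0%:~R : R) + 1 + 1 <= r%:~R by rewrite -[1]/(1%:~R) -!intrD ler_int; lia.
rewrite -(ler_pM2r T0) => h.
by rewrite ger0_norm; lra.
Qed.

(** The constant comes from [2 (r x + m)^2 + (1 + 2 x^2) r^2 = r^2 + m^2 + (2 r x + m)^2]. *)
Lemma om_norm_ge (x T r m : R) : 0 < T ->
  (2 + (1 + 2 * x ^+ 2) / T ^+ 2)^-1 * (r ^+ 2 + m ^+ 2) <= (r * x + m) ^+ 2 + (r * T) ^+ 2.
Proof.
move=> T0; have T2 : 0 < T ^+ 2 by rewrite exprn_gt0.
set q := (1 + 2 * x ^+ 2) / T ^+ 2.
have q0 : 0 <= q by rewrite divr_ge0 ?(ltW T2)// addr_ge0// mulr_ge0// sqr_ge0.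
have p0 : 0 < 2 + q by lra.
rewrite mulrC ler_pdivrMr//.
have qT : q * T ^+ 2 = 1 + 2 * x ^+ 2 by rewrite /q mulfVK// gt_eqF.
have -> : ((r * x + m) ^+ 2 + (r * T) ^+ 2) * (2 + q) =
  r ^+ 2 * (q * T ^+ 2) + 2 * (r * x + m) ^+ 2 + (2 * (r * T) ^+ 2 + q * (r * x + m) ^+ 2) by ring.
rewrite qT.
have h1 : 0 <= 2 * (r * T) ^+ 2 + q * (r * x + m) ^+ 2.
  by rewrite addr_ge0// mulr_ge0// sqr_ge0.
have h2 := sqr_ge0 (2 * r * x + m).
lra.
Qed.

Lemma norm_sum_le (k l : R) : `|2 * k + l| + `|l - k| <= 3 * (`|k| + `|l|).
Proof.
have h1 : `|2 * k + l| <= 2 * `|k| + `|l|.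
  by rewrite (le_trans (ler_normD _ _))// normrM ger0_norm.
have h2 : `|l - k| <= `|l| + `|k| by exact: ler_normB.
have := normr_ge0 l; lra.
Qed.

Lemma sqr_sum_le (k l : R) : k ^+ 2 + l ^+ 2 <= (2 * k + l) ^+ 2 + (l - k) ^+ 2.
Proof. have := sqr_ge0 (k + l); have := sqr_ge0 k; lra. Qed.

Lemma Re_hermitian (w1 w2 : C) : cRe (w1 * cbar w1 + (w1 * cbar w2 + cbar w1 * w2) / 2 + w2 * cbar w2) =
  cRe w1 ^+ 2 + cIm w1 ^+ 2 + (cRe w1 * cRe w2 + cIm w1 * cIm w2) + (cRe w2 ^+ 2 + cIm w2 ^+ 2).
Proof.
rewrite -[2 : C](rmorph_nat (real_complex R)) -fmorphV [_ * (2^-1)%:C]mulrC.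
rewrite ReD (ReD (w1 * _)) Re_realM !(ReM, ReD, Re_cbar, Im_cbar).
by field.
Qed.

Lemma hermitian_ge (q x T r1 r2 m n : R) :
  q * (r1 ^+ 2 + m ^+ 2) <= (r1 * x + m) ^+ 2 + (r1 * T) ^+ 2 ->
  q * (r2 ^+ 2 + n ^+ 2) <= (r2 * x + n) ^+ 2 + (r2 * T) ^+ 2 ->
  q / 2 * (r1 ^+ 2 + m ^+ 2 + (r2 ^+ 2 + n ^+ 2)) <=
  (r1 * x + m) ^+ 2 + (r1 * T) ^+ 2 + ((r1 * x + m) * (r2 * x + n) + r1 * T * (r2 * T))
  + ((r2 * x + n) ^+ 2 + (r2 * T) ^+ 2).
Proof.
move=> h1 h2.
have := sqr_ge0 (r1 * x + m + (r2 * x + n)); have := sqr_ge0 (r1 * T + r2 * T).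
by move: (r1 * x + m) (r1 * T) (r2 * x + n) (r2 * T) h1 h2 => a b c d; lra.
Qed.

(** The denominators are bounded below, the hermitian form gives Gaussian decay in [(r1, m, r2, n)],
    and [(r1, r2)] controls [(k1, k2)]; the remaining terms of the exponent are linear. *)
Lemma absum_Fterm u v tau : 0 < cIm tau ->
  (forall r m : int, u + r%:~R * tau + m%:~R != 0) -> absum (Fterm u v tau).
Proof.
move=> t0 hu; have [dl dl0 dlb] := lattice_lower_bound t0 hu.
pose T := cIm tau; pose x := cRe tau.
have T0 : 0 < T := t0.
pose kap := (2 + (1 + 2 * x ^+ 2) / T ^+ 2)^-1.
have kap0 : 0 < kap.
  by rewrite invr_gt0 ltr_wpDr// divr_ge0 ?sqr_ge0// addr_ge0// mulr_ge0// sqr_ge0.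
pose pT := pi / T.
have pT0 : 0 < pT by rewrite divr_gt0 ?pi_gt0.
pose A := pT / 6 * kap.
have A0 : 0 < A by rewrite mulr_gt0// divr_gt0.
pose wb := cbar (u - v).
pose B := pT * ((cn v + cn wb) * (cn tau + 1)).
have B0 : 0 <= B by rewrite mulr_ge0 ?(ltW pT0)// mulr_ge0 ?addr_ge0 ?cn_ge0.
pose cst := u ^+ 2 - 2 * u * v - 2 * u * wb.
pose K := pT * cn cst.
pose g (k : int * int) : R := expR (- A * (k.1%:~R ^+ 2 + k.2%:~R ^+ 2) + 3 * B * (`|k.1%:~R| + `|k.2%:~R|) + K).
pose h (k : int * int) : R := expR (- A * (k.1%:~R ^+ 2 + k.2%:~R ^+ 2) + 3 * B * (`|k.1%:~R| + `|k.2%:~R|) + 0).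
have d2 : 0 <= dl^-1 * dl^-1 by rewrite mulr_ge0 ?invr_ge0 ?(ltW dl0).
apply: absum_le (nnsZ d2 (nns_prod (nns_gauss2 (3 * B) K A0) (nns_gauss2 (3 * B) 0 A0))) => y.
rewrite (FtermE _ _ _ t0) cnM mulrC; apply: ler_pM; rewrite ?cn_ge0//.
  rewrite cnV cnM invfM; apply: ler_pM; rewrite ?invr_ge0 ?cn_ge0//.
    by rewrite /om1 addrA lef_pV2 ?posrE ?dlb// (lt_le_trans dl0) ?dlb.
  by rewrite /om2 addrA lef_pV2 ?posrE ?dlb// (lt_le_trans dl0) ?dlb.
rewrite cn_cexp -expRD ler_expR.
have QD : 2 * Qpi / (tau - cbar tau) = pT%:C.
  rewrite cbar_sub /pT rmorphM fmorphV /= -/T /Qpi.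
  have Tn0 : T%:C != 0 :> C by rewrite -cn_eq0 cn_real normr_eq0 gt_eqF.
  have i0 : 'i != 0 :> C by rewrite -cn_eq0 cn_i oner_eq0.
  by move: (pi%:C) (T%:C) Tn0 => P t tn; field; rewrite tn i0.
have QD3 : 2 * Qpi / (3 * (tau - cbar tau)) = (pT / 3)%:C.
  rewrite (_ : (pT / 3)%:C = pT%:C / 3); last first.
    by rewrite (rmorphM (real_complex R) pT) fmorphV (rmorph_nat (real_complex R)).
  by rewrite -QD invfM [RHS]mulrAC mulrA.
rewrite /expo QD QD3 -/wb -/cst.
set w1 := om1 tau y; set w2 := om2 tau y.
have -> : cst - v * (cbar w1 + cbar w2) - wb * (w1 + w2) = cst - (v * (cbar w1 + cbar w2) + wb * (w1 + w2)).
  by move: (v * _) (wb * _) => A1 A2; rewrite opprD addrA.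
(* [Qpi] is purely imaginary: the pairing contributes only a phase. *)
have L0 : cRe (Qpi * (pairing y)%:~R) = 0.
  by rewrite /Qpi !ReImE Re_int Im_int /=; ring.
rewrite ReD [cRe (_ - Qpi * _)]ReD (ReN (Qpi * _)) L0 oppr0 addr0 -rmorphN !Re_realM.
have linb : cRe (cst - (v * (cbar w1 + cbar w2) + wb * (w1 + w2))) <=
    cn cst + (cn v + cn wb) * (cn w1 + cn w2).
  rewrite (le_trans (ler_norm _))// (le_trans (Re_le_cn _))// (le_trans (cnB _ _))// lerD2l.
  rewrite (le_trans (cnD _ _))// [leRHS]mulrDl !cnM; apply: lerD.
    by rewrite ler_wpM2l ?cn_ge0// (le_trans (cnD _ _))// !cn_cbar.
  by rewrite ler_wpM2l ?cn_ge0// cnD.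
pose r1 : R := (2 * y.1.1 + y.1.2)%:~R; pose r2 : R := (y.1.2 - y.1.1)%:~R.
pose m : R := y.2.1%:~R; pose n : R := y.2.2%:~R.
have cw1 : cn w1 <= (cn tau + 1) * (`|r1| + `|m|).
  rewrite /w1 /om1 /lam1 (le_trans (cnD _ _))// cnM !cn_int -/r1 -/m.
  have := mulr_ge0 (cn_ge0 tau) (normr_ge0 m); have := normr_ge0 r1; lra.
have cw2 : cn w2 <= (cn tau + 1) * (`|r2| + `|n|).
  rewrite /w2 /om2 /lam2 (le_trans (cnD _ _))// cnM !cn_int -/r2 -/n.
  have := mulr_ge0 (cn_ge0 tau) (normr_ge0 n); have := normr_ge0 r2; lra.
have Rw1 : cRe w1 = r1 * x + m /\ cIm w1 = r1 * T.
  by rewrite /w1 /om1 /lam1 !ReImE !Re_int !Im_int; split; rewrite -/r1 -/m -/x -/T; ring.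
have Rw2 : cRe w2 = r2 * x + n /\ cIm w2 = r2 * T.
  by rewrite /w2 /om2 /lam2 !ReImE !Re_int !Im_int; split; rewrite -/r2 -/n -/x -/T; ring.
have o1 := om_norm_ge x r1 m T0; have o2 := om_norm_ge x r2 n T0.
rewrite -/kap in o1 o2.
have Nb : kap / 2 * (r1 ^+ 2 + m ^+ 2 + (r2 ^+ 2 + n ^+ 2)) <=
   cRe (w1 * cbar w1 + (w1 * cbar w2 + cbar w1 * w2) / 2 + w2 * cbar w2).
  rewrite Re_hermitian; case: Rw1 => -> ->; case: Rw2 => -> ->.
  exact: hermitian_ge o1 o2.
set NN := cRe (_ + w2 * cbar w2) in Nb *.
set LL := cRe (cst - _) in linb *.
have e1 : pT * LL <= K + B * ((`|r1| + `|m|) + (`|r2| + `|n|)).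
  rewrite /K /B -(mulrA pT) -mulrDr ler_wpM2l ?(ltW pT0)// (le_trans linb)// lerD2l.
  rewrite -mulrA ler_wpM2l ?addr_ge0 ?cn_ge0// mulrDr lerD//.
have e2 : A * (r1 ^+ 2 + m ^+ 2 + (r2 ^+ 2 + n ^+ 2)) <= pT / 3 * NN.
  have -> : A * (r1 ^+ 2 + m ^+ 2 + (r2 ^+ 2 + n ^+ 2)) =
    pT / 3 * (kap / 2 * (r1 ^+ 2 + m ^+ 2 + (r2 ^+ 2 + n ^+ 2))) by rewrite /A; field.
  by rewrite ler_wpM2l// divr_ge0// ltW.
pose k : R := y.1.1%:~R; pose l : R := y.1.2%:~R.
have r1E : r1 = 2 * k + l by rewrite /r1 intrD intrM.
have r2E : r2 = l - k by rewrite /r2 intrD mulrNz.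
have e3 : A * (k ^+ 2 + l ^+ 2) <= A * (r1 ^+ 2 + r2 ^+ 2).
  by rewrite ler_wpM2l ?(ltW A0)// r1E r2E sqr_sum_le.
have e4 : B * (`|r1| + `|r2|) <= B * (3 * (`|k| + `|l|)).
  by rewrite ler_wpM2l// r1E r2E norm_sum_le.
have e5 : B * (`|m| + `|n|) <= B * (3 * (`|m| + `|n|)).
  by rewrite ler_wpM2l// ler_peMl ?addr_ge0// ler1n.
rewrite -/k -/l -/m -/n; clearbody k l m n r1 r2 NN LL A B K; lra.
Qed.

Definition Fsum u v tau : C := csum (Fterm u v tau).

Theorem Fsum_moebius u v tau (a b c d : int) (j := c%:~R * tau + d%:~R) :
  0 < cIm tau -> (forall r m : int, u + r%:~R * tau + m%:~R != 0) -> Gamma0 3 a b c d ->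
  Fsum (u / j) (v / j) ((a%:~R * tau + b%:~R) / j) =
  j ^+ 2 * e2pi (- (c%:~R * (u - v) ^+ 2 / j) + c%:~R * v ^+ 2 / j) * Fsum u v tau.
Proof.
move=> t0 hu /andP[/eqP det /dvdzP[c3 cE0]].
have cE : c = 3 * c3 by rewrite cE0 mulrC.
rewrite /j cE in det *.
have bij := moebius_idx_bij det.
have sF := absum_Fterm v t0 hu.
rewrite /Fsum -(csum_reindex (Fterm u v tau) bij) -csumZ; last exact: absum_reindex bij sF.
by apply: eq_csum => x; rewrite Fterm_moebius.
Qed.
End Lattice.

(** * Identification with the completed Appell function *)
Section Completion.
Variable R : realType.
Local Notation C := R[i].
Implicit Types (z w u v tau : C) (k l m n : int).

(** Outside two rows [|e(u + r tau)|] is at most [q] or at least [1 / q], and [1 / q - 1 >= 1 - q];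
    hence [|1 - e| >= 1 - q] there. *)
Lemma geometric_lower_bound u tau : 0 < cIm tau ->
  (forall r m : int, u + r%:~R * tau + m%:~R != 0) ->
  exists2 M : R, 0 <= M & forall r : int, cn ((1 - e2pi (u + r%:~R * tau))^-1) <= M.
Proof.
move=> t0 hu; pose T := cIm tau; pose y := cIm u; pose r0 := Num.floor (- y / T).
have T0 : 0 < T := t0.
pose f r := cn ((1 - e2pi (u + r%:~R * tau))^-1).
have pT0 : 0 < 2 * pi * T by rewrite !mulr_gt0 ?pi_gt0.
pose q := expR (- (2 * pi * T)).
have q1 : q < 1 by rewrite -expR0 ltr_expR; lra.
have q0 : 0 < q by exact: expR_gt0.
have f0 r : 0 <= f r by exact: cn_ge0.
exists (Num.max (1 - q)^-1 (Num.max (f r0) (f (r0 + 1)))).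
  by rewrite !le_max f0 orbT.
move=> r; rewrite !le_max -/(f r).
have f1 : r0%:~R <= - y / T by exact: floor_le.
have f2 : - y / T < r0%:~R + 1 by have := lt_succ_floor (- y / T); rewrite intrD.
rewrite ler_pdivlMr// in f1; rewrite ltr_pdivrMr// in f2.
have [rr|rn] := eqVneq r r0; first by rewrite rr lexx orbT.
have [rr|rn'] := eqVneq r (r0 + 1); first by rewrite rr lexx !orbT.
apply/orP; left; rewrite /f cnV lef_pV2 ?posrE ?subr_gt0//; last first.
  by rewrite cn_gt0 subr_eq0 eq_sym e2pi_neq1.
have nE : cn (e2pi (u + r%:~R * tau)) = expR (- (2 * pi * (y + r%:~R * T))).
  by rewrite cn_e2pi !ReImE Re_int Im_int mul0r addr0.
set x := e2pi _ in nE *.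
have h1 : 1 <= cn (1 - x) + cn x by rewrite -[leLHS](cn1 R) -{1}(subrK x 1) cnD.
have h2 : cn x <= cn (1 - x) + 1.
  by rewrite -{1}(subKr 1 x) (le_trans (cnB _ _))// cn1 addrC.
have [lt|gt] := ltP r r0.
  have : (r%:~R : R) + 1 <= r0%:~R by rewrite -[1]/(1%:~R) -intrD ler_int; lia.
  rewrite -(ler_pM2r T0) => h.
  have : q^-1 <= cn x.
    rewrite nE /q -expRN ler_expR opprK -mulrN ler_wpM2l ?mulr_ge0 ?pi_ge0//; lra.
  have : 1 + (1 - q) <= q^-1.
    rewrite -(ler_pM2r q0) mulVf ?gt_eqF//.
    have := sqr_ge0 (1 - q); lra.
  lra.
have : (r0%:~R : R) + 1 + 1 <= r%:~R by rewrite -[1]/(1%:~R) -!intrD ler_int; lia.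
rewrite -(ler_pM2r T0) => h.
have : cn x <= q.
  rewrite nE /q ler_expR lerN2 ler_wpM2l ?mulr_ge0 ?pi_ge0//; lra.
lra.
Qed.

Lemma cotzE z : e2pi z != 1 -> cotz z = 2 * (1 - e2pi z)^-1 - 1.
Proof.
move=> h; have h' : 1 - e2pi z != 0 by rewrite subr_eq0 eq_sym.
by rewrite /cotz; field.
Qed.

Lemma constant_int (f : int -> C) : (forall n, f (n + 1) = f n) -> forall n, f n = f 0.
Proof.
move=> h; elim/int_ind => // n IH; first by rewrite -addn1 PoszD h.
by rewrite -IH -[LHS]h; congr f; lia.
Qed.

Lemma sgk_eq n : sgk R n = if 0 < n then 1 else if n < 0 then -1 else 0.
Proof.
rewrite /sgk; case: ltrgt0P => h.
- by rewrite gtr0_sg// ltr0z.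
- by rewrite ltr0_sg// ltrz0.
- by rewrite h sgr0.
Qed.

(** A nonzero difference forces [k] to lie between [0] and [l]. The sums over [k] are thus finite,
    and the sign of [k (l - k)] controls the growth of [EKL]. *)
Lemma sgkB_supp k l : sgk R k - sgk R (2 * k - l) != 0 -> 0 <= k * (l - k) /\ (`|k| <= `|l|)%N.
Proof.
rewrite !sgk_eq => h.
have : (0 <= k <= l) || (l <= k <= 0).
  move: h; case: (ltrgtP 0 k) => hk; case: (ltrgtP 0 (2 * k - l)) => hl; rewrite ?subrr ?eqxx//; lia.
by move=> /orP[/andP[? ?]|/andP[? ?]]; split; nia.
Qed.

(* [sgk k - sgk (k - j)] is the trapezoidal weight of the segment from 0 to j. *)
Lemma telescope_sign (G E : int -> C) :
  (forall k, G k - G (k + 1) = E k + E (k + 1)) -> forall j,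
  G 0 = G j + csum (fun k => (sgk R k - sgk R (k - j))%:C * E k).
Proof.
move=> h.
have ab j : absum (fun k => (sgk R k - sgk R (k - j))%:C * E k).
  suff z0 k : k \notin symseq `|j|%N -> (sgk R k - sgk R (k - j))%:C * E k = 0.
    by have [] := csum_seq (symseq_uniq _) z0.
  rewrite mem_symseq => kj.
  rewrite (_ : sgk R k = sgk R (k - j)) ?subrr ?mul0r//.
  rewrite !sgk_eq; case: (ltrgtP 0 k) kj => hk; case: (ltrgtP 0 (k - j)) => hl //; lia.
pose D j := csum (fun k => (sgk R k - sgk R (k - j))%:C * E k).
have DS j : D (j + 1) = D j + (E j + E (j + 1)).
  have [a1 <-] := csum_delta j (E j).
  have [a2 <-] := csum_delta (j + 1) (E (j + 1)).
  rewrite -csumD// -csumD//; last exact: absumD.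
  apply: eq_csum => k.
  have -> : (sgk R k - sgk R (k - (j + 1)))%:C = (sgk R k - sgk R (k - j))%:C + (if k == j then 1 else 0) + (if k == j + 1 then 1 else 0) :> C.
    rewrite -addrA; have -> : (if k == j then 1 else 0) + (if k == j + 1 then 1 else 0) = (sgk R (k - j) - sgk R (k - (j + 1)))%:C :> C.
      rewrite !sgk_eq; have [->|kj] := eqVneq k j.
        rewrite (_ : j == j + 1 = false) ?addr0; last by lia.
        have -> : j - (j + 1) = -1 by ring.
        by rewrite subrr ltxx (_ : (0 < -1 :> int) = false)// (_ : -1 < 0 :> int)// sub0r opprK.
      have [->|kj'] := eqVneq k (j + 1).
        by rewrite subrr add0r addrAC subrr add0r /= subr0.
      rewrite addr0; case: ltrgt0P => h1; case: (ltrgt0P (k - (j + 1))) => h2; rewrite ?subrr//; lia.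
    by rewrite -rmorphD; congr (_%:C); ring.
  rewrite !mulrDl -addrA; congr (_ + (_ + _)).
    by case: eqP => [->|_]; rewrite ?mul1r ?mul0r.
  by case: eqP => [->|_]; rewrite ?mul1r ?mul0r.
move=> j; rewrite -/(D j).
have D0 : D 0 = 0.
  by rewrite /D -(csum0 R int); apply: eq_csum => k; rewrite subr0 subrr mul0r.
rewrite -[LHS]addr0 -D0; apply/esym.
apply: (constant_int (f := fun j => G j + D j)) => n.
by rewrite DS -h; ring.
Qed.

Lemma csum_even_odd (f : int -> C) : absum f ->
  csum f = csum (fun n => f (2 * n)) + csum (fun n => f (2 * n + 1)).
Proof.
move=> af; pose e (p : bool * int) : int := 2 * p.2 + p.1%:Z.
have be : bijective e.
  exists (fun n => (odd `|n|%N, ((n - (odd `|n|%N)%:Z) %/ 2)%Z)) => [[b n]|n]; rewrite /e /=.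
    by case: b; congr (_, _); lia.
  by lia.
rewrite -(csum_reindex f be) csum_pair; last exact: absum_reindex be af.
have z0 (b : bool) : b \notin [:: false; true] -> csum (fun n => f (e (b, n))) = 0 by case: b.
have [_ ->] := csum_seq (isT : uniq [:: false; true]) z0.
rewrite !big_cons big_nil addr0; congr (_ + _); apply: eq_csum => n; congr f; rewrite /e /=; lia.
Qed.

End Completion.

(** * Moving the corrections across the lattice and recognizing [mu21], [R1] and [R2] *)

Section Assembly.
Variable R : realType.
Local Notation C := R[i].
Variables u v tau : C.
Hypothesis t0 : 0 < cIm tau.
Hypothesis hu : forall r m : int, u + r%:~R * tau + m%:~R != 0.
Implicit Types (k l m n : int) (x : int * int).

Let T := cIm tau.
Let w := u - v.
Let a := cIm w / T.
Let c := theta_term v tau.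
Let Z1 x := u + lam1 tau x.
Let Z2 x := u + lam2 tau x.
Let Th := csum c.

Lemma Z1_neq1 x : e2pi (Z1 x) != 1.
Proof. by apply: e2pi_neq1 => n; exact: hu. Qed.
Lemma Z2_neq1 x : e2pi (Z2 x) != 1.
Proof. by apply: e2pi_neq1 => n; exact: hu. Qed.

(** The exponential factor of [R2], and at the same time the factor produced by a translation of
    [theta_term] in [c_shift]. *)
Definition EKL k l : C := e2pi ((k + l)%:~R * w + (- k ^+ 2 - l ^+ 2 + k * l)%:~R * tau).

Definition shift_idx k l x : int * int := (x.1 + k - l, x.2 + l).

Lemma shift_idx_bij k l : bijective (shift_idx k l).
Proof.
exists (shift_idx (- k) (- l)) => -[x y]; rewrite /shift_idx /=; congr (_, _); ring.
Qed.

Definition swap_idx x : int * int := (- x.1, x.1 + x.2).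

Lemma swap_idxK : involutive swap_idx.
Proof. by case=> x y; rewrite /swap_idx /=; congr (_, _); ring. Qed.

Lemma swap_idx_bij : bijective swap_idx.
Proof. by exists swap_idx; exact: swap_idxK. Qed.

Lemma c_swap x : c (swap_idx x) = c x.
Proof.
case: x => k l; rewrite /c /theta_term /swap_idx /fst /snd; 
have -> : - k + 2 * (k + l) = k + 2 * l by ring.
by have -> : (- k) ^+ 2 + (k + l) ^+ 2 + - k * (k + l) = k ^+ 2 + l ^+ 2 + k * l by ring.
Qed.

Lemma Z1_swap x : Z1 (swap_idx x) = Z2 x.
Proof.
case: x => k l; rewrite /Z1 /Z2 /lam1 /lam2 /swap_idx /fst /snd.
by rewrite (_ : 2 * - k + (k + l) = l - k)//; ring.
Qed.

Lemma Z2_swap x : Z2 (swap_idx x) = Z1 x.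
Proof. by rewrite -Z1_swap swap_idxK. Qed.

Lemma c_shift k l x : c x * (e2pi (k%:~R * Z1 x) * e2pi (l%:~R * Z2 x)) = EKL k l * c (shift_idx k l x).
Proof.
case: x => m n; rewrite /c /theta_term /EKL /Z1 /Z2 /lam1 /lam2 /shift_idx /fst /snd -!e2piD; congr e2pi.
rewrite /w !(intrD, intrM, mulrNz, rmorphXn); move: (m%:~R : C) (n%:~R : C) (k%:~R : C) (l%:~R : C) => M N K L.
ring.
Qed.

Lemma Z1_shift k l x : Z1 (shift_idx k l x) = Z1 x + (2 * k - l)%:~R * tau.
Proof.
case: x => m n; rewrite /Z1 /lam1 /shift_idx /fst /snd -[RHS]addrA -mulrDl -intrD.
by have -> : 2 * (m + k - l) + (n + l) = 2 * m + n + (2 * k - l) by ring.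
Qed.

Lemma absum_c : absum c. Proof. exact: absum_theta. Qed.

Lemma absum_bounded (f : int * int -> C) (M : R) : (forall x, cn (f x) <= M) -> absum (fun x => c x * f x).
Proof.
move=> h; have M0 : 0 <= M by rewrite (le_trans _ (h (0, 0)))// cn_ge0.
apply: absum_le (nnsZ M0 absum_c) => x.
by rewrite cnM mulrC ler_wpM2r ?cn_ge0.
Qed.

Lemma sum_c_shift k l : csum (fun x => c x * (e2pi (k%:~R * Z1 x) * e2pi (l%:~R * Z2 x))) = EKL k l * Th.
Proof.
rewrite (eq_csum (f' := fun x => EKL k l * c (shift_idx k l x))); last exact: c_shift.
rewrite csumZ; last exact: absum_reindex (shift_idx_bij k l) absum_c.
by rewrite (csum_reindex c (shift_idx_bij k l)).
Qed.

Lemma cotz_bound : exists2 M : R, 0 <= M & forall r, cn (cotz (u + r%:~R * tau)) <= M.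
Proof.
have [M M0 h] := geometric_lower_bound t0 hu.
exists (2 * M + 1) => [|r]; first by rewrite addr_ge0// mulr_ge0.
rewrite cotzE; last by apply: e2pi_neq1 => n; exact: hu.
have c2 : cn (2 : C) = 2 by rewrite -[2 : C]/(2%:~R) cn_int ger0_norm.
by rewrite (le_trans (cnB _ _))// cn1 lerD2r cnM c2 ler_wpM2l.
Qed.

(** One cotangent is kept; [l] comes from the error-function series in the other variable. The index
    [k] is auxiliary: it moves [GKL 0 l] to a place where [2 k - l] is 0 or -1. *)
Definition GKL k l : C := csum (fun x => c x * (e2pi (k%:~R * Z1 x) * e2pi (l%:~R * Z2 x)) * cotz (Z1 x)).
Definition S0 : C := csum (fun x => c x * cotz (Z1 x)).
Definition S1 : C := csum (fun x => c x * (cotz (Z1 x + tau) - 1)).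

Lemma absum_GKL k l : absum (fun x => c x * (e2pi (k%:~R * Z1 x) * e2pi (l%:~R * Z2 x)) * cotz (Z1 x)).
Proof.
have [M M0 h] := cotz_bound.
have ab := absumZ (EKL k l) (absum_reindex (shift_idx_bij k l) absum_c).
apply: absum_le (nnsZ M0 ab) => x.
by rewrite c_shift [leLHS]cnM mulrC ler_wpM2r ?cn_ge0//; exact: h.
Qed.

Lemma absum_cE k l : absum (fun x => c x * (e2pi (k%:~R * Z1 x) * e2pi (l%:~R * Z2 x))).
Proof.
apply: absum_ext (absumZ (EKL k l) (absum_reindex (shift_idx_bij k l) absum_c)) => x.
by rewrite c_shift.
Qed.

Lemma cotz_step (A X Y : C) z : e2pi z != 1 ->
  A * (X * Y) * cotz z - A * (X * e2pi z * Y) * cotz z = A * (X * Y) + A * (X * e2pi z * Y).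
Proof.
move=> h; have h' : 1 - e2pi z != 0 by rewrite subr_eq0 eq_sym.
by rewrite /cotz; field.
Qed.

(** From [cotz z * (1 - e(z)) = 1 + e(z)]: a unit step in [k] costs only terms without poles. *)
Lemma GKL_step l k : GKL k l - GKL (k + 1) l = Th * EKL k l + Th * EKL (k + 1) l.
Proof.
have e1 := sum_c_shift k l; have e2 := sum_c_shift (k + 1) l.
rewrite [Th * EKL k l]mulrC [Th * EKL (k + 1) l]mulrC -e1 -e2.
have := csumB (absum_GKL k l) (absum_GKL (k + 1) l); rewrite -!/(GKL _ _) => <-.
have := csumD (absum_cE k l) (absum_cE (k + 1) l) => <-.
apply: eq_csum => x.
have -> : e2pi ((k + 1)%:~R * Z1 x) = e2pi (k%:~R * Z1 x) * e2pi (Z1 x).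
  by rewrite -e2piD intrD mulrDl mul1r.
exact: cotz_step (Z1_neq1 x).
Qed.

(** The translation by [(n, 2 n)] fixes [Z1], so the cotangent sum factors out. *)
Lemma GKL_even n : GKL n (2 * n) = EKL n (2 * n) * S0.
Proof.
have b := shift_idx_bij n (2 * n).
have [M M0 h] := cotz_bound.
rewrite /S0 -(csum_reindex (fun x => c x * cotz (Z1 x)) b) -csumZ; last first.
  exact: (absum_reindex (f := fun x => c x * cotz (Z1 x)) b (absum_bounded (fun x => h _))).
apply: eq_csum => x; rewrite c_shift Z1_shift subrr mul0r addr0.
by rewrite mulrA.
Qed.

Lemma Z1_add x : Z1 x + tau = u + (2 * x.1 + x.2 + 1)%:~R * tau.
Proof. by rewrite /Z1 /lam1 [in RHS]intrD [in RHS]mulrDl mul1r addrA. Qed.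

(** The translation by [(n, 2 n + 1)] moves [Z1] by [- tau], whence the argument of the cotangent in
    [S1]. *)
Lemma GKL_odd n : GKL n (2 * n + 1) - Th * EKL n (2 * n + 1) = EKL n (2 * n + 1) * S1.
Proof.
have b := shift_idx_bij n (2 * n + 1).
have [M M0 h] := cotz_bound.
have ab : absum (fun x => c x * (cotz (Z1 x + tau) - 1)).
  apply: (absum_bounded (M := M + 1)) => x.
  rewrite (le_trans (cnB _ _))// cn1 lerD2r.
  by rewrite Z1_add h.
rewrite /S1 -(csum_reindex (fun x => c x * (cotz (Z1 x + tau) - 1)) b) -csumZ; last exact: absum_reindex b ab.
rewrite [Th * _]mulrC -sum_c_shift -csumB; [|exact: absum_GKL|exact: absum_cE].
apply: eq_csum => x; rewrite c_shift Z1_shift.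
rewrite (_ : 2 * n - (2 * n + 1) = -1) ?mulN1r ?subrK; last by ring.
by rewrite mulrA mulrBr mulr1.
Qed.

(** [GKL 0 l] without a pole-free part, whose signs are those occurring in [R2]; that part returns
    as [eS]. *)
Definition base l : C := GKL 0 l - csum (fun k => (sgk R k - sgk R (2 * k - l))%:C * (Th * EKL k l)).

Lemma base_even n : base (2 * n) = EKL n (2 * n) * S0.
Proof.
rewrite /base (telescope_sign (E := fun k => Th * EKL k (2 * n)) (GKL_step (2 * n)) n) GKL_even.
rewrite -addrA -[RHS]addr0; congr (_ + _); apply/eqP; rewrite subr_eq0; apply/eqP.
apply: eq_csum => k; rewrite (_ : sgk R (2 * k - 2 * n) = sgk R (k - n))//.
rewrite !sgk_eq; case: ltrgt0P => h1; case: ltrgt0P => h2 //; lia.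
Qed.

(** [sgk (2 k - 2 n - 1)] differs from [sgk (k - n)] only at [k = n]. The extra term there is the
    one subtracted in [GKL_odd], hence the [- 1] in [S1]. *)
Lemma base_odd n : base (2 * n + 1) = EKL n (2 * n + 1) * S1.
Proof.
rewrite -GKL_odd /base (telescope_sign (E := fun k => Th * EKL k (2 * n + 1)) (GKL_step (2 * n + 1)) n).
rewrite -addrA; congr (_ + _).
have [a1 <-] := csum_delta n (Th * EKL n (2 * n + 1)).
set f := (fun k => (sgk R k - sgk R (k - n))%:C * _).
set g := (fun k => (sgk R k - sgk R (2 * k - _))%:C * _).
set h := (fun k => if k == n then _ else _) in a1 *.
have ghE k : g k = f k + h k.
  rewrite /g /f /h; have [->|kn] := eqVneq k n.
    rewrite subrr (_ : 2 * n - (2 * n + 1) = -1); last by ring.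
    have s0 : sgk R 0 = 0 by rewrite /sgk sgr0.
    have sN : sgk R (-1) = -1 by rewrite /sgk rmorphN1 sgrN1.
    by rewrite s0 sN subr0 opprK rmorphD mulrDl mul1r.
  rewrite addr0 (_ : sgk R (2 * k - (2 * n + 1)) = sgk R (k - n))//.
  rewrite !sgk_eq; case: ltrgt0P => h1; case: ltrgt0P => h2 //; lia.
have af : absum f.
  suff z0 k : k \notin symseq `|n|%N -> f k = 0 by have [] := csum_seq (symseq_uniq _) z0.
  rewrite mem_symseq => kj; rewrite /f (_ : sgk R k = sgk R (k - n)) ?subrr ?mul0r//.
  rewrite !sgk_eq; case: (ltrgtP 0 k) kj => hk; case: (ltrgtP 0 (k - n)) => hl //; lia.
rewrite (eq_csum ghE) csumD//; ring.
Qed.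

Definition ee l : C := (EE T (l%:~R - a) - sgk R l)%:C.


Lemma ee_bound : exists2 B : R, 0 <= B & forall l,
  cn (ee l * e2pi (l%:~R * w)) <= 2 * expR (- (pi * (3 * T)) * l%:~R ^+ 2 + B * `|l%:~R|).
Proof.
have T3 : 0 < 3 * T by rewrite mulr_gt0.
exists (2 * pi * (3 * T) * `|a| + 2 * pi * `|cIm w|) => [|l].
  by have p0 := pi_ge0 R; have T' : 0 <= T := ltW t0; rewrite addr_ge0 ?mulr_ge0.
exact: E1_term_bound.
Qed.

Lemma EKL_norm k l : cn (EKL k l) =
  expR (- (2 * pi * ((k%:~R + l%:~R) * cIm w + (- k%:~R ^+ 2 - l%:~R ^+ 2 + k%:~R * l%:~R) * T))).
Proof.
rewrite /EKL cn_e2pi !ReImE !Re_int !Im_int !mul0r !addr0.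
by rewrite !(intrD, intrM, mulrNz, rmorphXn).
Qed.

Lemma absum_eE : absum (fun l => ee l * EKL 0 l).
Proof.
have [B B0 h] := ee_bound.
have pT : 0 < pi * T by rewrite mulr_gt0 ?pi_gt0.
apply: absum_le (nnsZ (ler0n _ 2) (nns_gauss B pT)) => l.
have -> : EKL 0 l = e2pi (l%:~R * w) * e2pi ((- l ^+ 2)%:~R * tau).
  by rewrite -e2piD /EKL add0r expr0n oppr0 add0r mul0r addr0.
rewrite mulrA [leLHS]cnM (le_trans (ler_wpM2r (cn_ge0 _) (h l)))//.
rewrite cn_e2pi ImM Re_int Im_int mul0r addr0 -[leLHS]mulrA -expRD ler_wpM2l// ler_expR.
rewrite mulrNz rmorphXn -/T; set L : R := l%:~R; lra.
Qed.

(** [EKL] grows like [exp (2 pi T (k^2 + l^2 - k l))] and [ee l] decays like [exp (- 3 pi T l^2)].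
    The decay wins because [k (l - k) >= 0] on the support of the signs, where also [k^2 <= l^2]. *)
Lemma absum_eEE : absum (fun p : int * int => ee p.2 * ((sgk R p.1 - sgk R (2 * p.1 - p.2))%:C * EKL p.1 p.2)).
Proof.
have [B B0 h] := ee_bound.
have pT : 0 < pi * T / 2 by rewrite divr_gt0// mulr_gt0 ?pi_gt0.
pose D := 2 * pi * `|cIm w|.
have D0 : 0 <= D by rewrite !mulr_ge0 ?pi_ge0.
apply: absum_le (nnsZ (ler0n _ 4) (nns_gauss2 (B + D) 0 pT)) => -[k l]; rewrite /fst /snd.
have [->|/sgkB_supp[kl kl']] := eqVneq (sgk R k - sgk R (2 * k - l)) 0.
  by rewrite mul0r mulr0 cn0 mulr_ge0// expR_ge0.
have sg1 n : `|sgk R n| <= 1 by rewrite sgk_eq; case: ltrgt0P; rewrite ?normrN ?normr1 ?normr0.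
have sg2 : `|sgk R k - sgk R (2 * k - l)| <= 2.
  by rewrite (le_trans (ler_normB _ _))//; have := sg1 k; have := sg1 (2 * k - l); lra.
pose K : R := k%:~R; pose L : R := l%:~R.
have klR : 0 <= K * (L - K) by rewrite /K /L -intrB -intrM ler0z.
have kl2 : K ^+ 2 <= L ^+ 2.
  by have := sqr_ge0 (L - K); lra.
have eE : EKL k l = e2pi (l%:~R * w) * e2pi (k%:~R * w + (- k ^+ 2 - l ^+ 2 + k * l)%:~R * tau).
  by rewrite -e2piD /EKL intrD; congr e2pi; ring.
have -> : ee l * ((sgk R k - sgk R (2 * k - l))%:C * EKL k l) =
  (sgk R k - sgk R (2 * k - l))%:C * (ee l * e2pi (l%:~R * w) * e2pi (k%:~R * w + (- k ^+ 2 - l ^+ 2 + k * l)%:~R * tau)).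
  rewrite eE; move: (e2pi _) (e2pi _) (_%:C) (ee l) => x1 x2 x3 x4; ring.
rewrite [leLHS]cnM cn_real.
have n1 : cn (ee l * e2pi (l%:~R * w) * e2pi (k%:~R * w + (- k ^+ 2 - l ^+ 2 + k * l)%:~R * tau)) <=
   2 * expR (- (pi * T / 2) * (K ^+ 2 + L ^+ 2) + (B + D) * (`|K| + `|L|) + 0).
  rewrite [leLHS]cnM (le_trans (ler_wpM2r (cn_ge0 _) (h l)))//.
  rewrite cn_e2pi ImD !ImM !Re_int !Im_int !mul0r !addr0 -[leLHS]mulrA -expRD ler_wpM2l// ler_expR.
  rewrite !(intrD, intrM, mulrNz, rmorphXn) -/T -/K -/L.
  have d1 : - (2 * pi * (K * cIm w)) <= D * `|K|.
    rewrite (le_trans (ler_norm _))// normrN !normrM (ger0_norm (pi_ge0 R)) ger0_norm// /D.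
    by rewrite -!mulrA (mulrC `|K|).
  have d2 := mulr_ge0 B0 (normr_ge0 K); have d3 := mulr_ge0 D0 (normr_ge0 L).
  have d4 : 0 <= pi * T * (L ^+ 2 - K ^+ 2) by rewrite mulr_ge0 ?subr_ge0// mulr_ge0 ?pi_ge0 ?(ltW t0).
  have d5 : 0 <= pi * T * (K * (L - K)) by rewrite mulr_ge0// mulr_ge0 ?pi_ge0 ?(ltW t0).
  rewrite -/L; lra.
have -> : 4 = 2 * 2 :> R by rewrite -natrM.
by rewrite -[leRHS]mulrA ler_pM ?cn_ge0.
Qed.

Definition bbc (p : int * int) : C := (bb T (p.1%:~R - a) (p.2%:~R - a) p.1 p.2)%:C.

(** The quadratic exponents of [bb] and [EKL] add up to [- (pi T / 3) (k^2 + l^2 + (k + l)^2)]; the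
    linear ones are expressed through [Im w = a T]. *)
Lemma absum_bbE : absum (fun p => bbc p * EKL p.1 p.2).
Proof.
have pT : 0 < pi * T / 3 by rewrite divr_gt0// mulr_gt0 ?pi_gt0.
pose D := 2 * pi * `|cIm w|.
apply: absum_le (nnsZ (ler0n _ 4) (nns_gauss2 D 0 pT)) => -[k l]; rewrite /fst /snd.
rewrite cnM cn_real (le_trans (ler_wpM2r (cn_ge0 _) (bb_bound t0 a a k l)))//.
rewrite EKL_norm -[leLHS]mulrA -expRD ler_wpM2l// ler_expR.
set K : R := k%:~R; set L : R := l%:~R.
have aT : cIm w = a * T by rewrite /a divfK// gt_eqF.
have d (x : R) : 2 * pi * (x * cIm w) <= D * `|x|.
  rewrite (le_trans (ler_norm _))// !normrM (ger0_norm (pi_ge0 R)) ger0_norm// /D.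
  by rewrite -!mulrA (mulrC `|x|).
have := d K; have := d L; rewrite aT.
have : 0 <= pi * T * (K + L) ^+ 2 by rewrite mulr_ge0 ?sqr_ge0// mulr_ge0 ?pi_ge0 ?(ltW t0).
lra.
Qed.

Definition tA x : C := c x * (cotz (Z1 x) * cotz (Z2 x)).
Definition fB (y : (int * int) * int) : C := c y.1 * cotz (Z1 y.1) * (ee y.2 * e2pi (y.2%:~R * Z2 y.1)).
Definition fD (y : (int * int) * (int * int)) : C := c y.1 * Bt T (Z1 y.1) (Z2 y.1) a a y.2.

Lemma absum_tA : absum tA.
Proof.
have [M M0 h] := cotz_bound.
apply: (absum_bounded (M := M * M)) => x; rewrite cnM.
by rewrite ler_pM ?cn_ge0//; exact: h.
Qed.

(** The translation by [(0, l)] separates the variables: what is left is a product of two summable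
    families times a bounded cotangent. *)
Lemma absum_fB : absum fB.
Proof.
have [M M0 h] := cotz_bound.
pose e (y : (int * int) * int) := (shift_idx 0 y.2 y.1, y.2).
have be : bijective e.
  exists (fun y : (int * int) * int => (shift_idx 0 (- y.2) y.1, y.2)) => -[[x y] n]; rewrite /e /shift_idx /=.
    congr (_, _, _); ring.
  congr (_, _, _); ring.
apply: absum_le (nnsZ M0 (nns_reindex be (nns_prod absum_c absum_eE))) => -[x l].
have -> : fB (x, l) = c (shift_idx 0 l x) * (ee l * EKL 0 l) * cotz (Z1 x).
  have E0 : e2pi (0%:~R * Z1 x) = 1 by rewrite mul0r e2pi0.
  have := c_shift 0 l x; rewrite E0 mul1r => E.
  rewrite /fB /fst /snd.
  transitivity (c x * e2pi (l%:~R * Z2 x) * ee l * cotz (Z1 x)).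
    move: (c x) (cotz _) (ee l) (e2pi _) => x1 x2 x3 x4; ring.
  rewrite E; move: (EKL 0 l) (c _) (cotz _) (ee l) => x1 x2 x3 x4; ring.
rewrite [leLHS]cnM (cnM (c _)) mulrC ler_wpM2r ?mulr_ge0 ?cn_ge0//; exact: h.
Qed.

Lemma fDE x p : fD (x, p) = c (shift_idx p.1 p.2 x) * (bbc p * EKL p.1 p.2).
Proof.
rewrite /fD /Bt /bbc /fst /snd; case: p => k l.
transitivity (c x * (e2pi (k%:~R * Z1 x) * e2pi (l%:~R * Z2 x)) * (bb T (k%:~R - a) (l%:~R - a) k l)%:C).
  move: (c x) (e2pi _) (e2pi _) (_%:C) => x1 x2 x3 x4; ring.
rewrite c_shift; move: (EKL k l) (c _) (_%:C) => x1 x2 x3; ring.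
Qed.

Lemma absum_fD : absum fD.
Proof.
pose e (y : (int * int) * (int * int)) := (shift_idx y.2.1 y.2.2 y.1, y.2).
have be : bijective e.
  exists (fun y : (int * int) * (int * int) => (shift_idx (- y.2.1) (- y.2.2) y.1, y.2)) => -[[x y] [m n]]; rewrite /e /shift_idx /=.
    congr (_, _, _); ring.
  congr (_, _, _); ring.
apply: absum_ext (absum_reindex be (absum_prod absum_c absum_bbE)) => -[x p].
by rewrite fDE.
Qed.

Lemma sum_fD : csum (fun x => csum (fun p => fD (x, p))) = Th * csum (fun p => bbc p * EKL p.1 p.2).
Proof.
rewrite (csum_swap absum_fD) [RHS]mulrC -csumZr; last exact: absum_bbE.
apply: eq_csum => p.
rewrite (eq_csum (f' := fun x => c (shift_idx p.1 p.2 x) * (bbc p * EKL p.1 p.2))); last by move=> x; rewrite fDE.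
rewrite csumZr; last exact: absum_reindex (shift_idx_bij p.1 p.2) absum_c.
by rewrite (csum_reindex c (shift_idx_bij p.1 p.2)) mulrC.
Qed.

Lemma sum_fB : csum (fun x => csum (fun l => fB (x, l))) = csum (fun l => ee l * GKL 0 l).
Proof.
rewrite (csum_swap absum_fB); apply: eq_csum => l.
rewrite /GKL -csumZ; last exact: absum_GKL.
apply: eq_csum => x; rewrite /fB /fst /snd mul0r e2pi0 mul1r.
move: (c x) (cotz _) (ee l) (e2pi _) => x1 x2 x3 x4; ring.
Qed.

Lemma absum_eG : absum (fun l => ee l * GKL 0 l).
Proof.
pose f (y : int * (int * int)) := fB (y.2, y.1).
have bs : bijective (fun y : int * (int * int) => (y.2, y.1)).
  by exists (fun y => (y.2, y.1)) => -[].
have af : absum f by exact: absum_reindex bs absum_fB.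
apply: absum_ext (absum_csum af) => l.
rewrite /GKL -csumZ; last exact: absum_GKL.
apply: eq_csum => x; rewrite /f /fB /fst /snd mul0r e2pi0 mul1r.
move: (c x) (cotz _) (ee l) (e2pi _) => x1 x2 x3 x4; ring.
Qed.


Lemma E1_sum_absum z : absum (fun l => ee l * e2pi (l%:~R * z)).
Proof. by apply: absum_E1_term; rewrite mulr_gt0. Qed.

(** [swap_idx] exchanges the two mixed terms, so both are written with [fB]. *)
Lemma lhs2_terms x : c x * lhs2 T (Z1 x) (Z2 x) a a =
  tA x + csum (fun l => fB (x, l)) + csum (fun l => fB (swap_idx x, l)) + csum (fun p => fD (x, p)).
Proof.
have b1 : csum (fun l => fB (x, l)) = c x * cotz (Z1 x) * csum (fun l => ee l * e2pi (l%:~R * Z2 x)).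
  by rewrite -csumZ//; exact: E1_sum_absum.
have b2 : csum (fun l => fB (swap_idx x, l)) = c x * cotz (Z2 x) * csum (fun l => ee l * e2pi (l%:~R * Z1 x)).
  rewrite -csumZ; last exact: E1_sum_absum.
  by apply: eq_csum => l; rewrite /fB /fst /snd c_swap Z1_swap Z2_swap.
have b3 : csum (fun p => fD (x, p)) = c x * csum (Bt T (Z1 x) (Z2 x) a a).
  by rewrite -csumZ//; apply: absum_Bt => // n; exact: hu.
rewrite b1 b2 b3 /tA /lhs2 /ee.
move: (csum _) (csum _) (csum _) (cotz _) (cotz _) (c x) => y1 y2 y3 y4 y5 y6; ring.
Qed.

Lemma Fsum_split : - ((pi ^- 2)%:C) * Fsum u v tau =
  csum tA + 2 * csum (fun l => ee l * GKL 0 l) + Th * csum (fun p => bbc p * EKL p.1 p.2).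
Proof.
have aF := absum_Fterm v t0 hu.
have -> : Fsum u v tau = csum (fun x => csum (fun p => Fterm u v tau (x, p))) by exact: csum_pair aF.
have eF := csumZ (- (pi ^- 2)%:C) (absum_csum aF); rewrite -eF.
have aB := absum_csum absum_fB.
have aB' := absum_reindex swap_idx_bij aB.
have aD := absum_csum absum_fD.
transitivity (csum (fun x => tA x + csum (fun l => fB (x, l)) + csum (fun l => fB (swap_idx x, l)) + csum (fun p => fD (x, p)))).
  apply: eq_csum => x.
  rewrite -lhs2_terms cot_E2//; [|move=> n; exact: hu..].
  rewrite mulrCA; congr (_ * _).
  by rewrite -csumZ//; apply: absum_Rt => // n; exact: hu.
rewrite (csumD (absumD (absumD absum_tA aB) aB') aD) (csumD (absumD absum_tA aB) aB') (csumD absum_tA aB).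
rewrite (csum_reindex (fun x => csum (fun l => fB (x, l))) swap_idx_bij) sum_fB sum_fD.
by move: (csum _) (csum _) (Th * _) => y1 y2 y3; ring.
Qed.

Lemma absum_sg (X : int -> C) l : absum (fun k => (sgk R k - sgk R (2 * k - l))%:C * X k).
Proof.
suff z0 k : k \notin symseq `|l|%N -> (sgk R k - sgk R (2 * k - l))%:C * X k = 0.
  by have [] := csum_seq (symseq_uniq _) z0.
rewrite mem_symseq => kl.
have [->|/sgkB_supp[_ h]] := eqVneq (sgk R k - sgk R (2 * k - l)) 0; first by rewrite mul0r.
by rewrite h in kl.
Qed.

(** The pole-free part removed in [base], weighted by [ee l]. *)
Definition eS (p : int * int) : C := ee p.2 * ((sgk R p.1 - sgk R (2 * p.1 - p.2))%:C * EKL p.1 p.2).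

Lemma eG_split l : ee l * GKL 0 l = ee l * base l + Th * csum (fun k => eS (k, l)).
Proof.
have -> : csum (fun k => eS (k, l)) = ee l * csum (fun k => (sgk R k - sgk R (2 * k - l))%:C * EKL k l).
  by rewrite -csumZ//; exact: absum_sg.
have -> : GKL 0 l = base l + Th * csum (fun k => (sgk R k - sgk R (2 * k - l))%:C * EKL k l).
  rewrite -csumZ; last exact: absum_sg.
  rewrite /base -[LHS](subrK (csum (fun k => (sgk R k - sgk R (2 * k - l))%:C * (Th * EKL k l)))).
  by congr (_ + _); apply: eq_csum => k; rewrite mulrCA.
by rewrite mulrDr; congr (_ + _); rewrite mulrCA.
Qed.

Lemma absum_eS : absum (fun l => csum (fun k => eS (k, l))).
Proof.
have bs : bijective (fun y : int * int => (y.2, y.1)) by exists (fun y => (y.2, y.1)) => -[].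
exact: (absum_csum (absum_reindex bs absum_eEE)).
Qed.

Lemma absum_ebase : absum (fun l => ee l * base l).
Proof.
apply: absum_ext (absumB absum_eG (absumZ Th absum_eS)) => l.
by rewrite eG_split addrK.
Qed.

Lemma sum_eG : csum (fun l => ee l * GKL 0 l) = csum (fun l => ee l * base l) + Th * csum eS.
Proof.
rewrite (eq_csum eG_split) csumD; [|exact: absum_ebase|exact: absumZ absum_eS].
rewrite csumZ; last exact: absum_eS.
by congr (_ + _ * _); rewrite (csum_pair absum_eEE) (csum_swap absum_eEE).
Qed.

(** Near the line [l = 2 n] the product of [ee] and [EKL] decays like [exp (- 6 pi T n^2)]. The two
    hypotheses are what this estimate needs, and they hold for [2 n] and [2 n + 1] alike. *)
Lemma absum_diag (f : int -> int) : (forall n, (`|(f n)%:~R| : R) <= 2 * `|n%:~R| + 1) ->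
  (forall n, 2 * (n%:~R ^+ 2 - n%:~R * (f n)%:~R) - (f n)%:~R ^+ 2 <= - 6 * n%:~R ^+ 2 + 6 * `|n%:~R| :> R) ->
  absum (fun n => ee (f n) * EKL n (f n)).
Proof.
move=> h1 h2; have [B B0 h] := ee_bound.
have pT : 0 < 6 * (pi * T) by rewrite !mulr_gt0 ?pi_gt0.
have pT' : 0 <= pi * T by rewrite mulr_ge0 ?pi_ge0 ?(ltW t0).
pose D := 2 * pi * `|cIm w|.
have c0 : 0 <= 2 * expR B by rewrite mulr_ge0 ?expR_ge0.
apply: absum_le (nnsZ c0 (nns_gauss (6 * (pi * T) + 2 * B + D) pT)) => n.
move: (h1 n) (h2 n) (h (f n)) => {h1 h2 h}; move: (f n) => l.
set N : R := n%:~R; set L : R := l%:~R => h1 h2 h.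
have eE : EKL n l = e2pi (l%:~R * w) * e2pi (n%:~R * w + (- n ^+ 2 - l ^+ 2 + n * l)%:~R * tau).
  by rewrite -e2piD /EKL intrD; congr e2pi; ring.
rewrite eE mulrA [leLHS]cnM (le_trans (ler_wpM2r (cn_ge0 _) h))//.
rewrite cn_e2pi ImD !ImM !Re_int !Im_int !mul0r !addr0 -[leLHS]mulrA -expRD -[leRHS]mulrA -expRD ler_wpM2l// ler_expR.
rewrite !(intrD, intrM, mulrNz, rmorphXn) -/T -/N -/L.
have d1 : - (2 * pi * (N * cIm w)) <= D * `|N|.
  rewrite (le_trans (ler_norm _))// normrN !normrM (ger0_norm (pi_ge0 R)) ger0_norm// /D.
  by rewrite -!mulrA (mulrC `|N|).
have := ler_wpM2l B0 h1; have := ler_wpM2l pT' h2; lra.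
Qed.

Lemma absum_even : absum (fun n => ee (2 * n) * EKL n (2 * n)).
Proof.
apply: (absum_diag (f := fun n => 2 * n)) => n; rewrite intrM.
  by rewrite normrM ger0_norm// ler_wpDr.
have := normr_ge0 (n%:~R : R); move: (n%:~R : R) => N; lra.
Qed.

Lemma absum_odd : absum (fun n => ee (2 * n + 1) * EKL n (2 * n + 1)).
Proof.
apply: (absum_diag (f := fun n => 2 * n + 1)) => n; rewrite intrD intrM.
  by rewrite (le_trans (ler_normD _ _))// normrM (ger0_norm (_ : 0 <= 2%:~R))// normr1.
have := ler_norm (n%:~R : R); have := ler_norm (- (n%:~R : R)); rewrite normrN.
move: (n%:~R : R) => N; lra.
Qed.

Lemma sum_ebase : csum (fun l => ee l * base l) =
  S0 * csum (fun n => ee (2 * n) * EKL n (2 * n)) + S1 * csum (fun n => ee (2 * n + 1) * EKL n (2 * n + 1)).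
Proof.
rewrite (csum_even_odd absum_ebase); have e1 := csumZ S0 absum_even; have e2 := csumZ S1 absum_odd.
rewrite -e1 -e2; congr (_ + _); apply: eq_csum => n.
  by rewrite base_even mulrA mulrC.
by rewrite base_odd mulrA mulrC.
Qed.

Lemma R1_factor (l : R) m : m%:~R = 2 * l ->
  (Num.sg l - E1 (Num.sqrt (3 * T) * (2 * l - a)))%:C = - ee m.
Proof.
move=> h; have hs : Num.sg l = sgk R m by rewrite /sgk h sgrM (gtr0_sg (_ : 0 < 2))// mul1r.
by rewrite /ee /EE h hs -rmorphN opprB.
Qed.

Lemma neg3_real (x : R) : (- (3 * x ^+ 2))%:C = - (3 * x%:C ^+ 2) :> C.
Proof. by rewrite rmorphN rmorphM rmorphXn (rmorph_nat (real_complex R)). Qed.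

Lemma R1_even : R1 0 w tau = - csum (fun n => ee (2 * n) * EKL n (2 * n)).
Proof.
rewrite -csumN; last exact: absum_even.
rewrite -(sumZ_csum (absumN absum_even)) /R1; congr sumZ; apply: funext => n.
rewrite mul0r addr0 -/T -/a (R1_factor (m := 2 * n)); last by rewrite intrM.
rewrite mulNr -mulrA qpowE -e2piD mulNr; congr (- (_ * e2pi _)).
rewrite neg3_real -int_real.
by rewrite !(intrD, intrM, mulrNz, rmorphXn); ring.
Qed.

(** With [l = n + 1/2], the quotient of [e(3 l w) q^(-3 l^2)] by [EKL n (2 n + 1)] is
    [e(w / 2 + tau / 4)], independent of [n]. *)
Lemma R1_odd : R1 1 w tau = - (e2pi (w / 2 + tau / 4) * csum (fun n => ee (2 * n + 1) * EKL n (2 * n + 1))).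
Proof.
have ab := absumN (absumZ (e2pi (w / 2 + tau / 4)) absum_odd).
rewrite -csumZ; last exact: absum_odd.
rewrite -csumN; last exact: absumZ absum_odd.
rewrite -(sumZ_csum ab) /R1; congr sumZ; apply: funext => n.
rewrite -/T -/a (R1_factor (m := 2 * n + 1)); last by rewrite intrD intrM; field.
rewrite mulNr -mulrA qpowE -e2piD mulNr [in RHS]mulrCA -e2piD; congr (- (_ * e2pi _)).
have hx : (n%:~R + 1 / 2)%:C = n%:~R + 1 / 2 :> C.
  by rewrite (rmorphD (real_complex R)) (rmorph_int (real_complex R)) (rmorphM (real_complex R)) fmorphV (rmorph_nat (real_complex R)) rmorph1.
rewrite neg3_real hx !(intrD, intrM, mulrNz, rmorphXn).
by move: (n%:~R : C) => N; field.
Qed.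


(** The part of the term of [R2] that is not summable; because of it [R2] has its value only as a
    limit over squares. *)
Definition anti (k l : int) : C :=
  (sgk R k * EE T (l%:~R - a) - sgk R l * EE T (k%:~R - a))%:C * EKL k l.

Lemma EKL_sym k l : EKL l k = EKL k l.
Proof.
rewrite /EKL.
have -> : l + k = k + l by ring.
by have -> : - l ^+ 2 - k ^+ 2 + l * k = - k ^+ 2 - l ^+ 2 + k * l by ring.
Qed.

Lemma negB_real (x y : R) : (x - y)%:C = - (y - x)%:C :> C.
Proof. by rewrite -rmorphN opprB. Qed.

Lemma anti_sym k l : anti l k = - anti k l.
Proof. by rewrite /anti EKL_sym (negB_real (sgk R l * _)) mulNr. Qed.

Lemma sum_anti N : \sum_(p <- sqseq N) anti p.1 p.2 = 0.
Proof.
rewrite -(sum_sqseq anti); set S := (X in X = 0).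
have SN : S = - S.
  rewrite {1}/S exchange_big -sumrN; apply: eq_bigr => i _; rewrite -sumrN; apply: eq_bigr => j _.
  exact: anti_sym.
have : S *+ 2 == 0 by rewrite mulr2n {2}SN subrr.
by rewrite mulrn_eq0 => /eqP.
Qed.

Definition hR2 (k l : int) : C := - (bbc (k, l) * EKL k l) - 2 * eS (k, l).

Lemma absum_hR2 : absum (fun p => hR2 p.1 p.2).
Proof.
by apply: absum_ext (absumB (absumN absum_bbE) (absumZ 2 absum_eEE)) => -[k l].
Qed.

Lemma R2_brace (sk sl s N0 e1 e2 : R) (e : C) :
  ((sk * sl - 2 * (sl - e2) * s)%:C - N0%:C) * e =
  - ((N0 - sl * e1 - sk * e2 + sk * sl)%:C * e) - 2 * ((e2 - sl)%:C * ((sk - s)%:C * e))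
  + (sk * e2 - sl * e1)%:C * e.
Proof. by apply: ceqP; rewrite !ReImE /=; ring. Qed.

Lemma R2_term (k l : int) :
  (((Num.sg (k%:~R : R) * Num.sg (l%:~R : R)
      - 2 * (Num.sg (l%:~R : R) - E1 (Num.sqrt (3 * T) * (l%:~R - a))) * Num.sg (2 * (k%:~R : R) - l%:~R))%:C
     - E2 (Num.sqrt 3)^-1 (Num.sqrt T * (2 * k%:~R - l%:~R - a)) (Num.sqrt (3 * T) * (l%:~R - a)))
    * e2pi ((k + l)%:~R * w) * qpow tau (- k ^+ 2 - l ^+ 2 + k * l)%:~R) =
  hR2 k l + anti k l.
Proof.
have s0 : Num.sg (2 * (k%:~R : R) - l%:~R) = sgk R (2 * k - l).
  by rewrite /sgk intrB intrM.
have n0 : E2 (Num.sqrt 3)^-1 (Num.sqrt T * (2 * k%:~R - l%:~R - a)) (Num.sqrt (3 * T) * (l%:~R - a)) =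
   (NN T (k%:~R - a) (l%:~R - a))%:C.
  rewrite E2E; last exact: alpha3_gt0.
  by rewrite /NN; have -> : 2 * (k%:~R - a) - (l%:~R - a) = 2 * k%:~R - l%:~R - a by ring.
rewrite n0 s0 -mulrA qpowE -e2piD -/(EKL k l).
rewrite /hR2 /eS /anti /bbc /ee /bb /fst /snd -/(EE T _) -!/(sgk R _).
exact: R2_brace.
Qed.

Lemma R2_sum : R2 w tau = - csum (fun p => bbc p * EKL p.1 p.2) - 2 * csum eS.
Proof.
transitivity (csum (fun p => hR2 p.1 p.2)); last first.
  rewrite -csumN; last exact: absum_bbE.
  rewrite -csumZ; last exact: absum_eEE.
  rewrite -csumB; [|exact: absumN absum_bbE|exact: absumZ absum_eEE].
  by apply: eq_csum => -[k l].
rewrite /R2; apply: sumZ2_approx absum_hR2 _ => N.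
rewrite (eq_bigr (fun p => hR2 p.1 p.2 + anti p.1 p.2)); last first.
  by move=> p _; rewrite -R2_term.
by rewrite big_split /= sum_anti addr0.
Qed.

Lemma Fsum_R : - ((pi ^- 2)%:C) * Fsum u v tau =
  csum tA - 2 * S0 * R1 0 w tau - 2 * S1 * (e2pi (- (w / 2 + tau / 4)) * R1 1 w tau) - Th * R2 w tau.
Proof.
rewrite Fsum_split sum_eG sum_ebase R2_sum R1_even R1_odd e2piN.
have := e2pi_neq0 (w / 2 + tau / 4); move: (e2pi _) (csum _) (csum _) (csum _) (csum _) (csum _) => E y1 y2 y3 y4 y5 E0.
have -> : E^-1 * - (E * y3) = - y3 by rewrite mulrN mulKf.
by ring.
Qed.


Lemma ThE : Theta v tau = Th. Proof. exact: ThetaE. Qed.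

Let x1 x := e2pi (Z1 x).
Let x2 x := e2pi (Z2 x).

(** [tM], [tL] and [tN] are the summands of the Appell sums in [mu22], [mu21 u v] and
    [mu21 u (v - tau)], up to constant factors and, for [tN], a translation. *)
Definition tM x : C := c x * (x1 x / ((1 - x1 x) * (1 - x2 x))).
Definition tL x : C := c x * (x1 x / (1 - x1 x)).
Definition tN x : C := c x * (e2pi (Z1 x + tau) / (1 - e2pi (Z1 x + tau))).

Lemma frac_bound (M : R) z : z != 1 -> cn (1 - z)^-1 <= M -> cn (z / (1 - z)) <= M + 1.
Proof.
move=> z1 h; have z1' : 1 - z != 0 by rewrite subr_eq0 eq_sym.
have -> : z / (1 - z) = (1 - z)^-1 - 1 by field.
by rewrite (le_trans (cnB _ _))// cn1 lerD2r.
Qed.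

Lemma absum_tL : absum tL.
Proof.
have [M M0 h] := geometric_lower_bound t0 hu.
by apply: (absum_bounded (M := M + 1)) => x; apply: frac_bound (Z1_neq1 x) (h _).
Qed.

Lemma absum_tN : absum tN.
Proof.
have [M M0 h] := geometric_lower_bound t0 hu.
apply: (absum_bounded (M := M + 1)) => x; rewrite Z1_add; apply: frac_bound (h _).
by apply: e2pi_neq1 => n; exact: hu.
Qed.

Lemma absum_tM : absum tM.
Proof.
have [M M0 h] := geometric_lower_bound t0 hu.
apply: (absum_bounded (M := (M + 1) * M)) => x; rewrite invfM mulrA cnM.
by rewrite ler_pM ?cn_ge0//; [apply: frac_bound (Z1_neq1 x) (h _)|exact: h].
Qed.

(** The product of cotangents is [1 + 2 (x1 + x2) / ((1 - x1) (1 - x2))], and [swap_idx] shows that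
    [x1] and [x2] contribute equally. *)
Lemma sum_tA : csum tA = Th + 4 * csum tM.
Proof.
have aM' := absum_reindex swap_idx_bij absum_tM.
transitivity (csum (fun x => c x + 2 * tM x + 2 * tM (swap_idx x))).
  apply: eq_csum => x; rewrite /tM /x1 /x2 c_swap Z1_swap Z2_swap /tA /cotz.
  have h1 : 1 - e2pi (Z1 x) != 0 by rewrite subr_eq0 eq_sym Z1_neq1.
  have h2 : 1 - e2pi (Z2 x) != 0 by rewrite subr_eq0 eq_sym Z2_neq1.
  by move: (c x) (e2pi _) (e2pi _) h1 h2 => C0 X Y h1 h2; field; rewrite h1 h2.
rewrite (csumD (absumD absum_c (absumZ 2 absum_tM)) (absumZ 2 aM')) (csumD absum_c (absumZ 2 absum_tM)).
rewrite (csumZ 2 absum_tM) (csumZ 2 aM') (csum_reindex tM swap_idx_bij) -/Th.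
by move: (csum tM) => y; ring.
Qed.

(** The summand [Th] is the origin of the [1/2] in the coefficient of [R1 0] in [R22]. *)
Lemma S0E : S0 = Th + 2 * csum tL.
Proof.
rewrite -(csumZ 2 absum_tL) -(csumD absum_c (absumZ 2 absum_tL)).
apply: eq_csum => x; rewrite /tL /x1 /cotz.
have h1 : 1 - e2pi (Z1 x) != 0 by rewrite subr_eq0 eq_sym Z1_neq1.
by move: (c x) (e2pi _) h1 => C0 X h1; field.
Qed.

(** [cotz z - 1 = 2 x / (1 - x)] at [x = e(z)]: in contrast to [S0E], no constant is left. *)
Lemma S1E : S1 = 2 * csum tN.
Proof.
rewrite -(csumZ 2 absum_tN).
apply: eq_csum => x; rewrite /tN /cotz.
have h1 : 1 - e2pi (Z1 x + tau) != 0.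
  by rewrite subr_eq0 eq_sym Z1_add; apply: e2pi_neq1 => n; exact: hu.
by move: (c x) (e2pi _) h1 => C0 X h1; field.
Qed.

Lemma e2pi_Z1 x : e2pi u * qpow tau (2 * x.1 + x.2)%:~R = e2pi (Z1 x).
Proof. by rewrite qpowE -e2piD. Qed.

Lemma e2pi_Z2 x : e2pi u * qpow tau (x.2 - x.1)%:~R = e2pi (Z2 x).
Proof. by rewrite qpowE -e2piD. Qed.

Lemma numerator v' k l : e2pi (v' * (k + 2 * l)%:~R) * qpow tau (k ^+ 2 + l ^+ 2 + k * l + 2 * k + l)%:~R =
  e2pi (- u) * (theta_term v' tau (k, l) * e2pi (Z1 (k, l))).
Proof.
rewrite /theta_term qpowE -!e2piD; congr e2pi; rewrite /Z1 /lam1 /fst /snd.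
have -> : k ^+ 2 + l ^+ 2 + k * l + 2 * k + l = k ^+ 2 + l ^+ 2 + k * l + (2 * k + l) by ring.
by rewrite [in LHS](intrD _ _ (2 * k + l)); ring.
Qed.

Lemma e2pi_half : e2pi (- u) = (e2pi (u / 2) * e2pi (u / 2))^-1.
Proof. by rewrite -e2piD -splitr e2piN. Qed.

Lemma mu22E : mu22 u v tau = 4^-1 + csum tM / Th.
Proof.
have ab := absumZ (e2pi (- u)) absum_tM.
rewrite /mu22 ThE (_ : sumZ2 _ = e2pi (- u) * csum tM).
  have X0 := e2pi_neq0 u; rewrite e2piN; move: (e2pi u) X0 (csum tM) (Th^-1) => X X0 S W.
  by rewrite mulrACA mulfV// mul1r mulrC.
rewrite -(csumZ _ absum_tM) -(sumZ2_csum (f := fun k l => e2pi (- u) * tM (k, l))); last first.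
  by apply: absum_ext ab => -[k l].
congr sumZ2; apply: funext => k; apply: funext => l.
rewrite numerator (e2pi_Z1 (k, l)) (e2pi_Z2 (k, l)) /tM /x1 /x2 -/c.
by rewrite -!mulrA.
Qed.

Lemma mu21E : e2pi (u / 2) * (mu21 u v tau - 2^-1) = csum tL / Th.
Proof.
have ab := absumZ (e2pi (- u)) absum_tL.
rewrite /mu21 ThE (_ : sumZ2 _ = e2pi (- u) * csum tL).
  rewrite e2pi_half addrAC subrr add0r.
  have := e2pi_neq0 (u / 2); move: (e2pi _) (csum tL) (Th^-1) => X S W X0.
  by field.
rewrite -(csumZ _ absum_tL) -(sumZ2_csum (f := fun k l => e2pi (- u) * tL (k, l))); last first.
  by apply: absum_ext ab => -[k l].
congr sumZ2; apply: funext => k; apply: funext => l.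
rewrite numerator (e2pi_Z1 (k, l)) /tL /x1 -/c.
by rewrite -!mulrA.
Qed.

(** The translation by [(-1, -1)] absorbs the change of [v]; it moves [Z1] by [- tau], which the
    [+ tau] in [tN] undoes. *)
Lemma theta_term_shift x : theta_term (v - tau) tau x = e2pi (2 * v - tau) * c (shift_idx (-1) (-1) x).
Proof.
case: x => k l; rewrite /c /theta_term /shift_idx /fst /snd -e2piD; congr e2pi.
by rewrite !(intrD, intrM, mulrNz, rmorphXn); ring.
Qed.

Lemma Theta_shift : Theta (v - tau) tau = e2pi (2 * v - tau) * Th.
Proof.
have b := shift_idx_bij (-1) (-1).
by rewrite ThetaE// (eq_csum theta_term_shift) (csumZ _ (absum_reindex b absum_c)) (csum_reindex c b).
Qed.

Lemma mu21_shiftE : e2pi (u / 2) * (mu21 u (v - tau) tau - 2^-1) = csum tN / Th.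
Proof.
have b := shift_idx_bij (-1) (-1).
have ab := absum_reindex b absum_tN.
have ab' := absumZ (e2pi (- u) * e2pi (2 * v - tau)) ab.
rewrite /mu21 Theta_shift (_ : sumZ2 _ = e2pi (- u) * e2pi (2 * v - tau) * csum tN).
  rewrite (invfM (e2pi (2 * v - tau))) e2pi_half addrAC subrr add0r.
  have := e2pi_neq0 (u / 2); have := e2pi_neq0 (2 * v - tau).
  move: (e2pi (u / 2)) (e2pi _) (csum tN) (Th^-1) => X Y S W Y0 X0.
  by field; rewrite X0 Y0.
rewrite -(csum_reindex tN b) -(csumZ _ ab).
rewrite -(sumZ2_csum (f := fun k l => e2pi (- u) * e2pi (2 * v - tau) * tN (shift_idx (-1) (-1) (k, l)))); last first.
  by apply: absum_ext ab' => -[k l].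
congr sumZ2; apply: funext => k; apply: funext => l.
rewrite numerator (e2pi_Z1 (k, l)) theta_term_shift /tN Z1_shift.
rewrite (_ : 2 * -1 - -1 = -1) // mulN1r subrK.
by rewrite -!mulrA.
Qed.

(** Origin of the prefactor [e(v / 2) q^(-1/4)] of the [R1 1] term in [R22]. *)
Lemma cancel_e2pi_half : e2pi (- (w / 2 + tau / 4)) * e2pi (u / 2) = e2pi (v / 2) * qpow tau (- 4^-1).
Proof. by rewrite qpowE -!e2piD; congr e2pi; rewrite /w; field. Qed.

Lemma muhat22_Fsum : Th != 0 ->
  muhat22 u v tau = - (4^-1 * (pi ^- 2)%:C) * (Fsum u v tau / Th).
Proof.
move=> Th0; have FE := Fsum_R.
rewrite sum_tA S0E S1E in FE.
have e1 : csum tM = (mu22 u v tau - 4^-1) * Th by rewrite mu22E addrAC subrr add0r divfK.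
have e2 : csum tL = e2pi (u / 2) * (mu21 u v tau - 2^-1) * Th by rewrite mu21E divfK.
have e3 : csum tN = e2pi (u / 2) * (mu21 u (v - tau) tau - 2^-1) * Th by rewrite mu21_shiftE divfK.
rewrite e1 e2 e3 in FE.
rewrite /muhat22 /R22 -/w -[4 * e2pi (v / 2) * _]mulrA -cancel_e2pi_half.
have -> : - (4^-1 * (pi ^- 2)%:C) * (Fsum u v tau / Th) = - (pi ^- 2)%:C * Fsum u v tau / (4 * Th).
  by move: (Fsum _ _ _) (_%:C) => y1 y2; field.
rewrite FE.
move: (mu22 _ _ _) (mu21 _ _ _) (mu21 _ _ _) (R1 _ _ _) (R1 _ _ _) (R2 _ _) (e2pi _) (e2pi _) => m1 m2 m3 r0 r1 r2 E1' E2'.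
by field.
Qed.

End Assembly.

(** * Division by the transformation law of [Theta] *)

Lemma Gamma0_3_legendre (a b c d : int) : Gamma0 3 a b c d -> legendre 3 d = 1 \/ legendre 3 d = -1.
Proof.
move=> /andP[/eqP det /dvdzP[c3 cE]]; rewrite /legendre.
case: ifP => [/dvdzP[d3 dE]|_]; last by case: ifP => _; [left|right].
by move: det; rewrite cE dE; lia.
Qed.

Lemma mobius_nonlattice (R : realType) (u tau : R[i]) (a b c d : int) : a * d - b * c = 1 -> 0 < cIm tau ->
  (forall r m : int, u + r%:~R * tau + m%:~R != 0) ->
  forall r m : int, u / (c%:~R * tau + d%:~R) + r%:~R * ((a%:~R * tau + b%:~R) / (c%:~R * tau + d%:~R)) + m%:~R != 0.
Proof.
move=> det t0 hu r m; have j0 := cocycle_neq0 det t0.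
have -> : u / (c%:~R * tau + d%:~R) + r%:~R * ((a%:~R * tau + b%:~R) / (c%:~R * tau + d%:~R)) + m%:~R
  = (u + (r * a + m * c)%:~R * tau + (r * b + m * d)%:~R) / (c%:~R * tau + d%:~R).
  by rewrite !(intrD, intrM); field.
by rewrite mulf_neq0 ?invr_eq0.
Qed.

(** [j^2] over [j] leaves weight 1, the exponential [EB] of [Theta] cancels, and the character
    passes from denominator to numerator because [L^2 = 1]. *)
Lemma quotient_transform (R : realType) (K L j EA EB F Th : R[i]) : L * L = 1 -> j != 0 -> EB != 0 -> Th != 0 ->
  K * (j ^+ 2 * (EA * EB) * F / (L * j * EB * Th)) = L * j * EA * (K * (F / Th)).
Proof.
move=> LL j0 E0 T0.
have L0 : L != 0 by apply: contra_eq_neq LL => ->; rewrite mul0r eq_sym oner_eq0.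
have -> : L * j * EA * (K * (F / Th)) = L * L * (K * (j ^+ 2 * (EA * EB) * F / (L * j * EB * Th))).
  by field; rewrite T0 E0 L0 j0.
by rewrite LL mul1r.
Qed.

Theorem theorem5p3 (R : realType) (u v tau : R[i]) (a b c d : int)
  (htau : 0 < complex.Im tau)
  (hu : forall m n : int, u <> m%:~R * tau + n%:~R)
  (hv : Theta v tau <> 0)
  (hg : Gamma0 3 a b c d) :
  muhat22 (u / (c%:~R * tau + d%:~R)) (v / (c%:~R * tau + d%:~R))
    ((a%:~R * tau + b%:~R) / (c%:~R * tau + d%:~R))
  = (legendre 3 d)%:~R * (c%:~R * tau + d%:~R)
    * e2pi (- (c%:~R * (u - v) ^+ 2 / (c%:~R * tau + d%:~R)))
    * muhat22 u v tau.
Proof.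
have hu' : forall r m : int, u + r%:~R * tau + m%:~R != 0.
  move=> r m; apply/eqP => h; apply: (hu (- r) (- m)).
  rewrite !mulrNz mulNr -opprD; apply/eqP; rewrite -addr_eq0 addrA; exact/eqP.
have det : a * d - b * c = 1 by case/andP: (hg) => /eqP.
have t' := Im_mobius_gt0 det htau.
have j0 := cocycle_neq0 det htau.
have LL : (legendre 3 d)%:~R * (legendre 3 d)%:~R = 1 :> R[i].
  by case: (Gamma0_3_legendre hg) => ->; rewrite -intrM.
have T0 : csum (theta_term v tau) != 0 by rewrite -ThetaE//; exact/eqP.
have TE := theta_Gamma0 hg v htau.
rewrite (ThetaE _ htau) (ThetaE _ t') in TE.
have L0 : (legendre 3 d)%:~R != 0 :> R[i].
  by apply: contra_eq_neq LL => ->; rewrite mul0r eq_sym oner_eq0.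
(* [muhat22_Fsum] divides by [Theta] at the transformed point as well; it is nonzero there by the
   theta law. *)
have T0' : csum (theta_term (v / (c%:~R * tau + d%:~R)) ((a%:~R * tau + b%:~R) / (c%:~R * tau + d%:~R))) != 0.
  rewrite TE; apply: mulf_neq0 => //; apply: mulf_neq0; last exact: e2pi_neq0.
  exact: mulf_neq0.
rewrite (muhat22_Fsum htau hu' T0) (muhat22_Fsum t' (mobius_nonlattice det htau hu') T0').
rewrite TE (Fsum_moebius v htau hu' hg) e2piD.
exact: quotient_transform LL j0 (e2pi_neq0 _) T0.
Qed.
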